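(* Let $(\mathcal{A},\phi)$ be a $W^*$-probability space and let $(x_i)_{i\in\mathbb{N}}$ be a sequence of selfadjoint random variables which generate $\mathcal{A}$ as a von Neumann algebra. **(Free case.)** Suppose that $\phi$ is faithful. Let $\{E(n)\}_{n\in\mathbb{N}}$ be a sequence of orthogonal Hopf algebras such that $A_s(n)\subseteq E(n)\subseteq A_o(n)$ for each $n$. If the joint distribution of $(x_i)_{i\in\mathbb{N}}$ is $E(n)$-invariant for all $n$, then there are a $W^*$-subalgebra $\mathcal{B}$ with $1\in\mathcal{B}\subseteq\mathcal{A}$ and a $\phi$-preserving conditional expectation $\mathbb{E}:\mathcal{A}\to\mathcal{B}$ such that: 1. If $E(n)=A_s(n)$ for all $n$, then $(x_i)_{i\in\mathbb{N}}$ are freely independent and identically distributed with respect to $\mathbb{E}$. 2. If $A_s(n)\subseteq E(n)\subseteq A_h(n)$ for all $n$ and there exists a $k$ such that $E(k)\neq A_s(k)$, then $(x_i)_{i\in\mathbb{N}}$ are freely independent and have identical symmetric distribution with respect to $\mathbb{E}$. 3. If $A_s(n)\subseteq E(n)\subseteq A_b(n)$ for all $n$ and there exists a $k$ such that $E(k)\neq A_s(k)$, then $(x_i)_{i\in\mathbb{N}}$ are freely independent and have identical shifted-semicircular distribution with respect to $\mathbb{E}$. 4. If there exist $k_1,k_2$ such that $E(k_1)\not\subseteq A_h(k_1)$ and $E(k_2)\not\subseteq A_b(k_2)$, then $(x_i)_{i\in\mathbb{N}}$ are freely independent and have (identical) centered semicircular distribution with respect to $\mathbb{E}$. **(Boolean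 case.)** Suppose that $\phi$ is non-degenerated. Let $\{E(n)\}_{n\in\mathbb{N}}$ be a sequence of orthogonal Boolean quantum semigroups such that $B_s(n)\subseteq E(n)\subseteq B_o(n)$ for each $n$. If the joint distribution of $(x_i)_{i\in\mathbb{N}}$ is $E(n)$-invariant for all $n$, then there are a $W^*$-subalgebra $\mathcal{B}\subseteq\mathcal{A}$ (not necessarily containing the unit of $\mathcal{A}$) and a $\phi$-preserving conditional expectation $\mathbb{E}:\mathcal{A}\to\mathcal{B}$ such that: 1. If $E(n)=B_s(n)$ for all $n$, then $(x_i)_{i\in\mathbb{N}}$ are Boolean independent and identically distributed with respect to $\mathbb{E}$. 2. If $B_s(n)\subseteq E(n)\subseteq B_h(n)$ for all $n$ and there exists a $k$ such that $E(k)$ has a quotient algebra $E'(k)$ with $A_s(k)\subsetneq E'(k)\subseteq A_h(k)$, then $(x_i)_{i\in\mathbb{N}}$ are Boolean independent and have identical symmetric distribution with respect to $\mathbb{E}$. 3. If $B_s(n)\subseteq E(n)\subseteq B_b(n)$ for all $n$ and there exists a $k$ such that $E(k)$ has a quotient algebra $E'(k)$ with $A_s(k)\subsetneq E'(k)\subseteq A_b(k)$, then $(x_i)_{i\in\mathbb{N}}$ are Boolean independent and have identical shifted-Bernoulli distribution with respect to $\mathbb{E}$. 4. If there exist $k_1,k_2$ such that $E(k_1)$ and $E(k_2)$ have quotient algebras $E'(k_1)\subseteq A_o(k_1)$ and $E'(k_2)\subseteq A_o(k_2)$ with $E'(k_1)\not\subseteq A_h(k_1)$ and $E'(k_2)\not\subseteq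 A_b(k_2)$, then $(x_i)_{i\in\mathbb{N}}$ are Boolean independent and have (identical) centered Bernoulli distribution with respect to $\mathbb{E}$.
   Context: **Probability spaces.** A $W^*$-probability space $(\mathcal{A},\phi)$ is a $W^*$-algebra with a normal state. $\phi$ is faithful if $\phi(xx^* )=0$ implies $x=0$, and non-degenerated if its GNS representation is faithful. The joint distribution of $x_1,\dots,x_n\in\mathcal{A}$ is the linear functional $\mu_{x_1,\dots,x_n}$ on $\mathbb{C}\langle X_1,\dots,X_n\rangle$ with $\mu_{x_1,\dots,x_n}(p)=\phi(p(x_1,\dots,x_n))$. **Orthogonal Hopf algebras.** An orthogonal Hopf algebra (of size $n$) is a unital $C^*$-algebra $A$ generated by $n^2$ selfadjoint elements $\{u_{i,j}\}_{i,j=1}^n$ such that: (i) $\sum_k u_{i,k}u_{j,k}=\sum_k u_{k,i}u_{k,j}=\delta_{i,j}1_A$; (ii) $\Delta(u_{i,j})=\sum_k u_{i,k}\otimes u_{k,j}$ determines a unital $C^*$-homomorphism $A\to A\otimes_{\min}A$; (iii) $\epsilon(u_{i,j})=\delta_{i,j}$ defines a homomorphism $A\to\mathbb{C}$; (iv) $S(u_{i,j})=u_{j,i}$ defines a homomorphism $A\to A^{op}$. A matrix $u=(u_{i,j})\in M_n(A)$ over a $C^*$-algebra is *orthogonal* if its entries are selfadjoint and $uu^t=u^tu=1_n$, $u^t=(u_{j,i})$; *magic* if orthogonal with entries projections; *cubic* if orthogonal and $u_{i,j}u_{i,k}=u_{j,i}u_{k,i}=0$ for $j\ne k$; *bistochastic*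 if orthogonal and $\sum_i u_{i,j}=\sum_j u_{k,j}=1_A$ for all $j,k$. $A_o(n),A_s(n),A_h(n),A_b(n)$ are the universal unital $C^*$-algebras generated by the entries of an $n\times n$ matrix that is respectively orthogonal, magic, cubic, bistochastic. $(B,v)\subseteq(A,u)$ means that there is a unital $C^*$-homomorphism $A\to B$ with $u_{i,j}\mapsto v_{i,j}$ for all $i,j$; equality means both inclusions, and $\subsetneq$ means $\subseteq$ but not equal. **Boolean quantum semigroups.** Let $u=(u_{i,j})\in M_n(A)$ over a $C^*$-algebra $A$ and let $\mathbf{P}\in A$ be an orthogonal projection. $(u,\mathbf{P})$ is *$\mathbf{P}$-orthogonal* if all $u_{i,j}$ are selfadjoint and $\sum_k u_{i,k}u_{j,k}\mathbf{P}=\sum_k u_{k,i}u_{k,j}\mathbf{P}=\delta_{i,j}\mathbf{P}$; *$\mathbf{P}$-magic* if $\mathbf{P}$-orthogonal with entries of $u$ projections; *$\mathbf{P}$-cubic* if $\mathbf{P}$-orthogonal and $u_{i,j}u_{i,k}\mathbf{P}=u_{j,i}u_{k,i}\mathbf{P}=0$ for $j\neq k$; *$\mathbf{P}$-bistochastic* if $\mathbf{P}$-orthogonal and $\sum_j u_{i,j}\mathbf{P}=\sum_k u_{k,i}\mathbf{P}=\mathbf{P}$ for all $i$. $B_o(n),B_s(n),B_h(n),B_b(n)$ are the unital universal $C^*$-algebras generated by the entries of a matrix $u$ with $\|u\|\le1$ and an orthogonal projection $\mathbf{P}$ such that $(u,\mathbf{P})$ is respectively $\mathbf{P}$-orthogonal,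 $\mathbf{P}$-magic, $\mathbf{P}$-cubic, $\mathbf{P}$-bistochastic. An orthogonal Boolean quantum semigroup (of size $n$) is a unital $C^*$-algebra $A$ generated by $n^2$ selfadjoint elements $u_{i,j}$ and an orthogonal projection $\mathbf{P}$ such that $\|(u_{i,j})\|\le1$, $(u,\mathbf{P})$ is $\mathbf{P}$-orthogonal, and $\Delta(u_{i,j})=\sum_k u_{i,k}\otimes u_{k,j}$, $\Delta\mathbf{P}=\mathbf{P}\otimes\mathbf{P}$, $\Delta I=I\otimes I$ determine a unital $C^*$-homomorphism $A\to A\otimes_{\min}A$. For Boolean quantum semigroups, $B\subseteq A$ means that there is a unital $C^*$-homomorphism $A\to B$ sending generators $u_{i,j}$ to the corresponding generators and $\mathbf{P}$ to $\mathbf{P}$; equality means both inclusions. A ''quotient algebra'' $E'(k)$ of a Boolean quantum semigroup $E(k)$ is an orthogonal Hopf algebra of size $k$ with generators $u'_{i,j}$ together with a unital surjective $C^*$-homomorphism $\Psi:E(k)\to E'(k)$ with $\Psi(u_{i,j})=u'_{i,j}$ and $\Psi(\mathbf{P})=1_{E'(k)}$. **Invariance.** For $E(n)$ an orthogonal Hopf algebra or Boolean quantum semigroup, let $\alpha_n:\mathbb{C}\langle X_1,\dots,X_n\rangle\to\mathbb{C}\langle X_1,\dots,X_n\rangle\otimes E(n)$ be the unital homomorphism with $\alpha_n(X_i)=\sum_k X_k\otimes u_{k,i}$. $(x_1,\dots,x_n)$ has $E(n)$-invariant joint distribution $\mu$ if, for all $p\in\mathbb{C}\langle X_1,\dots,X_n\rangle$,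 $\mu(p)1_{E(n)}=(\mu\otimes id)(\alpha_n(p))$ (Hopf case), respectively $\mu(p)\mathbf{P}=(\mu\otimes id)(\alpha_n(p))\mathbf{P}$ (Boolean case). The $k$-th extension $E(n,k)$ is the algebra $E(n)$ with generators $v_{i,j}$, $1\le i,j\le n+k$, where $v_{i,j}=u_{i,j}$ if $i,j\le n$ and $v_{i,j}=\delta_{i,j}1$ otherwise (and the same $\mathbf{P}$ in the Boolean case). The joint distribution of an infinite sequence $(x_i)$ is $E(n)$-invariant if that of $(x_1,\dots,x_{n+k})$ is $E(n,k)$-invariant for all $k\in\mathbb{N}$. **Operator-valued notions.** A conditional expectation $\mathbb{E}:\mathcal{A}\to\mathcal{B}$ onto a subalgebra is a linear map with $\mathbb{E}[b_1ab_2]=b_1\mathbb{E}[a]b_2$ and $\mathbb{E}[b]=b$; it is $\phi$-preserving if $\phi\circ\mathbb{E}=\phi$. $\mathcal{B}\langle X\rangle$ is the algebra freely generated by $\mathcal{B}$ and $X$, i.e. the span of $\mathcal{B}$ and the monomials $b_0Xb_1\cdots Xb_n$ with $b_i\in\mathcal{B}\cup\mathbb{C}1$; $\mathcal{B}\langle X\rangle_0$ is the span of such monomials with $n\ge1$. $(x_i)$ are *freely independent* with respect to $\mathbb{E}$ if $\mathbb{E}[p_1(x_{i_1})\cdots p_n(x_{i_n})]=0$ whenever $i_1\ne i_2\ne\cdots\ne i_n$ (neighbours differ), $p_j\in\mathcal{B}\langle X\rangle$ and $\mathbb{E}[p_j(x_{i_j})]=0$ for all $j$. They are *Boolean independent*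 with respect to $\mathbb{E}$ if $\mathbb{E}[p_1(x_{i_1})\cdots p_n(x_{i_n})]=\mathbb{E}[p_1(x_{i_1})]\cdots\mathbb{E}[p_n(x_{i_n})]$ whenever $i_1\ne i_2\ne\cdots\ne i_n$ and $p_j\in\mathcal{B}\langle X\rangle_0$. They are identically distributed with respect to $\mathbb{E}$ if $\mathbb{E}[p(x_i)]$ does not depend on $i$ for each $\mathcal{B}$-polynomial $p$ (in $\mathcal{B}\langle X\rangle$, resp. $\mathcal{B}\langle X\rangle_0$). $x$ is symmetric with respect to $\mathbb{E}$ if $\mathbb{E}[b_0xb_1\cdots xb_n]=0$ for all odd $n$ and $b_i\in\mathcal{B}\cup\mathbb{C}1$. For a family of $\mathcal{B}$-functionals $\rho^{(n)}:\mathcal{A}^n\to\mathcal{B}$ and a noncrossing partition $\pi$ of $\{1,\dots,n\}$, $\rho^{(\pi)}$ is defined recursively by $\rho^{(\pi)}(a_1,\dots,a_n)=\rho^{(\pi\setminus V)}(a_1,\dots,a_l\,\rho^{(s)}(a_{l+1},\dots,a_{l+s}),a_{l+s+1},\dots,a_n)$ for an interval block $V=\{l+1,\dots,l+s\}$ of $\pi$. Free cumulants $\kappa^{(n)}_{\mathbb{E}}$ and Boolean cumulants $b^{(n)}_{\mathbb{E}}$ are determined recursively by $\mathbb{E}[a_1\cdots a_n]=\sum_{\pi\in NC(n)}\kappa^{(\pi)}_{\mathbb{E}}(a_1,\dots,a_n)$ and $\mathbb{E}[a_1\cdots a_n]=\sum_{\pi\in I(n)}b^{(\pi)}_{\mathbb{E}}(a_1,\dots,a_n)$,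 with $NC(n)$ the noncrossing and $I(n)$ the interval partitions. $x$ is shifted-semicircular (resp. shifted-Bernoulli) with respect to $\mathbb{E}$ if $\kappa^{(n)}_{\mathbb{E}}(b_0xb_1,xb_2,\dots,xb_n)=0$ (resp. $b^{(n)}_{\mathbb{E}}(b_0xb_1,xb_2,\dots,xb_n)=0$) for all $n\ge3$ and all $b_i\in\mathcal{B}\cup\mathbb{C}1$; centered semicircular (resp. centered Bernoulli) if this holds for all $n\ne2$. *)

(* Defs.v *)
From HB Require Import structures.
From mathcomp Require Import all_boot all_order all_algebra.
From mathcomp Require Import complex.
From mathcomp Require Import all_classical all_reals all_analysis.
(* The notations of monalg clash with those of mathcomp-analysis. *)
From mathcomp.multinomials Require Import -(notations) monalg.

Set Implicit Arguments.
Unset Strict Implicit.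
Unset Printing Implicit Defensive.

Import Order.TTheory GRing.Theory Num.Theory.
Import numFieldNormedType.Exports.

Local Open Scope classical_set_scope.
Local Open Scope complex_scope.
Local Open Scope ring_scope.

(** * C*-algebras, Hilbert spaces and representations *)

(* A (non-zero) unital C*-algebra.  The norm is a real-valued field of the
   mixin: Hierarchy Builder does not allow a new join of rings and normed
   modules below numDomainType. *)
HB.mixin Record isCStarAlgebra (R : realType) A & GRing.Algebra R[i] A := {
  star : A -> A;
  cnorm : A -> R;
  starK : involutive star;
  starD : {morph star : x y / x + y};
  starZ : forall (c : R[i]) (x : A), star (c *: x) = c^* *: star x;
  starM : forall x y : A, star (x * y) = star y * star x;
  cnorm_eq0 : forall x : A, cnorm x = 0 -> x = 0;
  cnormD : forall x y : A, cnorm (x + y) <= cnorm x + cnorm y;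
  cnormZ : forall (c : R[i]) (x : A), (cnorm (c *: x))%:C = `|c| * (cnorm x)%:C;
  cnormM : forall x y : A, cnorm (x * y) <= cnorm x * cnorm y;
  cnorm_star : forall x : A, cnorm (star x * x) = cnorm x ^+ 2;
  cnorm_complete : forall a : nat -> A,
    (forall e : R, 0 < e ->
       exists N : nat, forall m n, (N <= m)%N -> (N <= n)%N ->
         cnorm (a m - a n) < e) ->
    exists l : A, forall e : R, 0 < e ->
      exists N : nat, forall n, (N <= n)%N -> cnorm (a n - l) < e
}.

#[short(type="cstarType")]
HB.structure Definition CStarAlgebra (R : realType) :=
  {A of GRing.Algebra R[i] A & isCStarAlgebra R A}.

HB.mixin Record isHilbert (R : realType) H & CompleteNormedModule R[i] H := {
  dotp : H -> H -> R[i];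
  dotp_linear : forall (c : R[i]) (x y z : H),
    dotp (c *: x + y) z = c * dotp x z + dotp y z;
  dotpC : forall x y : H, dotp y x = (dotp x y)^*;
  dotp_norm : forall x : H, dotp x x = `|x| ^+ 2
}.

#[short(type="hilbertType")]
HB.structure Definition Hilbert (R : realType) :=
  {H of CompleteNormedModule R[i] H & isHilbert R H}.

Definition bounded_op (R : realType) (H : hilbertType R) (T : H -> H) : Prop :=
  linear T /\ continuous T.

Definition star_hom (R : realType) (A B : cstarType R)
    (f : {lrmorphism A -> B}) : Prop :=
  forall a, f (star a) = star (f a).

Definition representation (R : realType) (A : cstarType R) (H : hilbertType R)
    (pi : A -> H -> H) : Prop :=
  [/\ forall a, bounded_op (pi a),
      forall (c : R[i]) a b h, pi (c *: a + b) h = c *: pi a h + pi b h,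
      forall a b h, pi (a * b) h = pi a (pi b h),
      forall h, pi 1 h = h
    & forall a h k, dotp (pi a h) k = dotp h (pi (star a) k)].

Definition faithful_rep (R : realType) (A : cstarType R) (H : hilbertType R)
    (pi : A -> H -> H) : Prop :=
  representation pi /\ injective pi.

Definition star_subalgebra (R : realType) (A : cstarType R) (D : set A) : Prop :=
  [/\ D 0,
      forall (c : R[i]) a b, D a -> D b -> D (c *: a + b),
      forall a b, D a -> D b -> D (a * b)
    & forall a, D a -> D (star a)].

Definition norm_closed (R : realType) (A : cstarType R) (D : set A) : Prop :=
  forall a, (forall e : R, 0 < e -> exists2 b, D b & cnorm (a - b) < e) -> D a.

(* A is generated by S as a unital C*-algebra *)
Definition cstar_generated (R : realType) (A : cstarType R) (S : set A) : Prop :=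
  forall D : set A, star_subalgebra D -> norm_closed D -> D 1 ->
    S `<=` D -> D = setT.

(* T, with (a, b) |-> tens a b, is the minimal (spatial) tensor product of A
   and B: it is the C*-algebra of operators on the Hilbert tensor product L of
   H and K generated by the piA a (x) piB b, for faithful representations piA
   on H and piB on K. *)
Definition min_tensor (R : realType) (A B T : cstarType R) (tens : A -> B -> T) :
    Prop :=
  exists (H K L : hilbertType R) (piA : A -> H -> H) (piB : B -> K -> K)
         (piT : T -> L -> L) (t : H -> K -> L),
    [/\ faithful_rep piA, faithful_rep piB & faithful_rep piT] /\
    [/\ forall k, linear (t^~ k),
        forall h, linear (t h),
        forall h k h' k', dotp (t h k) (t h' k') = dotp h h' * dotp k k'
      & closure [set \sum_(p <- s) t p.1 p.2 | s in [set: seq (H * K)]] = setT] /\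
    (forall a b h k, piT (tens a b) (t h k) = t (piA a h) (piB b k)) /\
    cstar_generated [set tens a b | a in [set: A] & b in [set: B]].

Definition selfadjoint (R : realType) (A : cstarType R) (a : A) : Prop :=
  star a = a.

Definition projection (R : realType) (A : cstarType R) (a : A) : Prop :=
  star a = a /\ a * a = a.

(* The C*-norm of M_n(A): the operator norm on the Hilbert A-module A^n, whose
   norm is || sum_i v_i^* v_i ||^(1/2). *)
Definition hmod_norm (R : realType) (A : cstarType R) (n : nat) (v : 'cV[A]_n) : R :=
  Num.sqrt (cnorm (\sum_i star (v i ord0) * v i ord0)).

Definition mx_cnorm (R : realType) (A : cstarType R) (n : nat) (u : 'M[A]_n) : R :=
  sup [set hmod_norm (u *m v) | v in [set v : 'cV[A]_n | hmod_norm v <= 1]].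

(** * Orthogonal Hopf algebras *)

Definition mx_orthogonal (R : realType) (A : cstarType R) (n : nat)
    (u : 'M[A]_n) : Prop :=
  [/\ forall i j, selfadjoint (u i j), u *m u^T = 1%:M & u^T *m u = 1%:M].

Definition mx_magic (R : realType) (A : cstarType R) (n : nat)
    (u : 'M[A]_n) : Prop :=
  mx_orthogonal u /\ forall i j, projection (u i j).

Definition mx_cubic (R : realType) (A : cstarType R) (n : nat)
    (u : 'M[A]_n) : Prop :=
  mx_orthogonal u /\
  forall i j k, j != k -> u i j * u i k = 0 /\ u j i * u k i = 0.

Definition mx_bistochastic (R : realType) (A : cstarType R) (n : nat)
    (u : 'M[A]_n) : Prop :=
  [/\ mx_orthogonal u,
      forall j, \sum_i u i j = 1
    & forall k, \sum_j u k j = 1].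

Record genalg (R : realType) (n : nat) := GenAlg {
  ga_alg :> cstarType R;
  ga_u : 'M[ga_alg]_n
}.

Definition ga_generated (R : realType) (n : nat) (Q : genalg R n) : Prop :=
  cstar_generated [set x : Q | exists i j, x = ga_u Q i j].

Definition ga_sub (R : realType) (n : nat) (B A : genalg R n) : Prop :=
  exists2 f : {lrmorphism A -> B},
    star_hom f & forall i j, f (ga_u A i j) = ga_u B i j.

Definition ga_eq (R : realType) (n : nat) (B A : genalg R n) : Prop :=
  ga_sub B A /\ ga_sub A B.

Definition ga_proper (R : realType) (n : nat) (B A : genalg R n) : Prop :=
  ga_sub B A /\ ~ ga_eq B A.

Definition ga_universal (R : realType) (n : nat)
    (rel : forall A : cstarType R, 'M[A]_n -> Prop) (Q : genalg R n) : Prop :=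
  [/\ rel Q (ga_u Q), ga_generated Q
    & forall Q' : genalg R n, rel Q' (ga_u Q') -> ga_sub Q' Q].

Definition is_Ao (R : realType) (n : nat) (Q : genalg R n) : Prop :=
  ga_universal (fun A u => @mx_orthogonal R A n u) Q.
Definition is_As (R : realType) (n : nat) (Q : genalg R n) : Prop :=
  ga_universal (fun A u => @mx_magic R A n u) Q.
Definition is_Ah (R : realType) (n : nat) (Q : genalg R n) : Prop :=
  ga_universal (fun A u => @mx_cubic R A n u) Q.
Definition is_Ab (R : realType) (n : nat) (Q : genalg R n) : Prop :=
  ga_universal (fun A u => @mx_bistochastic R A n u) Q.

Definition has_comultiplication (R : realType) (n : nat) (Q : genalg R n) : Prop :=
  exists (T : cstarType R) (tens : Q -> Q -> T) (Delta : {lrmorphism Q -> T}),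
    [/\ min_tensor tens, star_hom Delta
      & forall i j,
          Delta (ga_u Q i j) = \sum_k tens (ga_u Q i k) (ga_u Q k j)].

Definition has_counit (R : realType) (n : nat) (Q : genalg R n) : Prop :=
  exists2 epsilon : {lrmorphism Q -> R[i]^o},
    forall a, epsilon (star a) = (epsilon a : R[i])^*
    & forall i j, epsilon (ga_u Q i j) = (i == j)%:R.

(* A homomorphism to the opposite algebra is written as an antihomomorphism. *)
Definition has_antipode (R : realType) (n : nat) (Q : genalg R n) : Prop :=
  exists S : {linear Q -> Q},
    [/\ S 1 = 1, forall a b, S (a * b) = S b * S a,
        forall a, S (star a) = star (S a)
      & forall i j, S (ga_u Q i j) = ga_u Q j i].

Definition orthogonal_hopf (R : realType) (n : nat) (Q : genalg R n) : Prop :=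
  [/\ ga_generated Q, mx_orthogonal (ga_u Q), has_comultiplication Q,
      has_counit Q & has_antipode Q].

(** * Orthogonal Boolean quantum semigroups *)

Definition P_orthogonal (R : realType) (A : cstarType R) (n : nat)
    (u : 'M[A]_n) (P : A) : Prop :=
  (forall i j, selfadjoint (u i j)) /\
  forall i j, (\sum_k u i k * u j k) * P = (i == j)%:R * P /\
              (\sum_k u k i * u k j) * P = (i == j)%:R * P.

Definition P_magic (R : realType) (A : cstarType R) (n : nat)
    (u : 'M[A]_n) (P : A) : Prop :=
  P_orthogonal u P /\ forall i j, projection (u i j).

Definition P_cubic (R : realType) (A : cstarType R) (n : nat)
    (u : 'M[A]_n) (P : A) : Prop :=
  P_orthogonal u P /\
  forall i j k, j != k -> u i j * u i k * P = 0 /\ u j i * u k i * P = 0.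

Definition P_bistochastic (R : realType) (A : cstarType R) (n : nat)
    (u : 'M[A]_n) (P : A) : Prop :=
  P_orthogonal u P /\
  forall i, (\sum_j u i j) * P = P /\ (\sum_k u k i) * P = P.

Record bgenalg (R : realType) (n : nat) := BGenAlg {
  bg_alg :> cstarType R;
  bg_u : 'M[bg_alg]_n;
  bg_P : bg_alg
}.

Definition bg_generated (R : realType) (n : nat) (Q : bgenalg R n) : Prop :=
  cstar_generated [set x : Q | x = bg_P Q \/ exists i j, x = bg_u Q i j].

Definition bg_sub (R : realType) (n : nat) (B A : bgenalg R n) : Prop :=
  exists f : {lrmorphism A -> B},
    [/\ star_hom f, forall i j, f (bg_u A i j) = bg_u B i j
      & f (bg_P A) = bg_P B].

Definition bg_eq (R : realType) (n : nat) (B A : bgenalg R n) : Prop :=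
  bg_sub B A /\ bg_sub A B.

Definition bg_universal (R : realType) (n : nat)
    (rel : forall A : cstarType R, 'M[A]_n -> A -> Prop) (Q : bgenalg R n) : Prop :=
  let adm (Q' : bgenalg R n) :=
    [/\ projection (bg_P Q'), mx_cnorm (bg_u Q') <= 1
      & rel Q' (bg_u Q') (bg_P Q')] in
  [/\ adm Q, bg_generated Q & forall Q', adm Q' -> bg_sub Q' Q].

Definition is_Bo (R : realType) (n : nat) (Q : bgenalg R n) : Prop :=
  bg_universal (fun A u P => @P_orthogonal R A n u P) Q.
Definition is_Bs (R : realType) (n : nat) (Q : bgenalg R n) : Prop :=
  bg_universal (fun A u P => @P_magic R A n u P) Q.
Definition is_Bh (R : realType) (n : nat) (Q : bgenalg R n) : Prop :=
  bg_universal (fun A u P => @P_cubic R A n u P) Q.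
Definition is_Bb (R : realType) (n : nat) (Q : bgenalg R n) : Prop :=
  bg_universal (fun A u P => @P_bistochastic R A n u P) Q.

Definition boolean_semigroup (R : realType) (n : nat) (Q : bgenalg R n) : Prop :=
  [/\ bg_generated Q, projection (bg_P Q), mx_cnorm (bg_u Q) <= 1,
      P_orthogonal (bg_u Q) (bg_P Q)
    & exists (T : cstarType R) (tens : Q -> Q -> T) (Delta : {lrmorphism Q -> T}),
        [/\ min_tensor tens, star_hom Delta,
            forall i j,
              Delta (bg_u Q i j) = \sum_k tens (bg_u Q i k) (bg_u Q k j)
          & Delta (bg_P Q) = tens (bg_P Q) (bg_P Q)]].

Definition quotient_algebra (R : realType) (n : nat) (Q : bgenalg R n)
    (Q' : genalg R n) : Prop :=
  orthogonal_hopf Q' /\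
  exists Psi : {lrmorphism Q -> Q'},
    [/\ star_hom Psi, forall y, exists x, Psi x = y,
        forall i j, Psi (bg_u Q i j) = ga_u Q' i j
      & Psi (bg_P Q) = 1].

(** * W*-probability spaces *)

(* A is *-isomorphic to a von Neumann algebra: some faithful unital
   representation has an image equal to its bicommutant. *)
Definition is_wstar (R : realType) (A : cstarType R) : Prop :=
  exists (H : hilbertType R) (pi : A -> H -> H),
    faithful_rep pi /\
    forall T : H -> H, bounded_op T ->
      (forall S : H -> H, bounded_op S ->
         (forall a h, S (pi a h) = pi a (S h)) -> forall h, T (S h) = S (T h)) ->
      exists a, T = pi a.

Definition cstar_le (R : realType) (A : cstarType R) (a b : A) : Prop :=
  exists c, b - a = star c * c.

Definition cstar_lub (R : realType) (A : cstarType R) (D : set A) (s : A) : Prop :=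
  (forall d, D d -> cstar_le d s) /\
  forall t, (forall d, D d -> cstar_le d t) -> cstar_le s t.

Definition state (R : realType) (A : cstarType R) (phi : {scalar A}) : Prop :=
  phi 1 = 1 /\ forall a, 0 <= phi (star a * a).

(* Preservation of suprema: phi s is the supremum of phi over D, for every increasing net D of
   selfadjoint elements with least upper bound s *)
Definition normal (R : realType) (A : cstarType R) (phi : {scalar A}) : Prop :=
  forall (D : set A) (s : A), D !=set0 -> (forall d, D d -> selfadjoint d) ->
    (forall d d', D d -> D d' ->
       exists2 d'', D d'' & cstar_le d d'' /\ cstar_le d' d'') ->
    cstar_lub D s ->
    forall e : R, 0 < e -> exists2 d, D d & phi s <= phi d + e%:C.

Definition normal_state (R : realType) (A : cstarType R) (phi : {scalar A}) : Prop :=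
  state phi /\ normal phi.

Definition faithful_state (R : realType) (A : cstarType R) (phi : {scalar A}) : Prop :=
  forall x, phi (x * star x) = 0 -> x = 0.

Definition GNS (R : realType) (A : cstarType R) (phi : {scalar A})
    (H : hilbertType R) (pi : A -> H -> H) (xi : H) : Prop :=
  [/\ representation pi, forall a, phi a = dotp (pi a xi) xi
    & closure [set pi a xi | a in [set: A]] = setT].

Definition nondegenerate_state (R : realType) (A : cstarType R)
    (phi : {scalar A}) : Prop :=
  exists (H : hilbertType R) (pi : A -> H -> H) (xi : H),
    GNS phi pi xi /\ injective pi.

(* Closed for the sigma-weak topology, the one defined by the normal states
   (which span the predual). *)
Definition sigma_weak_closed (R : realType) (A : cstarType R) (D : set A) : Prop :=
  forall a,
    (forall (m : nat) (psi : 'I_m -> {scalar A}) (e : R),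
       (forall i, normal_state (psi i)) -> 0 < e ->
       exists2 b, D b & forall i, `|psi i (a - b) : R[i]| < e%:C) ->
    D a.

(* The unit of A need not be in B. *)
Definition wstar_subalgebra (R : realType) (A : cstarType R) (B : set A) : Prop :=
  star_subalgebra B /\ sigma_weak_closed B.

Definition wstar_generated (R : realType) (A : cstarType R) (S : set A) : Prop :=
  forall D : set A, wstar_subalgebra D -> D 1 -> S `<=` D -> D = setT.

(** * Invariance of joint distributions *)

(* C<X_1, ..., X_n>, as the algebra of the free monoid on n letters; more
   generally, [malg (fmonom 'I_n) E] is C<X_1, ..., X_n> (x) E. *)
Definition ncpoly (R : realType) (n : nat) := malg (fmonom 'I_n) R[i].

Definition nc_eval (R : realType) (A : cstarType R) (n : nat) (x : 'I_n -> A)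
    (p : ncpoly R n) : A :=
  mmap (in_alg A) (fun w : fmonom 'I_n => \prod_(i <- w) x i) p.

Definition joint_distribution (R : realType) (A : cstarType R) (phi : {scalar A})
    (n : nat) (x : 'I_n -> A) (p : ncpoly R n) : R[i] :=
  phi (nc_eval x p).

Definition coaction (R : realType) (E : cstarType R) (n : nat) (u : 'M[E]_n)
    (p : ncpoly R n) : malg (fmonom 'I_n) E :=
  mmap (mkmalgU (@one (fmonom 'I_n)) \o in_alg E)
       (fun w : fmonom 'I_n => \prod_(i <- w) \sum_k mkmalgU (fmu k) (u k i)) p.

(* mu (x) id *)
Definition slice (R : realType) (E : cstarType R) (n : nat)
    (mu : ncpoly R n -> R[i]) (q : malg (fmonom 'I_n) E) : E :=
  mmap idfun
       (fun w : fmonom 'I_n => (mu (mkmalgU w (1 : R[i])))%:A) q.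

Definition extend_gen (R : realType) (E : cstarType R) (n k : nat)
    (u : 'M[E]_n) : 'M[E]_(n + k) :=
  block_mx u 0 0 1%:M.

Definition hopf_invariant (R : realType) (A : cstarType R) (phi : {scalar A})
    (x : nat -> A) (n : nat) (E : genalg R n) : Prop :=
  forall (k : nat) (p : ncpoly R (n + k)),
    let mu := joint_distribution phi (fun i : 'I_(n + k) => x i) in
    (mu p)%:A = slice mu (coaction (extend_gen k (ga_u E)) p).

Definition boolean_invariant (R : realType) (A : cstarType R) (phi : {scalar A})
    (x : nat -> A) (n : nat) (E : bgenalg R n) : Prop :=
  forall (k : nat) (p : ncpoly R (n + k)),
    let mu := joint_distribution phi (fun i : 'I_(n + k) => x i) in
    mu p *: bg_P E = slice mu (coaction (extend_gen k (bg_u E)) p) * bg_P E.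

(** * Operator-valued independence *)

Definition conditional_expectation (R : realType) (A : cstarType R) (B : set A)
    (EE : {linear A -> A}) : Prop :=
  [/\ forall a, B (EE a), forall b, B b -> EE b = b
    & forall b1 a b2, B b1 -> B b2 -> EE (b1 * a * b2) = b1 * EE a * b2].

(* The coefficients B \cup C1. *)
Definition coef (R : realType) (A : cstarType R) (B : set A) (b : A) : Prop :=
  B b \/ exists c : R[i], b = c%:A.

(* The pair (b_0, [:: b_1; ...; b_n]) stands for b_0 X b_1 ... X b_n, and a
   sequence of such pairs for the sum of its terms: every element of B<X> is
   represented (complex coefficients are absorbed in b_0). *)
Definition bpoly (R : realType) (A : cstarType R) : Type := seq (A * seq A).

Definition is_bmonomial (R : realType) (A : cstarType R) (B : set A)
    (m : A * seq A) : Prop :=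
  coef B m.1 /\ forall b, b \in m.2 -> coef B b.

Definition in_BX (R : realType) (A : cstarType R) (B : set A)
    (p : bpoly A) : Prop :=
  forall m, m \in p -> is_bmonomial B m.

Definition in_BX0 (R : realType) (A : cstarType R) (B : set A)
    (p : bpoly A) : Prop :=
  forall m, m \in p -> is_bmonomial B m /\ (0 < size m.2)%N.

Definition bmon_eval (R : realType) (A : cstarType R) (x : A) (m : A * seq A) : A :=
  m.1 * \prod_(b <- m.2) (x * b).

Definition bpoly_eval (R : realType) (A : cstarType R) (x : A) (p : bpoly A) : A :=
  \sum_(m <- p) bmon_eval x m.

Definition neighbours_differ (T : Type) (s : seq (nat * T)) : bool :=
  sorted (fun i j => i != j) (map fst s).

Definition free_independent (R : realType) (A : cstarType R) (B : set A)
    (EE : A -> A) (x : nat -> A) : Prop :=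
  forall s : seq (nat * bpoly A), s <> [::] -> neighbours_differ s ->
    (forall t, t \in s -> in_BX B t.2 /\ EE (bpoly_eval (x t.1) t.2) = 0) ->
    EE (\prod_(t <- s) bpoly_eval (x t.1) t.2) = 0.

Definition boolean_independent (R : realType) (A : cstarType R) (B : set A)
    (EE : A -> A) (x : nat -> A) : Prop :=
  forall s : seq (nat * bpoly A), s <> [::] -> neighbours_differ s ->
    (forall t, t \in s -> in_BX0 B t.2) ->
    EE (\prod_(t <- s) bpoly_eval (x t.1) t.2)
      = \prod_(t <- s) EE (bpoly_eval (x t.1) t.2).

Definition identically_distributed (R : realType) (A : cstarType R) (B : set A)
    (EE : A -> A) (x : nat -> A) : Prop :=
  forall p : bpoly A, in_BX B p ->
    forall i j, EE (bpoly_eval (x i) p) = EE (bpoly_eval (x j) p).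

Definition identically_distributed0 (R : realType) (A : cstarType R) (B : set A)
    (EE : A -> A) (x : nat -> A) : Prop :=
  forall p : bpoly A, in_BX0 B p ->
    forall i j, EE (bpoly_eval (x i) p) = EE (bpoly_eval (x j) p).

Definition symmetric_distribution (R : realType) (A : cstarType R) (B : set A)
    (EE : A -> A) (x : A) : Prop :=
  forall m : A * seq A, is_bmonomial B m -> odd (size m.2) ->
    EE (bmon_eval x m) = 0.

(** * Operator-valued cumulants *)

Definition noncrossing (n : nat) (pi : {set {set 'I_n}}) : bool :=
  [forall i : 'I_n, forall j : 'I_n, forall k : 'I_n, forall l : 'I_n,
     [&& (i < j)%N, (j < k)%N, (k < l)%N,
         finset.pblock pi i == finset.pblock pi k & finset.pblock pi j == finset.pblock pi l]
     ==> (finset.pblock pi i == finset.pblock pi j)].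

Definition interval_partition (n : nat) (pi : {set {set 'I_n}}) : bool :=
  [forall i : 'I_n, forall j : 'I_n, forall k : 'I_n,
     [&& (i < j)%N, (j < k)%N & finset.pblock pi i == finset.pblock pi k]
     ==> (finset.pblock pi i == finset.pblock pi j)].

(* In the sequence c of the blocks of the successive points, position l starts
   an interval block. *)
Definition interval_block_at (L : eqType) (c : seq L) (l : nat) : bool :=
  if drop l c is V :: _ then
    take (count_mem V c) (drop l c) == nseq (count_mem V c) V
  else false.

(* w lists pairs (block, argument).  The first interval block V that does not
   contain the first point is removed and rho V is multiplied to the argument
   on its left; when there is none, only one block is left.  (The order of the
   removals does not matter for families of B-functionals.)  The number of
   removals is bounded by fuel. *)
Fixpoint nested (R : realType) (A : cstarType R) (L : eqType)
    (rho : seq A -> A) (fuel : nat) (w : seq (L * A)) : A :=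
  if fuel is fuel'.+1 then
    let c := unzip1 w in
    let l := find (fun l => interval_block_at c l.+1) (iota 0 (size w).-1) in
    if drop l w is (U, a) :: (V, b) :: w' then
      let s := count_mem V c in
      let v := unzip2 (take s ((V, b) :: w')) in
      nested rho fuel'
        (take l w ++ (U, a * rho v) :: drop s ((V, b) :: w'))
    else rho (unzip2 w)
  else 0.

(* rho^(pi)(a_1, ..., a_n) *)
Definition rho_partition (R : realType) (A : cstarType R) (rho : seq A -> A)
    (n : nat) (pi : {set {set 'I_n}}) (a : n.-tuple A) : A :=
  nested rho n [seq (finset.pblock pi i, tnth a i) | i <- enum 'I_n].

Definition moment_cumulant (R : realType) (A : cstarType R)
    (lattice : forall n, {set {set 'I_n}} -> bool)
    (EE : A -> A) (rho : seq A -> A) : Prop :=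
  forall (n : nat) (a : n.-tuple A), (0 < n)%N ->
    EE (\prod_(y <- a) y) =
    \sum_(pi : {set {set 'I_n}} | finset.partition pi [set: 'I_n] && lattice n pi)
       rho_partition rho pi a.

Definition free_cumulants (R : realType) (A : cstarType R)
    (EE : A -> A) (kappa : seq A -> A) : Prop :=
  moment_cumulant noncrossing EE kappa.

Definition boolean_cumulants (R : realType) (A : cstarType R)
    (EE : A -> A) (beta : seq A -> A) : Prop :=
  moment_cumulant interval_partition EE beta.

(* rho^(n)(b_0 x b_1, x b_2, ..., x b_n) = 0 for all n in N and all
   coefficients *)
Definition cumulants_vanish (R : realType) (A : cstarType R) (B : set A)
    (rho : seq A -> A) (N : pred nat) (x : A) : Prop :=
  forall (b0 b1 : A) (bs : seq A),
    coef B b0 -> coef B b1 -> (forall b, b \in bs -> coef B b) ->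
    N (size bs).+1 ->
    rho (b0 * x * b1 :: [seq x * b | b <- bs]) = 0.

Definition shifted_semicircular (R : realType) (A : cstarType R) (B : set A)
    (EE : A -> A) (x : A) : Prop :=
  exists2 kappa, free_cumulants EE kappa &
    cumulants_vanish B kappa (fun n => (3 <= n)%N) x.

Definition centered_semicircular (R : realType) (A : cstarType R) (B : set A)
    (EE : A -> A) (x : A) : Prop :=
  exists2 kappa, free_cumulants EE kappa &
    cumulants_vanish B kappa (fun n => n != 2) x.

Definition shifted_bernoulli (R : realType) (A : cstarType R) (B : set A)
    (EE : A -> A) (x : A) : Prop :=
  exists2 beta, boolean_cumulants EE beta &
    cumulants_vanish B beta (fun n => (3 <= n)%N) x.

Definition centered_bernoulli (R : realType) (A : cstarType R) (B : set A)
    (EE : A -> A) (x : A) : Prop :=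
  exists2 beta, boolean_cumulants EE beta &
    cumulants_vanish B beta (fun n => n != 2) x.

(* Main.v *)
(* Invariance under magic matrices gives invariance under finite permutations and under the block
   matrices ((p, 1 - p), (1 - p, p)), with non-commuting projections p.  Shifting letters to
   infinity yields the conditional expectation (onto the tail algebra in the free case, a |-> e a e
   for a projection e in the Boolean case), and a descending induction on the number of distinct
   letters of a word, crossings being resolved by such pairs of projections, yields
   independence.  The coaction acts diagonally on cumulants, and mixed cumulants vanish: if the
   cumulant of order m is not zero, then sum_k u_(k i_1) ... u_(k i_m) = 1 when i_1 = ... = i_m and
   0 otherwise.  This relation makes u magic, cubic or bistochastic, according to m. *)
Require Import Defs.
From HB Require Import structures.
From mathcomp Require Import all_boot all_order all_algebra.
From mathcomp Require Import complex.
From mathcomp Require Import all_classical all_reals all_analysis.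
From mathcomp Require Import ring lra zify.
From mathcomp.multinomials Require Import -(notations) monalg.

Set Implicit Arguments.
Unset Strict Implicit.
Unset Printing Implicit Defensive.

Import Order.TTheory GRing.Theory Num.Theory.
Import numFieldNormedType.Exports.

Local Open Scope classical_set_scope.
Local Open Scope complex_scope.
Local Open Scope ring_scope.

(** The position of two pairs of projections decides which independence appears. If p q p = p / 2,
    an alternating product with d changes, summed over the choices of p or 1 - p and of q or 1 - q,
    is a scalar below 1 only from d = 3 on: a word with pattern k l k l is forced to vanish, k l k
    is not. The rank one projections on Omega + e, Omega - e, Omega + f, Omega - f give 2^(1 - d) on
    Omega, below 1 from d = 2 on, so that k l k is excluded already. Three obstacles shape the rest.
    Weak limits exist for bounded sequences, by the bicommutant property; hence renamings of letters
    are shown to be contractive, and elements are approximated by bounded polynomials. Invariance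
    concerns the scalars [phi], while cumulants are operators: functionals built from [phi] separate
    the values, and [tensor_separation] transfers the relations. Cumulants are defined by sums over
    set partitions; reading the points from left to right with a stack of open blocks turns them
    into a recursion on the block of the first point. *)

(* Identities in noncommutative algebras: an expression is expanded into a sum of terms
   [(scalars, word, multiplicity)]. *)
Inductive nexp :=
  NV of nat | N0 | N1 | NA of nexp & nexp | NO of nexp | NM of nexp & nexp | NS of nat & nexp.

Section NcRing.
Variables (K : comNzRingType) (A : algType K).
Variables (sg : seq K) (rho : seq A).

Fixpoint nev (e : nexp) : A :=
  match e with
  | NV n => nth 0 rho n | N0 => 0 | N1 => 1 | NA a b => nev a + nev b
  | NO a => - nev a | NM a b => nev a * nev b | NS c a => nth 0 sg c *: nev a
  end.

(** The multiplicity is a formal difference of two natural numbers, so that normal forms compute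
    without integers. Scalars commute and are kept sorted; the word keeps its order. *)
Definition nterm : Type := (seq nat * seq nat) * (nat * nat).

Definition nmon (m : seq nat * seq nat) : A :=
  (\prod_(i <- m.1) nth 0 sg i) *: \prod_(i <- m.2) nth 0 rho i.

Definition nt_ev (t : nterm) : A := nmon t.1 *+ t.2.1 - nmon t.1 *+ t.2.2.

Definition nl_ev (l : seq nterm) : A := \sum_(t <- l) nt_ev t.

Definition nt_mul (t u : nterm) : nterm :=
  ((sort leq (t.1.1 ++ u.1.1), t.1.2 ++ u.1.2),
   (t.2.1 * u.2.1 + t.2.2 * u.2.2, t.2.1 * u.2.2 + t.2.2 * u.2.1)%N).

Definition nt_opp (t : nterm) : nterm := (t.1, (t.2.2, t.2.1)).

Fixpoint nins (t : nterm) (l : seq nterm) : seq nterm :=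
  if l is u :: l' then
    if u.1 == t.1 then (u.1, (u.2.1 + t.2.1, u.2.2 + t.2.2)%N) :: l' else u :: nins t l'
  else [:: t].

Fixpoint nnf (e : nexp) : seq nterm :=
  match e with
  | NV n => [:: (([::], [:: n]), (1%N, 0%N))] | N0 => [::]
  | N1 => [:: (([::], [::]), (1%N, 0%N))]
  | NA a b => foldr nins (nnf b) (nnf a)
  | NO a => [seq nt_opp t | t <- nnf a]
  | NM a b => foldr nins [::] [seq nt_mul t u | t <- nnf a, u <- nnf b]
  | NS c a => [seq ((sort leq (c :: t.1.1), t.1.2), t.2) | t <- nnf a]
  end.

Lemma nt_mulE t u : nt_ev (nt_mul t u) = nt_ev t * nt_ev u.
Proof.
case: t u => [[s w] [p q]] [[s' w'] [p' q']]; rewrite /nt_ev /=.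
have -> : nmon (sort leq (s ++ s'), w ++ w') = nmon (s, w) * nmon (s', w').
  rewrite /nmon /= -scalerAl -scalerAr scalerA -big_cat -big_cat; congr (_ *: _).
  exact/perm_big/permEl/perm_sort.
set a := nmon _; set b := nmon _.
rewrite mulrBl !mulrBr !mulrnAl !mulrnAr -!mulrnA !mulrnDr opprB.
rewrite (mulnC p') (mulnC q') (mulnC p' q) (mulnC q' q) opprD !addrA.
by rewrite -!addrA; congr (_ + _); rewrite addrCA addrC -!addrA; congr (_ + _); rewrite addrC.
Qed.

Lemma nt_oppE t : nt_ev (nt_opp t) = - nt_ev t.
Proof. by rewrite /nt_ev /= opprB. Qed.

Lemma ninsE t l : nl_ev (nins t l) = nt_ev t + nl_ev l.
Proof.
elim: l => [|u l IH] /=; first by rewrite /nl_ev big_cons.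
case: eqP => [e|_]; rewrite /nl_ev !big_cons; last by rewrite -/(nl_ev _) IH addrCA.
rewrite addrA; congr (_ + _); rewrite /nt_ev /= e !mulrnDr opprD addrACA.
exact: addrC.
Qed.

Lemma ninsrE l l' : nl_ev (foldr nins l' l) = nl_ev l + nl_ev l'.
Proof.
elim: l => [|t l IH]; first by rewrite /nl_ev big_nil add0r.
by rewrite /= ninsE IH /nl_ev big_cons addrA.
Qed.

Lemma nnfE e : nl_ev (nnf e) = nev e.
Proof.
elim: e => [n|||a IHa b IHb|a IH|a IHa b IHb|c a IH] /=.
- by rewrite /nl_ev big_seq1 /nt_ev /nmon /= big_nil big_seq1 scale1r subr0.
- by rewrite /nl_ev big_nil.
- by rewrite /nl_ev big_seq1 /nt_ev /nmon /= !big_nil scale1r subr0.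
- by rewrite ninsrE IHa IHb.
- by rewrite -IH /nl_ev big_map -sumrN; apply: eq_bigr => t _; rewrite nt_oppE.
- rewrite ninsrE {2}/nl_ev big_nil addr0 -IHa -IHb /nl_ev big_allpairs_dep mulr_suml.
  by apply: eq_bigr => t _; rewrite mulr_sumr; apply: eq_bigr => u _; rewrite nt_mulE.
- rewrite -IH /nl_ev big_map scaler_sumr; apply: eq_bigr => t _.
  rewrite /nt_ev /= scalerBr !scalerMnr /nmon /= !scalerA.
  by rewrite (perm_big (c :: t.1.1)) /= ?perm_sort // big_cons.
Qed.

Lemma ncring_correct a b :
  all (fun t : nterm => t.2.1 == t.2.2) (nnf (NA a (NO b))) -> nev a = nev b.
Proof.
move=> h; apply/eqP; rewrite -subr_eq0 -[X in X == 0]/(nev (NA a (NO b))) -nnfE /nl_ev.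
rewrite big_seq big1 // => t /(allP h) /eqP e.
by rewrite /nt_ev e subrr.
Qed.

End NcRing.

Ltac nc_add x l :=
  lazymatch l with
  | [::] => constr:([:: x])
  | x :: _ => constr:(l)
  | ?y :: ?l' =>
    match tt with
    | _ => let _ := match tt with _ => unify x y end in constr:(l)
    | _ => let r := nc_add x l' in constr:(y :: r)
    end
  end.
Ltac nc_idx x l :=
  lazymatch l with
  | x :: _ => constr:(0%N)
  | ?y :: ?l' =>
    match tt with
    | _ => let _ := match tt with _ => unify x y end in constr:(0%N)
    | _ => let n := nc_idx x l' in constr:(S n)
    end
  end.
Ltac nc_atoms t l :=
  lazymatch t with
  | (?a + ?b)%R => let l1 := nc_atoms a l in nc_atoms b l1
  | (- ?a)%R => nc_atoms a l
  | (?a * ?b)%R => let l1 := nc_atoms a l in nc_atoms b l1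
  | (?c *: ?a)%R => nc_atoms a l
  | (?a ^+ 2)%R => nc_atoms a l
  | 0%R => constr:(l)
  | 1%R => constr:(l)
  | _ => nc_add t l
  end.
Ltac nc_scal t l :=
  lazymatch t with
  | (?a + ?b)%R => let l1 := nc_scal a l in nc_scal b l1
  | (- ?a)%R => nc_scal a l
  | (?a * ?b)%R => let l1 := nc_scal a l in nc_scal b l1
  | (?c *: ?a)%R => let l1 := nc_add c l in nc_scal a l1
  | (?a ^+ 2)%R => nc_scal a l
  | _ => constr:(l)
  end.
Ltac nc_reify t s l :=
  lazymatch t with
  | (?a + ?b)%R => let x := nc_reify a s l in let y := nc_reify b s l in constr:(NA x y)
  | (- ?a)%R => let x := nc_reify a s l in constr:(NO x)
  | (?a * ?b)%R => let x := nc_reify a s l in let y := nc_reify b s l in constr:(NM x y)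
  | (?c *: ?a)%R => let n := nc_idx c s in let x := nc_reify a s l in constr:(NS n x)
  | (?a ^+ 2)%R => let x := nc_reify a s l in constr:(NM x x)
  | 0%R => constr:(N0)
  | 1%R => constr:(N1)
  | _ => let n := nc_idx t l in constr:(NV n)
  end.
Ltac ncring_in K A :=
  lazymatch goal with
  | |- ?a = ?b =>
    let l := nc_atoms a (@nil A) in let l := nc_atoms b l in
    let s := nc_scal a (@nil K) in let s := nc_scal b s in
    let x := nc_reify a s l in let y := nc_reify b s l in
    refine (@ncring_correct _ _ s l x y _); vm_compute; reflexivity
  end.

(** * Square roots, positivity and inverses in a C*-algebra *)

Section CStarBasics.
Variables (R : realType) (A : cstarType R).
Implicit Types (b x y z v q t w u : A).

Lemma star0 : star (0 : A) = 0.
Proof. by rewrite -(scale0r (0 : A)) starZ rmorph0 !scale0r. Qed.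

Lemma starN x : star (- x) = - star x.
Proof. by rewrite -scaleN1r starZ rmorphN rmorph1 scaleN1r. Qed.

Lemma starB x y : star (x - y) = star x - star y.
Proof. by rewrite starD starN. Qed.

Lemma star1 : star (1 : A) = 1.
Proof. by have := starM (star (1 : A)) 1; rewrite mulr1 starK mulr1. Qed.

Lemma star_sum (I : Type) (s : seq I) (F : I -> A) :
  star (\sum_(i <- s) F i) = \sum_(i <- s) star (F i).
Proof. by elim: s => [|i s IH]; rewrite ?big_nil ?star0 // !big_cons starD IH. Qed.

Lemma starZr (r : R) x : star (r%:C *: x) = r%:C *: star x.
Proof. by rewrite starZ; congr (_ *: _); apply/CrealP; rewrite complex_real. Qed.

Lemma cnorm0 : cnorm (0 : A) = 0.
Proof.
have := cnormZ 0 (0 : A); rewrite scale0r normr0 mul0r => /eqP.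
by rewrite (_ : 0 = 0%:C) // => /eqP [].
Qed.

Lemma normRC (r : R) : `|r%:C| = `|r|%:C.
Proof.
by case: (ger0P r) => h; [rewrite ger0_norm ?ler0c|rewrite ltr0_norm ?ltcR // rmorphN].
Qed.

Lemma cnormZr (r : R) x : cnorm (r%:C *: x) = `|r| * cnorm x.
Proof.
have := cnormZ (r%:C) x; rewrite normRC -rmorphM /= => /eqP.
by rewrite eq_complex /= eqxx andbT => /eqP.
Qed.

Lemma cnormN x : cnorm (- x) = cnorm x.
Proof.
have := cnormZr (-1) x; rewrite normrN1 mul1r => <-; congr cnorm.
by rewrite rmorphN rmorph1 scaleN1r.
Qed.

Lemma cnorm_ge0 x : 0 <= cnorm x.
Proof.
have := cnormD x (- x); rewrite subrr cnorm0 cnormN; lra.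
Qed.

Lemma cnormB x y : cnorm (x - y) <= cnorm x + cnorm y.
Proof. by apply: le_trans (cnormD _ _) _; rewrite cnormN. Qed.

Lemma cnorm_distC x y : cnorm (x - y) = cnorm (y - x).
Proof. by rewrite -cnormN opprB. Qed.

Lemma cnorm_triB x y z : cnorm (x - z) <= cnorm (x - y) + cnorm (y - z).
Proof. by apply: le_trans (cnormD _ _); rewrite addrA subrK. Qed.

Lemma cnorm1 : cnorm (1 : A) = 1.
Proof.
have := cnorm_star (1 : A); rewrite star1 mulr1 => h.
have [/cnorm_eq0/eqP|n0] := eqVneq (cnorm (1 : A)) 0; first by rewrite oner_eq0.
by apply: (mulfI n0); rewrite mulr1 -expr2 -h.
Qed.

Lemma cnormS x : cnorm (star x) = cnorm x.
Proof.
have le y : cnorm y <= cnorm (star y).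
  have := cnormM (star y) y; rewrite cnorm_star.
  have [->|n0] := eqVneq (cnorm y) 0; first by rewrite cnorm_ge0.
  by rewrite expr2 ler_pM2r // lt_def n0 cnorm_ge0.
by apply/eqP; rewrite eq_le le andbT -{2}(starK x).
Qed.

Lemma star_mul_eq0 x : star x * x = 0 -> x = 0.
Proof.
move=> h; apply/cnorm_eq0/eqP; have := cnorm_star x.
by rewrite h cnorm0 => /esym/eqP; rewrite sqrf_eq0.
Qed.

Lemma cnorm_small x : (forall e : R, 0 < e -> cnorm x < e) -> x = 0.
Proof.
move=> h; apply/cnorm_eq0/eqP; rewrite eq_le cnorm_ge0 andbT leNgt; apply/negP => x0.
by have := h _ x0; rewrite ltxx.
Qed.

Lemma halfD x : (2^-1 : R)%:C *: (x + x) = x.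
Proof.
rewrite scalerDr -scalerDl -rmorphD /= (_ : 2^-1 + 2^-1 = 1 :> R); last by lra.
by rewrite rmorph1 scale1r.
Qed.

Lemma comm_sqr x y : x * y = y * x -> x * (y * y) = y * y * x.
Proof. by move=> h; rewrite mulrA h -mulrA h mulrA. Qed.

Definition nlim (a : nat -> A) (l : A) := forall e : R, 0 < e ->
  exists N : nat, forall n, (N <= n)%N -> cnorm (a n - l) < e.

Lemma nlim_uniq (a : nat -> A) l l' : nlim a l -> nlim a l' -> l = l'.
Proof.
move=> h h'; apply/eqP; rewrite -subr_eq0; apply/eqP/cnorm_small => e e0.
have e2 : 0 < e / 2 by lra.
have [N hN] := h _ e2; have [N' hN'] := h' _ e2.
have := hN (maxn N N') (leq_maxl _ _); have := hN' (maxn N N') (leq_maxr _ _).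
have := cnorm_triB l (a (maxn N N')) l'; rewrite (cnorm_distC l (a _)); lra.
Qed.

Lemma nlimS a l : nlim a l -> nlim (fun n => a n.+1) l.
Proof. by move=> h e /h [N hN]; exists N => n hn; apply: hN; apply: leqW. Qed.

Lemma nlim_le a l (M : R) : nlim a l -> (forall n, cnorm (a n) <= M) -> cnorm l <= M.
Proof.
move=> h hM; rewrite leNgt; apply/negP => lt.
have [|N hN] := h (cnorm l - M); first by lra.
have := hN _ (leqnn N); have := hM N.
have := cnorm_triB l (a N) 0; rewrite !subr0 (cnorm_distC l); lra.
Qed.

Lemma nlimM c d a l : nlim a l -> nlim (fun n => c * a n * d) (c * l * d).
Proof.
move=> h e e0; set M := cnorm c * cnorm d + 1.
have M0 : 0 < M by have := cnorm_ge0 c; have := cnorm_ge0 d; rewrite /M; nra.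
have [|N hN] := h (e / M); first by rewrite divr_gt0.
exists N => n /hN; rewrite ltr_pdivlMr // => hh.
rewrite -mulrBl -mulrBr; apply: le_lt_trans (cnormM _ _) _.
apply: le_lt_trans (_ : cnorm c * cnorm (a n - l) * cnorm d < e).
  by rewrite ler_wpM2r ?cnorm_ge0 // cnormM.
by have := cnorm_ge0 (a n - l); move: hh; rewrite /M; nra.
Qed.

Lemma nlimD a a' l l' : nlim a l -> nlim a' l' -> nlim (fun n => a n + a' n) (l + l').
Proof.
move=> h h' e e0; have e2 : 0 < e / 2 by lra.
have [N hN] := h _ e2; have [N' hN'] := h' _ e2.
exists (maxn N N') => n; rewrite geq_max => /andP[/hN h1 /hN' h2].
rewrite opprD addrACA; apply: le_lt_trans (cnormD _ _) _; lra.
Qed.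

Lemma nlimC l : nlim (fun=> l) l.
Proof. by move=> e e0; exists 0%N => n _; rewrite subrr cnorm0. Qed.

Lemma nlimZ (c : R[i]) a l : nlim a l -> nlim (fun n => c *: a n) (c *: l).
Proof.
move=> /(nlimM (c%:A) 1) h e /h [N hN]; exists N => n /hN.
by rewrite !mulr1 !mulr_algl.
Qed.

Lemma nlim_star a l : nlim a l -> nlim (fun n => star (a n)) (star l).
Proof. by move=> h e /h [N hN]; exists N => n /hN; rewrite -starB cnormS. Qed.

Lemma nlim_sqr a l : (forall n, cnorm (a n) <= 1) -> nlim a l ->
  nlim (fun n => a n * a n) (l * l).
Proof.
move=> hb h e e0; have l1 := nlim_le h hb.
have [|N hN] := h (e / 2); first by lra.
exists N => n /hN hn; have := hb n => an.
have -> : a n * a n - l * l = a n * (a n - l) + (a n - l) * l.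
  by rewrite mulrBr mulrBl addrA subrK.
apply: le_lt_trans (cnormD _ _) _.
have := cnormM (a n) (a n - l); have := cnormM (a n - l) l.
have := cnorm_ge0 (a n - l); have := cnorm_ge0 (a n); have := cnorm_ge0 l; nra.
Qed.

(** Comparison with a bounded real sequence: its increments dominate norms, so it is nondecreasing,
    and closeness to its supremum gives the Cauchy property. *)
Lemma nlim_ex (a : nat -> A) (s : nat -> R) (M : R) : (forall n, s n <= M) ->
  (forall n, cnorm (a n.+1 - a n) <= s n.+1 - s n) -> exists l, nlim a l.
Proof.
move=> sM h; have step m n : (n <= m)%N -> cnorm (a m - a n) <= s m - s n.
  move/subnK => <-; elim: (m - n)%N => [|k IH]; first by rewrite !subrr cnorm0.
  by rewrite addSn; have := cnorm_triB (a (k + n).+1) (a (k + n)%N) (a n); have := h (k + n)%N; lra.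
apply: cnorm_complete => e e0.
have hs : has_sup (range s) by split; [exists (s 0%N), 0%N|exists M => _ [n _ <-]].
have e2 : 0 < e / 2 by lra.
have [_ [N _ <-] hN] := sup_adherent e2 hs.
have su n : s n <= sup (range s) by apply: sup_upper_bound => //; exists n.
exists N => m n hm hn.
have := step _ _ hm; have := step _ _ hn; have := cnorm_triB (a m) (a N) (a n).
rewrite (cnorm_distC (a N)); have := su m; have := su n; lra.
Qed.

(* [1 - r] is the limit of the iteration [y' = (t + y ^ 2) / 2] started at [0], which is
   dominated by the same iteration started at [0] for the real number [1]. *)
Lemma csqrt (t : A) : star t = t -> cnorm t <= 1 ->
  exists r, [/\ star r = r, r * r = 1 - t, cnorm (1 - r) <= 1
    & forall z, z * t = t * z -> z * r = r * z].
Proof.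
move=> st t1.
pose Y := fix Y n := if n is n'.+1 then (2^-1 : R)%:C *: (t + Y n' * Y n') else 0.
pose s := fix s n : R := if n is n'.+1 then 2^-1 * (1 + s n' * s n') else 0.
have YS n : Y n.+1 = (2^-1 : R)%:C *: (t + Y n * Y n) by [].
have sS n : s n.+1 = 2^-1 * (1 + s n * s n) by [].
have Y0 : Y 0%N = 0 by []. have s0 : s 0%N = 0 by [].
move: Y s YS sS Y0 s0 => Y s YS sS Y0 s0.
have hs n : 0 <= s n <= 1 by elim: n => [|n IH]; rewrite ?s0 ?sS; nra.
have cY n z : z * t = t * z -> z * Y n = Y n * z.
  move=> hz; elim: n => [|n IH]; first by rewrite Y0 mulr0 mul0r.
  rewrite YS -scalerAr -scalerAl mulrDr mulrDl hz; congr (_ *: (_ + _)).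
  by rewrite mulrA IH -mulrA IH mulrA.
have YY m n : Y m * Y n = Y n * Y m by apply: (cY _ _) => //; rewrite (cY _ t).
have sY n : star (Y n) = Y n.
  by elim: n => [|n IH]; rewrite ?Y0 ?star0 // YS starZr starD starM st IH.
have nY n : cnorm (Y n) <= s n.
  elim: n => [|n IH]; first by rewrite Y0 s0 cnorm0.
  rewrite YS sS cnormZr ger0_norm ?invr_ge0 // ler_wpM2l ?invr_ge0 //.
  apply: le_trans (cnormD _ _) _; apply: lerD => //.
  apply: le_trans (cnormM _ _) _; have := cnorm_ge0 (Y n); have := hs n; nra.
have dY n : cnorm (Y n.+1 - Y n) <= s n.+1 - s n /\ s n <= s n.+1.
  elim: n => [|n [IH IHs]].
    rewrite !YS !sS Y0 s0 subr0 !mulr0 !addr0 cnormZr ger0_norm ?invr_ge0 // subr0 mulr1; split; last by lra.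
    by have := cnorm_ge0 t; lra.
  split; last by have := hs n; have := hs n.+1; move: IHs; rewrite (sS n.+1) {2}sS; nra.
  have -> : Y n.+2 - Y n.+1 = (2^-1 : R)%:C *: ((Y n.+1 - Y n) * (Y n.+1 + Y n)).
    have -> : (Y n.+1 - Y n) * (Y n.+1 + Y n) = Y n.+1 * Y n.+1 - Y n * Y n + (Y n.+1 * Y n - Y n * Y n.+1).
      by ncring_in R[i] A.
    rewrite (YY n) subrr addr0.
    transitivity ((2^-1 : R)%:C *: (t + Y n.+1 * Y n.+1) - (2^-1 : R)%:C *: (t + Y n * Y n)).
      by rewrite -!YS.
    by ncring_in R[i] A.
  rewrite cnormZr ger0_norm ?invr_ge0 //.
  have -> : s n.+2 - s n.+1 = 2^-1 * ((s n.+1 - s n) * (s n.+1 + s n)).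
    transitivity (2^-1 * (1 + s n.+1 * s n.+1) - 2^-1 * (1 + s n * s n)); first by rewrite -!sS.
    by ring.
  rewrite ler_wpM2l ?invr_ge0 //; apply: le_trans (cnormM _ _) _.
  have := cnormD (Y n.+1) (Y n); have := nY n; have := nY n.+1.
  have := cnorm_ge0 (Y n.+1 - Y n); have := cnorm_ge0 (Y n.+1 + Y n).
  by move=> *; apply: ler_pM => //; lra.
have [|y hy] := @nlim_ex Y s 1 _ (fun n => (dY n).1); first by move=> n; case/andP: (hs n).
have bY n : cnorm (Y n) <= 1 by apply: le_trans (nY n) _; case/andP: (hs n).
have y1 : cnorm y <= 1 by exact: nlim_le hy bY.
have sy : star y = y.
  have h := nlim_star hy; rewrite (_ : (fun n => star (Y n)) = Y) in h; last exact: funext.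
  exact: nlim_uniq h hy.
have ey : y + y = t + y * y.
  have h1 : nlim (fun n => Y n.+1) y by apply: nlimS.
  have h2 := nlimZ ((2^-1 : R)%:C) (nlimD (nlimC t) (nlim_sqr bY hy)).
  have h3 : nlim (fun n => Y n.+1) ((2^-1 : R)%:C *: (t + y * y)).
    by move=> e /h2 [N hN]; exists N => n /hN; rewrite -YS.
  have e := nlim_uniq h1 h3.
  by rewrite -[t + _]halfD scalerDr -e.
exists (1 - y); split.
- by rewrite starB star1 sy.
- have -> : (1 - y) * (1 - y) = 1 - (y + y) + y * y by ncring_in R[i] A.
  by rewrite ey; ncring_in R[i] A.
- by rewrite opprB addrCA subrr addr0.
- move=> z hz; rewrite mulrBr mulrBl mulr1 mul1r; congr (_ - _).
  have := nlimM z 1 hy; have := nlimM 1 z hy.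
  rewrite !mulr1 !mul1r; rewrite (_ : (fun n => z * Y n * 1) = (fun n => 1 * Y n * z)).
    by move=> h1 h2; apply: nlim_uniq h2 h1.
  by apply: funext => n; rewrite mulr1 mul1r cY.
Qed.

(** The element [v + 'i *: q] satisfies [star x * x = c ^ 2], hence has norm [c], and [v] is its
    real part. *)
Lemma sq_norm v q (c : R) : star v = v -> star q = q -> v * q = q * v -> 0 <= c ->
  v * v + q * q = (c ^+ 2)%:C *: 1 -> cnorm v <= c.
Proof.
move=> sv sq vq c0 e; pose x := v + 'i *: q.
have sx : star x = v - 'i *: q by rewrite starD starZ conjCi sv sq scaleNr.
have xx : star x * x = (c ^+ 2)%:C *: 1.
  rewrite sx -e /x; transitivity (v * v - 'i *: ('i *: (q * q)) + 'i *: (v * q - q * v)).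
    by ncring_in R[i] A.
  by rewrite vq subrr scaler0 addr0 scalerA -(expr2 'i) sqrCi scaleN1r opprK.
have nx : cnorm x = c.
  apply/eqP; rewrite -(@eqrXn2 _ 2) ?cnorm_ge0 // -cnorm_star xx cnormZr cnorm1 mulr1.
  by rewrite ger0_norm ?sqr_ge0.
have -> : v = (2^-1 : R)%:C *: (x + star x).
  by rewrite sx /x addrACA subrr addr0 halfD.
rewrite cnormZr ger0_norm ?invr_ge0 //.
have := cnormD x (star x); rewrite cnormS nx; lra.
Qed.

Lemma cnorm_sqr_le1 y : cnorm y <= 1 -> cnorm (y * y) <= 1.
Proof. by move=> h; have := cnormM y y; have := cnorm_ge0 y; nra. Qed.

(** A square root [r] of [1 - y * y] commutes with [y], and their squares add up to 1: [sq_norm]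
    bounds [r], hence its square. *)
Lemma norm_compl y : star y = y -> cnorm y <= 1 -> cnorm (1 - y * y) <= 1.
Proof.
move=> sy y1; have [|r [sr rr _ cr]] := @csqrt (y * y) _ (cnorm_sqr_le1 y1).
  by rewrite starM sy.
rewrite -rr; apply: cnorm_sqr_le1; apply: (@sq_norm r y) => //.
- by apply/esym/cr; rewrite mulrA.
- by rewrite rr subrK expr1n rmorph1 scale1r.
Qed.

(** [m] is the absolute value of [y] and [q] the square root of [m]. After scaling, both come from
    [csqrt] applied to a complement; its bound on [1 - m] is what allows the second application. *)
Lemma cabs y : star y = y -> exists m q, [/\ star m = m, star q = q, m * m = y * y,
  q * q = m & forall z, z * y = y * z -> z * m = m * z /\ z * q = q * z].
Proof.
move=> sy; pose l := 1 + cnorm y; have l0 : 0 < l by have := cnorm_ge0 y; rewrite /l; lra.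
pose y1 := (l^-1)%:C *: y.
have sy1 : star y1 = y1 by rewrite starZr sy.
have n1 : cnorm y1 <= 1.
  rewrite cnormZr gtr0_norm ?invr_gt0 //.
  by rewrite ler_pdivrMl // mulr1 /l; lra.
have [|m [sm mm m1 cm]] := @csqrt (1 - y1 * y1) _ (norm_compl sy1 n1).
  by rewrite starB star1 starM sy1.
have [|q [sq qq _ cq]] := @csqrt (1 - m) _ m1; first by rewrite starB star1 sm.
exists (l%:C *: m), ((Num.sqrt l)%:C *: q).
have CM (a b : R) z w : (a%:C *: z) * (b%:C *: w) = (a * b)%:C *: (z * w).
  by rewrite -scalerAl -scalerAr scalerA rmorphM.
have c1 z : z * y = y * z -> z * (y1 * y1) = y1 * y1 * z.
  move=> h; have h1 : z * y1 = y1 * z by rewrite /y1 -scalerAr -scalerAl h.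
  exact: comm_sqr.
have c2 z : z * y = y * z -> z * m = m * z.
  by move=> /c1 h; apply: cm; rewrite mulrBr mulrBl mulr1 mul1r h.
split.
- by rewrite starZr sm.
- by rewrite starZr sq.
- rewrite CM mm subKr /y1 CM scalerA -rmorphM /=.
  by rewrite (_ : l * l * _ = 1) ?rmorph1 ?scale1r //; field; rewrite lt0r_neq0.
- by rewrite CM qq subKr -expr2 sqr_sqrtr // ltW.
- move=> z hz; rewrite -!scalerAr -!scalerAl (c2 _ hz); split=> //; congr (_ *: _).
  by apply: cq; rewrite mulrBr mulrBl mulr1 mul1r (c2 _ hz).
Qed.

Definition lfun (th : A -> R[i]) := forall (c : R[i]) x y, th (c *: x + y) = c * th x + th y.

Lemma lfunD th x y : lfun th -> th (x + y) = th x + th y.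
Proof. by move=> h; have := h 1 x y; rewrite scale1r mul1r. Qed.

Lemma lfun0 th : lfun th -> th 0 = 0.
Proof. by move=> h; apply: (@addrI _ (th 0)); rewrite -lfunD // !addr0. Qed.

Lemma lfunZ th (c : R[i]) x : lfun th -> th (c *: x) = c * th x.
Proof. by move=> h; have := h c x 0; rewrite !addr0 lfun0 // addr0. Qed.

Lemma lfunN th x : lfun th -> th (- x) = - th x.
Proof. by move=> h; rewrite -scaleN1r lfunZ // mulN1r. Qed.

Lemma lfunB th x y : lfun th -> th (x - y) = th x - th y.
Proof. by move=> h; rewrite lfunD // lfunN. Qed.

Lemma lfun_sum th (I : Type) (s : seq I) (F : I -> A) : lfun th ->
  th (\sum_(i <- s) F i) = \sum_(i <- s) th (F i).
Proof. by move=> h; elim: s => [|i s IH]; rewrite ?big_nil ?lfun0 // !big_cons lfunD // IH. Qed.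

(** Plays the role of a faithful representation when positivity and norms are tested. It is
    instantiated by vector functionals of [ro], by vectors of C^d, and by the conjugates of
    [phi]. *)
Definition sep_family (T : set (A -> R[i])) :=
  [/\ forall th, T th -> lfun th, forall th z, T th -> 0 <= th (star z * z)
    & forall z, (forall th, T th -> th (star z * z) = 0) -> z = 0].

(** With m = |y|, the element n = m - y is twice the negative part of [y], and y n = - m n. Testing
    [y] at n makes - (q n)^* (q n) nonnegative under every functional, so q n = 0 and n = 0. *)
Lemma pos_detect T y : sep_family T -> star y = y ->
  (forall th w, T th -> 0 <= th (star w * y * w)) ->
  exists q, [/\ star q = q, y = q * q & forall z, z * y = y * z -> z * q = q * z].
Proof.
move=> [Tl Tp Ts] sy hy; have [m [q [sm sq mm qq cmq]]] := cabs sy.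
have [ym yq] := cmq y erefl; have [mm' mq] := cmq m (esym ym).
pose n := m - y.
have yn : y * n = - (m * n) by rewrite /n !mulrBr mm ym opprB.
have qn : q * n = n * q by rewrite /n mulrBr mulrBl yq mq.
have sn : star n = n by rewrite starB sm sy.
have n0 : q * n = 0.
  apply: Ts => th Tth; apply/eqP; rewrite eq_le Tp // andbT.
  have := hy th n Tth; rewrite sn -mulrA yn mulrN lfunN ?oppr_ge0; last exact: Tl.
  by rewrite starM sq sn -!qq !mulrA.
have mn0 : m * n = 0 by rewrite -qq -mulrA n0 mulr0.
have : n = 0.
  apply: star_mul_eq0; rewrite sn; have -> : n * n = m * n - y * n by rewrite -mulrBl.
  by rewrite mn0 yn mn0 oppr0 subrr.
move/eqP; rewrite subr_eq0 => /eqP my; exists q; split=> //; first by rewrite qq.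
by move=> z /cmq [].
Qed.

(** By [pos_detect] both [star x * x] and its complement to [c ^ 2] are squares, of commuting
    selfadjoint elements [v] and [q]; [sq_norm] gives the bound on [v]. *)
Lemma norm_detect T x (c : R) : sep_family T -> 0 <= c ->
  (forall th w, T th -> th (star w * (star x * x) * w) <= (c ^+ 2)%:C * th (star w * w)) ->
  cnorm x <= c.
Proof.
move=> ST c0 h; have [Tl Tp Ts] := ST; pose u := star x * x.
have su : star u = u by rewrite starM starK.
have [|v [sv uv _]] := @pos_detect T u ST su.
  by move=> th w Tth; have := Tp th (x * w) Tth; rewrite starM /u !mulrA.
have [|th w Tth|q [sq uq cq]] := @pos_detect T ((c ^+ 2)%:C *: 1 - u) ST.
- by rewrite starB starZr star1 su.
- rewrite mulrBr mulrBl lfunB; last exact: Tl.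
  by rewrite -scalerAr -scalerAl mulr1 lfunZ ?subr_ge0 ?h //; apply: Tl.
have vq : v * q = q * v.
  apply: cq; rewrite mulrBr mulrBl -scalerAr -scalerAl mulr1 mul1r uv.
  by rewrite mulrA.
have := sq_norm sv sq vq c0; rewrite -uv -uq addrC subrK => /(_ erefl) nv.
rewrite -(@ler_pXn2r _ 2) ?nnegrE ?cnorm_ge0 // -cnorm_star -/u uv.
apply: le_trans (cnormM _ _) _; rewrite expr2; have := cnorm_ge0 v; nra.
Qed.

(** [v] is (1 - r) (1 - t)^-1. This normalisation gives norm at most 1, the iteration being
    dominated by the same one for the number r. The last clause places [v] in every closed *-algebra
    that contains [t]. *)
Lemma neumann t (r : R) : 0 <= r -> r < 1 -> cnorm t <= r ->
  exists v, [/\ (1 - t) * v = (1 - r)%:C *: 1, cnorm v <= 1,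
    forall z, z * t = t * z -> z * v = v * z, star t = t -> star v = v
    & forall D : set A, star_subalgebra D -> norm_closed D -> D 1 -> D t -> D v].
Proof.
move=> r0 r1 tr.
pose v := fix v n := if n is n'.+1 then (1 - r)%:C *: 1 + t * v n' else 0.
pose s := fix s n : R := if n is n'.+1 then 1 - r + r * s n' else 0.
have vS n : v n.+1 = (1 - r)%:C *: 1 + t * v n by [].
have sS n : s n.+1 = 1 - r + r * s n by [].
have v0 : v 0%N = 0 by []. have s0 : s 0%N = 0 by [].
move: v s vS sS v0 s0 => v s vS sS v0 s0.
have hs n : 0 <= s n <= 1 by elim: n => [|n IH]; rewrite ?s0 ?sS; nra.
have nv n : cnorm (v n) <= 1.
  elim: n => [|n IH]; first by rewrite v0 cnorm0.
  rewrite vS; apply: le_trans (cnormD _ _) _; rewrite cnormZr cnorm1 ger0_norm; last by lra.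
  by have := cnormM t (v n); have := cnorm_ge0 t; have := cnorm_ge0 (v n); nra.
have dv n : cnorm (v n.+1 - v n) <= s n.+1 - s n.
  elim: n => [|n IH].
    rewrite vS sS v0 s0 !mulr0 !subr0 !addr0 cnormZr cnorm1 ger0_norm; lra.
  have -> : v n.+2 - v n.+1 = t * (v n.+1 - v n).
    by rewrite (vS n.+1); move: (vS n) => e; rewrite {2}e; ncring_in R[i] A.
  apply: le_trans (cnormM _ _) _; rewrite (sS n.+1); move: (sS n) (cnorm_ge0 (v n.+1 - v n)) (cnorm_ge0 t).
  by move: IH; set a := cnorm _; set b := s n.+1; nra.
have [|w hw] := @nlim_ex v s 1 _ dv; first by move=> n; case/andP: (hs n).
have ew : w = (1 - r)%:C *: 1 + t * w.
  have h1 := nlimS hw.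
  have h2 := nlimD (nlimC ((1 - r)%:C *: 1)) (nlimM t 1 hw).
  apply: (nlim_uniq h1); rewrite -[t * w]mulr1; move=> e /h2 [N hN].
  by exists N => n /hN; rewrite mulr1 -vS.
exists w; split.
- by rewrite mulrBl mul1r {1}ew addrK.
- exact: nlim_le hw nv.
- move=> z hz.
  have cv n : z * v n = v n * z.
    elim: n => [|n IH]; first by rewrite v0 mulr0 mul0r.
    by rewrite vS mulrDr mulrDl -scalerAr -scalerAl mulr1 mul1r mulrA hz -!mulrA IH.
  have h1 := nlimM z 1 hw; have h2 := nlimM 1 z hw; rewrite !mulr1 !mul1r in h1 h2.
  apply: (nlim_uniq h1) => e /h2 [N hN]; exists N => n /hN.
  by rewrite mulr1 mul1r -cv.
- move=> st; apply: (nlim_uniq _ hw).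
  have cv n : t * v n = v n * t.
    elim: n => [|n IH]; first by rewrite v0 mulr0 mul0r.
    by rewrite vS mulrDr mulrDl -scalerAr -scalerAl mulr1 mul1r {1}IH mulrA.
  have sv n : star (v n) = v n.
    elim: n => [|n IH]; first by rewrite v0 star0.
    by rewrite vS starD starZr star1 starM st IH cv.
  by move=> e /(nlim_star hw) [N hN]; exists N => n /hN; rewrite sv.
- move=> D [D0 Dl DM _] Dc D1 Dt.
  have Dv n : D (v n).
    elim: n => [|n IH]; first by rewrite v0.
    by rewrite vS; apply: Dl => //; apply: DM.
  apply: Dc => e /hw [N hN]; exists (v N) => //.
  by rewrite cnorm_distC; apply: hN.
Qed.

(** With M = 2 + |q|^2, one has (1 + q^2) / M = 1 - t where t = (1 - 1/M) (1 - w^2) and w = q / sqrt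
    (M - 1) is a contraction. So t has norm at most 1 - 1/M, and the factor 1/M of [neumann]
    cancels. *)
Lemma inv1p q : star q = q ->
  exists v, [/\ (1 + q * q) * v = 1, star v = v, cnorm v <= 1,
    forall z, z * q = q * z -> z * v = v * z
    & forall D : set A, star_subalgebra D -> norm_closed D -> D 1 -> D q -> D v].
Proof.
move=> sq; pose M := 2 + cnorm q ^+ 2.
have M1 : 1 < M by have := sqr_ge0 (cnorm q); rewrite /M; lra.
pose l := Num.sqrt (M - 1); have l0 : 0 < l by rewrite sqrtr_gt0; lra.
have ll : l ^+ 2 = M - 1 by rewrite sqr_sqrtr //; lra.
pose w := (l^-1)%:C *: q.
have sw : star w = w by rewrite starZr sq.
have nw : cnorm w <= 1.
  rewrite cnormZr gtr0_norm ?invr_gt0 //.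
  rewrite ler_pdivrMl // mulr1.
  rewrite -(@ler_pXn2r _ 2) ?nnegrE ?cnorm_ge0 ?ltW // ll /M; lra.
have ww : w * w = ((M - 1)^-1)%:C *: (q * q).
  rewrite /w -scalerAl -scalerAr scalerA -rmorphM /= -ll; congr (_%:C *: _).
  by rewrite -invfM expr2.
pose r := 1 - M^-1; have Mi : 0 < M^-1 by rewrite invr_gt0; lra.
have Mi1 : M^-1 < 1 by rewrite invf_lt1; lra.
pose t := r%:C *: (1 - w * w).
have r0 : 0 <= r by rewrite /r; lra.
have r1 : r < 1 by rewrite /r; lra.
have [|v [e nv cv sv Dv]] := @neumann t r r0 r1.
  rewrite cnormZr ger0_norm; last by lra.
  by have := norm_compl sw nw; have := cnorm_ge0 (1 - w * w); rewrite /r; nra.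
have e1 : 1 - t = (M^-1)%:C *: (1 + q * q).
  rewrite /t ww /r; rewrite !scalerBr scalerDr scalerA -rmorphM /=.
  rewrite (_ : (1 - M^-1) * (M - 1)^-1 = M^-1); last first.
    by field; rewrite !lt0r_neq0 //; lra.
  have -> : (1 - M^-1)%:C = 1 - (M^-1)%:C by rewrite rmorphB.
  rewrite scalerBl scale1r.
  ncring_in R[i] A.
have ct z : z * q = q * z -> z * t = t * z.
  move=> hz; rewrite /t ww -scalerAr -scalerAl mulrBr mulrBl mulr1 mul1r -scalerAr -scalerAl.
  by rewrite mulrA hz -mulrA hz mulrA.
exists v; split=> //.
- move: e; rewrite e1 subKr -scalerAl => /(congr1 (fun z => M%:C *: z)).
  by rewrite !scalerA -rmorphM /= mulfV ?rmorph1 ?scale1r // lt0r_neq0 //; lra.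
- by apply: sv; rewrite /t starZr starB star1 starM sw.
- by move=> z /ct /cv.
- move=> D SD Dc D1 Dq; apply: Dv => //; case: SD => D0 Dl DM _.
  have DZ c z : D z -> D (c *: z) by move=> Dz; rewrite -[_ *: _]addr0; apply: Dl.
  apply: (DZ _ _); rewrite ww addrC -scaleN1r; apply: Dl => //; apply: (DZ _ _); exact: DM.
Qed.

End CStarBasics.

(** * Moduli, degenerate inner products and approximate minimisation *)

Notation Re := complex.Re.

Lemma natC (R : realType) n : (n%:R : R)%:C = n%:R :> R[i].
Proof. exact: rmorph_nat. Qed.

Section Modulus.
Variable R : realType.
Implicit Types (z w : R[i]) (r e : R).

Definition mod z : R := Re `|z|.

Lemma modE z : `|z| = (mod z)%:C.
Proof. by rewrite /mod; case: z => a b; rewrite normc_def. Qed.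

Lemma mod_ge0 z : 0 <= mod z.
Proof. by rewrite -lecR -modE normr_ge0. Qed.

Lemma modD z w : mod (z + w) <= mod z + mod w.
Proof. by rewrite -lecR rmorphD /= -!modE ler_normD. Qed.

Lemma modM z w : mod (z * w) = mod z * mod w.
Proof.
have := normrM z w; rewrite !modE -rmorphM /= => /eqP.
by rewrite eq_complex /= eqxx andbT => /eqP.
Qed.

Lemma modN z : mod (- z) = mod z.
Proof. by rewrite /mod normrN. Qed.

Lemma mod_real r : mod r%:C = `|r|.
Proof. by rewrite /mod normRC. Qed.

Lemma mod0 : mod 0 = 0.
Proof. by rewrite /mod normr0. Qed.

Lemma mod1 : mod 1 = 1.
Proof. by rewrite /mod normr1. Qed.

Lemma mod_i : mod 'i = 1.
Proof. by rewrite /mod; have -> : `|'i| = 1 :> R[i] by exact: normCi. Qed.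

Lemma mod_conj z : mod z^* = mod z.
Proof. by rewrite /mod norm_conjC. Qed.

Lemma mod_eq0 z : mod z = 0 -> z = 0.
Proof. by move=> h; apply/eqP; rewrite -normr_eq0 modE h. Qed.

Lemma mod_sqr z : ((mod z) ^+ 2)%:C = z * z^*.
Proof. by rewrite rmorphXn /= -modE normCK. Qed.

Lemma mod_triB z w x : mod (z - x) <= mod (z - w) + mod (w - x).
Proof. by have := modD (z - w) (w - x); rewrite addrA subrK. Qed.

Lemma mod_distC z w : mod (z - w) = mod (w - z).
Proof. by rewrite -modN opprB. Qed.

Lemma mod_small z : (forall e, 0 < e -> mod z < e) -> z = 0.
Proof.
move=> h; apply: mod_eq0; apply/eqP; rewrite eq_le mod_ge0 andbT leNgt; apply/negP => x0.
by have := h _ x0; rewrite ltxx.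
Qed.

Lemma ReD z w : Re (z + w) = Re z + Re w.
Proof. by case: z w => ? ? [? ?]. Qed.

Lemma ReN z : Re (- z) = - Re z.
Proof. by case: z. Qed.

Lemma ReZ r z : Re (r%:C * z) = r * Re z.
Proof. by case: z => a b /=; rewrite mul0r subr0. Qed.

Lemma Re_conj z : Re z^* = Re z.
Proof. by case: z. Qed.

Lemma ge0_ReE z : 0 <= z -> z = (Re z)%:C.
Proof. by case: z => a b; rewrite lecE /= => /andP[/eqP -> _]. Qed.

Lemma Re_ge0 z : 0 <= z -> 0 <= Re z.
Proof. by case: z => a b; rewrite lecE /= => /andP[]. Qed.

Lemma Re_le_mod z : `|Re z| <= mod z.
Proof.
have h := mod_sqr z; rewrite -(@ler_pXn2r _ 2) ?nnegrE ?mod_ge0 ?normr_ge0 //.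
rewrite real_normK ?num_real //; case: z h => a b; set m := mod _ => h.
have : m ^+ 2 = a ^+ 2 + b ^+ 2.
  move/eqP: h; rewrite eq_complex /= => /andP[/eqP -> _]; rewrite mulrN opprK; ring.
by move=> -> /=; rewrite lerDl sqr_ge0.
Qed.

Lemma mod_le_ReIm z : mod z <= `|Re z| + `|complex.Im z|.
Proof.
have h := mod_sqr z; rewrite -(@ler_pXn2r _ 2) ?nnegrE ?addr_ge0 ?mod_ge0 ?normr_ge0 //.
case: z h => a b; set m := mod _ => h /=.
have -> : m ^+ 2 = a ^+ 2 + b ^+ 2.
  move/eqP: h; rewrite eq_complex /= => /andP[/eqP -> _]; rewrite mulrN opprK; ring.
rewrite -(real_normK (num_real a)) -(real_normK (num_real b)).
by have := normr_ge0 a; have := normr_ge0 b; nra.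
Qed.

Lemma sqB_le (u v : R) : (u - v) ^+ 2 <= 2 * u ^+ 2 + 2 * v ^+ 2.
Proof. have := sqr_ge0 (u + v); nra. Qed.

Lemma quad_disc (a b e : R) : 0 <= a -> (forall t, 0 <= t ^+ 2 * a + 2 * t * b + e) ->
  b ^+ 2 <= e * a.
Proof.
rewrite le_eqVlt => /orP[/eqP <- h|a0 h].
  have [->|b0] := eqVneq b 0; first by rewrite expr0n mulr0.
  have := h (- (e + 1) / (2 * b)).
  have -> : 2 * (- (e + 1) / (2 * b)) * b = - (e + 1) by field.
  by rewrite mulr0 add0r opprD addrAC addNr add0r; lra.
have := h (- b / a).
have -> : (- b / a) ^+ 2 * a + 2 * (- b / a) * b + e = e - b ^+ 2 / a by field; rewrite lt0r_neq0.
by rewrite subr_ge0 ler_pdivrMr.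
Qed.

End Modulus.

Section Forms.
Variables (R : realType) (V : lmodType R[i]) (f : V -> V -> R[i]).
Hypothesis f_lin : forall (c : R[i]) x y z, f (c *: x + y) z = c * f x z + f y z.
Hypothesis f_conj : forall x y, f y x = (f x y)^*.
Hypothesis f_pos : forall x, 0 <= f x x.

(** The form may be degenerate. Its value at x - t f(x, y) y is a nonnegative quadratic polynomial
    in the real number t; the discriminant gives m^2 <= f(x, x) m f(y, y), and m is cancelled. *)
Lemma form_CS x y : mod (f x y) ^+ 2 <= Re (f x x) * Re (f y y).
Proof.
set m := mod (f x y) ^+ 2.
have m0 : 0 <= m by rewrite sqr_ge0.
have mE : m%:C = f x y * f y x by rewrite mod_sqr -f_conj.
have H : m ^+ 2 <= Re (f x x) * (m * Re (f y y)).
  rewrite -(sqrrN m); apply: quad_disc; first by rewrite mulr_ge0 // Re_ge0.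
  move=> t; pose c := - (t%:C * f x y).
  have fx u : f u (c *: y + x) = c^* * f u y + f u x.
    by rewrite (f_conj (c *: y + x) u) f_lin rmorphD rmorphM /= -(f_conj y u) -(f_conj x u).
  have cc : c^* = - (t%:C * f y x).
    by rewrite rmorphN rmorphM /= -f_conj; congr (- (_ * _)); apply/CrealP; rewrite complex_real.
  have := f_pos (c *: y + x); rewrite f_lin !fx.
  have -> : c * (c^* * f y y + f y x) + (c^* * f x y + f x x) =
      (t ^+ 2)%:C * m%:C * f y y + (2 * t * - m)%:C + f x x.
    have -> : (2 * t * - m)%:C = - (2 * t%:C * m%:C) :> R[i].
      by rewrite mulrN rmorphN /= !rmorphM /= rmorph_nat.
    by rewrite rmorphXn /= cc /c mE; ring.
  rewrite (ge0_ReE (f_pos y)) (ge0_ReE (f_pos x)) -!rmorphM -!rmorphD /= ler0c.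
  by rewrite mulrA.
have [e|n0] := eqVneq m 0; first by rewrite e mulr_ge0 // Re_ge0.
have mp : 0 < m by rewrite lt_def n0.
by rewrite -(ler_pM2l mp) -expr2 mulrCA.
Qed.

End Forms.

(* Approximate Riesz representation in a possibly incomplete and degenerate inner product
   space: minimise [g w w - 2 f w] over [D] up to [e]. *)
Lemma approx_riesz (R : realType) (X : lmodType R[i]) (D : set X) (g : X -> X -> R)
    (f : X -> R) (K : R) :
  D 0 -> (forall (r : R) x y, D x -> D y -> D (r%:C *: x + y)) ->
  (forall (r : R) x y z, g (r%:C *: x + y) z = r * g x z + g y z) ->
  (forall x y, g x y = g y x) -> (forall x, 0 <= g x x) ->
  (forall (r : R) x y, f (r%:C *: x + y) = r * f x + f y) ->
  0 <= K -> (forall x, D x -> f x ^+ 2 <= K * g x x) ->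
  forall e, 0 < e -> exists2 w, D w & forall x, D x -> (f x - g x w) ^+ 2 <= e * g x x.
Proof.
move=> D0 Dl gl gs gp fl K0 fK e e0.
pose J x := g x x - 2 * f x.
have Jlb x : D x -> - K <= J x.
  move=> /fK h; rewrite /J lerBrDr.
  suff : 2 * f x <= K + g x x by lra.
  have gx := gp x; rewrite leNgt; apply/negP => lt.
  have : (K + g x x) ^+ 2 < (2 * f x) ^+ 2 by nra.
  by have := sqr_ge0 (K - g x x); nra.
pose S := [set - J x | x in D].
have hS : has_sup S.
  by split; [exists (- J 0), 0|exists K => _ [x Dx <-]; have := Jlb x Dx; lra].
have [_ [w Dw <-] hw] := sup_adherent e0 hS.
exists w => // x Dx; rewrite mulrC [X in _ <= X]mulrC.
have -> : (f x - g x w) ^+ 2 = (g x w - f x) ^+ 2 by ring.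
apply: quad_disc => // t.
have : - J (t%:C *: x + w) <= sup S.
  by apply: sup_upper_bound => //; exists (t%:C *: x + w) => //; apply: Dl.
move: hw; rewrite /J fl gl (gs x (_ + _)) (gs w (_ + _)) !gl (gs w x).
move=> h1 h2; lra.
Qed.

(** * Limits along ultrafilters *)

Section Ultrafilters.

Definition uf (I : Type) (F : set (set I)) := [/\ F setT, ~ F set0,
  forall S T, F S -> S `<=` T -> F T, forall S T, F S -> F T -> F (S `&` T)
  & forall S, F S \/ F (~` S)].

Lemma uf_ex (I : Type) (B : set (set I)) : B !=set0 -> (forall S, B S -> S !=set0) ->
  (forall S T, B S -> B T -> exists2 U, B U & U `<=` S `&` T) ->
  exists2 F, uf F & B `<=` F.
Proof.
move=> [S0 BS0] Bn Bd.
pose F0 : set_system I := [set S | exists2 T, B T & T `<=` S].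
have F0P : ProperFilter F0.
  apply: Build_ProperFilter_ex.
    by move=> S [T /Bn [x Tx] TS]; exists x; exact: TS.
  split; first by exists S0.
    move=> S T [S' BS' SS'] [T' BT' TT']; have [U BU UST] := Bd _ _ BS' BT'.
    by exists U => // x /UST [/SS' ? /TT' ?].
  by move=> S T ST [S' BS' SS']; exists S' => // x /SS' /ST.
have [G [GU GF]] := ultraFilterLemma F0P.
exists G; last by move=> S BS; apply: GF; exists S.
have GP : ProperFilter G := @ultra_proper _ _ GU.
split.
- exact: filterT.
- exact: filter_not_empty.
- by move=> S T GS ST; apply: filterS GS.
- by move=> S T GS GT; apply: filterI.
- by move=> S; apply: in_ultra_setVsetC.
Qed.

Lemma nat_uf : exists2 F : set (set nat), uf F & forall N, F [set n | (N <= n)%N].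
Proof.
have [] := @uf_ex nat [set [set n | (N <= n)%N] | N in [set: nat]].
- by exists [set n | (0 <= n)%N], 0%N.
- by move=> _ [N _ <-]; exists N => /=.
- move=> _ _ [M _ <-] [N _ <-]; exists [set n | (maxn M N <= n)%N]; first by exists (maxn M N).
  by move=> n /=; rewrite geq_max => /andP[].
- by move=> F uF BF; exists F => // N; apply: BF; exists N.
Qed.

Variables (R : realType) (I : Type) (F : set (set I)).
Hypothesis uF : uf F.
Implicit Types (f g : I -> R[i]) (l : R[i]).

Lemma uf_S S T : F S -> S `<=` T -> F T.
Proof. by case: uF => _ _ h _ _; exact: h. Qed.

Lemma uf_I S T : F S -> F T -> F (S `&` T).
Proof. by case: uF => _ _ _ h _; exact: h. Qed.

Lemma uf_T S : (forall i, S i) -> F S.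
Proof. by case: uF => h _ h' _ _ a; apply: h' h _. Qed.

Lemma uf_n0 S : F S -> exists i, S i.
Proof.
move=> FS; apply: contrapT => h; case: uF => _ h0 h1 _ _.
by apply: h0; apply: h1 FS _ => i Si; apply: h; exists i.
Qed.

Definition flim f l := forall e : R, 0 < e -> F [set i | mod (f i - l) < e].

Lemma flim_uniq f l l' : flim f l -> flim f l' -> l = l'.
Proof.
move=> h h'; apply/eqP; rewrite -subr_eq0; apply/eqP/mod_small => e e0.
have e2 : 0 < e / 2 by lra.
have [i [/= h1 h2]] := uf_n0 (uf_I (h _ e2) (h' _ e2)).
have := mod_triB l (f i) l'; rewrite (mod_distC l (f i)); lra.
Qed.

Lemma flimC l : flim (fun=> l) l.
Proof. by move=> e e0; apply: uf_T => i /=; rewrite subrr mod0. Qed.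

Lemma flim_eqF f g l : F [set i | f i = g i] -> flim f l -> flim g l.
Proof.
move=> h hf e /hf he; apply: uf_S (uf_I h he) _ => i [/= <-].
by [].
Qed.

Lemma flim_ext f g l : (forall i, f i = g i) -> flim f l -> flim g l.
Proof. by move=> h; apply: flim_eqF; apply: uf_T. Qed.

Lemma flimD f g l l' : flim f l -> flim g l' -> flim (fun i => f i + g i) (l + l').
Proof.
move=> h h' e e0; have e2 : 0 < e / 2 by lra.
apply: uf_S (uf_I (h _ e2) (h' _ e2)) _ => i [/= h1 h2].
rewrite opprD addrACA; apply: le_lt_trans (modD _ _) _; lra.
Qed.

Lemma flimZ (c : R[i]) f l : flim f l -> flim (fun i => c * f i) (c * l).
Proof.
move=> h e e0; have c0 := mod_ge0 c.
have e2 : 0 < e / (mod c + 1) by rewrite divr_gt0 //; lra.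
apply: uf_S (h _ e2) _ => i /=; rewrite -mulrBr modM ltr_pdivlMr; last by lra.
by have := mod_ge0 (f i - l); nra.
Qed.

Lemma flimB f g l l' : flim f l -> flim g l' -> flim (fun i => f i - g i) (l - l').
Proof.
move=> h h'; rewrite -mulN1r; have := flimD h (flimZ (-1) h').
by apply: flim_ext => i; rewrite mulN1r.
Qed.

Lemma flim_conj f l : flim f l -> flim (fun i => (f i)^*) l^*.
Proof.
by move=> h e /h he; apply: uf_S he _ => i /=; rewrite -rmorphB mod_conj.
Qed.

Lemma flim_bound f l (M : R) : flim f l -> (forall i, mod (f i) <= M) -> mod l <= M.
Proof.
move=> h hM; rewrite leNgt; apply/negP => lt.
have [|i /= hi] := uf_n0 (h (mod l - M) _); first by lra.
have := mod_triB l (f i) 0; rewrite !subr0 (mod_distC l (f i)); have := hM i; lra.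
Qed.

Lemma flim_Re_ge0 f l : flim f l -> F [set i | 0 <= f i] -> 0 <= l.
Proof.
move=> h h0.
have Re0 : 0 <= Re l.
  rewrite leNgt; apply/negP => lt.
  have [|i [/= hi /Re_ge0 fi]] := uf_n0 (uf_I (h (- Re l) _) h0); first by lra.
  have := Re_le_mod (f i - l); rewrite ReD ReN ger0_norm; lra.
have Im0 : complex.Im l = 0.
  apply/eqP; rewrite -normr_eq0 eq_le normr_ge0 andbT leNgt; apply/negP => lt.
  have [i [/= hi fi]] := uf_n0 (uf_I (h _ lt) h0).
  have : mod ('i * (f i - l)) < `|complex.Im l|.
    by rewrite modM (_ : mod 'i = 1) ?mul1r // /mod normCi.
  apply/negP; rewrite -leNgt; apply: le_trans (Re_le_mod _).
  rewrite (ge0_ReE fi) mulrBr ReD ReN mulrC ReZ.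
  rewrite -complexiE /= mulr0 add0r; case: (l) => a b /=.
  by rewrite !mul0r mul1r sub0r opprK.
by case: l h Re0 Im0 => a b /= _ ha ->; rewrite ler0c.
Qed.

(** The limit is the supremum of the r with [r <= f i] for almost every i; maximality of the
    ultrafilter turns the failure of a lower bound into an upper bound almost everywhere. *)
Lemma rlim_ex (f : I -> R) (M : R) : (forall i, `|f i| <= M) ->
  exists l : R, forall e, 0 < e -> F [set i | `|f i - l| < e].
Proof.
move=> hM; pose S := [set r | F [set i | r <= f i]].
have hS : has_sup S.
  split; first by exists (- M); apply: uf_T => i /=; have := hM i; rewrite ler_norml => /andP[].
  exists M => r /uf_n0 [i /= h]; apply: le_trans h _.
  by have := hM i; rewrite ler_norml => /andP[].
exists (sup S) => e e0.
have [r Sr hr] := sup_adherent e0 hS.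
have : F (~` [set i | sup S + e <= f i]).
  case: uF => _ _ _ _ /(_ [set i | sup S + e <= f i]) [] // h.
  have := sup_upper_bound hS h; lra.
move=> /(uf_I Sr) /uf_S; apply=> i [/= h1 /negP]; rewrite -ltNge => h2.
rewrite ltr_norml; apply/andP; split; lra.
Qed.

Lemma flim_ex f (M : R) : (forall i, mod (f i) <= M) -> exists l, flim f l.
Proof.
move=> hM.
have [|a ha] := @rlim_ex (fun i => Re (f i)) M.
  by move=> i; apply: le_trans (Re_le_mod _) _.
have [|b hb] := @rlim_ex (fun i => Re ('i * f i)) M.
  move=> i; apply: le_trans (Re_le_mod _) _; rewrite modM.
  by rewrite (_ : mod 'i = 1) ?mul1r // /mod normCi.
(* [b] is the limit of Re (i z) = - Im z, whence the sign. *)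
exists (a +i* (- b)) => e e0; have e2 : 0 < e / 2 by lra.
apply: uf_S (uf_I (ha _ e2) (hb _ e2)) _ => i [/=].
rewrite -complexiE; case: (f i) => c d /= h1; rewrite mul0r mul1r sub0r => h2.
apply: le_lt_trans (mod_le_ReIm _) _; rewrite /= opprK.
move: h2; rewrite -normrN opprD !opprK => h2; lra.
Qed.

End Ultrafilters.

(** * Hilbert spaces and the Riesz representation *)

Section HilbertSpace.
Variables (R : realType) (H : hilbertType R).
Implicit Types (h k x y z : H).

Lemma dotpDl x y z : dotp (x + y) z = dotp x z + dotp y z.
Proof. by have := dotp_linear 1 x y z; rewrite scale1r mul1r. Qed.

Lemma dotp0l z : dotp 0 z = 0.
Proof. by apply: (@addrI _ (dotp 0 z)); rewrite -dotpDl !addr0. Qed.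

Lemma dotpZl (c : R[i]) x z : dotp (c *: x) z = c * dotp x z.
Proof. by have := dotp_linear c x 0 z; rewrite !addr0 dotp0l addr0. Qed.

Lemma dotpBl x y z : dotp (x - y) z = dotp x z - dotp y z.
Proof. by rewrite dotpDl -scaleN1r dotpZl mulN1r. Qed.

Lemma dotpDr x y z : dotp z (x + y) = dotp z x + dotp z y.
Proof. by rewrite dotpC dotpDl rmorphD /= -!dotpC. Qed.

Lemma dotpZr (c : R[i]) x z : dotp z (c *: x) = c^* * dotp z x.
Proof. by rewrite dotpC dotpZl rmorphM /= -dotpC. Qed.

Lemma dotpBr x y z : dotp z (x - y) = dotp z x - dotp z y.
Proof. by rewrite dotpDr -scaleN1r dotpZr rmorphN rmorph1 mulN1r. Qed.

Lemma dotp_ge0 x : 0 <= dotp x x.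
Proof. by rewrite dotp_norm exprn_ge0. Qed.

(** The squared norm with values in R rather than in R[i]: estimates stay in the real field and
    avoid square roots. *)
Definition hs x : R := Re (dotp x x).

Lemma hsE x : dotp x x = (hs x)%:C.
Proof. by rewrite (ge0_ReE (dotp_ge0 x)). Qed.

Lemma hs_ge0 x : 0 <= hs x.
Proof. exact: Re_ge0 (dotp_ge0 x). Qed.

Lemma hs_eq0 x : hs x = 0 -> x = 0.
Proof.
move=> h; have := dotp_norm x; rewrite hsE h => /esym/eqP.
by rewrite sqrf_eq0 normr_eq0 => /eqP.
Qed.

Lemma dotp_CS x y : mod (dotp x y) ^+ 2 <= hs x * hs y.
Proof.
apply: (form_CS (f := @dotp R H)); first exact: dotp_linear.
- by move=> ? ?; exact: dotpC.
- exact: dotp_ge0.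
Qed.

Lemma dotp_inj x y : (forall k, dotp x k = dotp y k) -> x = y.
Proof.
move=> e; apply/eqP; rewrite -subr_eq0; apply/eqP/hs_eq0.
by rewrite /hs dotpBl e subrr.
Qed.

Lemma hsZ (c : R[i]) x : hs (c *: x) = mod c ^+ 2 * hs x.
Proof. by rewrite /hs dotpZl dotpZr mulrA -mod_sqr ReZ. Qed.

Lemma hs_norm x : `|x| = (Num.sqrt (hs x))%:C.
Proof.
have h : 0 <= `|x| by rewrite normr_ge0.
apply/eqP; rewrite -(@eqrXn2 _ 2) //; last by rewrite ler0c sqrtr_ge0.
by rewrite -dotp_norm hsE -rmorphXn /= sqr_sqrtr ?hs_ge0.
Qed.

Lemma hilb_complete (h : nat -> H) :
  (forall e : R, 0 < e -> exists N, forall m n, (N <= m)%N -> (N <= n)%N ->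
     hs (h m - h n) < e) ->
  exists l, forall e : R, 0 < e -> exists N, forall n, (N <= n)%N -> hs (l - h n) < e.
Proof.
move=> hc.
have ltn (x : H) (e : R) : 0 < e -> (`|x| < e%:C) = (hs x < e ^+ 2).
  move=> e0; rewrite hs_norm ltcR -(@ltr_pXn2r _ 2) ?nnegrE ?sqrtr_ge0 ?ltW //.
  by rewrite sqr_sqrtr ?hs_ge0.
have FF : ProperFilter (h @ \oo) by apply: fmap_proper_filter.
have : cvg (h @ \oo).
  apply/cauchy_cvgP/cauchy_exP => eps eps0.
  have e0 : 0 < Re eps by move: eps0; rewrite ltcE => /andP[].
  have eE : eps = (Re eps)%:C by apply: ge0_ReE; exact: ltW.
  have [N hN] := hc (Re eps ^+ 2) (exprn_gt0 _ e0).
  exists (h N); exists N => // n /= hn.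
  by rewrite -ball_normE /ball_ /= eE ltn //; apply: hN.
move=> /cvg_ex [l /cvgrPdist_lt hl]; exists l => e e0.
pose d := Num.sqrt e; have d0 : 0 < d by rewrite sqrtr_gt0.
have [|N _ hN] := hl d%:C _; first by rewrite ltcR.
exists N => n hn; have := hN n hn; rewrite ltn // sqr_sqrtr //; exact: ltW.
Qed.

(** Approximate representatives with error 1/(n+1) are tested on their own differences, which shows
    that they are Cauchy; the representative is their limit. *)
Lemma riesz (f : H -> R[i]) (K : R) : 0 <= K ->
  (forall (c : R[i]) x y, f (c *: x + y) = c * f x + f y) ->
  (forall x, mod (f x) ^+ 2 <= K * hs x) -> exists k, forall x, f x = dotp x k.
Proof.
move=> K0 fl fK.
pose g x y := Re (dotp x y).
have gs x y : g x y = g y x by rewrite /g dotpC Re_conj.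
have gl (r : R) x y z : g (r%:C *: x + y) z = r * g x z + g y z.
  by rewrite /g dotp_linear ReD ReZ.
pose F x := Re (f x).
have Fl (r : R) x y : F (r%:C *: x + y) = r * F x + F y by rewrite /F fl ReD ReZ.
have FK x : setT x -> F x ^+ 2 <= K * g x x.
  move=> _; apply: le_trans (fK x); rewrite -(real_normK (num_real (F x))).
  by rewrite ler_pXn2r ?nnegrE ?mod_ge0 // Re_le_mod.
have e0 n : 0 < (n.+1%:R^-1 : R) by rewrite invr_gt0 ltr0n.
have H1 n : exists w, forall x, (F x - g x w) ^+ 2 <= n.+1%:R^-1 * hs x.
  have [|w _ hw] := @approx_riesz R H setT g F K I _ gl gs hs_ge0 Fl K0 FK _ (e0 n) => //.
  by exists w => x; apply: hw.
have [w hw] := choice H1.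
have gB x y z : g x (y - z) = g x y - g x z by rewrite /g dotpBr ReD ReN.
have [|l hl] := hilb_complete (h := w).
  move=> e he; have [N] : exists N, (N.+1%:R^-1 : R) < e / 4.
    by exists (Num.truncn (e / 4)^-1); rewrite invf_plt ?posrE ?divr_gt0 // truncnS_gt.
  move=> hN; exists N => m n hm hn.
  have lem (k : nat) : (N <= k)%N -> (k.+1%:R^-1 : R) < e / 4.
    by move=> hk; apply: le_lt_trans hN; rewrite lef_pV2 ?posrE ?ltr0n // ler_nat.
  have := hw m (w m - w n); have := hw n (w m - w n).
  have : hs (w m - w n) = g (w m - w n) (w m) - g (w m - w n) (w n) by rewrite -gB.
  set a := g _ (w m); set b := g _ (w n); set c := F _; set d := hs _ => ed h1 h2.
  have d0 : 0 <= d by exact: hs_ge0.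
  have := lem _ hm; have := lem _ hn; move: h1 h2.
  set u := n.+1%:R^-1; set v := m.+1%:R^-1 => h1 h2 hu hv.
  have : d ^+ 2 <= 2 * (u * d + v * d).
    rewrite {1}(_ : d = (c - b) - (c - a)); last by rewrite ed; ring.
    by apply: le_trans (sqB_le _ _) _; lra.
  rewrite ltNge => hd; apply/negP => hd2; nra.
have FE x : F x = g x l.
  apply/eqP; rewrite -subr_eq0 -sqrf_eq0 eq_le sqr_ge0 andbT leNgt; apply/negP => lt.
  set q := (F x - g x l) ^+ 2 in lt.
  have x0 := hs_ge0 x; pose e := q / (4 * (hs x + 1)).
  have ep : 0 < e by rewrite divr_gt0 // mulr_gt0 //; lra.
  have eE : e * (4 * (hs x + 1)) = q by rewrite /e divfK // lt0r_neq0 // mulr_gt0 //; lra.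
  have [N1 hN1] := hl e ep.
  pose N2 := Num.truncn e^-1.
  have hN2 : (N2.+1%:R^-1 : R) < e by rewrite invf_plt ?posrE // truncnS_gt.
  pose n := maxn N1 N2.
  have h1 := hN1 n (leq_maxl _ _).
  have h2 : (n.+1%:R^-1 : R) < e.
    by apply: le_lt_trans hN2; rewrite lef_pV2 ?posrE ?ltr0n // ler_nat ltnS leq_maxr.
  have h3 := hw n x.
  have h4 : (g x l - g x (w n)) ^+ 2 <= hs x * hs (l - w n).
    rewrite -gB; apply: le_trans (dotp_CS _ _); rewrite -(real_normK (num_real (g _ _))).
    by rewrite ler_pXn2r ?nnegrE ?mod_ge0 // Re_le_mod.
  have : q <= 2 * (n.+1%:R^-1 * hs x) + 2 * (hs x * hs (l - w n)).
    have -> : q = ((F x - g x (w n)) - (g x l - g x (w n))) ^+ 2 by rewrite /q; ring.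
    by apply: le_trans (sqB_le _ _) _; rewrite lerD // ler_wpM2l.
  have u1 : n.+1%:R^-1 * hs x <= e * hs x by rewrite ler_wpM2r // ltW.
  have u2 : hs x * hs (l - w n) <= hs x * e by rewrite ler_wpM2l // ltW.
  clearbody e; clearbody q; move=> h5.
  have : e * (4 * (hs x + 1)) <= 4 * (e * hs x).
    rewrite eE; apply: le_trans h5 _.
    rewrite (_ : 4 * (e * hs x) = 2 * (e * hs x) + 2 * (hs x * e)); last by ring.
    by rewrite lerD // ler_pM2l.
  by rewrite mulrCA ler_pM2l // mulrDr mulr1 gerDl leNgt ep.
(* Only real parts have been represented so far; the vector ['i *: x] supplies the imaginary
   part. *)
exists l => x; have h1 := FE x; have h2 := FE ('i *: x).
move: h1 h2; rewrite /F /g (_ : f ('i *: x) = 'i * f x); last first.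
  have f0 : f 0 = 0.
    by have := fl (-1) 0 0; rewrite scaler0 addr0 mulN1r addNr.
  by have := fl 'i x 0; rewrite f0 !addr0.
rewrite dotpZl -complexiE; case: (f x) => a b; case: (dotp x l) => c d /= -> .
by rewrite !mul0r !mul1r !sub0r => /oppr_inj ->.
Qed.

End HilbertSpace.

(** * Positive functionals and their seminorms *)

Section PositiveFunctionals.
Variables (R : realType) (A : cstarType R).
Implicit Types (a b x y z : A) (ph : A -> R[i]).

Lemma pos_norm x : exists2 r, star r = r & (cnorm x ^+ 2)%:C *: 1 - star x * x = r * r.
Proof.
have [e|n0] := eqVneq (cnorm x) 0.
  exists 0; first by rewrite star0.
  by rewrite (cnorm_eq0 _ e) cnorm0 expr0n scale0r !mulr0 subrr.
have np : 0 < cnorm x by rewrite lt_def n0 cnorm_ge0.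
have n2 : 0 < cnorm x ^+ 2 by rewrite exprn_gt0.
have [||r [sr rr _ _]] := @csqrt R A ((cnorm x ^- 2)%:C *: (star x * x)).
- by rewrite starZr starM starK.
- by rewrite cnormZr cnorm_star ger0_norm ?invr_ge0 ?sqr_ge0 // mulVf // lt0r_neq0.
exists ((cnorm x)%:C *: r); first by rewrite starZr sr.
rewrite -scalerAl -scalerAr rr !scalerBr !scalerA -!rmorphM /= -expr2.
by rewrite mulfV ?lt0r_neq0 // rmorph1 scale1r.
Qed.

(** The order with selfadjoint square roots as witnesses, which is convenient for conjugation;
    [cstar_leP] identifies it with [cstar_le]. *)
Definition ple a b := exists2 q, star q = q & b - a = q * q.

Definition pfun ph := lfun ph /\ forall z, 0 <= ph (star z * z).

(** The squared seminorm of the GNS space of [ph]. *)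
Definition n2 ph x : R := Re (ph (star x * x)).

(** Polarisation: [ph] is real at the positive elements built from [a + 1] and [a + 'i%:A], which
    gives the sum and the difference of [ph a] and [ph (star a)]. *)
Lemma pf_star ph a : pfun ph -> ph (star a) = (ph a)^*.
Proof.
move=> [hl hp].
have real (z : R[i]) : 0 <= z -> z^* = z by move=> z0; apply/CrealP; rewrite realE z0.
have p1 := real _ (hp 1); have pa := real _ (hp a).
have h1 := real _ (hp (a + 1)); have h2 := real _ (hp (a + 'i%:A)).
have e1 : ph a + ph (star a) = (ph a + ph (star a))^*.
  have : star (a + 1) * (a + 1) = star a * a + star 1 * 1 + (a + star a).
    by rewrite starD star1; ncring_in R[i] A.
  move: h1 => /[swap] ->; rewrite !lfunD // !rmorphD /= p1 pa => /addrI.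
  by move=> ->.
have e2 : 'i * ph (star a) - 'i * ph a = ('i * ph (star a) - 'i * ph a)^*.
  have : star (a + 'i%:A) * (a + 'i%:A) = star a * a + star 1 * 1 + ('i *: star a - 'i *: a).
    rewrite starD starZ star1 conjCi scaleNr.
    transitivity (star a * a - 'i *: ('i *: 1) + ('i *: star a - 'i *: a)); first by ncring_in R[i] A.
    by rewrite scalerA -expr2 sqrCi scaleN1r opprK mulr1.
  move: h2 => /[swap] ->; rewrite !lfunD // lfunN // !lfunZ // => /eqP.
  by rewrite rmorphD /= rmorphD /= p1 pa (inj_eq (addrI _)) => /eqP ->.
move: e1 e2; rewrite !rmorphD rmorphN !rmorphM /= conjCi.
set u := ph a; set v := ph (star a) => e1 e2.
have e3 : v - u = u^* - v^*.
  apply: (@mulfI _ 'i); first exact: neq0Ci.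
  by rewrite mulrBr e2; ring.
have : 2 * v = 2 * u^* by rewrite -[2 * v]/(2 * v); transitivity ((u + v) + (v - u)); [ring|rewrite e1 e3; ring].
by apply: mulfI; rewrite pnatr_eq0.
Qed.

Lemma pCS ph x y : pfun ph -> mod (ph (star y * x)) ^+ 2 <= n2 ph x * n2 ph y.
Proof.
move=> hph; have [hl hp] := hph.
apply: (form_CS (f := fun x y => ph (star y * x))) => //.
- by move=> c u v z; rewrite mulrDr -scalerAr hl.
- by move=> u v; rewrite -pf_star // starM starK.
Qed.

Lemma n2_ge0 ph x : pfun ph -> 0 <= n2 ph x.
Proof. by move=> [_ hp]; apply: Re_ge0. Qed.

Lemma n2E ph x : pfun ph -> ph (star x * x) = (n2 ph x)%:C.
Proof. by move=> [_ hp]; apply: ge0_ReE. Qed.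

Lemma pf_sq ph q : pfun ph -> star q = q -> 0 <= ph (q * q).
Proof. by move=> [_ hp] sq; rewrite -{1}sq. Qed.

Lemma pf_le ph a b : pfun ph -> ple a b -> ph a <= ph b.
Proof.
move=> hph [q sq e]; rewrite -subr_ge0 -lfunB; last by case: hph.
by rewrite e pf_sq.
Qed.

Lemma pf_conj ph w : pfun ph -> pfun (fun x => ph (star w * x * w)).
Proof.
move=> [hl hp]; split; first by move=> c x y; rewrite mulrDr mulrDl -scalerAr -scalerAl hl.
by move=> z; have := hp (z * w); rewrite starM !mulrA.
Qed.

Lemma pf_bound1 ph x : pfun ph -> n2 ph x <= cnorm x ^+ 2 * Re (ph 1).
Proof.
move=> hph; have [hl hp] := hph; have [r sr e] := pos_norm x.
have := pf_sq hph sr; rewrite -e lfunB // lfunZ // => /Re_ge0.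
by rewrite ReD ReN ReZ subr_ge0.
Qed.

Lemma pf_bound ph w x : pfun ph -> n2 ph (x * w) <= cnorm x ^+ 2 * n2 ph w.
Proof.
move=> hph; have := pf_bound1 x (pf_conj w hph).
by rewrite /n2 mulr1 starM !mulrA.
Qed.

Lemma pf_norm ph x : pfun ph -> mod (ph x) <= Re (ph 1) * cnorm x.
Proof.
move=> hph; have [hl hp] := hph.
have p1 : 0 <= Re (ph 1) by have := n2_ge0 1 hph; rewrite /n2 star1 mulr1.
rewrite -(@ler_pXn2r _ 2) ?nnegrE ?mod_ge0 ?mulr_ge0 ?cnorm_ge0 //.
have := pCS x 1 hph; rewrite star1 mul1r => h; apply: le_trans h _.
have := pf_bound1 x hph => h; have -> : n2 ph 1 = Re (ph 1) by rewrite /n2 star1 mulr1.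
rewrite exprMn expr2 -mulrA [X in X <= _]mulrC ler_wpM2l //.
by rewrite mulrC.
Qed.

Lemma n2_tri ph x y : pfun ph -> n2 ph (x + y) <= 2 * (n2 ph x + n2 ph y).
Proof.
move=> hph; have [hl hp] := hph.
have := n2_ge0 (x - y) hph; rewrite /n2 !starD starN.
have -> : (star x - star y) * (x - y) = 2%:R *: (star x * x + star y * y) -
    (star x + star y) * (x + y).
  by rewrite scaler_nat mulr2n; ncring_in R[i] A.
by rewrite lfunB // lfunZ // lfunD // -natC ReD ReN ReZ ReD; lra.
Qed.

Lemma n2N ph x : n2 ph (- x) = n2 ph x.
Proof. by rewrite /n2 starN mulNr mulrN opprK. Qed.

End PositiveFunctionals.

Lemma zorn_set (T : Type) (S : set T) (le : T -> T -> Prop) :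
  (forall s, S s -> le s s) -> (forall r s t, le r s -> le s t -> le r t) ->
  (forall s t, le s t -> le t s -> s = t) ->
  (forall K : set T, K `<=` S -> (forall s t, K s -> K t -> le s t \/ le t s) ->
     exists2 t, S t & forall s, K s -> le s t) ->
  exists2 m, S m & forall s, S s -> le m s -> s = m.
Proof.
move=> refl trans anti ub.
pose X := {a : T | S a}; pose Rl : rel X := fun s t => `[< le (sval s) (sval t) >].
have [||||[m Sm] hm] := @Zorn X Rl.
- by move=> [a Sa]; apply/asboolP; exact: refl.
- by move=> r s t /asboolP h1 /asboolP h2; apply/asboolP; exact: trans h1 h2.
- move=> [s Ss] [t St] /asboolP h1 /asboolP h2; apply: eq_exist.
  exact: anti.
- move=> K tK; have [|s t [s' Ks' <-] [t' Kt' <-]|t St ht] := ub [set sval s | s in K].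
  + by move=> _ [[s Ss] _ <-].
  + by case: (tK _ _ Ks' Kt') => /asboolP h; [left|right].
  + by exists (exist _ t St) => s Ks; apply/asboolP/ht; exists s.
exists m => // s Ss ms; have := hm (exist _ s Ss).
by move=> /(_ (asboolT ms)) /(congr1 sval).
Qed.

Definition bicommutant (R : realType) (A : cstarType R) (H : hilbertType R) (ro : A -> H -> H) :=
  forall T : H -> H, bounded_op T ->
    (forall S : H -> H, bounded_op S ->
       (forall a h, S (ro a h) = ro a (S h)) -> forall h, T (S h) = S (T h)) ->
    exists a, T = ro a.

(** * Weak compactness of balls, and normality as weak continuity *)

Section Representation.
Variables (R : realType) (A : cstarType R) (H : hilbertType R) (ro : A -> H -> H).
Hypothesis ro_f : faithful_rep ro.
Implicit Types (a b c d q x y z e : A) (h k : H).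

Lemma ro_lin (c : R[i]) a b h : ro (c *: a + b) h = c *: ro a h + ro b h.
Proof. by case: ro_f => -[]. Qed.

Lemma ro_lfun h k : lfun (fun a => dotp (ro a h) k).
Proof. by move=> c a b; rewrite ro_lin dotpDl dotpZl. Qed.

Lemma roM a b h : ro (a * b) h = ro a (ro b h).
Proof. by case: ro_f => -[]. Qed.

Lemma ro1 h : ro 1 h = h.
Proof. by case: ro_f => -[]. Qed.

Lemma ro_adj a h k : dotp (ro a h) k = dotp h (ro (star a) k).
Proof. by case: ro_f => -[]. Qed.

Lemma ro_inj a b : (forall h, ro a h = ro b h) -> a = b.
Proof. by move=> e; case: ro_f => _; apply; apply: funext. Qed.

Lemma ro0 h : ro 0 h = 0.
Proof.
by apply: dotp_inj => k; rewrite dotp0l; have := lfun0 (ro_lfun h k).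
Qed.

Lemma roB a b h : ro (a - b) h = ro a h - ro b h.
Proof.
by apply: dotp_inj => k; have := lfunB a b (ro_lfun h k) => /= ->; rewrite dotpBl.
Qed.

Lemma ro_linh a (c : R[i]) h k : ro a (c *: h + k) = c *: ro a h + ro a k.
Proof.
apply: dotp_inj => l; rewrite !dotpDl !dotpZl !ro_adj.
by rewrite dotpDl dotpZl.
Qed.

Lemma ro_pfun h : pfun (fun a => dotp (ro a h) h).
Proof.
split; first exact: ro_lfun.
by move=> z; rewrite roM ro_adj starK dotp_ge0.
Qed.

Lemma ro_n2 h x : n2 (fun a => dotp (ro a h) h) x = hs (ro x h).
Proof. by rewrite /n2 roM ro_adj starK. Qed.

Lemma ro_bound a h : hs (ro a h) <= cnorm a ^+ 2 * hs h.
Proof. by have := pf_bound1 a (ro_pfun h); rewrite ro_n2 ro1. Qed.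

Definition ro_fam := [set (fun a => dotp (ro a h) h) | h in [set: H]].

Lemma ro_sep : sep_family ro_fam.
Proof.
split; first by move=> _ [h _ <-]; exact: ro_lfun.
- by move=> _ z [h _ <-]; case: (ro_pfun h).
- move=> z hz; apply: ro_inj => h; rewrite ro0; apply: hs_eq0.
  by rewrite -ro_n2 /n2 (hz (fun a => dotp (ro a h) h)) //; exists h.
Qed.

Lemma ro_pos y : star y = y -> (forall h, 0 <= dotp (ro y h) h) ->
  exists q, [/\ star q = q, y = q * q & forall z, z * y = y * z -> z * q = q * z].
Proof.
move=> sy hy; apply: (pos_detect ro_sep sy) => _ w [h _ <-].
by rewrite -mulrA roM ro_adj starK roM.
Qed.

Lemma pleP a b : ple a b <-> star (b - a) = b - a /\ forall h, 0 <= dotp (ro (b - a) h) h.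
Proof.
split=> [[q sq e]|[sy hy]].
  split; first by rewrite e starM sq.
  by move=> h; rewrite e; apply: (pf_sq (ro_pfun h)).
by have [q [sq e _]] := ro_pos sy hy; exists q.
Qed.

Lemma cstar_leP a b : cstar_le a b <-> ple a b.
Proof.
split=> [[c e]|[q sq e]]; last by exists q; rewrite sq.
apply/pleP; rewrite e starM starK; split=> // h.
by case: (ro_pfun h).
Qed.

Lemma ple_refl a : ple a a.
Proof. by exists 0; rewrite ?star0 // subrr mulr0. Qed.

Lemma ple_trans a b c : ple a b -> ple b c -> ple a c.
Proof.
move=> /pleP [s1 h1] /pleP [s2 h2]; apply/pleP.
have -> : c - a = (c - b) + (b - a) by rewrite addrA subrK.
split; first by rewrite starD s1 s2.
by move=> h; rewrite -[ro _ h]/(ro _ h) (lfunD _ _ (ro_lfun h h)) addr_ge0.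
Qed.

Lemma ple_add a b c : ple a b -> ple (a + c) (b + c).
Proof. by move=> [q sq e]; exists q => //; rewrite opprD addrACA subrr addr0. Qed.

Lemma ple_antisym a b : ple a b -> ple b a -> a = b.
Proof.
move=> [q sq e] /pleP [_ h2]; apply/eqP; rewrite eq_sym -subr_eq0 e; apply/eqP.
suff -> : q = 0 by rewrite mulr0.
apply: ro_inj => h; rewrite ro0; apply: hs_eq0.
apply/eqP; rewrite eq_le hs_ge0 andbT -lecR -hsE.
have -> : dotp (ro q h) (ro q h) = dotp (ro (b - a) h) h by rewrite e roM [in RHS]ro_adj sq.
by rewrite -[b - a]opprB; have := lfunN (a - b) (ro_lfun h h) => /= ->; rewrite oppr_le0.
Qed.

Lemma ple_conj a b c : ple a b -> ple (star c * a * c) (star c * b * c).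
Proof.
move=> /pleP [s1 h1]; apply/pleP; rewrite -mulrBl -mulrBr.
split; first by rewrite !starM s1 starK mulrA.
by move=> h; rewrite -mulrA roM ro_adj starK roM.
Qed.

Lemma ple0_sa a : ple 0 a -> star a = a.
Proof. by move=> [q sq]; rewrite subr0 => ->; rewrite starM sq. Qed.

Lemma ple0D a b : ple 0 a -> ple 0 b -> ple 0 (a + b).
Proof. by move=> h1 h2; apply: ple_trans h2 _; have := ple_add b h1; rewrite add0r. Qed.

Lemma ple_sub a b : ple a b <-> ple 0 (b - a).
Proof. by split=> -[q sq e]; exists q => //; rewrite -e subr0. Qed.

(* For [0 <= d <= 1]: [d - d ^ 2 = d (1 - d) d + (1 - d) d (1 - d)]. *)
Lemma ple_sqr d : ple 0 d -> ple d 1 -> ple (d * d) d.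
Proof.
move=> h0 h1; have sd := ple0_sa h0; apply/ple_sub.
have -> : d - d * d = star d * (1 - d) * d + star (1 - d) * d * (1 - d).
  by rewrite starB star1 sd; ncring_in R[i] A.
apply: ple0D.
  by have := ple_conj d ((ple_sub _ _).1 h1); rewrite mulr0 mul0r.
by have := ple_conj (1 - d) h0; rewrite mulr0 mul0r.
Qed.

Lemma op_norm a (c : R) : 0 <= c -> (forall h, hs (ro a h) <= c ^+ 2 * hs h) -> cnorm a <= c.
Proof.
move=> c0 ha; apply: (norm_detect ro_sep c0) => _ w [h _ <-].
rewrite -mulrA roM roM ro_adj starK roM (roM (star w)) [X in _ <= _ * X]ro_adj starK.
by rewrite ro_adj starK !hsE -rmorphM /= lecR ha.
Qed.

Lemma hs3_ge0 h k (M : R) : 0 <= M ^+ 2 * hs h * hs k.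
Proof. by apply: mulr_ge0; [apply: mulr_ge0|]; rewrite ?sqr_ge0 ?hs_ge0. Qed.

Definition wlim (I : Type) (F : set (set I)) (a : I -> A) e :=
  forall h k, flim F (fun i => dotp (ro (a i) h) k) (dotp (ro e h) k).

Lemma dotp_bound a h k (M : R) : cnorm a <= M ->
  mod (dotp (ro a h) k) <= Num.sqrt (M ^+ 2 * hs h * hs k).
Proof.
move=> hM; rewrite -(@ler_pXn2r _ 2) ?nnegrE ?mod_ge0 ?sqrtr_ge0 //.
have hh := hs_ge0 h; have hk := hs_ge0 k; have a0 := cnorm_ge0 a.
rewrite sqr_sqrtr ?hs3_ge0 //.
apply: le_trans (dotp_CS _ _) _.
rewrite ler_wpM2r //; apply: le_trans (ro_bound _ _) _; rewrite ler_wpM2r //; nra.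
Qed.

Lemma wlim_norm (I : Type) (F : set (set I)) (a : I -> A) e (M : R) : uf F ->
  (forall i : I, cnorm (a i) <= M) -> wlim F a e -> cnorm e <= M.
Proof.
move=> uF hM he; have M0 : 0 <= M.
  have [i _] : exists i : I, setT i by apply: (uf_n0 uF); case: uF.
  exact: le_trans (cnorm_ge0 (a i)) (hM i).
apply: op_norm => // h.
have := flim_bound uF (he h (ro e h)) (fun i => dotp_bound h (ro e h) (hM i)).
rewrite hsE mod_real ger0_norm ?hs_ge0 //; have h0 := hs_ge0 h; have h1 := hs_ge0 (ro e h).
rewrite -(@ler_pXn2r _ 2) ?nnegrE ?sqrtr_ge0 // sqr_sqrtr ?mulr_ge0 ?sqr_ge0 // => h2.
move: h1; rewrite le_eqVlt => /orP[/eqP <-|h1]; first by rewrite mulr_ge0 ?sqr_ge0.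
by rewrite -(ler_pM2r h1) -expr2.
Qed.

Hypothesis ro_bic : bicommutant ro.

Lemma bop_bound (S : H -> H) : bounded_op S -> exists2 K : R, 0 <= K & forall h, hs (S h) <= K * hs h.
Proof.
move=> [Sl Sc].
pose SL : {linear H -> H} := HB.pack S (GRing.isLinear.Build _ _ _ _ S Sl).
have : bounded_near SL (nbhs 0) by apply/linear_bounded_continuous; exact: Sc.
move=> /linear_boundedP [M [Mr hM]].
pose c : R[i] := `|M| + 1.
have Mc : M < c by apply: le_lt_trans (real_ler_norm Mr) _; rewrite ltrDl.
have c0 : 0 <= c by rewrite addr_ge0.
have cE := ge0_ReE c0; exists (Re c ^+ 2); first exact: sqr_ge0.
move=> h; have := hM c Mc h; rewrite /= !hs_norm cE -rmorphM /= lecR => hh.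
have r0 := Re_ge0 c0.
have : Num.sqrt (hs (S h)) ^+ 2 <= (Re c * Num.sqrt (hs h)) ^+ 2.
  by rewrite ler_pXn2r ?nnegrE ?mulr_ge0 ?sqrtr_ge0.
by rewrite exprMn !sqr_sqrtr ?hs_ge0.
Qed.

Lemma bop_of_bound (T : H -> H) (K : R) : 0 <= K -> linear T ->
  (forall h, hs (T h) <= K * hs h) -> bounded_op T.
Proof.
move=> K0 Tl hT; split=> //.
pose TL : {linear H -> H} := HB.pack T (GRing.isLinear.Build _ _ _ _ T Tl).
suff : continuous TL by [].
apply/linear_bounded_continuous/linear_boundedP.
exists (Num.sqrt K)%:C; split; first by rewrite complex_real.
move=> c hc h; apply: le_trans (_ : (Num.sqrt K)%:C * `|h| <= _); last first.
  by rewrite ler_wpM2r // ltW.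
rewrite /= !hs_norm -rmorphM /= lecR -sqrtrM // ler_wsqrtr //.
Qed.

Lemma adjoint (S : H -> H) k : bounded_op S -> exists k', forall h, dotp (S h) k = dotp h k'.
Proof.
move=> bS; have [K K0 hK] := bop_bound bS; case: bS => Sl _.
apply: (@riesz R H _ (K * hs k)); first by rewrite mulr_ge0 ?hs_ge0.
- by move=> c x y; rewrite Sl dotpDl dotpZl.
- move=> x; apply: le_trans (dotp_CS _ _) _; rewrite mulrAC ler_wpM2r ?hs_ge0 //.
Qed.

(** Matrix coefficients of a bounded family have limits along the ultrafilter, and Riesz turns the
    limit form into a bounded operator. It commutes with everything that commutes with [ro], since
    each [ro (a i)] does; so it lies in the image of [ro]. *)
Lemma wcompact (I : Type) (F : set (set I)) (a : I -> A) (M : R) : uf F ->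
  (forall i, cnorm (a i) <= M) -> exists2 e, cnorm e <= M & wlim F a e.
Proof.
move=> uF hM.
have H1 h k : exists l, flim F (fun i => dotp (ro (a i) h) k) l.
  exact: (flim_ex uF (fun i => dotp_bound h k (hM i))).
have H1' h : exists f, forall k, flim F (fun i => dotp (ro (a i) h) k) (f k).
  by have [f hf] := choice (H1 h); exists f.
have [L hL] := choice H1'.
have Lk h (c : R[i]) k k' : L h (c *: k + k') = c^* * L h k + L h k'.
  apply: (flim_uniq uF (hL _ _)); apply: (flim_ext uF _ (flimD uF (flimZ uF c^* (hL h k)) (hL h k'))).
  by move=> i; rewrite dotpDr dotpZr.
have Lh k (c : R[i]) h h' : L (c *: h + h') k = c * L h k + L h' k.
  apply: (flim_uniq uF (hL _ _)); apply: (flim_ext uF _ (flimD uF (flimZ uF c (hL h k)) (hL h' k))).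
  by move=> i; rewrite ro_linh dotpDl dotpZl.
have Lb h k : mod (L h k) ^+ 2 <= M ^+ 2 * hs h * hs k.
  have := flim_bound uF (hL h k) (fun i => dotp_bound h k (hM i)).
  rewrite -(@ler_pXn2r _ 2) ?nnegrE ?mod_ge0 ?sqrtr_ge0 // sqr_sqrtr //.
  exact: hs3_ge0.
have H2 h : exists t, forall k, L h k = dotp t k.
  have [|c x y|x|t ht] := @riesz R H (fun k => (L h k)^*) (M ^+ 2 * hs h).
  - by rewrite mulr_ge0 ?sqr_ge0 ?hs_ge0.
  - by rewrite Lk rmorphD rmorphM /= conjCK.
  - by rewrite mod_conj.
  by exists t => k; rewrite dotpC -ht conjCK.
have [T hT] := choice H2.
have Tl : linear T.
  by move=> c h h'; apply: dotp_inj => k; rewrite dotpDl dotpZl -!hT Lh.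
have Tb h : hs (T h) <= M ^+ 2 * hs h.
  have := Lb h (T h); rewrite hT hsE mod_real ger0_norm ?hs_ge0 //.
  have := hs_ge0 (T h); rewrite le_eqVlt => /orP[/eqP <-|h1].
    by move=> _; apply: mulr_ge0; rewrite ?sqr_ge0 ?hs_ge0.
  by rewrite expr2 ler_pM2r.
have [S bS cS h|e eT] := ro_bic (bop_of_bound (sqr_ge0 M) Tl Tb).
  apply: dotp_inj => k; have [k' hk'] := adjoint k bS.
  rewrite -hT hk' -hT; apply: (flim_uniq uF (hL _ _)); apply: (flim_ext uF _ (hL _ _)) => i.
  by rewrite -hk' cS.
have he : wlim F a e by move=> h k; rewrite -eT -hT.
by exists e => //; apply: wlim_norm he.
Qed.

Implicit Types (s : A) (th ph psi : A -> R[i]).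

Lemma ple_sub0 a b : ple a b -> ple 0 (b - a).
Proof. by move=> /ple_sub. Qed.

Lemma roZh (c : R[i]) a h : ro a (c *: h) = c *: ro a h.
Proof.
have r0 : ro a 0 = 0 by have := ro_linh a (-1) 0 0; rewrite !scaleN1r !addNr.
by have := ro_linh a c h 0; rewrite r0 !addr0.
Qed.

(** Continuity for the weak operator topology on bounded sets. For positive functionals it is
    equivalent to normality, by [normal_wcont] and [wcont_normal]. *)
Definition wcont th := forall (I : Type) (F : set (set I)) (a : I -> A) (M : R) e, uf F ->
  (forall i, cnorm (a i) <= M) -> wlim F a e -> flim F (fun i => th (a i)) (th e).

Lemma wcontD th th' : wcont th -> wcont th' -> wcont (fun a => th a + th' a).
Proof. by move=> h h' I F a M e uF hM he; apply: flimD => //; [apply: h hM he|apply: h' hM he]. Qed.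

Lemma wcontZ (k : R[i]) th : wcont th -> wcont (fun a => k * th a).
Proof. by move=> h I F a M e uF hM he; apply: flimZ => //; apply: h hM he. Qed.

Lemma wcont_mul c d th : wcont th -> wcont (fun a => th (c * a * d)).
Proof.
move=> h I F a M e uF hM he; apply: (h I F (fun i => c * a i * d) (cnorm c * M * cnorm d)) => //.
  move=> i; apply: le_trans (cnormM _ _) _; rewrite ler_wpM2r ?cnorm_ge0 //.
  by apply: le_trans (cnormM _ _) _; rewrite ler_wpM2l ?cnorm_ge0.
move=> u v; rewrite !roM (ro_adj c).
by apply: (flim_ext uF _ (he (ro d u) (ro (star c) v))) => i; rewrite !roM (ro_adj c).
Qed.

Lemma wcont_vf h k : wcont (fun a => dotp (ro a h) k).
Proof. by move=> I F a M e uF hM he; exact: he. Qed.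

Lemma wcont_unif th : (forall r : R, 0 < r -> exists2 th', wcont th' &
  forall x, mod (th x - th' x) <= r * cnorm x) -> wcont th.
Proof.
move=> hu I F a M e uF hM he r r0.
have eM := wlim_norm uF hM he.
have M0 : 0 <= M by exact: le_trans (cnorm_ge0 e) eM.
have r1 : 0 < r / (3 * (M + 1)) by rewrite divr_gt0 //; lra.
have [th' h1 h2] := hu _ r1.
have r3 : 0 < r / 3 by lra.
have h3 := h1 _ _ _ _ _ uF hM he _ r3.
have bd x : cnorm x <= M -> mod (th x - th' x) < r / 3.
  move=> xM; apply: le_lt_trans (h2 x) _.
  apply: le_lt_trans (_ : r / (3 * (M + 1)) * M < _); first by rewrite ler_wpM2l // ltW.
  rewrite -(@ltr_pM2r _ (3 * (M + 1))); last by lra.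
  rewrite mulrAC divfK; last by rewrite lt0r_neq0 //; lra.
  nra.
apply: (uf_S uF h3) => i /= h4.
have := mod_triB (th (a i)) (th' (a i)) (th e).
have := mod_triB (th' (a i)) (th' e) (th e); rewrite (mod_distC (th' e)).
have := bd _ (hM i); have := bd _ eM; lra.
Qed.

Lemma wlim_ge (I : Type) (F : set (set I)) (a : I -> A) c e : uf F -> wlim F a e ->
  F [set i | ple c (a i)] -> ple c e.
Proof.
move=> uF he hc; apply/pleP; split.
  apply: ro_inj => h; apply: dotp_inj => k.
  have f1 : flim F (fun i => dotp (ro (a i - c) h) k) (dotp (ro (e - c) h) k).
    rewrite roB dotpBl; apply: (flim_ext uF _ (flimB uF (he h k) (flimC uF _))).
    by move=> i; rewrite roB dotpBl.
  have f2 : flim F (fun i => dotp (ro (star (a i - c)) h) k) (dotp (ro (star (e - c)) h) k).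
    rewrite ro_adj starK dotpC roB dotpBl.
    apply: (flim_ext uF _ (flim_conj uF (flimB uF (he k h) (flimC uF (dotp (ro c k) h))))) => i.
    by rewrite [RHS]ro_adj starK [RHS]dotpC roB dotpBl.
  apply: (flim_uniq uF f2); apply: (flim_eqF uF _ f1).
  by apply: uf_S hc _ => // i /pleP [/= -> _].
move=> h.
have f1 : flim F (fun i => dotp (ro (a i - c) h) h) (dotp (ro (e - c) h) h).
  rewrite roB dotpBl; apply: (flim_ext uF _ (flimB uF (he h h) (flimC uF _))).
  by move=> i; rewrite roB dotpBl.
apply: (flim_Re_ge0 uF f1); apply: (uf_S uF hc) => i /pleP [_ /=].
exact.
Qed.

Lemma wlimN (I : Type) (F : set (set I)) (a : I -> A) e : uf F -> wlim F a e ->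
  wlim F (fun i => - a i) (- e).
Proof.
move=> uF he h k; have E x := lfunN x (ro_lfun h k); rewrite /= in E.
by rewrite E -mulN1r; apply: (flim_ext uF _ (flimZ uF (-1) (he h k))) => i; rewrite E mulN1r.
Qed.

Lemma pleN a b : ple a b -> ple (- b) (- a).
Proof. by move=> [q sq e]; exists q; rewrite // opprK addrC. Qed.

Lemma wlim_le (I : Type) (F : set (set I)) (a : I -> A) c e : uf F -> wlim F a e ->
  F [set i | ple (a i) c] -> ple e c.
Proof.
move=> uF he hc; rewrite -(opprK e) -(opprK c); apply: pleN.
by apply: (wlim_ge uF (wlimN uF he)); apply: (uf_S uF hc) => i; exact: pleN.
Qed.

(** With [a = q * q], the squared norm of a h is <a q h, q h> <= |b| <q h, q h> = |b| <a h, h> <=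
    |b|^2 |h|^2. *)
Lemma ple_norm a b : ple 0 a -> ple a b -> cnorm a <= cnorm b.
Proof.
move=> [q sq]; rewrite subr0 => aE /pleP [_ hab].
have le h : dotp (ro a h) h <= dotp (ro b h) h.
  by rewrite -subr_ge0 -dotpBl -roB.
have b0 := cnorm_ge0 b.
have bb h : dotp (ro a h) h <= (cnorm b * hs h)%:C.
  have ha : 0 <= dotp (ro a h) h by rewrite aE roM ro_adj sq dotp_ge0.
  apply: le_trans (le h) _; rewrite (ge0_ReE (le_trans ha (le h))) lecR.
  apply: le_trans (ler_norm _) _; apply: le_trans (Re_le_mod _) _.
  have := dotp_bound h h (lexx (cnorm b)); rewrite -mulrA -expr2 -exprMn sqrtr_sqr.
  by rewrite ger0_norm // mulr_ge0 // hs_ge0.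
apply: op_norm => // h.
have e1 : dotp (ro a h) (ro a h) = dotp (ro a (ro q h)) (ro q h).
  have adj u v : dotp u (ro q v) = dotp (ro q u) v by rewrite ro_adj sq.
  by rewrite {2}aE roM adj -!roM aE mulrA.
have e2 : dotp (ro q h) (ro q h) = dotp (ro a h) h.
  by rewrite aE roM [RHS]ro_adj sq.
rewrite -lecR -hsE e1; apply: le_trans (bb _) _; rewrite rmorphM /= -hsE e2.
by apply: le_trans (ler_wpM2l _ (bb h)) _; rewrite ?ler0c // -rmorphM /= lecR mulrA -expr2.
Qed.

(** An ultrafilter that contains all upper sections of the chain makes the chain converge weakly.
    The order is weakly closed on both sides, so the limit is the least upper bound. *)
Lemma chain_lim (K : set A) c : K !=set0 -> (forall s t, K s -> K t -> ple s t \/ ple t s) ->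
  (forall s, K s -> ple 0 s /\ ple s c) ->
  exists (F : set (set A)) (a : A -> A) e (M : R), [/\ uf F, forall i : A, cnorm (a i) <= M, wlim F a e,
    (forall k : A, K k -> F [set i | K (a i) /\ ple k (a i)])
    & (forall k : A, K k -> ple k e) /\ forall t, (forall k : A, K k -> ple k t) -> ple e t].
Proof.
move=> [k0 Kk0] tK hK.
have [||S T [k Kk <-] [l Kl <-]|F uF BF] := @uf_ex A [set [set i | K i /\ ple k i] | k in K].
- by exists [set i | K i /\ ple k0 i], k0.
- by move=> _ [k Kk <-]; exists k; split=> //; apply: ple_refl.
- case: (tK k l Kk Kl) => h.
    exists [set i | K i /\ ple l i]; first by exists l.
    by move=> i [Ki li]; split; split=> //; apply: (ple_trans h).
  exists [set i | K i /\ ple k i]; first by exists k.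
  by move=> i [Ki li]; split; split=> //; apply: (ple_trans h).
(* The index type is the whole algebra; the default value 0 outside [K] is invisible to the
   ultrafilter and keeps the family bounded. *)
pose a i := if `[< K i >] then i else 0.
have aM i : cnorm (a i) <= cnorm c.
  rewrite /a; case: asboolP => [/hK [h1 h2]|_]; first exact: ple_norm.
  by rewrite cnorm0 cnorm_ge0.
have [e _ he] := wcompact uF aM.
have Fk (k : A) : K k -> F [set i | K (a i) /\ ple k (a i)].
  move=> Kk; apply: (uf_S uF (BF _ (ex_intro2 _ _ k Kk erefl))) => i [Ki ki] /=.
  by rewrite /a asboolT.
exists F, a, e, (cnorm c); split=> //; split.
  by move=> k Kk; apply: (wlim_ge uF he); apply: (uf_S uF (Fk _ Kk)) => i [].
move=> t ht; apply: (wlim_le uF he); apply: (uf_S uF (Fk _ Kk0)) => i [Ki _].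
exact: ht.
Qed.

Lemma ge0_total (u v : R[i]) : 0 <= u -> 0 <= v -> u <= v \/ v < u.
Proof.
move=> /ge0_ReE -> /ge0_ReE ->; rewrite lecR ltcR.
by case: leP => _; [left|right].
Qed.

(* Below [e] there is an element [d <> 0] on which [ph] is dominated by a vector functional:
   [d = e - a] for a maximal [a <= e] among those on which [ph] dominates it. *)
Lemma dominated_part ph e : pfun ph -> ple 0 e -> ple e 1 -> e <> 0 ->
  exists d, [/\ ple 0 d, ple d e, d <> 0 & wcont (fun x => ph (x * d))].
Proof.
move=> hph e0 e1 en0; have [hl hp] := hph.
have [q sq] := e0; rewrite subr0 => eE.
have phe : 0 <= ph e by rewrite eE pf_sq.
have [h0 hh0] : exists h0, hs (ro q h0) != 0.
  apply: contrapT => hn; apply: en0; rewrite eE (_ : q = 0) ?mulr0 //.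
  apply: ro_inj => h; rewrite ro0; apply: hs_eq0.
  by apply/eqP/negPn/negP => hh; apply: hn; exists h.
have hp0 : 0 < hs (ro q h0) by rewrite lt_def hh0 hs_ge0.
(* This scaling gives [om e = ph e + 1]: the vector functional is strictly above [ph] at [e], which
   prevents the maximal element from being [e]. *)
pose t := (Re (ph e) + 1) / hs (ro q h0).
have t0 : 0 < t by rewrite divr_gt0 //; have := Re_ge0 phe; lra.
pose h := (Num.sqrt t)%:C *: h0.
pose om a := dotp (ro a h) h.
have omp : pfun om by exact: ro_pfun.
have [oml _] := omp.
have ome : ph e < om e.
  rewrite /om eE roM ro_adj sq hsE /h roZh.
  rewrite hsZ mod_real ger0_norm ?sqrtr_ge0 // sqr_sqrtr ?ltW // divfK //.
  by rewrite -eE {1}(ge0_ReE phe) ltcR; lra.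
pose S a := [/\ ple 0 a, ple a e & om a <= ph a].
have [||||m [m0 me hm] mmax] := @zorn_set A S (@ple R A).
- by move=> s _; apply: ple_refl.
- exact: ple_trans.
- exact: ple_antisym.
- move=> K KS tK; have [[k0 Kk0]|Kn0] := pselect (K !=set0); last first.
    exists 0; first by split=> //; [apply: ple_refl|rewrite !lfun0].
    by move=> s Ks; case: Kn0; exists s.
  have [||F [a [e' [M [uF aM he Fk [ub lub]]]]]] := @chain_lim K e _ tK; first by exists k0.
    by move=> s /KS [].
  exists e' => //; split; last 1 first.
  + rewrite -subr_ge0; apply: (flim_Re_ge0 uF (flimB uF (flimC uF (ph e')) (he h h))).
    apply: (uf_S uF (Fk _ Kk0)) => i [Ki _]; rewrite /= subr_ge0.
    by have [_ _ hi] := KS _ Ki; apply: le_trans hi _; apply: pf_le => //; apply: ub.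
  + by apply: (ple_trans _ (ub _ Kk0)); case: (KS _ Kk0).
  + by apply: lub => k /KS [].
pose d := e - m.
have d0 : ple 0 d by exact: ple_sub0.
have de : ple d e by apply/ple_sub; rewrite /d subKr.
have d1 : ple d 1 by apply: (ple_trans de).
have sd := ple0_sa d0.
exists d; split=> //.
  move=> dz; move: ome; have -> : e = m by apply/eqP; rewrite -subr_eq0 -/d dz.
  by move=> lt; have := lt_le_trans lt hm; rewrite ltxx.
have Hc c : ple 0 c -> ple c d -> ph c <= om c.
  move=> c0 cd; have [q' sq' cE] := c0; rewrite subr0 in cE.
  have pc : 0 <= ph c by rewrite cE pf_sq.
  have oc : 0 <= om c by rewrite cE; exact: pf_sq omp sq'.
  have [//|lt] := ge0_total pc oc.
  have mc : m + c = m.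
    apply: mmax; last by have := ple_add m c0; rewrite add0r addrC.
    split; first exact: ple0D.
      by have := ple_add m cd; rewrite /d subrK addrC.
    by rewrite !lfunD // lerD // ltW.
  have c00 : c = 0 by apply: (@addrI _ m); rewrite addr0.
  by rewrite c00 !lfun0 ?ltxx in lt *.
(* For a contraction x, the element (x d)^* (x d) is below d^2, hence below d, where [ph] is
   dominated by [om]. *)
have H1 x : cnorm x <= 1 -> n2 ph (x * d) <= hs (ro (x * d) h).
  move=> x1; rewrite -ro_n2 -lecR -!n2E //; apply: Hc.
    by apply/cstar_leP; exists (x * d); rewrite subr0.
  apply: (ple_trans _ (ple_sqr d0 d1)).
  have [r sr rE] := pos_norm x.
  have : ple (star x * x) 1.
    apply: (@ple_trans _ ((cnorm x ^+ 2)%:C%:A)); first by exists r.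
    have x2 : 0 <= 1 - cnorm x ^+ 2 by have := cnorm_ge0 x; nra.
    exists ((Num.sqrt (1 - cnorm x ^+ 2))%:C%:A); first by rewrite starZr star1.
    rewrite -scalerAl -scalerAr scalerA -rmorphM /= -expr2 sqr_sqrtr // mulr1.
    by rewrite rmorphB rmorph1 scalerBl scale1r.
  by move=> /(ple_conj d); rewrite starM sd mulr1 !mulrA.
have H2 x : n2 ph (x * d) <= hs (ro (x * d) h).
  have [e'|n0] := eqVneq (cnorm x) 0.
    rewrite (cnorm_eq0 _ e') mul0r /n2 mulr0 lfun0 // ro0.
    by rewrite /hs dotp0l.
  have np : 0 < cnorm x by rewrite lt_def n0 cnorm_ge0.
  have := H1 ((cnorm x)^-1%:C *: x).
  rewrite cnormZr gtr0_norm ?invr_gt0 //.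
  rewrite mulVf ?n0 // => /(_ (lexx _)).
  rewrite -scalerAl -!ro_n2 /n2 starZr -scalerAl -scalerAr !scalerA -!rmorphM /=.
  by rewrite -!/(om _) !lfunZ // !ReZ ler_pM2l // mulr_gt0 ?invr_gt0.
(* [ph (x * d)] is bounded for the seminorm of x |-> ro (x d) h, so approximate Riesz represents it
   by functionals <ro (x d) h, ro (w d) h>, with an error small uniformly on the unit ball:
   [wcont_unif] applies. *)
pose g x y := Re (dotp (ro (x * d) h) (ro (y * d) h)).
have rolin (r : R) x y : ro ((r%:C *: x + y) * d) h = r%:C *: ro (x * d) h + ro (y * d) h.
  by rewrite mulrDl -scalerAl ro_lin.
have p1 : 0 <= Re (ph 1) by have := hp 1; rewrite star1 mulr1 => /Re_ge0.
apply: wcont_unif => r r0.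
have hd := hs_ge0 (ro d h).
pose eps := (r / 2) ^+ 2 / (hs (ro d h) + 1).
have eps0 : 0 < eps by rewrite divr_gt0 ?exprn_gt0 //; lra.
have gl (r' : R) x y z : g (r'%:C *: x + y) z = r' * g x z + g y z.
  by rewrite /g rolin dotp_linear ReD ReZ.
have gs x y : g x y = g y x by rewrite /g dotpC Re_conj.
have g0 x : 0 <= g x x by exact: hs_ge0.
have fl (r' : R) x y : Re (ph ((r'%:C *: x + y) * d)) =
    r' * Re (ph (x * d)) + Re (ph (y * d)).
  by rewrite mulrDl -scalerAl hl ReD ReZ.
have fK x : setT x -> Re (ph (x * d)) ^+ 2 <= Re (ph 1) * g x x.
  move=> _; rewrite -(real_normK (num_real (Re _))).
  apply: le_trans (_ : mod (ph (x * d)) ^+ 2 <= _).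
    by rewrite ler_pXn2r ?nnegrE ?mod_ge0 // Re_le_mod.
  have := pCS (x * d) 1 hph; rewrite star1 mul1r => hcs; apply: le_trans hcs _.
  by rewrite mulrC {1}/n2 star1 mulr1 ler_wpM2l.
have [w _ hw] := approx_riesz I (fun _ _ _ _ _ => I) gl gs g0 fl p1 fK eps0.
exists (fun x => dotp (ro (x * d) h) (ro (w * d) h)).
  have := wcont_mul 1 d (wcont_vf h (ro (w * d) h)).
  by move=> hh I' F a M e' uF aM he; have := hh I' F a M e' uF aM he; rewrite /= mul1r;
     apply: flim_ext => // i; rewrite mul1r.
have Rb x : `|Re (ph (x * d)) - g x w| <= r / 2 * cnorm x.
  have := hw x Logic.I => hx; rewrite -(@ler_pXn2r _ 2) ?nnegrE ?normr_ge0 ?mulr_ge0 ?cnorm_ge0 //; last by lra.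
  rewrite real_normK ?num_real //; apply: le_trans hx _.
  have := ro_bound x (ro d h); rewrite -roM => hb.
  apply: le_trans (_ : eps * (cnorm x ^+ 2 * (hs (ro d h) + 1)) <= _).
    by rewrite ler_wpM2l ?(ltW eps0) //; apply: le_trans hb _; rewrite ler_wpM2l ?sqr_ge0 //; lra.
  rewrite mulrCA /eps divfK; last by rewrite lt0r_neq0 //; lra.
  by rewrite [leRHS]exprMn mulrC.
move=> x; apply: le_trans (mod_le_ReIm _) _.
have ImE (u : R[i]) : complex.Im u = - Re ('i * u).
  by rewrite -complexiE; case: u => u1 u2 /=; rewrite mul0r mul1r sub0r opprK.
have := Rb x; have := Rb ('i *: x).
have RB (u v : R[i]) : Re (u - v) = Re u - Re v by case: u v => ? ? [].
have -> : Re (ph ('i *: x * d)) - g ('i *: x) w =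
    - complex.Im (ph (x * d) - dotp (ro (x * d) h) (ro (w * d) h)).
  have IB (u v : R[i]) : complex.Im (u - v) = complex.Im u - complex.Im v by case: u v => ? ? [].
  rewrite IB (ImE (ph _)) (ImE (dotp _ _)) opprB opprK addrC /g -!scalerAl (lfunZ _ _ hl).
  by rewrite -[_ *: (x * d)]addr0 ro_lin ro0 addr0 dotpZl addrC.
rewrite normrN RB -/(g x w).
rewrite (_ : cnorm ('i *: x) = cnorm x); first by lra.
by have := cnormZ 'i x; rewrite normCi mul1r => /eqP; rewrite eq_complex /= eqxx andbT => /eqP.
Qed.

Definition normf ph := forall (D : set A) (s : A), D !=set0 -> (forall d, D d -> selfadjoint d) ->
    (forall d d', D d -> D d' ->
       exists2 d'', D d'' & cstar_le d d'' /\ cstar_le d' d'') ->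
    cstar_lub D s ->
    forall e : R, 0 < e -> exists2 d, D d & ph s <= ph d + e%:C.

(** Exhaustion. Let [m] be maximal in [0, 1] among the elements with [ph (_ * m)] weakly continuous.
    If [m] is not 1, [dominated_part] finds below 1 - m a non-zero d to be added, against
    maximality. *)
Theorem normal_wcont ph : pfun ph -> normf ph -> wcont ph.
Proof.
move=> hph hn; have [hl hp] := hph.
have p1 : 0 <= Re (ph 1) by have := hp 1; rewrite star1 mulr1 => /Re_ge0.
pose S s := [/\ ple 0 s, ple s 1 & wcont (fun x => ph (x * s))].
have p01 : ple (0 : A) 1 by exists 1; rewrite ?star1 // subr0 mulr1.
have [||||m [m0 m1 hm] mmax] := @zorn_set A S (@ple R A).
- by move=> s _; apply: ple_refl.
- exact: ple_trans.
- exact: ple_antisym.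
- move=> K KS tK; have [[k0 Kk0]|Kn0] := pselect (K !=set0); last first.
    exists 0; last by move=> s Ks; case: Kn0; exists s.
    split=> //; first exact: ple_refl.
    by move=> I F a M e uF aM he; rewrite mulr0 lfun0 //; apply: (flim_ext uF _ (flimC uF 0)) => i; rewrite mulr0 lfun0.
  have [||F [a [e [M [uF aM he Fk [ub lub]]]]]] := @chain_lim K 1 _ tK; first by exists k0.
    by move=> s /KS [].
  have e0 : ple 0 e by apply: (ple_trans _ (ub _ Kk0)); case: (KS _ Kk0).
  have e1 : ple e 1 by apply: lub => k /KS [].
  (* The functional at the supremum [e] is a uniform limit of those at the members k of the chain:
     by Cauchy-Schwarz the error at x is at most |x| times the square root of (ph 1) ph (e - k), and
     normality makes the last factor small. *)
  exists e => //; split=> //; apply: wcont_unif => r r0.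
  pose eps := r ^+ 2 / (Re (ph 1) + 1).
  have eps0 : 0 < eps by rewrite divr_gt0 ?exprn_gt0 //; lra.
  have [||||k Kk hk] := hn K e _ _ _ _ eps eps0.
  + by exists k0.
  + by move=> d /KS [/ple0_sa].
  + move=> d d' Kd Kd'; case: (tK d d' Kd Kd') => h.
      by exists d' => //; split; apply/cstar_leP => //; exact: ple_refl.
    by exists d => //; split; apply/cstar_leP => //; exact: ple_refl.
  + split; first by move=> d /ub /cstar_leP.
    by move=> t ht; apply/cstar_leP/lub => k /ht /cstar_leP.
  exists (fun x => ph (x * k)); first by case: (KS _ Kk).
  move=> x; rewrite -lfunB // -mulrBr.
  have [k00 k1 _] := KS _ Kk.
  have ek0 : ple 0 (e - k) by apply: ple_sub0; exact: ub.
  have ek1 : ple (e - k) 1.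
    apply: (ple_trans _ e1); apply/ple_sub; by rewrite subKr.
  have n2ek : n2 ph (e - k) <= eps.
    rewrite /n2 (ple0_sa ek0); have /(pf_le hph) := ple_sqr ek0 ek1.
    rewrite lecE => /andP[_ h]; apply: le_trans h _.
    by move: hk; rewrite lfunB // -lerBlDl lecE /= => /andP[_].
  rewrite -(@ler_pXn2r _ 2) ?nnegrE ?mod_ge0 //; last by rewrite mulr_ge0 ?cnorm_ge0 // ltW.
  have := pCS (e - k) (star x) hph; rewrite starK => hh; apply: le_trans hh _.
  have hx := pf_bound1 (star x) hph; rewrite cnormS in hx.
  apply: le_trans (ler_pM (n2_ge0 _ hph) (n2_ge0 _ hph) n2ek hx) _.
  rewrite exprMn mulrCA [X in _ <= X]mulrC ler_wpM2l ?sqr_ge0 //.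
  rewrite /eps mulrAC ler_pdivrMr; last by lra.
  by rewrite ler_wpM2l ?sqr_ge0 //; lra.
have [em|nm] := pselect (m = 1).
  move=> I F a M e uF aM he; have := hm I F a M e uF aM he; rewrite em /= mulr1.
  by apply: flim_ext => // i; rewrite mulr1.
have [|||d [d0 dm dn0 hd]] := @dominated_part ph (1 - m) hph.
- exact: ple_sub0.
- by apply/ple_sub; rewrite subKr.
- by move=> h; apply: nm; apply/esym/eqP; rewrite -subr_eq0 h.
case: dn0; have : m + d = m; last by move=> h; apply: (@addrI _ m); rewrite addr0.
apply: mmax; last by have := ple_add m d0; rewrite add0r addrC.
split; first exact: ple0D.
  by have := ple_add m dm; rewrite subrK addrC.
move=> I F a M e uF aM he; have := wcontD hm hd uF aM he.
by rewrite -lfunD // -mulrDr; apply: flim_ext => // i; rewrite -lfunD // -mulrDr.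
Qed.

(** The directed set, read above one of its elements [d0] so as to be bounded, converges weakly
    along an ultrafilter of its upper sections, and the limit is its supremum. *)
Theorem wcont_normal ph : pfun ph -> wcont ph -> normf ph.
Proof.
move=> hph hw D s [d0 Dd0] Dsa Dd [sub slub] r r0; have [hl hp] := hph.
have sub' d : D d -> ple d s by move=> /sub /cstar_leP.
have [||S T [k [Kk k0] <-] [l [Kl l0] <-]|F uF BF] :=
    @uf_ex A [set [set i | D i /\ ple k i] | k in [set k | D k /\ ple d0 k]].
- by exists [set i | D i /\ ple d0 i], d0 => //; split=> //; apply: ple_refl.
- by move=> _ [k [Kk _] <-]; exists k; split=> //; apply: ple_refl.
- have [m Dm [/cstar_leP km /cstar_leP lm]] := Dd _ _ Kk Kl.
  exists [set i | D i /\ ple m i].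
    by exists m => //; split=> //; apply: (ple_trans k0).
  by move=> i [Di mi]; split; split=> //; [apply: (ple_trans km)|apply: (ple_trans lm)].
pose a i := if `[< D i /\ ple d0 i >] then i else d0.
have Da i : D (a i) /\ ple d0 (a i).
  by rewrite /a; case: asboolP => // _; split=> //; exact: ple_refl.
have aM i : cnorm (a i) <= cnorm d0 + cnorm (s - d0).
  have [h1 h2] := Da i; have := cnormD d0 (a i - d0); rewrite addrCA subrr addr0.
  suff : cnorm (a i - d0) <= cnorm (s - d0) by lra.
  by apply: ple_norm; [exact: (ple_sub _ _).1|apply: ple_add; exact: sub'].
have [e _ he] := wcompact uF aM.
have ed (k : A) : D k -> ple k e.
  move=> Dk; have [m Dm [/cstar_leP km /cstar_leP lm]] := Dd _ _ Dk Dd0.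
  apply: (wlim_ge uF he); apply: (uf_S uF (BF _ (ex_intro2 _ _ m (conj Dm lm) erefl))) => i [Di mi] /=.
  rewrite /a asboolT; first exact: (ple_trans km).
  by split=> //; exact: (ple_trans lm).
have es : e = s.
  apply: ple_antisym.
    by apply: (wlim_le uF he); apply: uf_T => // i /=; apply: sub'; case: (Da i).
  by apply/cstar_leP; apply: slub => d /ed /cstar_leP.
have [i /= hi] := uf_n0 uF (hw _ _ _ _ _ uF aM he r r0).
exists (a i); first by case: (Da i).
have : 0 <= ph (s - a i).
  by rewrite -(lfun0 hl); apply: pf_le => //; apply: ple_sub0; apply: sub'; case: (Da i).
move=> h; rewrite es in hi; rewrite -lerBlDl -lfunB // (ge0_ReE h) lecR ltW //.
apply: le_lt_trans (ler_norm _) _; apply: le_lt_trans (Re_le_mod _) _.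
by rewrite -modN -lfunN // opprB lfunB.
Qed.

Implicit Types (p w : A) (D : set A) (g : A -> R).

Definition mkscalar th (h : lfun th) : {scalar A} :=
  HB.pack th (GRing.isLinear.Build R[i] A R[i] *%R th h).

Definition cl D a := forall (m : nat) (psi : 'I_m -> {scalar A}) (e : R),
  (forall i, normal_state (psi i)) -> 0 < e ->
  exists2 b, D b & forall i, `|psi i (a - b) : R[i]| < e%:C.

Lemma cl_sub D a : D a -> cl D a.
Proof. by move=> Da m psi e _ e0; exists a => // i; rewrite subrr linear0 normr0 ltcR. Qed.

(** Domination by finitely many normal states, that is, continuity of a seminorm for the sigma-weak
    topology. Through [cl_ndom], such estimates pass from a set to its closure. *)
Definition ndom g := exists (m : nat) (psi : 'I_m -> {scalar A}) (K : R),
  [/\ 0 <= K, forall i, normal_state (psi i) & forall a, g a <= K * \sum_i mod (psi i a)].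

Lemma ndom_le g g' : ndom g -> (forall a, g' a <= g a) -> ndom g'.
Proof.
by move=> [m [psi [K [K0 hp hK]]]] h; exists m, psi, K; split=> // a; apply: le_trans (h a) (hK a).
Qed.

Lemma ndom0 : ndom (fun=> 0).
Proof.
have f (i : 'I_0) : {scalar A} by case: i.
exists 0%N, f, 0; split=> //; first by case.
by move=> a; rewrite mul0r.
Qed.

Lemma ndomZ g (k : R) : 0 <= k -> ndom g -> ndom (fun a => k * g a).
Proof.
move=> k0 [m [psi [K [K0 hp hK]]]]; exists m, psi, (k * K); split=> //; first exact: mulr_ge0.
by move=> a; rewrite -mulrA ler_wpM2l.
Qed.

Lemma ndomD g g' : ndom g -> ndom g' -> ndom (fun a => g a + g' a).
Proof.
move=> [m [psi [K [K0 hp hK]]]] [m' [psi' [K' [K0' hp' hK']]]].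
pose f (i : 'I_(m + m')%N) := match fintype.split i with inl j => psi j | inr j => psi' j end.
exists (m + m')%N, f, (K + K'); split; first exact: addr_ge0.
  by move=> i; rewrite /f; case: fintype.split.
move=> a; rewrite big_split_ord /=.
have -> : \sum_(i < m) mod (f (lshift m' i) a) = \sum_i mod (psi i a).
  by apply: eq_bigr => i _; rewrite /f (unsplitK (inl i)).
have -> : \sum_(i < m') mod (f (rshift m i) a) = \sum_i mod (psi' i a).
  by apply: eq_bigr => i _; rewrite /f (unsplitK (inr i)).
have s0 : 0 <= \sum_i mod (psi i a) by apply: sumr_ge0 => i _; exact: mod_ge0.
have s1 : 0 <= \sum_i mod (psi' i a) by apply: sumr_ge0 => i _; exact: mod_ge0.
by have := hK a; have := hK' a; nra.
Qed.

Lemma ndom_sum (I : Type) (s : seq I) (f : I -> A -> R) : (forall i, ndom (f i)) ->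
  ndom (fun a => \sum_(i <- s) f i a).
Proof.
move=> h; elim: s => [|i s IH]; first by apply: ndom_le ndom0 _ => a; rewrite big_nil.
by apply: ndom_le (ndomD (h i) IH) _ => a; rewrite big_cons.
Qed.

Lemma cl_ndom D a g : cl D a -> ndom g -> forall r : R, 0 < r -> exists2 b, D b & g (a - b) < r.
Proof.
move=> ha [m [psi [K [K0 hp hK]]]] r r0.
pose e := r / (K * m%:R + 1).
have km : 0 <= K * m%:R by rewrite mulr_ge0.
have e0 : 0 < e by rewrite divr_gt0 //; lra.
have [b Db hb] := ha m psi e hp e0; exists b => //; apply: le_lt_trans (hK _) _.
apply: le_lt_trans (_ : K * (m%:R * e) < _).
  rewrite ler_wpM2l //; apply: le_trans (_ : \sum_(i < m) e <= _).
    by apply: ler_sum => i _; rewrite ltW // -ltcR -modE.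
  by rewrite sumr_const card_ord mulr_natl.
rewrite mulrA /e mulrA ltr_pdivrMr; last by lra.
by rewrite mulrDr mulr1 mulrC ltrDl.
Qed.

Lemma ndom_pos ph : pfun ph -> wcont ph -> ndom (fun a => mod (ph a)).
Proof.
move=> hph hw; have [hl hp] := hph.
have p1 : 0 <= ph 1 by have := hp 1; rewrite star1 mulr1.
have p1E := ge0_ReE p1; set k := Re (ph 1) in p1E.
have k0 : 0 <= k by exact: Re_ge0.
have [kz|kn] := eqVneq k 0.
  apply: ndom_le ndom0 _ => a; have := pf_norm a hph; rewrite -/k kz mul0r.
  exact.
have kp : 0 < k by rewrite lt_def kn.
have hl' : lfun (fun a => (k^-1)%:C * ph a) by move=> c x y; rewrite hl mulrDr mulrCA.
have kk : k%:C * (k^-1)%:C = 1 :> R[i] by rewrite -rmorphM /= mulfV.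
have hp' : pfun (fun a => (k^-1)%:C * ph a).
  by split=> // z; rewrite mulr_ge0 // ler0c invr_ge0.
exists 1%N, (fun=> mkscalar hl'), k; split=> //.
  move=> _; split; first split.
  - by rewrite /= p1E mulrC.
  - by case: hp'.
  - exact: (wcont_normal hp' (wcontZ _ hw)).
by move=> a; rewrite big_ord1 /= modM mod_real ger0_norm ?invr_ge0 // mulrA mulfV // mul1r.
Qed.

(** The term of index [l] in the polarisation formula. The topology is defined by states, so a
    functional [ph (c * _ * d)] has to be written through four positive ones. *)
Definition pol ph (l : R[i]) c d x := ph (star (d + l *: c) * x * (d + l *: c)).

Lemma polarize ph c d x : lfun ph ->
  4 * ph (star c * x * d) = (pol ph 1 c d x - pol ph (-1) c d x) +
    'i * (pol ph 'i c d x - pol ph (- 'i) c d x).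
Proof.
move=> hl; rewrite /pol.
have E (l : R[i]) : ph (star (d + l *: c) * x * (d + l *: c)) =
    ph (star d * x * d) + l * ph (star d * x * c) + l^* * ph (star c * x * d) +
    l^* * l * ph (star c * x * c).
  rewrite starD starZ; set l' := l^*.
  have -> : (star d + l' *: star c) * x * (d + l *: c) = star d * x * d +
    l *: (star d * x * c) + l' *: (star c * x * d) + l' *: (l *: (star c * x * c)).
    by ncring_in R[i] A.
  by rewrite !lfunD // !lfunZ // mulrA.
rewrite !E !rmorphN /= !conjC1 !conjCi.
have i2 : 'i * 'i = -1 :> R[i] by rewrite -expr2 sqrCi.
set u1 := ph (star d * x * d); set u2 := ph (star d * x * c); set u3 := ph (star c * x * d).
set u4 := ph (star c * x * c).
transitivity (2 * u2 + 2 * u3 + 2 * ('i * 'i) * u2 - 2 * ('i * 'i) * u3); first by rewrite i2; ring.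
ring.
Qed.

Lemma ndom_pol ph c d : pfun ph -> wcont ph -> ndom (fun a => mod (ph (c * a * d))).
Proof.
move=> hph hw; have [hl _] := hph.
have hP l : ndom (fun x => mod (pol ph l (star c) d x)).
  by apply: ndom_pos; [exact: pf_conj|exact: wcont_mul].
have h := ndomD (ndomD (hP 1) (hP (-1))) (ndomD (hP 'i) (hP (- 'i))).
apply: ndom_le h _ => a.
have := polarize (star c) d a hl; rewrite starK => /(congr1 (@mod R)).
rewrite modM (_ : mod 4 = 4); last first.
  by rewrite -natC mod_real ger0_norm.
set P1 := pol _ 1 _ _ _; set P2 := pol _ (-1) _ _ _; set P3 := pol _ 'i _ _ _; set P4 := pol _ _ _ _ _.
move=> e; have := modD (P1 - P2) ('i * (P3 - P4)); rewrite -e modM (_ : mod 'i = 1) ?mul1r; last first.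
  by rewrite /mod normCi.
have := modD P1 (- P2); have := modD P3 (- P4); rewrite !modN.
have := mod_ge0 (ph (c * a * d)); lra.
Qed.

Lemma cl_mulr D c a : cl D a -> forall D', (forall d, D d -> D' (d * c)) -> cl D' (a * c).
Proof.
move=> ha D' hD m psi e hp e0.
have h : ndom (fun x => \sum_i mod (psi i (1 * x * c))).
  apply: ndom_sum => i; apply: ndom_pol; have [[h1 h2] h3] := hp i.
    by split=> // k x y; rewrite linearP.
  by apply: normal_wcont => //; split=> // k x y; rewrite linearP.
have [b Db hb] := cl_ndom ha h e0; exists (b * c); first exact: hD.
move=> i; rewrite modE ltcR -mulrBl; apply: le_lt_trans hb.
by rewrite (bigD1 i) //= mul1r lerDl; apply: sumr_ge0 => j _; exact: mod_ge0.
Qed.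

Lemma cl_mull D c a : cl D a -> forall D', (forall d, D d -> D' (c * d)) -> cl D' (c * a).
Proof.
move=> ha D' hD m psi e hp e0.
have h : ndom (fun x => \sum_i mod (psi i (c * x * 1))).
  apply: ndom_sum => i; apply: ndom_pol; have [[h1 h2] h3] := hp i.
    by split=> // k x y; rewrite linearP.
  by apply: normal_wcont => //; split=> // k x y; rewrite linearP.
have [b Db hb] := cl_ndom ha h e0; exists (c * b); first exact: hD.
move=> i; rewrite modE ltcR -mulrBr; apply: le_lt_trans hb.
by rewrite (bigD1 i) //= mulr1 lerDl; apply: sumr_ge0 => j _; exact: mod_ge0.
Qed.

Lemma cl_idem D : sigma_weak_closed (cl D).
Proof.
move=> a ha m psi e hp e0; have e2 : 0 < e / 2 by lra.
have [b hb hab] := ha m psi _ hp e2; have [c Dc hbc] := hb m psi _ hp e2.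
exists c => // i; have := hab i; have := hbc i; rewrite !modE !ltcR => h1 h2.
rewrite (_ : a - c = (a - b) + (b - c)); last by rewrite addrA subrK.
by rewrite linearD; apply: le_lt_trans (modD _ _) _; lra.
Qed.

Lemma cl_star_subalgebra D : star_subalgebra D -> star_subalgebra (cl D).
Proof.
move=> [D0 Dl DM DS]; split.
- exact: cl_sub.
- move=> c a b ha hb m psi e hp e0.
  have c0 := mod_ge0 c; have e1 : 0 < e / (2 * (mod c + 1)) by rewrite divr_gt0 //; lra.
  have e2 : 0 < e / 2 by lra.
  have [a' Da' ha'] := ha m psi _ hp e1; have [b' Db' hb'] := hb m psi _ hp e2.
  exists (c *: a' + b'); first exact: Dl.
  move=> i; rewrite opprD addrACA -scalerBr linearD linearZ modE ltcR.
  apply: le_lt_trans (modD _ _) _; rewrite modM.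
  have := ha' i; have := hb' i; rewrite !modE !ltcR !ltr_pdivlMr //; last by lra.
  by have := mod_ge0 (psi i (a - a')); nra.
(* Multiplication is continuous in each factor separately: the closure is taken twice and [cl_idem]
   merges the two. *)
- move=> a b ha hb.
  have h1 d : D d -> cl D (d * b) by move=> Dd; apply: (cl_mull hb) => b' Db'; exact: DM.
  by apply: cl_idem; apply: (cl_mulr ha) => d; exact: h1.
- move=> a ha m psi e hp e0; have [b Db hb] := ha m psi e hp e0.
  exists (star b); first exact: DS.
  move=> i; rewrite -starB; have := hb i; rewrite !modE !ltcR.
  have [[h1 h2] h3] := hp i.
  have hpi : pfun (psi i) by split=> // k x y; rewrite linearP.
  by rewrite (pf_star _ hpi) mod_conj.
Qed.

Lemma cl_lfun0 D a ph c d : cl D a -> pfun ph -> wcont ph ->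
  (forall b, D b -> ph (c * b * d) = 0) -> ph (c * a * d) = 0.
Proof.
move=> ha hph hw h; have [hl _] := hph; apply: mod_small => e e0.
have [b Db] := cl_ndom ha (ndom_pol c d hph hw) e0.
by rewrite mulrBr mulrBl lfunB // (h b Db) subr0.
Qed.

(** * Strong density and bounded approximation *)

Section Limits.
Variable U : set (set nat).
Hypothesis uU : uf U.
Hypothesis U_cof : forall N, U [set n | (N <= n)%N].

Lemma flim_leF (I : Type) (F : set (set I)) (f : I -> R[i]) (l k : R[i]) (M : R) : uf F -> flim F f l ->
  F [set i | mod (f i - k) <= M] -> mod (l - k) <= M.
Proof.
move=> uF h hM; rewrite leNgt; apply/negP => lt.
have [|i [/= h1 h2]] := uf_n0 uF (uf_I uF (h (mod (l - k) - M) _) hM); first by lra.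
have := mod_triB l (f i) k; rewrite (mod_distC l (f i)); lra.
Qed.

Lemma cross_le ph x z w (B dl : R) : pfun ph -> n2 ph z <= B -> n2 ph w <= B ->
  n2 ph (z - w) <= dl ->
  mod (ph (star z * x * z) - ph (star w * x * w)) <= 2 * (cnorm x * Num.sqrt (dl * B)).
Proof.
move=> hph hz hw hd; have [hl _] := hph.
have B0 : 0 <= B by exact: le_trans (n2_ge0 z hph) hz.
have d0 : 0 <= dl by exact: le_trans (n2_ge0 (z - w) hph) hd.
have x0 := cnorm_ge0 x.
have key u v : n2 ph u <= cnorm x ^+ 2 * dl -> n2 ph v <= B ->
    mod (ph (star v * u)) <= cnorm x * Num.sqrt (dl * B).
  move=> hu hv; rewrite -(@ler_pXn2r _ 2) ?nnegrE ?mod_ge0 ?mulr_ge0 ?sqrtr_ge0 //.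
  apply: le_trans (pCS _ _ hph) _; rewrite exprMn sqr_sqrtr ?mulr_ge0 // mulrA.
  by apply: ler_pM => //; exact: n2_ge0.
have k1 := key (x * (z - w)) z; have k2 := key (star x * (z - w)) w.
rewrite -lfunB // (_ : _ - _ = star z * (x * (z - w)) + star (star x * (z - w)) * w); last first.
  by rewrite starM starK starB; ncring_in R[i] A.
rewrite lfunD //; apply: le_trans (modD _ _) _.
have e1 : mod (ph (star (star x * (z - w)) * w)) = mod (ph (star w * (star x * (z - w)))).
  by rewrite -mod_conj -pf_star // starM starK.
rewrite e1 mulr2n mulrDl !mul1r; apply: lerD.
  by apply: k1 => //; apply: le_trans (pf_bound _ _ hph) _; rewrite ler_wpM2l ?sqr_ge0.
by apply: k2 => //; apply: le_trans (pf_bound _ _ hph) _; rewrite cnormS ler_wpM2l ?sqr_ge0.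
Qed.

(** The limit is the vector functional of a vector of the completed GNS space, to which the [z n]
    converge. The convergence is uniform on the unit ball, by [cross_le], so weak continuity
    survives. *)
Lemma lim_pos ph (z : nat -> A) (B : R) : pfun ph -> wcont ph ->
  (forall n, n2 ph (z n) <= B) ->
  (forall r : R, 0 < r -> exists N, forall m n, (N <= m)%N -> (N <= n)%N -> n2 ph (z m - z n) <= r) ->
  exists psi, [/\ pfun psi, wcont psi & forall x, flim U (fun n => ph (star (z n) * x * z n)) (psi x)].
Proof.
move=> hph hw hB hC; have [hl hp] := hph.
have B0 : 0 <= B by exact: le_trans (n2_ge0 (z 0%N) hph) (hB 0%N).
have H1 x : exists l, flim U (fun n => ph (star (z n) * x * z n)) l.
  apply: (flim_ex uU (M := B * cnorm x)) => n.
  apply: le_trans (pf_norm x (pf_conj (z n) hph)) _; rewrite ler_wpM2r ?cnorm_ge0 //.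
  by rewrite mulr1; exact: hB.
have [psi hpsi] := choice H1; exists psi; split=> //.
  split.
    move=> c x y; apply: (flim_uniq uU (hpsi _)).
    apply: (flim_ext uU _ (flimD uU (flimZ uU c (hpsi x)) (hpsi y))) => n.
    by have [h _] := pf_conj (z n) hph; rewrite -h.
  move=> x; apply: (flim_Re_ge0 uU (hpsi _)); apply: uf_T => // n /=.
  by have [_ h] := pf_conj (z n) hph; exact: h.
apply: wcont_unif => r r0.
pose dl := (r / 2) ^+ 2 / (B + 1).
have dl0 : 0 < dl by rewrite divr_gt0 ?exprn_gt0 //; lra.
have [N hN] := hC dl dl0.
exists (fun x => ph (star (z N) * x * z N)); first exact: wcont_mul.
move=> x; apply: (flim_leF uU (hpsi x)); apply: (uf_S uU (U_cof N)) => n /= hn.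
apply: le_trans (cross_le x hph (hB n) (hB N) (hN _ _ hn (leqnn N))) _.
have : Num.sqrt (dl * B) <= r / 2.
  rewrite -[r / 2]ger0_norm -?sqrtr_sqr; last by lra.
  rewrite ler_wsqrtr // /dl mulrAC ler_pdivrMr; last by lra.
  by rewrite ler_wpM2l ?sqr_ge0 //; lra.
by have := cnorm_ge0 x; nra.
Qed.

(** A sigma-weakly adherent point is strongly adherent, and this is obtained by projection rather
    than by convexity. Approximate minimisers [w n] of the distance to D leave residues [y n] almost
    orthogonal to D. The limit of [G _ (y n)] is sigma-weakly continuous with real part zero on D,
    hence at [s], and the size of [y n] tends to 0. D is only a real subspace, as its use for
    selfadjoint parts requires. *)
Lemma strong_dense ph D s : pfun ph -> wcont ph -> D 0 ->
  (forall (r : R) x y, D x -> D y -> D (r%:C *: x + y)) -> cl D s ->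
  forall (cs : seq A) (r : R), 0 < r -> exists2 p, D p & \sum_(c <- cs) n2 ph ((s - p) * c) < r.
Proof.
move=> hph hw D0 Dl hs cs r r0; have [hl hp] := hph.
pose G x y := \sum_(c <- cs) ph (star (y * c) * (x * c)).
have Gl (k : R[i]) x y z : G (k *: x + y) z = k * G x z + G y z.
  rewrite /G mulr_sumr -big_split; apply: eq_bigr => c _ /=.
  by rewrite mulrDl -scalerAl mulrDr -scalerAr hl.
have Gs x y : G y x = (G x y)^*.
  rewrite /G rmorph_sum; apply: eq_bigr => c _ /=.
  by rewrite -pf_star // [in RHS]starM starK.
have Gp x : 0 <= G x x by apply: sumr_ge0 => c _; exact: hp.
have GCS x y := form_CS Gl Gs Gp x y.
pose N2 x := Re (G x x).
have N2E x : N2 x = \sum_(c <- cs) n2 ph (x * c).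
  by rewrite /N2 /G (big_morph _ (@ReD R) (erefl : Re 0 = 0)).
have N20 x : 0 <= N2 x by exact: Re_ge0.
pose g x y := Re (G x y).
have gs x y : g x y = g y x by rewrite /g Gs Re_conj.
have gl (k : R) x y z : g (k%:C *: x + y) z = k * g x z + g y z by rewrite /g Gl ReD ReZ.
have gB x y z : g (x - y) z = g x z - g y z.
  have := gl (-1) y x z; rewrite rmorphN rmorph1 scaleN1r addrC => ->; ring.
have gBr x y z : g z (x - y) = g z x - g z y by rewrite !(gs z) gB.
have gCS x y : g x y ^+ 2 <= N2 x * N2 y.
  apply: le_trans (GCS x y); rewrite -(real_normK (num_real (g x y))).
  by rewrite ler_pXn2r ?nnegrE ?mod_ge0 // Re_le_mod.
have N2D x y : N2 (x + y) <= 2 * (N2 x + N2 y).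
  rewrite !N2E -big_split mulr_sumr /=; apply: ler_sum => c _.
  by rewrite mulrDl; exact: n2_tri.
have N2N x : N2 (- x) = N2 x by rewrite !N2E; apply: eq_bigr => c _; rewrite mulNr n2N.
have e0 n : 0 < (n.+1%:R^-1 : R) by rewrite invr_gt0 ltr0n.
have e1 n : (n.+1%:R^-1 : R) <= 1 by rewrite invf_le1 ?ltr0n // ler1n.
have H1 n : exists w, D w /\ forall x, D x -> (g x (s - w)) ^+ 2 <= n.+1%:R^-1 * N2 x.
  have [|w Dw hw'] := @approx_riesz R A D g (g^~ s) (N2 s) D0 Dl gl gs N20 (fun (k : R) x y => gl k x y s) (N20 s) _ _ (e0 n).
    by move=> x _; rewrite mulrC; exact: gCS.
  by exists w; split=> // x Dx; rewrite gBr; exact: hw'.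
have [w hw'] := choice H1.
pose y n := s - w n.
have DB n m : D (w m - w n).
  by have := Dl (-1) (w n) (w m) (hw' n).1 (hw' m).1; rewrite rmorphN rmorph1 scaleN1r addrC.
have yw m n : y m - y n = w n - w m by rewrite /y opprB addrC addrA subrK.
have Cy m n : N2 (y m - y n) <= 2 * (m.+1%:R^-1 + n.+1%:R^-1).
  rewrite yw; set dd := N2 _.
  have ed : dd = g (w n - w m) (s - w m) - g (w n - w m) (s - w n).
    by rewrite -gBr (_ : s - w m - (s - w n) = w n - w m) // opprB addrC addrA subrK.
  have h1 := (hw' m).2 _ (DB m n); have h2 := (hw' n).2 _ (DB m n).
  have : dd ^+ 2 <= 2 * (m.+1%:R^-1 + n.+1%:R^-1) * dd.
    have := sqB_le (g (w n - w m) (s - w m)) (g (w n - w m) (s - w n)); rewrite -ed.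
    move: h1 h2; rewrite -/dd; clear ed; clearbody dd; move: (m.+1%:R^-1) (n.+1%:R^-1) dd (_ ^+ 2) (_ ^+ 2) => a b z t u; lra.
  have : 0 <= dd by exact: N20.
  rewrite le_eqVlt => /orP[/eqP <-|dd0]; last by rewrite expr2 ler_pM2r.
  by move=> _; rewrite mulr_ge0 // addr_ge0 // ltW.
have By n : N2 (y n) <= 2 * (N2 (y 0%N) + 4).
  have := N2D (y 0%N) (- (y 0%N - y n)); rewrite subKr N2N => h.
  apply: le_trans h _; rewrite ler_pM2l // lerD2l.
  by apply: le_trans (Cy _ _) _; have := e1 n; have := e1 0%N; move: (0.+1%:R^-1) (n.+1%:R^-1) => a b; lra.
set BB := 2 * _ in By.
have lim_small (r' : R) : 0 < r' -> exists N, forall n, (N <= n)%N -> (n.+1%:R^-1 : R) < r'.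
  move=> r1; exists (Num.truncn r'^-1) => n hn.
  apply: le_lt_trans (_ : (Num.truncn r'^-1).+1%:R^-1 < _).
    by rewrite lef_pV2 ?posrE ?ltr0n // ler_nat.
  by rewrite invf_plt ?posrE // truncnS_gt.
have Cc c n m : c \in cs -> n2 ph ((y n - y m) * c) <= N2 (y n - y m).
  move=> cin; rewrite N2E (big_rem c) //= lerDl; apply: sumr_ge0 => c' _; exact: n2_ge0.
have Bc c n : c \in cs -> n2 ph (y n * c) <= BB.
  move=> cin; apply: le_trans (By n); rewrite N2E (big_rem c) //= lerDl.
  by apply: sumr_ge0 => c' _; exact: n2_ge0.
(* The limit functional attached to one vector [c] is assembled by polarisation from four limits of
   positive functionals, each provided by [lim_pos]. *)
have Hth c : exists th, c \in cs -> [/\ lfun th, ndom (fun x => mod (th x)) &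
    forall x, flim U (fun n => ph (star (y n * c) * x * c)) (th x)].
  have [cin|/negP cnin] := boolP (c \in cs); last by exists (fun=> 0).
  have HP l : mod l = 1 -> exists psi, [/\ pfun psi, wcont psi &
      forall x, flim U (fun n => pol ph l (y n * c) c x) (psi x)].
    move=> l1; apply: (@lim_pos ph (fun n => c + l *: (y n * c)) (2 * (n2 ph c + BB))) => //.
      move=> n; apply: le_trans (n2_tri _ _ hph) _; rewrite ler_pM2l // lerD2l.
      rewrite /n2 starZ -scalerAl -scalerAr scalerA lfunZ //.
      by rewrite [l^* * l]mulrC -mod_sqr l1 expr1n rmorph1 mul1r; exact: (Bc c n cin).
    move=> r1 r10; have r14 : 0 < r1 / 4 by lra.
    have [N hN] := lim_small _ r14.
    exists N => m n hm hn.
    rewrite (_ : c + _ - _ = l *: ((y m - y n) * c)); last first.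
      by rewrite opprD addrACA subrr add0r -scalerBr -mulrBl.
    have -> : n2 ph (l *: ((y m - y n) * c)) = n2 ph ((y m - y n) * c).
      by rewrite /n2 starZ -scalerAl -scalerAr scalerA lfunZ // [l^* * l]mulrC -mod_sqr l1 expr1n rmorph1 mul1r.
    apply: le_trans (Cc c m n cin) _; apply: le_trans (Cy _ _) _.
    have := hN _ hm; have := hN _ hn; move: (m.+1%:R^-1) (n.+1%:R^-1) => a b; lra.
  have [|p1 [a1 b1 c1]] := HP 1; first exact: mod1.
  have [|p2 [a2 b2 c2]] := HP (-1); first by rewrite modN mod1.
  have [|p3 [a3 b3 c3]] := HP 'i; first exact: mod_i.
  have [|p4 [a4 b4 c4]] := HP (- 'i); first by rewrite modN mod_i.
  exists (fun x => 4^-1 * ((p1 x - p2 x) + 'i * (p3 x - p4 x))) => _; split.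
  - move=> k x z; case: a1 => -> _; case: a2 => -> _; case: a3 => -> _; case: a4 => -> _; ring.
  - have h := ndomD (ndomD (ndom_pos a1 b1) (ndom_pos a2 b2)) (ndomD (ndom_pos a3 b3) (ndom_pos a4 b4)).
    apply: ndom_le h _ => x; rewrite modM.
    have -> : mod 4^-1 = 4^-1 :> R.
      by rewrite -natC -fmorphV mod_real ger0_norm // invr_ge0.
    have := modD (p1 x - p2 x) ('i * (p3 x - p4 x)); rewrite modM mod_i mul1r.
    have := modD (p1 x) (- p2 x); have := modD (p3 x) (- p4 x); rewrite !modN.
    have := mod_ge0 (p1 x - p2 x + 'i * (p3 x - p4 x)); set t := mod (_ + 'i * _) => *.
    have := mod_ge0 (p1 x); have := mod_ge0 (p2 x); lra.
  - move=> x; have h := flimD uU (flimB uU (c1 x) (c2 x)) (flimZ uU 'i (flimB uU (c3 x) (c4 x))).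
    apply: (flim_ext uU _ (flimZ uU 4^-1 h)) => n.
    by rewrite -polarize // mulrA mulVf ?mul1r // pnatr_eq0.
have [th hth] := choice Hth.
pose TH x := \sum_(c <- cs) th c x.
have THlim x : flim U (fun n => G x (y n)) (TH x).
  have gen (l : seq A) : {subset l <= cs} ->
      flim U (fun n => \sum_(c <- l) ph (star (y n * c) * (x * c))) (\sum_(c <- l) th c x).
    elim: l => [|c l IH] hl'.
      by rewrite big_nil; apply: (flim_ext uU _ (flimC uU 0)) => n; rewrite big_nil.
    have [_ _ hc] := hth c (hl' c (mem_head _ _)).
    rewrite big_cons; apply: (flim_ext uU _ (flimD uU (hc x) (IH _))).
      by move=> n; rewrite big_cons mulrA.
    by move=> c' hc'; apply: hl'; rewrite inE hc' orbT.
  exact: gen.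
have THB x z : TH (x - z) = TH x - TH z.
  rewrite /TH !big_seq -sumrB; apply: eq_bigr => c cin.
  by have [hc _ _] := hth c cin; rewrite lfunB.
have THd : ndom (fun x => mod (TH x)).
  have gen (l : seq A) : {subset l <= cs} -> ndom (fun x => mod (\sum_(c <- l) th c x)).
    elim: l => [|c l IH] hl'; first by apply: ndom_le ndom0 _ => x; rewrite big_nil mod0.
    have [_ hc _] := hth c (hl' c (mem_head _ _)).
    apply: ndom_le (ndomD hc (IH _)) _; first by move=> c' hc'; apply: hl'; rewrite inE hc' orbT.
    by move=> x; rewrite big_cons; exact: modD.
  exact: gen.
have ReTH p : D p -> Re (TH p) = 0.
  move=> Dp; apply/eqP; rewrite -normr_eq0 eq_le normr_ge0 andbT leNgt; apply/negP => lt.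
  set t := `|_| in lt.
  have q0 : 0 < (t / 2) ^+ 2 / (N2 p + 1) by rewrite divr_gt0 ?exprn_gt0 //; have := N20 p; lra.
  have [N hN] := lim_small _ q0; have t2 : 0 < t / 2 by lra.
  have [n [/= h1 h2]] := uf_n0 uU (uf_I uU (THlim p _ t2) (U_cof N)).
  have h3 := (hw' n).2 _ Dp; have h4 := hN n h2.
  have : g p (y n) ^+ 2 < (t / 2) ^+ 2.
    apply: le_lt_trans h3 _; move: h4; rewrite ltr_pdivlMr; last by have := N20 p; lra.
    by move=> h4; apply: le_lt_trans h4; rewrite ler_wpM2l ?(ltW (e0 n)) // lerDl ler01.
  rewrite -[g p (y n) ^+ 2](real_normK (num_real _)) ltr_pXn2r ?nnegrE ?normr_ge0 //; last by lra.
  have := Re_le_mod (G p (y n) - TH p); rewrite ReD ReN -/(g p (y n)) => h5 h6.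
  have := lerB_dist (Re (TH p)) (g p (y n)); rewrite distrC -/t; lra.
(* Here closure is used: [s] is approximated by elements of D in the seminorm |TH|, which is
   dominated by normal states. *)
have ReTHs : Re (TH s) = 0.
  apply/eqP; rewrite -normr_eq0 eq_le normr_ge0 andbT leNgt; apply/negP => lt.
  have [p Dp hp'] := cl_ndom hs THd lt.
  have := Re_le_mod (TH (s - p)); rewrite THB ReD ReN (ReTH p Dp) subr0 -THB; lra.
have q0 : 0 < (r / 2) ^+ 2 / (2 * (N2 s + BB) + 1).
  by rewrite divr_gt0 ?exprn_gt0 //; have := N20 s; have := le_trans (N20 _) (By 0%N); lra.
have [N hN] := lim_small _ q0; have r2 : 0 < r / 2 by lra.
have [n [/= h1 h2]] := uf_n0 uU (uf_I uU (THlim s _ r2) (U_cof N)).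
exists (w n); first by case: (hw' n).
rewrite -N2E -/(y n).
have -> : N2 (y n) = g s (y n) - g (w n) (y n) by rewrite -gB.
have h3 : `|g s (y n)| < r / 2.
  apply: le_lt_trans h1; have := Re_le_mod (G s (y n) - TH s).
  by rewrite ReD ReN ReTHs subr0.
have h4 : `|g (w n) (y n)| < r / 2.
  rewrite -(@ltr_pXn2r _ 2) ?nnegrE ?normr_ge0 //; last by lra.
  rewrite real_normK ?num_real //; apply: le_lt_trans ((hw' n).2 _ (hw' n).1) _.
  have := hN n h2; rewrite ltr_pdivlMr; last by have := N20 s; have := le_trans (N20 _) (By 0%N); lra.
  move=> h5; apply: le_lt_trans h5; rewrite ler_wpM2l ?(ltW (e0 n)) //.
  have := N2D s (- y n); rewrite N2N /y subKr => h6; have := By n; rewrite /y; lra.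
have := ler_norm (g s (y n)); have := ler_norm (- g (w n) (y n)); rewrite normrN; lra.
Qed.

End Limits.

Implicit Types (v : A).

Definition ncl D a := forall r : R, 0 < r -> exists2 b, D b & cnorm (a - b) < r.

Lemma ncl_sub D : D `<=` ncl D.
Proof. by move=> a Da r r0; exists a => //; rewrite subrr cnorm0. Qed.

Lemma ncl_closed D : norm_closed (ncl D).
Proof.
move=> a h r r0; have r2 : 0 < r / 2 by lra.
have [b hb ab] := h _ r2; have [c Dc bc] := hb _ r2; exists c => //.
by apply: le_lt_trans (cnorm_triB _ b _) _; lra.
Qed.

Lemma cnormZm (k : R[i]) a : cnorm (k *: a) = mod k * cnorm a.
Proof. by have := cnormZ k a; rewrite modE -rmorphM /= => /complexI. Qed.

Lemma ncl_subalgebra D : star_subalgebra D -> star_subalgebra (ncl D).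
Proof.
move=> [D0 Dl DM DS]; split.
- exact: ncl_sub.
- move=> k a b ha hb r r0; have k0 := mod_ge0 k.
  have r1 : 0 < r / (2 * (mod k + 1)) by rewrite divr_gt0 //; lra.
  have r2 : 0 < r / 2 by lra.
  have [a' Da aa] := ha _ r1; have [b' Db bb] := hb _ r2.
  exists (k *: a' + b'); first exact: Dl.
  rewrite opprD addrACA -scalerBr; apply: le_lt_trans (cnormD _ _) _.
  rewrite cnormZm; move: aa bb; rewrite !ltr_pdivlMr //; last by lra.
  by have := cnorm_ge0 (a - a'); nra.
- move=> a b ha hb r r0; have a0 := cnorm_ge0 a; have b0 := cnorm_ge0 b.
  pose M := cnorm a + cnorm b + 1; have M0 : 0 < M by rewrite /M; lra.
  have r1 : 0 < Num.min 1 (r / (2 * M)).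
    by rewrite lt_min ltr01 divr_gt0 // mulr_gt0.
  have [a' Da] := ha _ r1; have [b' Db] := hb _ r1.
  rewrite !lt_min => /andP[bb bb'] /andP[aa aa'].
  exists (a' * b'); first exact: DM.
  have -> : a * b - a' * b' = (a - a') * b + a' * (b - b') by ncring_in R[i] A.
  apply: le_lt_trans (cnormD _ _) _.
  have := cnormM (a - a') b; have := cnormM a' (b - b').
  have := cnormB a (a - a'); rewrite subKr; move: aa' bb'; rewrite !ltr_pdivlMr ?mulr_gt0 //.
  have := cnorm_ge0 (a - a'); have := cnorm_ge0 (b - b').
  rewrite /M; set u := cnorm (a - a') in aa *; set t := cnorm (b - b') in bb *.
  move: (cnorm ((a - a') * b)) (cnorm (a' * (b - b'))) (cnorm a') => X Y Z.
  move=> t0 u0 h1 h2 h3 h4 h5.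
  have : Z * t <= (cnorm a + 1) * t by rewrite ler_wpM2r //; lra.
  have : 0 <= u * cnorm a by exact: mulr_ge0.
  have : 0 <= t * cnorm b by exact: mulr_ge0.
  by move: (cnorm a) (cnorm b) a0 b0 h1 h2 h4 h5 => na nb *; nra.
- move=> a ha r r0; have [b Db ab] := ha r r0.
  by exists (star b); [exact: DS|rewrite -starB cnormS].
Qed.

(* [a = 2 s w] with [w = (1 + s ^ 2)^-1]; the functional calculus is replaced by explicit
   square roots. *)
Lemma cayley a : star a = a -> cnorm a <= 1 ->
  exists s w, [/\ star s = s, (1 + s * s) * w = 1, s * w = w * s & 2%:R *: (s * w) = a].
Proof.
move=> sa a1.
have [|r [sr rr r1 cr]] := @csqrt _ _ (a * a) _ (cnorm_sqr_le1 a1); first by rewrite starM sa.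
have ra : r * a = a * r by apply/esym/cr; rewrite mulrA.
have [|q [sq qq _ cq]] := @csqrt _ _ (1 - r) _ r1; first by rewrite starB star1 sr.
have qr : q * q = r by rewrite qq subKr.
have [v [v1 sv _ cv _]] := inv1p sq; rewrite qr in v1.
have comq z : z * r = r * z -> z * q = q * z.
  by move=> h; apply: cq; rewrite mulrBr mulrBl mulr1 mul1r h.
have va : a * v = v * a by apply/cv/comq; rewrite ra.
have vr : r * v = v * r by apply/cv/comq.
pose w := (2^-1 : R)%:C *: (1 + r).
have h2 : (2%:R : R[i]) * (2^-1 : R)%:C = 1.
  by rewrite -natC -rmorphM /= mulfV // pnatr_eq0.
have ss : (a * v) * (a * v) = (1 - r) * v.
  have -> : a * v * (a * v) = (a * a) * (v * v).
    by rewrite mulrA -(mulrA a v a) -va !mulrA.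
  have -> : a * a = 1 - r * r by rewrite rr subKr.
  have -> : 1 - r * r = (1 - r) * (1 + r) by ncring_in R[i] A.
  by rewrite -mulrA (mulrA (1 + r)) v1 mul1r.
have e1 : 1 + (1 - r) * v = v + v.
  by transitivity ((1 + r) * v + (1 - r) * v); [rewrite v1|ncring_in R[i] A].
exists (a * v), w; split.
- by rewrite starM sv sa va.
- rewrite ss e1 /w -scalerAr mulrDl; have -> : v * (1 + r) = 1.
    by rewrite mulrDr mulr1 -vr -v1 mulrDl mul1r.
  by rewrite halfD.
- rewrite /w -scalerAr -scalerAl; congr (_ *: _).
  rewrite mulrDr mulrDl mulr1 mul1r; congr (_ + _).
  by rewrite -mulrA -vr !mulrA ra.
- rewrite /w -scalerAr scalerA h2 scale1r -mulrA (_ : v * (1 + r) = 1) ?mulr1 //.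
  by rewrite mulrDr mulr1 -vr -v1 mulrDl mul1r.
Qed.

Definition sa_part D := [set p | D p /\ star p = p].

Lemma cl_sa D s : star_subalgebra D -> cl D s -> star s = s -> cl (sa_part D) s.
Proof.
move=> [D0 Dl DM DS] hs ss m psi e hp e0; have [b Db hb] := hs m psi e hp e0.
have D2 x y : D x -> D y -> D (x + y) by move=> Dx Dy; have := Dl 1 x y Dx Dy; rewrite scale1r.
exists ((2^-1 : R)%:C *: (b + star b)).
  split; last by rewrite starZr starD starK addrC.
  by have := Dl (2^-1 : R)%:C (b + star b) 0 (D2 _ _ Db (DS _ Db)) D0; rewrite addr0.
move=> i; rewrite modE ltcR; have := hb i; rewrite modE ltcR => h.
have hpf : pfun (psi i) by have [[_ h1] _] := hp i; split=> // k x y; rewrite linearP.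
have -> : s - (2^-1 : R)%:C *: (b + star b) = (2^-1 : R)%:C *: ((s - b) + star (s - b)).
  by rewrite starB ss -[X in X - _]halfD -scalerBr; congr (_ *: _); ncring_in R[i] A.
have hl := hpf.1.
rewrite lfunZ // lfunD // pf_star // modM mod_real ger0_norm ?invr_ge0 //.
apply: le_lt_trans (_ : 2^-1 * (mod (psi i (s - b)) + mod (psi i (s - b))) < _).
  by rewrite ler_wpM2l ?invr_ge0 //; have := modD (psi i (s - b)) (psi i (s - b))^*; rewrite mod_conj.
lra.
Qed.

(** Write a = 2 s / (1 + s^2). A selfadjoint p in D close to s strongly, but with no bound on its
    norm, yields the contraction f = 2 p / (1 + p^2) close to a. As f lies only in the norm closure
    of D, it is replaced by a nearby element of D, and the bound becomes 2. *)
Lemma kaplansky_sa ph D a (cs : seq A) (r : R) : pfun ph -> wcont ph ->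
  star_subalgebra D -> D 1 -> (forall s, cl D s) -> star a = a -> cnorm a <= 1 -> 0 < r ->
  exists p, [/\ D p, cnorm p <= 2 & \sum_(c <- cs) n2 ph ((a - p) * c) < r].
Proof.
move=> hph hw hD D1 hcl sa a1 r0; have [D0 Dl DM DS] := hD.
have [s [w [ss sw csw aE]]] := cayley sa a1.
have [U uU Ucof] := nat_uf.
have r8 : 0 < r / 32 by lra.
(* The test vectors come from the identity a - f = 2 v (s - p) w - v p (s - p) a, with v = 1 / (1 +
   p^2) and w = 1 / (1 + s^2), used in [key] below. *)
have [||p [Dp sp] hp] := @strong_dense U uU Ucof ph (sa_part D) s hph hw _ _
  (cl_sa hD (hcl s) ss) ([seq w * c | c <- cs] ++ [seq a * c | c <- cs]) _ r8.
- by split; rewrite ?star0.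
- by move=> k x y [Dx sx] [Dy sy]; split; [exact: Dl|rewrite starD starZr sx sy].
have [v [v1 sv nv cv hv]] := inv1p sp.
have pv : p * v = v * p by exact: cv.
have v1' : v * (1 + p * p) = 1 by rewrite mulrDr mulr1 mulrA -pv -mulrA -pv mulrA -{1}(mul1r v) -mulrDl.
have c2 : star ((2%:R : R[i]) *: (1 : A)) = 2%:R *: 1 by rewrite starZ star1 rmorph_nat.
have c2c (x : A) : (2%:R : R[i]) *: x = (2 : R)%:C *: x by rewrite natC.
pose f := (2 : R)%:C *: (p * v).
have sf : star f = f by rewrite /f starZr starM sv sp pv.
(* f and g are the sine and cosine of a Cayley transform: f^2 + g^2 = 1, so that [sq_norm] bounds
   f. *)
pose g := (1 - p * p) * v.
have ppv : p * p * v = v * (p * p) by rewrite mulrA -pv -!mulrA pv.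
have sg : star g = g.
  by rewrite /g starM sv starB star1 starM sp mulrBr mulrBl mulr1 mul1r ppv.
have fg : f * g = g * f.
  have pg : p * g = g * p.
    by rewrite /g -mulrA -pv !mulrA; congr (_ * _); ncring_in R[i] A.
  have vg : v * g = g * v.
    by rewrite /g mulrA; congr (_ * _); rewrite mulrBr mulrBl mulr1 mul1r ppv.
  by rewrite /f -scalerAl -scalerAr; congr (_ *: _); rewrite -mulrA vg mulrA pg mulrA.
have nf : cnorm f <= 1.
  apply: (sq_norm sf sg fg ler01); rewrite expr1n scale1r.
  have e1 : (1 - p * p) * v = v * (1 - p * p) by rewrite mulrBr mulrBl mulr1 mul1r ppv.
  have -> : g * g = v * ((1 - p * p) * (1 - p * p)) * v by rewrite /g {1}e1 !mulrA.
  have -> : f * f = v * ((2 : R)%:C *: ((2 : R)%:C *: (p * p))) * v.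
    by rewrite /f {1}pv -scalerAl -scalerAr -!scalerAr -!scalerAl !mulrA.
  rewrite -mulrDl -mulrDr -!c2c.
  have -> : 2%:R *: (2%:R *: (p * p)) + (1 - p * p) * (1 - p * p) = (1 + p * p) * (1 + p * p).
    by rewrite !scaler_nat ?mulr2n; ncring_in R[i] A.
  by rewrite mulrA v1' mul1r v1.
have nvp : cnorm (v * p) <= 1.
  move: nf; rewrite /f cnormZr pv ger0_norm //; have := cnorm_ge0 (v * p); lra.
have hf : ncl D f.
  have [E0 El EM ES] := ncl_subalgebra hD.
  have vD := hv _ (ncl_subalgebra hD) (@ncl_closed D) (ncl_sub D1) (ncl_sub Dp).
  by have := El (2 : R)%:C (p * v) 0 (EM _ _ (ncl_sub Dp) vD) E0; rewrite addr0.
have key c : n2 ph ((a - f) * c) <= 8 * (n2 ph ((s - p) * (w * c)) + n2 ph ((s - p) * (a * c))).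
  have -> : (a - f) * c = (2 : R)%:C *: (v * ((s - p) * (w * c))) + - (v * p * ((s - p) * (a * c))).
    rewrite -aE -!c2c.
    have E1 : s * w - p * v = v * ((s - p) * w) - v * p * ((s - p) * (s * w)).
      transitivity (v * (1 + p * p) * (s * w) - v * p * ((1 + s * s) * w)).
        by rewrite v1' mul1r sw mulr1 pv.
      ncring_in R[i] A.
    rewrite /f -!c2c -scalerBr E1 !scaler_nat ?mulr2n; ncring_in R[i] A.
  apply: le_trans (n2_tri _ _ hph) _; rewrite n2N.
  have : n2 ph ((2 : R)%:C *: (v * ((s - p) * (w * c)))) <= 4 * n2 ph ((s - p) * (w * c)).
    rewrite scalerAl; apply: le_trans (pf_bound _ _ hph) _.
    rewrite ler_wpM2r ?n2_ge0 // cnormZr ger0_norm //.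
    have := cnorm_ge0 v; nra.
  have : n2 ph (v * p * ((s - p) * (a * c))) <= n2 ph ((s - p) * (a * c)).
    apply: le_trans (pf_bound _ _ hph) _; rewrite ler_piMl ?n2_ge0 //.
    have := cnorm_ge0 (v * p); nra.
  have := n2_ge0 ((s - p) * (w * c)) hph; have := n2_ge0 ((s - p) * (a * c)) hph; lra.
pose S := \sum_(c <- cs) n2 ph c.
have S0 : 0 <= S by apply: sumr_ge0 => c _; exact: n2_ge0.
have d0 : 0 < Num.min 1 (r / (8 * (S + 1))).
  by rewrite lt_min ltr01 divr_gt0 // mulr_gt0 //; lra.
have [b Db] := hf _ d0; rewrite lt_min => /andP[fb1 fb2].
exists b; split=> //.
  by have := cnormB f (f - b); rewrite subKr; lra.
have hb c : n2 ph ((a - b) * c) <= 16 * (n2 ph ((s - p) * (w * c)) + n2 ph ((s - p) * (a * c))) +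
   2 * (cnorm (f - b) * n2 ph c).
  have -> : (a - b) * c = (a - f) * c + (f - b) * c by ncring_in R[i] A.
  apply: le_trans (n2_tri _ _ hph) _.
  have := key c; have := pf_bound c (f - b) hph; have := n2_ge0 c hph; have := cnorm_ge0 (f - b).
  move: (n2 ph ((a - f) * c)) (n2 ph ((f - b) * c)) (n2 ph c) (cnorm (f - b)) fb1 => X Y Z W W1 W0 Z0 h1 h2.
  have : W ^+ 2 * Z <= W * Z by rewrite ler_wpM2r // expr2 ler_piMl // ltW.
  lra.
apply: le_lt_trans (ler_sum _ (fun c _ => hb c)) _.
rewrite big_split /= -!mulr_sumr big_split /=.
move: hp; rewrite big_cat !big_map /= => hp.
have : cnorm (f - b) * S <= r / 8.
  move: fb2; rewrite ltr_pdivlMr; last by rewrite mulr_gt0 //; lra.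
  have := cnorm_ge0 (f - b); nra.
rewrite -/S; lra.
Qed.

(** Real and imaginary parts are scaled by K = |a| + 1 to contractions; each approximant has norm at
    most 2, whence 4 K. *)
Lemma kaplansky ph D a (cs : seq A) (r : R) : pfun ph -> wcont ph ->
  star_subalgebra D -> D 1 -> (forall s, cl D s) -> 0 < r ->
  exists p, [/\ D p, cnorm p <= 4 * (cnorm a + 1) & \sum_(c <- cs) n2 ph ((a - p) * c) < r].
Proof.
move=> hph hw hD D1 hcl r0; have [D0 Dl DM DS] := hD.
have a0 := cnorm_ge0 a; pose K := cnorm a + 1; have K0 : 0 < K by rewrite /K; lra.
pose h := (K^-1 / 2)%:C; have Kn : 0 <= K^-1 / 2 by rewrite divr_ge0 // invr_ge0 ltW.
pose a1 := h *: (a + star a); pose a2 := h *: ('i *: (star a - a)).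
have hK : K%:C * h = (2^-1 : R)%:C.
  by rewrite /h -rmorphM mulrA mulfV ?mul1r // gt_eqF.
have aE : a = K%:C *: a1 + ('i * K%:C) *: a2.
  have e2 : 'i * K%:C * h * 'i = - (2^-1 : R)%:C.
    have -> : 'i * K%:C * h * 'i = K%:C * h * ('i * 'i) by ring.
    by rewrite hK -expr2 sqrCi mulrN1.
  rewrite /a1 /a2 !scalerA hK e2 scaleNr -scalerN opprB -scalerDr addrACA subrr addr0.
  by rewrite halfD.
have na1 : cnorm a1 <= 1.
  rewrite cnormZr ger0_norm // mulrAC ler_pdivrMr // ler_pdivrMl // mul1r.
  by apply: le_trans (cnormD _ _) _; rewrite cnormS /K; lra.
have na2 : cnorm a2 <= 1.
  rewrite cnormZr ger0_norm // mulrAC ler_pdivrMr // ler_pdivrMl // mul1r cnormZm.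
  rewrite (_ : mod 'i = 1) ?mul1r; last by rewrite /mod; have -> : `|'i| = 1 :> R[i] by exact: normCi.
  by apply: le_trans (cnormB _ _) _; rewrite cnormS /K; lra.
have sa1 : star a1 = a1 by rewrite starZr starD starK addrC.
have sa2 : star a2 = a2 by rewrite starZr starZ starB starK conjCi scaleNr -scalerN opprB.
have r4 : 0 < r / (4 * K ^+ 2) by rewrite divr_gt0 // mulr_gt0 // exprn_gt0.
have [p1 [Dp1 n1 h1]] := kaplansky_sa cs hph hw hD D1 hcl sa1 na1 r4.
have [p2 [Dp2 n2' h2]] := kaplansky_sa cs hph hw hD D1 hcl sa2 na2 r4.
exists (K%:C *: p1 + ('i * K%:C) *: p2); split.
- by apply: (Dl) => //; have := Dl ('i * K%:C) p2 0 Dp2 D0; rewrite addr0.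
- apply: le_trans (cnormD _ _) _; rewrite !cnormZm modM mod_i mul1r mod_real ger0_norm ?(ltW K0) //.
  by rewrite -/K; nra.
have E c : n2 ph ((a - (K%:C *: p1 + ('i * K%:C) *: p2)) * c) <=
    2 * K ^+ 2 * (n2 ph ((a1 - p1) * c) + n2 ph ((a2 - p2) * c)).
  have -> : (a - (K%:C *: p1 + ('i * K%:C) *: p2)) * c =
      K%:C *: ((a1 - p1) * c) + ('i * K%:C) *: ((a2 - p2) * c).
    by rewrite {1}aE opprD addrACA -!scalerBr mulrDl -!scalerAl.
  apply: le_trans (n2_tri _ _ hph) _.
  have nZ (k : R[i]) x : n2 ph (k *: x) = mod k ^+ 2 * n2 ph x.
    by rewrite /n2 starZ -scalerAl -scalerAr scalerA [k^* * k]mulrC -mod_sqr (lfunZ _ _ hph.1) ReZ.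
  by rewrite !nZ modM mod_i mul1r mod_real ger0_norm ?(ltW K0) // -mulrDr mulrA.
apply: le_lt_trans (ler_sum _ (fun c _ => E c)) _.
rewrite -mulr_sumr big_split /=; move: h1 h2; rewrite !ltr_pdivlMr ?mulr_gt0 ?exprn_gt0 //.
move: (K ^+ 2) => k; lra.
Qed.

End Representation.

(** * Words in the variables and the coaction on them *)

Section Words.
Variables (R : realType) (A : cstarType R) (x : nat -> A).
Hypothesis hx : forall i, star (x i) = x i.
Implicit Types (a b c y : A) (w v : seq nat) (p : pred (seq nat)).

Definition X w : A := \prod_(i <- w) x i.

Lemma X_nil : X [::] = 1.
Proof. by rewrite /X big_nil. Qed.

Lemma X_cons i w : X (i :: w) = x i * X w.
Proof. by rewrite /X big_cons. Qed.

Lemma X_cat w v : X (w ++ v) = X w * X v.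
Proof. by rewrite /X big_cat. Qed.

Lemma X1 i : X [:: i] = x i.
Proof. by rewrite X_cons X_nil mulr1. Qed.

Lemma star_X w : star (X w) = X (rev w).
Proof.
elim: w => [|i w IH]; first by rewrite X_nil star1.
by rewrite X_cons starM IH hx rev_cons -cats1 X_cat X1.
Qed.

(** Polynomials are kept as lists of weighted words, because renaming letters is defined on
    expressions and not on elements of A. *)
Definition ev (P : seq (R[i] * seq nat)) : A := \sum_(q <- P) q.1 *: X q.2.

Definition span_w p a := exists2 P : seq (R[i] * seq nat), all (fun q => p q.2) P & a = ev P.

Lemma ev_nil : ev [::] = 0.
Proof. by rewrite /ev big_nil. Qed.

Lemma ev_cons q P : ev (q :: P) = q.1 *: X q.2 + ev P.
Proof. by rewrite /ev big_cons. Qed.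

Lemma ev_cat P Q : ev (P ++ Q) = ev P + ev Q.
Proof. by rewrite /ev big_cat. Qed.

Lemma span_wX p w : p w -> span_w p (X w).
Proof.
by move=> pw; exists [:: (1, w)]; rewrite /= ?pw // ev_cons ev_nil addr0 scale1r.
Qed.

Lemma span_w0 p : span_w p 0.
Proof. by exists [::]; rewrite ?ev_nil. Qed.

Lemma span_wP p (c : R[i]) a b : span_w p a -> span_w p b -> span_w p (c *: a + b).
Proof.
move=> [P hP ->] [Q hQ ->]; exists ([seq (c * q.1, q.2) | q <- P] ++ Q).
  by rewrite all_cat all_map hQ andbT.
by rewrite ev_cat /ev big_map scaler_sumr; congr (_ + _); apply: eq_bigr => q _; rewrite scalerA.
Qed.

Lemma span_w_ind p (D : set A) : D 0 -> (forall (c : R[i]) a b, D a -> D b -> D (c *: a + b)) ->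
  (forall w, p w -> D (X w)) -> span_w p `<=` D.
Proof.
move=> D0 Dl h a [P hP ->]; elim: P hP => [|q P IH]; first by rewrite ev_nil.
by move=> /= /andP[hq hP]; rewrite ev_cons; apply: Dl; [exact: h|exact: IH].
Qed.

Lemma span_w_subalgebra p : (forall w v, p w -> p v -> p (w ++ v)) -> (forall w, p w -> p (rev w)) ->
  star_subalgebra (span_w p).
Proof.
move=> hM hS; split; [exact: span_w0|move=> *; exact: span_wP| |].
- move=> a b ha hb.
  apply: (span_w_ind (D := fun a => span_w p (a * b))) ha.
  + by rewrite mul0r; exact: span_w0.
  + by move=> c a1 a2 h1 h2; rewrite mulrDl -scalerAl; exact: span_wP.
  move=> w pw; apply: (span_w_ind (D := fun b => span_w p (X w * b))) hb.
  + by rewrite mulr0; exact: span_w0.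
  + by move=> c a1 a2 h1 h2; rewrite mulrDr -scalerAr; exact: span_wP.
  by move=> v pv; rewrite -X_cat; apply/span_wX/hM.
- move=> a; apply: (span_w_ind (D := fun a => span_w p (star a))).
  + by rewrite star0; exact: span_w0.
  + by move=> c a1 a2 h1 h2; rewrite starD starZ; exact: span_wP.
  by move=> w pw; rewrite star_X; apply/span_wX/hS.
Qed.

Definition far n w := all (leq n) w.
(** These algebras decrease with n; the intersection of their sigma-weak closures is the tail
    algebra. *)
Definition alg n := span_w (far n).

Lemma alg_subalgebra n : star_subalgebra (alg n).
Proof.
apply: span_w_subalgebra => [w v hw hv|w hw]; first by rewrite /far all_cat; apply/andP.
by rewrite /far all_rev.
Qed.

Lemma alg1 n : alg n 1.
Proof. by rewrite -X_nil; exact: span_wX. Qed.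

End Words.

Section Tokens.
Variables (R : realType) (A : cstarType R) (x : nat -> A).
Variables (Q : cstarType R) (n : nat) (u : 'I_n -> 'I_n -> Q).
Implicit Types (a b c y : A) (L : A -> Q) (t : seq ('I_n + A)).

(** The functional L applied, in the A-leg, to the image under x_i |-> sum_k x_k (x) u_(k i) of a
    product of letters and coefficients. Coefficients are fixed and only move into L. *)
Fixpoint Phi L t : Q :=
  match t with
  | [::] => L 1
  | inl i :: t' => \sum_k u k i * Phi (fun y => L (x k * y)) t'
  | inr b :: t' => Phi (fun y => L (b * y)) t'
  end.

Definition evt t : A := \prod_(s <- t) match s with inl i => x i | inr b => b end.

Lemma evt_cons s t : evt (s :: t) = match s with inl i => x i | inr b => b end * evt t.
Proof. by rewrite /evt big_cons. Qed.

Lemma evt_cat t1 t2 : evt (t1 ++ t2) = evt t1 * evt t2.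
Proof. by rewrite /evt big_cat. Qed.

Lemma Phi_ext L L' t : L =1 L' -> Phi L t = Phi L' t.
Proof.
elim: t L L' => [|[i|b] t IH] L L' h /=; first exact: h.
  by apply: eq_bigr => k _; congr (_ * _); apply: IH => y; exact: h.
by apply: IH => y; exact: h.
Qed.

Lemma Phi_lin (k : R[i]) L L' t :
  Phi (fun y => k *: L y + L' y) t = k *: Phi L t + Phi L' t.
Proof.
elim: t L L' => [|[i|b] t IH] L L' //=.
rewrite scaler_sumr -big_split; apply: eq_bigr => j _ /=.
by rewrite IH mulrDr -scalerAr.
Qed.

(** Letters beyond [n] become coefficients: the extension of the matrix by an identity block fixes
    them. *)
Definition tok_word (w : seq nat) : seq ('I_n + A) :=
  [seq if insub i is Some j then inl j else inr (x i) | i <- w].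

Lemma evt_tok w : evt (tok_word w) = X x w.
Proof.
elim: w => [|i w IH]; first by rewrite /evt X_nil big_nil.
rewrite /= evt_cons IH X_cons; case: insubP => [j _ <-|] //.
Qed.

Lemma Phi_expand L (f : seq ('I_n + (seq nat))) :
  (forall w, inr w \in f -> far n w) ->
  Phi L (flatten [seq match s with inl i => [:: inl i] | inr w => tok_word w end | s <- f]) =
  Phi L [seq match s with inl i => inl i | inr w => inr (X x w) end | s <- f].
Proof.
elim: f L => [|[i|w] f IH] L hf //=.
  by apply: eq_bigr => k _; rewrite IH // => w hw; apply: hf; rewrite inE hw orbT.
have hw : far n w by apply: hf; rewrite inE eqxx.
have IH' L' := IH L' (fun v hv => hf v (@mem_behead _ (_ :: _) _ hv)).
elim: w L hw {hf} => [|i w IHw] L /=.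
  by move=> _; rewrite IH'; apply: Phi_ext => y; rewrite X_nil mul1r.
move=> /andP[ni hw]; case: insubP => [j ji _|_] /=; first by rewrite ltnNge ni in ji.
by rewrite IHw //; apply: Phi_ext => y; rewrite X_cons mulrA.
Qed.

End Tokens.

(** * Invariance with operator coefficients *)

Section CoefInv.
Variables (R : realType) (A : cstarType R) (H : hilbertType R) (ro : A -> H -> H).
Hypothesis ro_f : faithful_rep ro.
Hypothesis ro_bic : bicommutant ro.
Variables (x : nat -> A) (phi : A -> R[i]).
Hypothesis hphi : pfun phi.
Hypothesis wphi : wcont ro phi.
Variables (Q : cstarType R) (n : nat) (u : 'I_n -> 'I_n -> Q) (P : Q).
Implicit Types (a b c y : A) (L : A -> Q) (t : seq ('I_n + A)).
Local Notation Phi := (Phi x u).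
Local Notation evt := (evt x (n := n)).

Definition inv t := Phi (fun y => phi y *: P) t = phi (evt t) *: P.

Definition inv_words := forall w, inv (tok_word x n w).

Lemma Phi_coef_lin L t1 t2 (k : R[i]) b b' :
  (forall (k : R[i]) y y', L (k *: y + y') = k *: L y + L y') ->
  Phi L (t1 ++ inr (k *: b + b') :: t2) =
  k *: Phi L (t1 ++ inr b :: t2) + Phi L (t1 ++ inr b' :: t2).
Proof.
elim: t1 L => [|[i|c] t1 IH] L hL /=.
- by rewrite -Phi_lin; apply: Phi_ext => y; rewrite mulrDl -scalerAl hL.
- rewrite scaler_sumr -big_split; apply: eq_bigr => j _ /=.
  rewrite IH ?mulrDr -?scalerAr // => k' y y'.
  by rewrite mulrDr -scalerAr hL.
- by apply: IH => k' y y'; rewrite mulrDr -scalerAr hL.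
Qed.

Lemma Phi_ndom2 t2 c d : ndom (fun b => cnorm (Phi (fun y => phi (c * b * (d * y)) *: P) t2)).
Proof.
elim: t2 d => [|[i|b'] t2 IH] d /=.
- have h := ndomZ (cnorm_ge0 P) (ndom_pol ro_f ro_bic c (d * 1) hphi wphi).
  by apply: ndom_le h _ => b; rewrite cnormZm mulrC.
- have h := @ndom_sum _ A _ (index_enum 'I_n) _ (fun k => ndomZ (cnorm_ge0 (u k i)) (IH (d * x k))).
  apply: ndom_le h _ => b; elim/big_ind2: _ => [|y1 z1 y2 z2 h1 h2|k _]; first by rewrite cnorm0.
    exact: le_trans (cnormD _ _) (lerD h1 h2).
  apply: le_trans (cnormM _ _) _; rewrite ler_wpM2l ?cnorm_ge0 //.
  by rewrite (@Phi_ext _ _ _ _ _ _ _ (fun y => phi (c * b * (d * x k * y)) *: P)) // => y; rewrite !mulrA.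
- apply: ndom_le (IH (d * b')) _ => b.
  by rewrite (@Phi_ext _ _ _ _ _ _ _ (fun y => phi (c * b * (d * b' * y)) *: P)) // => y; rewrite !mulrA.
Qed.

(** After expansion the coefficient [b] occurs only inside functionals [phi (c * b * d)], which are
    dominated by normal states; [Phi_ndom2] treats the tokens to the right of [b], this lemma those
    to its left. *)
Lemma Phi_ndom t1 t2 c : ndom (fun b => cnorm (Phi (fun y => phi (c * y) *: P) (t1 ++ inr b :: t2))).
Proof.
elim: t1 c => [|[i|b'] t1 IH] c /=.
- apply: ndom_le (Phi_ndom2 t2 c 1) _ => b.
  by rewrite (@Phi_ext _ _ _ _ _ _ _ (fun y => phi (c * b * (1 * y)) *: P)) // => y; rewrite mul1r mulrA.
- have h := @ndom_sum _ A _ (index_enum 'I_n) _ (fun k => ndomZ (cnorm_ge0 (u k i)) (IH (c * x k))).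
  apply: ndom_le h _ => b; elim/big_ind2: _ => [|y1 z1 y2 z2 h1 h2|k _]; first by rewrite cnorm0.
    exact: le_trans (cnormD _ _) (lerD h1 h2).
  apply: le_trans (cnormM _ _) _; rewrite ler_wpM2l ?cnorm_ge0 //.
  by rewrite (@Phi_ext _ _ _ _ _ _ _ (fun y => phi (c * x k * y) *: P)) // => y; rewrite !mulrA.
- apply: ndom_le (IH (c * b')) _ => b.
  by rewrite (@Phi_ext _ _ _ _ _ _ _ (fun y => phi (c * b' * y) *: P)) // => y; rewrite !mulrA.
Qed.

Lemma phiP_lin (k : R[i]) y y' : phi (k *: y + y') *: P = k *: (phi y *: P) + phi y' *: P.
Proof. by rewrite hphi.1 scalerDl scalerA. Qed.

Lemma inv_cl (S : set A) t1 t2 b : S 0 -> (forall (k : R[i]) a b, S a -> S b -> S (k *: a + b)) ->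
  (forall a, S a -> inv (t1 ++ inr a :: t2)) -> cl S b -> inv (t1 ++ inr b :: t2).
Proof.
move=> S0 Sl hS hb.
pose D b := Phi (fun y => phi y *: P) (t1 ++ inr b :: t2) - phi (evt (t1 ++ inr b :: t2)) *: P.
have DB a c : D (a - c) = D a - D c.
  rewrite /D -[a - c]addrC -scaleN1r Phi_coef_lin; last exact: phiP_lin.
  rewrite !evt_cat !evt_cons mulrDl mulrDr -scalerAl -scalerAr phiP_lin !scaleN1r opprD opprK addrACA.
  by rewrite addrC; congr (_ + _); rewrite opprB addrC.
have Dn : ndom (fun b => cnorm (D b)).
  have h1 := Phi_ndom t1 t2 1.
  have h2 := ndomZ (cnorm_ge0 P) (ndom_pol ro_f ro_bic (evt t1) (evt t2) hphi wphi).
  apply: ndom_le (ndomD h1 h2) _ => a; apply: le_trans (cnormB _ _) _; apply: lerD.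
    by rewrite (@Phi_ext _ _ _ _ _ _ _ (fun y => phi (1 * y) *: P)) // => y; rewrite mul1r.
  by rewrite cnormZm mulrC evt_cat evt_cons mulrA.
apply/eqP; rewrite -subr_eq0 -/(D b); apply/eqP/cnorm_small => r r0.
have [a Sa] := cl_ndom hb Dn r0; rewrite DB.
have -> : D a = 0 by rewrite /D hS // subrr.
by rewrite subr0.
Qed.

(** A word in letters beyond [n] is fixed by the coaction, so it may serve as a coefficient. The
    defect of invariance is linear and sigma-weakly continuous in each coefficient, hence vanishes
    on closures. *)
Lemma inv_coef : inv_words -> forall t,
  (forall t1 b t2, t = t1 ++ inr b :: t2 -> cl (alg x n) b) -> inv t.
Proof.
move=> hw.
have h1 (f : seq ('I_n + seq nat)) : (forall w, inr w \in f -> far n w) ->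
    inv [seq match s with inl i => inl i | inr w => inr (X x w) end | s <- f].
  move=> hf; rewrite /inv -Phi_expand //.
  pose g (s : 'I_n + seq nat) := match s with inl i => [:: val i] | inr w => w end.
  have -> : flatten [seq match s with inl i => [:: inl i] | inr w => tok_word x n w end | s <- f] =
      tok_word x n (flatten (map g f)).
    elim: f {hf} => //= s f ->; rewrite /tok_word map_cat; congr (_ ++ _).
    by case: s => [i|w] //=; rewrite valK.
  rewrite (hw _) evt_tok; congr (phi _ *: P).
  elim: f {hf} => [|s f IH]; first by rewrite /= X_nil /evt big_nil.
  by rewrite /= X_cat evt_cons IH; case: s => [i|w] //=; rewrite X1.
pose g (s : 'I_n + seq nat) : 'I_n + A := match s with inl i => inl i | inr w => inr (X x w) end.
(* Coefficients are replaced one at a time: the prefix [f] still has words as coefficients, the rest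
   [t] has already elements of the closure. *)
have h2 t (f : seq ('I_n + seq nat)) : (forall w, inr w \in f -> far n w) ->
    (forall t1 b t2, t = t1 ++ inr b :: t2 -> cl (alg x n) b) -> inv (map g f ++ t).
  elim: t f => [|s t IH] f hf ht; first by rewrite cats0; exact: h1.
  have ht' t1 b t2 : t = t1 ++ inr b :: t2 -> cl (alg x n) b.
    by move=> e; apply: (ht (s :: t1) b t2); rewrite e.
  case: s ht => [i|b] ht.
    have := IH (rcons f (inl i)); rewrite map_rcons cat_rcons; apply=> // w.
    by rewrite mem_rcons inE => /hf.
  apply: (inv_cl (S := alg x n)); [exact: span_w0|exact: span_wP| |exact: (ht [::] b t)].
  apply: span_w_ind.
  - rewrite /inv; have E := Phi_coef_lin (map g f) t (-1) 0 0 phiP_lin.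
    rewrite evt_cat evt_cons mul0r mulr0 (lfun0 hphi.1) scale0r.
    by move: E; rewrite [-1 *: 0]scaler0 addr0 scaleN1r addNr.
  - move=> k a c ha hc; rewrite /inv Phi_coef_lin; last exact: phiP_lin.
    by rewrite ha hc !evt_cat !evt_cons mulrDl mulrDr -scalerAl -scalerAr phiP_lin.
  move=> w fw; have := IH (rcons f (inr w)); rewrite map_rcons cat_rcons; apply=> // v.
  by rewrite mem_rcons inE => /orP[/eqP[->] //|/hf].
by move=> t ht; exact: (h2 t [::]).
Qed.

End CoefInv.

(** * From free-monoid polynomials to words *)

Section MonomialInvariance.
Variables (R : realType) (A : cstarType R) (x : nat -> A) (phi : {scalar A}).
Variables (Q : cstarType R).

(** The companion of [Phi] for words without coefficients: the functional sees the whole index word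
    rather than its value in A, which permits sums over cuts of the word later. *)
Fixpoint Psi N (U : 'M[Q]_N) (f : seq 'I_N -> Q) (w : seq 'I_N) : Q :=
  if w is i :: w' then \sum_k U k i * Psi U (fun v => f (k :: v)) w' else f [::].

Lemma Psi_ext N (U : 'M[Q]_N) f g w : f =1 g -> Psi U f w = Psi U g w.
Proof.
elim: w f g => [|i w IH] f g h /=; first exact: h.
by apply: eq_bigr => k _; congr (_ * _); apply: IH => v; exact: h.
Qed.

Lemma expand_prod N (U : 'M[Q]_N) (w : seq 'I_N) : exists s : seq (Q * seq 'I_N),
  \prod_(i <- w) \sum_k mkmalgU (fmu k) (U k i) = \sum_(p <- s) mkmalgU (FMonom p.2) p.1 /\
  forall f : seq 'I_N -> Q, \sum_(p <- s) p.1 * f p.2 = Psi U f w.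
Proof.
elim: w => [|i w [s [hs hf]]].
  exists [:: (1, [::])]; split; last by move=> f; rewrite big_seq1 mul1r.
  by rewrite big_nil big_seq1 /= -fmoneE.
exists [seq (U k i * p.1, k :: p.2) | k <- index_enum 'I_N, p <- s]; split.
  rewrite big_cons hs big_distrl big_allpairs_dep /=; apply: eq_bigr => k _.
  rewrite big_distrr /=; apply: eq_bigr => p _.
  rewrite malgM_def fgmulUU; congr (mkmalgU _ _); rewrite /mmul /mul /= fmmulE.
  by rewrite fmuE.
move=> f; rewrite big_allpairs_dep /=; apply: eq_bigr => k _.
rewrite -hf big_distrr /=; apply: eq_bigr => p _.
by rewrite mulrA.
Qed.

Lemma nc_evalU N (z : 'I_N -> A) (v : seq 'I_N) :
  nc_eval z (mkmalgU (FMonom v) 1) = \prod_(i <- v) z i.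
Proof. by rewrite /nc_eval mmapU /= scale1r mul1r. Qed.

Lemma slice_coaction N (U : 'M[Q]_N) (w : seq 'I_N) :
  let mu := joint_distribution phi (fun i : 'I_N => x i) in
  slice mu (coaction U (mkmalgU (FMonom w) 1)) =
  Psi U (fun v => (phi (X x (map val v)))%:A) w.
Proof.
move=> mu; rewrite /coaction mmapU /=.
have [s [-> hf]] := expand_prod U w.
rewrite scale1r (_ : mkmalgU _ 1 = 1) ?mul1r // /slice raddf_sum -hf.
apply: eq_bigr => p _ /=; rewrite mmapU /=; congr (_ * _%:A).
by rewrite /mu /joint_distribution nc_evalU /X big_map.
Qed.

Lemma Psi_tok n K (u : 'M[Q]_n) (P : Q) (w : seq 'I_(n + K)) :
  Psi (extend_gen K u) (fun v => phi (X x (map val v)) *: P) w =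
  Phi x u (fun y => phi y *: P) (tok_word x n (map val w)).
Proof.
have gen (L : A -> Q) : Psi (extend_gen K u) (fun v => L (X x (map val v))) w =
    Phi x u L (tok_word x n (map val w)).
  elim: w L => [|i w IH] L /=; first by rewrite X_nil.
  rewrite -(splitK i); case: (fintype.split i) => j /=.
    rewrite big_split_ord /= [X in _ + X]big1 ?addr0; last first.
      by move=> k _; rewrite block_mxEdl mxE mul0r.
    rewrite valK /=; apply: eq_bigr => k _; rewrite block_mxEul -IH; congr (_ * _).
    by apply: Psi_ext => v; rewrite /= X_cons.
  rewrite insubF /=; last by rewrite ltnNge leq_addr.
  rewrite big_split_ord /= big1 ?add0r; last first.
    by move=> k _; rewrite block_mxEur mxE mul0r.
  rewrite (bigD1 j) //= big1 ?addr0; last first.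
    by move=> k kj; rewrite block_mxEdr mxE (negbTE kj) mul0r.
  rewrite block_mxEdr mxE eqxx mul1r -IH.
  by apply: Psi_ext => v; rewrite /= X_cons.
exact: gen.
Qed.

Lemma PsiMr N (U : 'M[Q]_N) f w (P : Q) : Psi U f w * P = Psi U (fun v => f v * P) w.
Proof.
elim: w f => [|i w IH] f //=.
by rewrite mulr_suml; apply: eq_bigr => k _; rewrite -IH mulrA.
Qed.

Lemma word_bound (n : nat) (w : seq nat) : exists K (v : seq 'I_(n + K)), w = map val v.
Proof.
pose K := (\max_(i <- w) i.+1)%N; exists K.
have h : all (fun i => i < n + K)%N w.
  apply/allP => i hi; apply: leq_trans (leq_addl n K).
  by rewrite /K (big_rem i) //= leq_maxl.
clearbody K; exists (pmap insub w); elim: w h => //= i w IH /andP[hi hw].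
by rewrite insubT /= -IH.
Qed.

End MonomialInvariance.

Lemma hopf_inv_words (R : realType) (A : cstarType R) (x : nat -> A) (phi : {scalar A}) n
  (E : genalg R n) : hopf_invariant phi x E -> inv_words x phi (ga_u E) 1.
Proof.
move=> h w; rewrite /inv evt_tok; have [K [v ->]] := word_bound n w.
rewrite -(@Psi_tok R A x phi E n K (ga_u E) 1 v) -slice_coaction -h; congr (_ *: _).
by rewrite /joint_distribution nc_evalU /X big_map.
Qed.

Lemma boolean_inv_words (R : realType) (A : cstarType R) (x : nat -> A) (phi : {scalar A}) n
  (E : bgenalg R n) : boolean_invariant phi x E -> inv_words x phi (bg_u E) (bg_P E).
Proof.
move=> h w; rewrite /inv evt_tok; have [K [v ->]] := word_bound n w.
rewrite -(@Psi_tok R A x phi E n K (bg_u E) (bg_P E) v); have := h K (mkmalgU (FMonom v) 1).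
rewrite /= slice_coaction PsiMr => e.
transitivity (Psi (extend_gen K (bg_u E)) (fun s => (phi (X x (map val s)))%:A * bg_P E) v).
  by apply: Psi_ext => s; rewrite -scalerAl mul1r.
rewrite -e; congr (_ *: _).
by rewrite /joint_distribution nc_evalU /X big_map.
Qed.

Lemma inv_words_hom (R : realType) (A : cstarType R) (x : nat -> A) (phi : A -> R[i]) n
  (Q Q' : cstarType R) (f : {lrmorphism Q -> Q'}) (u : 'I_n -> 'I_n -> Q) (P : Q) :
  inv_words x phi u P -> inv_words x phi (fun k i => f (u k i)) (f P).
Proof.
move=> h w; rewrite /inv; have := congr1 f (h w); rewrite linearZ /= => <-.
have gen (L : A -> Q) t : Phi x (fun k i => f (u k i)) (fun y => f (L y)) t = f (Phi x u L t).
  elim: t L => [|[i|b] t IH] L //=; rewrite ?raddf_sum //.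
  by apply: eq_bigr => k _; rewrite IH; exact: (esym (rmorphM f _ _)).
by rewrite -gen; apply: Phi_ext => y; rewrite linearZ.
Qed.

(** * Complex matrices as a C*-algebra *)

Section MatrixAlgebra.
Variables (R : realType).

Definition Mat (d : nat) : Type := 'M[R[i]]_d.+1.
HB.instance Definition _ d := GRing.Algebra.copy (Mat d) 'M[R[i]]_d.+1.

Section Norm.
Variable d : nat.
Local Notation M := 'M[R[i]]_d.+1.
Local Notation V := 'cV[R[i]]_d.+1.
Implicit Types (a b : M) (v w : V).

Definition vdot v w : R[i] := \sum_i v i 0 * (w i 0)^*.
Definition hv v : R := Re (vdot v v).
Definition mstar a : M := (map_mx Num.conj a)^T.

Lemma vdot_lin (c : R[i]) v v' w : vdot (c *: v + v') w = c * vdot v w + vdot v' w.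
Proof.
rewrite /vdot mulr_sumr -big_split; apply: eq_bigr => i _ /=.
by rewrite !mxE mulrDl mulrA.
Qed.

Lemma vdotC v w : vdot w v = (vdot v w)^*.
Proof.
rewrite /vdot rmorph_sum; apply: eq_bigr => i _ /=.
by rewrite rmorphM /= conjCK mulrC.
Qed.

Lemma vdotE v : vdot v v = (hv v)%:C.
Proof. by apply/ge0_ReE/sumr_ge0 => i _; rewrite -normCK exprn_ge0. Qed.

Lemma vdot_ge0 v : 0 <= vdot v v.
Proof. by apply: sumr_ge0 => i _; rewrite -normCK exprn_ge0. Qed.

Lemma hvE v : hv v = \sum_i mod (v i 0) ^+ 2.
Proof.
apply: complexI; rewrite -vdotE rmorph_sum; apply: eq_bigr => i _ /=.
by rewrite -mod_sqr.
Qed.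

Lemma hv_ge0 v : 0 <= hv v.
Proof. exact: Re_ge0 (vdot_ge0 v). Qed.

Lemma vdot_CS v w : mod (vdot v w) ^+ 2 <= hv v * hv w.
Proof. exact: (form_CS vdot_lin vdotC vdot_ge0). Qed.

Lemma vdot_adj a v w : vdot (a *m v) w = vdot v (mstar a *m w).
Proof.
rewrite /vdot; under eq_bigr => i _ do rewrite mxE mulr_suml.
rewrite exchange_big; apply: eq_bigr => j _ /=.
rewrite mxE rmorph_sum mulr_sumr; apply: eq_bigr => i _ /=.
by rewrite !mxE rmorphM /= conjCK mulrCA mulrA.
Qed.

Lemma mstarK : involutive mstar.
Proof. by move=> a; apply/matrixP => i j; rewrite !mxE conjCK. Qed.

Lemma hvD_le v w (r s : R) : 0 <= r -> 0 <= s -> hv v <= r ^+ 2 -> hv w <= s ^+ 2 ->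
  hv (v + w) <= (r + s) ^+ 2.
Proof.
move=> r0 s0 hr hs.
have -> : hv (v + w) = hv v + 2 * Re (vdot v w) + hv w.
  have e : v + w = 1 *: v + w by rewrite scale1r.
  rewrite {1}/hv {1}e vdot_lin mul1r !(vdotC (v + w)) e !vdot_lin !mul1r.
  by rewrite -rmorphD Re_conj !ReD (vdotC v w) Re_conj /hv; ring.
have h1 := Re_le_mod (vdot v w); have h2 := vdot_CS v w.
have h3 : mod (vdot v w) <= r * s.
  rewrite -(@ler_pXn2r _ 2) ?nnegrE ?mod_ge0 ?mulr_ge0 // exprMn; apply: le_trans h2 _.
  by apply: ler_pM => //; exact: hv_ge0.
have h4 := ler_norm (Re (vdot v w)).
have -> : (r + s) ^+ 2 = r ^+ 2 + 2 * (r * s) + s ^+ 2 by ring.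
lra.
Qed.

Lemma hvZ (c : R[i]) v : hv (c *: v) = mod c ^+ 2 * hv v.
Proof.
rewrite !hvE mulr_sumr; apply: eq_bigr => i _.
by rewrite mxE modM exprMn.
Qed.

Definition bnd a (c : R) := 0 <= c /\ forall v, hv (a *m v) <= c ^+ 2 * hv v.

Lemma bnd_D a b (r s : R) : bnd a r -> bnd b s -> bnd (a + b) (r + s).
Proof.
move=> [r0 hr] [s0 hs]; split; first exact: addr_ge0.
move=> v; have v0 := hv_ge0 v; have q := sqr_sqrtr v0.
rewrite mulmxDl -q -exprMn mulrDl; apply: hvD_le.
- by rewrite mulr_ge0 // sqrtr_ge0.
- by rewrite mulr_ge0 // sqrtr_ge0.
- by rewrite exprMn q.
- by rewrite exprMn q.
Qed.

Lemma bnd_Z a (c : R[i]) (r : R) : bnd a r -> bnd (c *: a) (mod c * r).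
Proof.
move=> [r0 hr]; split; first by rewrite mulr_ge0 // mod_ge0.
by move=> v; rewrite -scalemxAl hvZ exprMn -[leRHS]mulrA ler_wpM2l // sqr_ge0.
Qed.

Lemma bnd_M a b (r s : R) : bnd a r -> bnd b s -> bnd (a *m b) (r * s).
Proof.
move=> [r0 hr] [s0 hs]; split; first exact: mulr_ge0.
move=> v; rewrite -mulmxA; apply: le_trans (hr _) _.
by rewrite exprMn -[leRHS]mulrA ler_wpM2l // sqr_ge0.
Qed.

Lemma bnd_delta (i j : 'I_d.+1) : bnd (delta_mx i j) 1.
Proof.
split=> // v; rewrite expr1n mul1r !hvE (bigD1 i) //= big1 ?addr0; last first.
  move=> k ki; rewrite mxE big1 ?mod0 ?expr0n // => l _.
  by rewrite mxE (negbTE ki) mul0r.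
rewrite mxE (bigD1 j) //= big1 ?addr0; last by move=> l lj; rewrite mxE (negbTE lj) andbF mul0r.
rewrite mxE !eqxx mul1r (bigD1 j) //= lerDl; apply: sumr_ge0 => l _; exact: sqr_ge0.
Qed.

Lemma bnd0 : bnd 0 0.
Proof.
by split=> // v; rewrite mul0mx expr0n mul0r hvE big1 // => i _; rewrite mxE mod0 expr0n.
Qed.

Lemma bnd_entries a : bnd a (\sum_i \sum_j mod (a i j)).
Proof.
rewrite {1}(matrix_sum_delta a).
elim/big_ind2: _ => [|y1 z1 y2 z2|i _]; [exact: bnd0|exact: bnd_D|].
elim/big_ind2: _ => [|y1 z1 y2 z2|j _]; [exact: bnd0|exact: bnd_D|].
by have := bnd_Z (a i j) (bnd_delta i j); rewrite mulr1.
Qed.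

(** The operator norm, as the least bound; [mnorm_bnd] shows that the infimum is attained. *)
Definition mnorm a : R := inf [set c | bnd a c].

Lemma mnorm_lb a : has_inf [set c | bnd a c].
Proof. by split; [exists (\sum_i \sum_j mod (a i j)); exact: bnd_entries|exists 0 => c []]. Qed.

Lemma mnorm_le a c : bnd a c -> mnorm a <= c.
Proof. by move=> h; apply: ge_inf => //; have [] := mnorm_lb a. Qed.

Lemma mnorm_bnd a : bnd a (mnorm a).
Proof.
have m0 : 0 <= mnorm a by apply: lb_le_inf; [have [] := mnorm_lb a|move=> c []].
split=> // v; apply/ler_addgt0Pr => e e0.
have v0 := hv_ge0 v.
pose r := Num.min 1 (e / ((2 * mnorm a + 1) * (hv v + 1))).
have k0 : 0 < (2 * mnorm a + 1) * (hv v + 1) by rewrite mulr_gt0 //; lra.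
have r0 : 0 < r by rewrite lt_min ltr01 divr_gt0.
have [c [c0 hc] cl'] := inf_adherent r0 (mnorm_lb a).
apply: le_trans (hc v) _; rewrite -/(mnorm a) in cl'.
have r1 : r <= 1 by rewrite ge_min lexx.
have r2 : r * ((2 * mnorm a + 1) * (hv v + 1)) <= e.
  by rewrite -ler_pdivlMr // ge_min lexx orbT.
have : c ^+ 2 <= (mnorm a + r) ^+ 2 by rewrite -subr_ge0 subr_sqr mulr_ge0 //; lra.
have -> : (mnorm a + r) ^+ 2 = mnorm a ^+ 2 + r * (2 * mnorm a + r) by ring.
move=> h.
have : r * (2 * mnorm a + r) <= r * (2 * mnorm a + 1) by rewrite ler_wpM2l ?(ltW r0) //; lra.
move=> h2; apply: le_trans (_ : (mnorm a ^+ 2 + r * (2 * mnorm a + 1)) * hv v <= _).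
  by rewrite ler_wpM2r //; lra.
rewrite mulrDl lerD2l; apply: le_trans r2; rewrite -mulrA ler_wpM2l ?(ltW r0) //.
by rewrite ler_wpM2l //; lra.
Qed.

Lemma mnorm_star_le a : mnorm a ^+ 2 <= mnorm (mstar a *m a).
Proof.
have [n0 hn] := mnorm_bnd (mstar a *m a).
have : bnd a (Num.sqrt (mnorm (mstar a *m a))).
  split; first exact: sqrtr_ge0.
  move=> v; rewrite sqr_sqrtr //.
  have : mod (vdot (mstar a *m a *m v) v) <= mnorm (mstar a *m a) * hv v.
    rewrite -(@ler_pXn2r _ 2) ?nnegrE ?mod_ge0 ?mulr_ge0 ?hv_ge0 //; apply: le_trans (vdot_CS _ _) _.
    by rewrite exprMn [X in _ <= _ * X]expr2 mulrA ler_wpM2r ?hv_ge0.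
  rewrite -mulmxA vdotC -[a in mstar a *m (a *m v)]mstarK -vdot_adj.
  have -> : mstar (mstar a) = a by exact: mstarK.
  rewrite mod_conj vdotE mod_real ger0_norm ?hv_ge0 //.
move=> /mnorm_le h; rewrite -[leRHS](sqr_sqrtr n0).
have [a0 _] := mnorm_bnd a; exact: (lerXn2r 2 a0 (sqrtr_ge0 _) h).
Qed.

Lemma mnormM a b : mnorm (a *m b) <= mnorm a * mnorm b.
Proof. exact/mnorm_le/bnd_M/mnorm_bnd/mnorm_bnd. Qed.

Lemma mnorm_adj_le a : mnorm a <= mnorm (mstar a).
Proof.
have [a0 _] := mnorm_bnd a; have [|n0] := eqVneq (mnorm a) 0.
  by move=> ->; have [] := mnorm_bnd (mstar a).
have : mnorm a ^+ 2 <= mnorm (mstar a) * mnorm a := le_trans (mnorm_star_le a) (mnormM _ _).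
by rewrite expr2 ler_pM2r // lt_def n0.
Qed.

Lemma mnorm_entry a i j : mod (a i j) <= mnorm a.
Proof.
have [a0 h] := mnorm_bnd a; have := h (delta_mx j 0).
have -> : hv (delta_mx j 0) = 1.
  rewrite hvE (bigD1 j) //= big1 ?addr0; first by rewrite mxE !eqxx mod1 expr1n.
  by move=> k kj; rewrite mxE (negbTE kj) mod0 expr0n.
rewrite mulr1 -colE hvE (bigD1 i) //= mxE => h'.
rewrite -(@ler_pXn2r _ 2) ?nnegrE ?mod_ge0 //; apply: le_trans h'.
by rewrite lerDl; apply: sumr_ge0 => k _; exact: sqr_ge0.
Qed.

Lemma mnorm_le_entries a : mnorm a <= \sum_i \sum_j mod (a i j).
Proof. exact/mnorm_le/bnd_entries. Qed.

(** The sequence is bounded from some rank on, so it has a limit along a free ultrafilter; the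
    Cauchy property makes it an ordinary limit. *)
Lemma ccomplete (f : nat -> R[i]) :
  (forall e : R, 0 < e -> exists N, forall m n, (N <= m)%N -> (N <= n)%N -> mod (f m - f n) < e) ->
  exists l, forall e : R, 0 < e -> exists N, forall n, (N <= n)%N -> mod (f n - l) < e.
Proof.
move=> hf; have [U uU Uc] := nat_uf; have [N0 h0] := hf 1 ltr01.
pose g i := f (N0 + i)%N.
have [|l hl] := @flim_ex R nat U uU g (mod (f N0) + 1).
  move=> i; have := modD (f N0) (g i - f N0); rewrite addrC subrK => h; apply: le_trans h _.
  by rewrite lerD2l ltW // h0 // leq_addr.
exists l => e e0; have e2 : 0 < e / 2 by lra.
have [N hN] := hf _ e2; exists N => n hn.
have [i [/= h1 h2]] := uf_n0 uU (uf_I uU (hl _ e2) (Uc N)).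
apply: le_lt_trans (mod_triB _ (g i) _) _.
have := hN n (N0 + i)%N hn (leq_trans h2 (leq_addl _ _)); rewrite -/(g i); lra.
Qed.

Lemma mcomplete (f : nat -> M) :
  (forall e : R, 0 < e -> exists N : nat, forall m n, (N <= m)%N -> (N <= n)%N -> mnorm (f m - f n) < e) ->
  exists l : M, forall e : R, 0 < e -> exists N : nat, forall n, (N <= n)%N -> mnorm (f n - l) < e.
Proof.
move=> hf.
have H (q : 'I_d.+1 * 'I_d.+1) : exists l, forall e : R, 0 < e -> exists N, forall n, (N <= n)%N ->
    mod (f n q.1 q.2 - l) < e.
  apply: ccomplete => e e0; have [N hN] := hf e e0; exists N => m n h1 h2.
  by have := mnorm_entry (f m - f n) q.1 q.2; rewrite !mxE => /le_lt_trans; apply; exact: hN.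
have [l hl] := choice H.
exists (\matrix_(i, j) l (i, j)) => e e0.
pose K : R := (d.+1 * d.+1)%:R; have K0 : 0 < K by rewrite ltr0n.
have eK : 0 < e / (2 * K) by rewrite divr_gt0 // mulr_gt0.
have H2 (q : 'I_d.+1 * 'I_d.+1) : exists N, forall n, (N <= n)%N -> mod (f n q.1 q.2 - l q) < e / (2 * K).
  exact: hl.
have [N hN] := choice H2.
exists (\max_q N q)%N => n hn; apply: le_lt_trans (mnorm_le_entries _) _.
apply: le_lt_trans (_ : \sum_(i < d.+1) \sum_(j < d.+1) e / (2 * K) < _).
  apply: ler_sum => i _; apply: ler_sum => j _; rewrite !mxE ltW //.
  by apply: (hN (i, j)); apply: leq_trans hn; exact: leq_bigmax.
rewrite !sumr_const !card_ord -mulrnA -[_ *+ _]mulr_natr -/K.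
have -> : e / (2 * K) * K = e / 2 by clear -K0; clearbody K; field; rewrite gt_eqF.
lra.
Qed.

Lemma mnormZ (c : R[i]) a : mnorm (c *: a) = mod c * mnorm a.
Proof.
apply/eqP; rewrite eq_le mnorm_le; last exact/bnd_Z/mnorm_bnd.
have [->|c0] := eqVneq c 0; first by rewrite mod0 mul0r; have [] := mnorm_bnd (0 *: a).
have m0 : 0 < mod c by rewrite lt_def mod_ge0 andbT; apply: contra_neq c0 => /mod_eq0.
have := mnorm_le (bnd_Z c^-1 (mnorm_bnd (c *: a))); rewrite scalerA mulVf // scale1r.
rewrite -(ler_pM2l m0) mulrA => h; apply: le_trans h _.
by rewrite -modM mulfV // mod1 mul1r.
Qed.

Lemma mnorm_star a : mnorm (mstar a *m a) = mnorm a ^+ 2.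
Proof.
apply/eqP; rewrite eq_le mnorm_star_le andbT; apply: le_trans (mnormM _ _) _.
rewrite expr2 ler_wpM2r //; first by have [] := mnorm_bnd a.
by have := mnorm_adj_le (mstar a); rewrite mstarK.
Qed.

Lemma mstarD : {morph mstar : a b / a + b}.
Proof. by move=> a b; rewrite /mstar map_mxD linearD. Qed.

Lemma mstarZ (c : R[i]) a : mstar (c *: a) = c^* *: mstar a.
Proof. by rewrite /mstar map_mxZ linearZ. Qed.

Lemma mstarM a b : mstar (a *m b) = mstar b *m mstar a.
Proof. by rewrite /mstar map_mxM trmx_mul. Qed.

Lemma mnorm_eq0 a : mnorm a = 0 -> a = 0.
Proof.
move=> h; apply/matrixP => i j; rewrite mxE; apply: mod_eq0; apply/eqP.
by rewrite eq_le mod_ge0 andbT -h mnorm_entry.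
Qed.

Lemma mnormD a b : mnorm (a + b) <= mnorm a + mnorm b.
Proof. exact/mnorm_le/bnd_D/mnorm_bnd/mnorm_bnd. Qed.

Lemma mnormZC (c : R[i]) a : (mnorm (c *: a))%:C = `|c| * (mnorm a)%:C.
Proof. by rewrite mnormZ modE rmorphM. Qed.

End Norm.

HB.instance Definition _ d := isCStarAlgebra.Build R (Mat d) (@mstarK d) (@mstarD d) (@mstarZ d)
  (@mstarM d) (@mnorm_eq0 d) (@mnormD d) (@mnormZC d) (@mnormM d) (@mnorm_star d) (@mcomplete d).

End MatrixAlgebra.

(** The universal algebra maps to any algebra that holds a magic matrix, and [E] maps to it:
    invariance is transported along both homomorphisms. This frees the choice of projections
    later. *)
Lemma magic_inv_words (R : realType) (A : cstarType R) (x : nat -> A) (phi : {scalar A}) n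
    (As E : genalg R n) (Q : cstarType R) (u : 'M[Q]_n) :
  is_As As -> ga_sub As E -> hopf_invariant phi x E -> mx_magic u -> inv_words x phi u 1.
Proof.
move=> [_ _ h] [f _ hf] /hopf_inv_words hE mu.
have [g _ hg] := h (GenAlg u) mu.
have h1 := inv_words_hom f hE; have := inv_words_hom g h1; rewrite !rmorph1.
rewrite (_ : (fun k i => g (f (ga_u E k i))) = u) //.
by apply/funext => k; apply/funext => i; rewrite hf hg.
Qed.

(** Restricted to involutions, whose permutation matrices are symmetric: transpositions, exchanges
    of two blocks, and [lift]. *)
Definition finperm n (f : nat -> nat) := [/\ (0 < n)%N, involutive f,
  forall i, (i < n)%N -> (f i < n)%N & forall i, (n <= i)%N -> f i = i].

Definition transp i j k : nat := if k == i then j else if k == j then i else k.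

Lemma transpL i j : transp i j i = j.
Proof. by rewrite /transp eqxx. Qed.

Lemma transp_perm i j : finperm (i + j).+1 (transp i j).
Proof. by split=> // k; rewrite /transp; do 4?case: eqP; lia. Qed.

Definition swp n i := if (i < n)%N then (i + n)%N else if (i < n + n)%N then (i - n)%N else i.

Lemma swp_perm n : finperm (n.+1 + n.+1) (swp n.+1).
Proof. by split=> // i; rewrite /swp; do ?case: ifP; lia. Qed.

(** Moves the chosen letters out of reach of the first [n] and leaves the others in place; the
    second branch makes it an involution. *)
Definition lift (n : nat) (ly : seq nat) i :=
  if i \in ly then (i + n)%N else if (n <= i)%N && ((i - n)%N \in ly) then (i - n)%N else i.

Lemma liftK n ly : all (gtn n) ly -> involutive (lift n ly).
Proof.
move=> /allP /= h i; rewrite /lift.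
case: (boolP (i \in ly)) => hi.
  by rewrite leq_addl addnK hi ifF //; apply/negP => /h; lia.
case: (boolP ((n <= i)%N && ((i - n)%N \in ly))) => hi'; last by rewrite (negbTE hi) (negbTE hi').
by have /andP[h1 h2] := hi'; rewrite h2 subnK.
Qed.

Lemma lift_perm n ly : (0 < n)%N -> all (gtn n) ly -> finperm (n + n) (lift n ly).
Proof.
move=> n0 hl; have /allP /= h := hl; split=> [||i|i]; [by rewrite addn_gt0 n0|exact: liftK| |].
  by rewrite /lift; case: ifP => [/h|_]; [|case: ifP => _]; lia.
by move=> hi; rewrite /lift ifF; [rewrite ifF //; apply/negP => /andP[_ /h]|apply/negP => /h]; lia.
Qed.

(** * Free case: the conditional expectation onto the tail algebra *)

Section FreeExpectation.
Variables (R : realType) (A : cstarType R) (H : hilbertType R) (ro : A -> H -> H).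
Hypothesis ro_f : faithful_rep ro.
Hypothesis ro_bic : bicommutant ro.
Variables (x : nat -> A) (phi : {scalar A}).
Hypothesis hx : forall i, star (x i) = x i.
Hypothesis hphi : pfun phi.
Hypothesis wphi : wcont ro phi.
Hypothesis magic : forall n (Q : cstarType R) (u : 'M[Q]_n), (0 < n)%N -> mx_magic u ->
  inv_words x phi u 1.
Implicit Types (a b c e y z : A) (w : seq nat) (t : seq (nat + A)).

Definition evn t : A := \prod_(s <- t) match s with inl i => x i | inr b => b end.

Definition ren (f : nat -> nat) t : seq (nat + A) :=
  [seq match s with inl i => inl (f i) | inr b => inr b end | s <- t].

Definition letters t : seq nat := pmap (fun s => match s with inl i => Some i | inr _ => None end) t.
Definition coefs t : seq A := pmap (fun s => match s with inl _ => None | inr b => Some b end) t.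

Lemma evn_cons s t : evn (s :: t) = match s with inl i => x i | inr b => b end * evn t.
Proof. by rewrite /evn big_cons. Qed.

Lemma evn_nil : evn [::] = 1.
Proof. by rewrite /evn big_nil. Qed.

Lemma evn_cat t1 t2 : evn (t1 ++ t2) = evn t1 * evn t2.
Proof. by rewrite /evn big_cat. Qed.

Lemma letters_cat t1 t2 : letters (t1 ++ t2) = letters t1 ++ letters t2.
Proof. by rewrite /letters pmap_cat. Qed.

Lemma coefs_cat t1 t2 : coefs (t1 ++ t2) = coefs t1 ++ coefs t2.
Proof. by rewrite /coefs pmap_cat. Qed.

Lemma coefs_ren f t : coefs (ren f t) = coefs t.
Proof. by elim: t => //= -[i|b] t IH //=; congr (_ :: _). Qed.

Lemma letters_ren f t : letters (ren f t) = map f (letters t).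
Proof. by elim: t => //= -[i|b] t IH //=; congr (_ :: _). Qed.

Lemma ren_cat f t1 t2 : ren f (t1 ++ t2) = ren f t1 ++ ren f t2.
Proof. by rewrite /ren map_cat. Qed.

Lemma ren_id f t : (forall i, i \in letters t -> f i = i) -> ren f t = t.
Proof.
elim: t => //= -[i|b] t IH h //=; rewrite IH ?h ?inE ?eqxx //.
by move=> j hj; apply: h; rewrite inE hj orbT.
Qed.

Definition wt w : seq (nat + A) := map inl w.

Lemma evn_wt w : evn (wt w) = X x w.
Proof. by elim: w => [|i w IH]; rewrite ?evn_nil ?X_nil // evn_cons IH X_cons. Qed.

Lemma letters_wt w : letters (wt w) = w.
Proof. by elim: w => //= i w IH; congr (_ :: _). Qed.

Lemma coefs_wt w : coefs (wt w) = [::].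
Proof. by elim: w. Qed.

Lemma ren_wt f w : ren f (wt w) = wt (map f w).
Proof. by rewrite /ren /wt -!map_comp. Qed.

Definition tok n (s : nat + A) : 'I_n + A :=
  match s with inl i => if insub i is Some j then inl j else inr (x i) | inr b => inr b end.

Lemma evt_tokn n t : evt x (map (tok n) t) = evn t.
Proof.
elim: t => [|[i|b] t IH]; rewrite ?evn_nil /evt ?big_nil ?big_cons ?evn_cons -?IH //=.
by case: insubP => [j _ <-|].
Qed.

Lemma words_inv n (Q : cstarType R) (u : 'I_n -> 'I_n -> Q) (P : Q) t : inv_words x phi u P ->
  {in coefs t, forall b, cl (alg x n) b} ->
  Phi x u (fun y => phi y *: P) (map (tok n) t) = phi (evn t) *: P.
Proof.
move=> hu ht; have := inv_coef ro_f ro_bic hphi wphi hu (t := map (tok n) t).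
rewrite /inv evt_tokn; apply=> t1 b t2.
elim: t t1 ht => [|s t IH] [|s1 t1] ht //= [e1 e2]; last first.
  by apply: IH e2 => b' hb; apply: ht; case: s {e1} => //= b''; rewrite inE hb orbT.
case: s e1 ht => [i|b'] /=; last by case=> <- h; apply: h; rewrite inE eqxx.
case: insubP => // hi [<-] _; apply: cl_sub; rewrite -X1; apply: span_wX.
by rewrite /far /= andbT leqNgt.
Qed.

Lemma magic_inv n (Q : cstarType R) (u : 'M[Q]_n) t : (0 < n)%N -> mx_magic u ->
  {in coefs t, forall b, cl (alg x n) b} ->
  Phi x u (fun y => phi y *: (1 : Q)) (map (tok n) t) = phi (evn t) *: 1.
Proof. by move=> n0 mu; exact/words_inv/magic. Qed.

Lemma Phi_perm n (Q : cstarType R) (f : nat -> nat) t (L : A -> Q) :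
  (forall i, i < n -> f i < n)%N -> (forall i, n <= i -> f i = i)%N ->
  Phi x (fun (k i : 'I_n) => (val k == f i)%:R : Q) L (map (tok n) t) = L (evn (ren f t)).
Proof.
move=> f1 f2; elim: t L => [|[i|b] t IH] L /=; rewrite ?evn_nil ?evn_cons //.
case: insubP => [j hj ji|hi] /=.
  rewrite (bigD1 (Ordinal (f1 j (ltn_ord j)))) //= eqxx mul1r big1 ?addr0.
    by rewrite IH ji.
  by move=> k; rewrite -val_eqE /= => /negbTE ->; rewrite mul0r.
by rewrite IH f2 // leqNgt.
Qed.

Lemma magic_perm n (Q : cstarType R) (f : nat -> nat) : (forall i, i < n -> f i < n)%N ->
  involutive f -> mx_magic (\matrix_(k < n, i < n) ((val k == f i)%:R : Q)).
Proof.
move=> f1 ff.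
have fsw i j : (i == f j) = (j == f i).
  by apply/eqP/eqP => ->; rewrite ff.
have E (i j : 'I_n) : \sum_(k < n) (val i == f k)%:R * (val j == f k)%:R = (i == j)%:R :> Q.
  rewrite (bigD1 (Ordinal (f1 i (ltn_ord i)))) //= ff eqxx mul1r big1 ?addr0.
    by rewrite eq_sym val_eqE.
  move=> k; rewrite -val_eqE /= fsw => /negbTE ->; exact: mul0r.
split.
  split=> [i j||].
  - by rewrite /selfadjoint mxE; case: (_ == _); rewrite ?star1 ?star0.
  - by apply/matrixP => i j; rewrite !mxE -E; apply: eq_bigr => k _; rewrite !mxE.
  - apply/matrixP => i j; rewrite !mxE -E; apply: eq_bigr => k _; rewrite !mxE.
    by rewrite fsw [in X in _ * X]fsw.
by move=> i j; rewrite mxE; split; case: (_ == _); rewrite ?star1 ?star0 ?mulr1 ?mulr0.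
Qed.

Lemma perm_inv n f t : finperm n f -> {in coefs t, forall b, cl (alg x n) b} ->
  phi (evn (ren f t)) = phi (evn t).
Proof.
move=> [n0 ff f1 f2] ht.
have := magic_inv n0 (@magic_perm n (Mat R 0) f f1 ff) ht.
rewrite (_ : Phi _ _ _ _ = phi (evn (ren f t)) *: 1); last first.
  rewrite -(Phi_perm t (fun y => phi y *: (1 : Mat R 0)) f1 f2); congr (Phi _ _ _ _).
  by apply/funext => k; apply/funext => i; rewrite mxE.
move=> /matrixP /(_ 0 0); rewrite !mxE eqxx !mulr1; exact.
Qed.

(** The coaction of the block matrix ((s, s'), (s', s)), written out: letter i becomes s_i (x) x_i +
    s'_i (x) x_(N+i). See [Phi_pair]. *)
Fixpoint Pair (Q : cstarType R) N (s s' : nat -> Q) (L : A -> Q) t : Q :=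
  match t with
  | [::] => L 1
  | inr b :: t' => Pair N s s' (fun y => L (b * y)) t'
  | inl i :: t' => s i * Pair N s s' (fun y => L (x i * y)) t' +
                   s' i * Pair N s s' (fun y => L (x (N + i)%N * y)) t'
  end.

Section PairMatrix.
Variables (Q : cstarType R) (N : nat) (s s' : nat -> Q).

Definition pairmx : 'M[Q]_(N + N) := block_mx (diag_mx (\row_i s i)) (diag_mx (\row_i s' i))
  (diag_mx (\row_i s' i)) (diag_mx (\row_i s i)).

Let dE (r : nat -> Q) (i j : 'I_N) : diag_mx (\row_i r i) i j = (i == j)%:R * r i.
Proof. by rewrite !mxE; case: (i == j); rewrite ?mul1r ?mul0r. Qed.

Lemma pairmx_sym : pairmx^T = pairmx.
Proof. by rewrite /pairmx tr_block_mx !tr_diag_mx. Qed.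

Hypothesis ps : forall i, projection (s i).
Hypothesis ps' : forall i, projection (s' i).
Hypothesis os : forall i, s i * s' i = 0.

(** The diagonal entries s + s' are 1 in the free case; in the Boolean case they are projections
    that fix P. *)
Lemma pairmx_sqr (i j : 'I_(N + N)) : (pairmx *m pairmx) i j =
  (i == j)%:R * (s (i %% N)%N + s' (i %% N)%N).
Proof.
have os' k : s' k * s k = 0.
  by have := congr1 star (os k); rewrite starM star0 (ps k).1 (ps' k).1.
have dM (r r' : nat -> Q) : diag_mx (\row_i r i) *m diag_mx (\row_i r' i) = diag_mx (\row_(i < N) (r i * r' i)).
  apply/matrixP => k l; rewrite mxE (bigD1 k) //= big1 ?addr0; last first.
    by move=> m mk; rewrite !dE eq_sym (negbTE mk) !mul0r.
  rewrite !dE eqxx mul1r [RHS](dE (fun i => r i * r' i)).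
  by case: eqP => [->|_]; rewrite ?mul1r // !mul0r mulr0.
rewrite /pairmx mulmx_block !dM -!linearD /=.
have e1 : \row_(i < N) (s i * s i) + \row_(i < N) (s' i * s' i) = \row_(i < N) (s i + s' i).
  by apply/rowP => k; rewrite !mxE (ps k).2 (ps' k).2.
have e4 : \row_(i < N) (s' i * s' i) + \row_(i < N) (s i * s i) = \row_(i < N) (s i + s' i) by rewrite addrC.
have e2 : \row_(i < N) (s i * s' i) + \row_(i < N) (s' i * s i) = 0.
  by apply/rowP => k; rewrite !mxE os os' addr0.
have e3 : \row_(i < N) (s' i * s i) + \row_(i < N) (s i * s' i) = 0 by rewrite addrC.
rewrite e1 e2 e3 e4 linear0 -(splitK i) -(splitK j).
case: (fintype.split i) => i'; case: (fintype.split j) => j' /=.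
- by rewrite block_mxEul (dE (fun i => s i + s' i)) modn_small // (inj_eq (@lshift_inj _ _)).
- by rewrite block_mxEur mxE eq_lrshift mul0r.
- by rewrite block_mxEdl mxE eq_rlshift mul0r.
by rewrite block_mxEdr (dE (fun i => s i + s' i)) modnDl modn_small // (inj_eq (@rshift_inj _ _)).
Qed.

Lemma pairmx_proj i j : projection (pairmx i j).
Proof.
have hb (r : Q) (b : bool) : projection r -> projection (b%:R * r).
  by move=> [h1 h2]; rewrite /projection; case: b; rewrite ?mul1r ?mul0r ?star0.
rewrite -(splitK i) -(splitK j).
by case: (fintype.split i) => i'; case: (fintype.split j) => j'; rewrite /= ?block_mxEul
  ?block_mxEur ?block_mxEdl ?block_mxEdr dE; apply: hb.
Qed.

Lemma Phi_pair (L : A -> Q) t : all (gtn N) (letters t) ->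
  Phi x pairmx L (map (tok (N + N)) t) = Pair N s s' L t.
Proof.
elim: t L => [|[i|b] t IH] L ht //=; last exact: IH.
have /andP[iN {}ht] := ht.
rewrite insubT ?(leq_trans iN) ?leq_addr //= => h.
have -> : Sub i h = lshift N (Ordinal iN) by exact: val_inj.
rewrite big_split_ord /=; congr (_ + _).
  rewrite (bigD1 (Ordinal iN)) //= big1 ?addr0; last first.
    by move=> k ki; rewrite block_mxEul dE (negbTE ki) !mul0r.
  by rewrite block_mxEul dE eqxx mul1r IH.
rewrite (bigD1 (Ordinal iN)) //= big1 ?addr0; last first.
  by move=> k ki; rewrite block_mxEdl dE (negbTE ki) !mul0r.
by rewrite block_mxEdl dE eqxx mul1r IH.
Qed.

End PairMatrix.

Lemma pair_inv (Q : cstarType R) N (s s' : nat -> Q) t : (0 < N)%N ->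
  (forall i, projection (s i) /\ s i + s' i = 1) -> all (gtn N) (letters t) ->
  {in coefs t, forall b, cl (alg x (N + N)) b} ->
  Pair N s s' (fun y => phi y *: 1) t = phi (evn t) *: 1.
Proof.
move=> N0 hs ht hc.
have s'E i : s' i = 1 - s i by rewrite -(hs i).2 addrC addKr.
have ps i : projection (s i) by case: (hs i).
have os i : s i * s' i = 0 by rewrite s'E mulrBr mulr1 (ps i).2 subrr.
have ps' i : projection (s' i).
  by rewrite /projection s'E starB star1 (ps i).1 mulrBl mul1r -s'E os subr0.
have uu : pairmx N s s' *m pairmx N s s' = 1%:M.
  by apply/matrixP => i j; rewrite pairmx_sqr // (hs _).2 mulr1 !mxE.
rewrite -(magic_inv (u := pairmx N s s') _ _ hc) ?addn_gt0 ?N0 ?Phi_pair //.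
split; first split; rewrite ?pairmx_sym // => i j; last exact: pairmx_proj.
by case: (pairmx_proj ps ps' i j).
Qed.

(** Normal states follow weak limits, so a sigma-weak neighbourhood of the limit contains almost all
    members of the family. *)
Lemma cl_wlim (I : Type) (F : set (set I)) (f : I -> A) (M : R) e (D : set A) : uf F ->
  (forall i, cnorm (f i) <= M) -> wlim ro F f e -> F [set i | D (f i)] -> cl D e.
Proof.
move=> uF fM fe hD m psi r hp r0.
have H1 (s : seq 'I_m) : F [set i | forall j, j \in s -> mod (psi j (e - f i)) < r].
  elim: s => [|j s IH]; first by apply: (uf_T uF).
  have [[h1 h2] h3] := hp j.
  have pp : pfun (psi j) by split=> // k a b; rewrite linearP.
  have := normal_wcont ro_f ro_bic pp h3 uF fM fe r0 => hj.
  apply: (uf_S uF (uf_I uF hj IH)) => i [/= hi1 hi2] j'; rewrite inE => /orP[/eqP ->|]; last exact: hi2.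
  by rewrite linearB mod_distC.
have [i [/= h1 h2]] := uf_n0 uF (uf_I uF hD (H1 (enum 'I_m))).
by exists (f i) => // j; rewrite modE ltcR; apply: h2; rewrite mem_enum.
Qed.

Hypothesis faithful : forall z, phi (star z * z) = 0 -> z = 0.
Hypothesis dense : forall a, cl (alg x 0) a.

Definition pren (f : nat -> nat) (P : seq (R[i] * seq nat)) := [seq (q.1, map f q.2) | q <- P].

Lemma phi_pren n f P : finperm n f ->
  forall c d, cl (alg x n) c -> cl (alg x n) d ->
  phi (c * ev x (pren f P) * d) = phi (c * ev x P * d).
Proof.
move=> hf c d hc hd; elim: P => [|q P IH] //=.
rewrite !ev_cons !mulrDr !mulrDl !linearD IH /= -!scalerAr -!scalerAl !linearZ /=.
congr (_ * _ + _); have := @perm_inv n f (inr c :: wt q.2 ++ [:: inr d]) hf.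
rewrite /= ren_cat ren_wt /= !evn_cons !evn_cat !evn_wt !evn_cons evn_nil mulr1 !mulrA; apply.
by move=> b; rewrite coefs_cat coefs_wt !inE => /orP[/eqP ->|/eqP ->].
Qed.

Definition pmul (P P' : seq (R[i] * seq nat)) := [seq (q.1 * q'.1, q.2 ++ q'.2) | q <- P, q' <- P'].
Definition pstar (P : seq (R[i] * seq nat)) := [seq ((q.1)^*, rev q.2) | q <- P].

Lemma ev_pmul P P' : ev x (pmul P P') = ev x P * ev x P'.
Proof.
rewrite /ev big_allpairs_dep mulr_suml; apply: eq_bigr => q _.
rewrite mulr_sumr; apply: eq_bigr => q' _.
by rewrite X_cat -scalerAl -scalerAr scalerA.
Qed.

Lemma ev_pstar P : ev x (pstar P) = star (ev x P).
Proof.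
by rewrite /ev big_map star_sum; apply: eq_bigr => q _; rewrite starZ (star_X hx).
Qed.

Lemma pren_mul f P P' : pren f (pmul P P') = pmul (pren f P) (pren f P').
Proof.
rewrite /pren /pmul map_allpairs allpairs_mapl allpairs_mapr.
by apply: eq_allpairs => // q q'; rewrite /= map_cat.
Qed.

Lemma pren_star f P : pren f (pstar P) = pstar (pren f P).
Proof. by rewrite /pren /pstar -!map_comp; apply: eq_map => q /=; rewrite map_rev. Qed.

Lemma cl_alg1 n : cl (alg x n) 1.
Proof. exact/cl_sub/alg1. Qed.

(** [strong_dense] approximates [w] by polynomials in the GNS seminorm, and [cross_le] controls the
    change of [phi (star w * h * w)]. *)
Lemma pos_dense h : (forall p, alg x 0 p -> 0 <= Re (phi (star p * h * p))) ->
  forall w : A, 0 <= Re (phi (star w * h * w)).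
Proof.
move=> hp w; rewrite leNgt; apply/negP => lt.
pose r := - Re (phi (star w * h * w)).
have r0 : 0 < r by rewrite oppr_gt0.
have [U uU Uc] := nat_uf.
pose B := 2 * (n2 phi w + 1); have n20 := n2_ge0 w hphi.
have h0 := cnorm_ge0 h.
pose q := r / (4 * (cnorm h + 1)); have q0 : 0 < q by rewrite divr_gt0 // mulr_gt0 //; lra.
pose dl := Num.min 1 (q ^+ 2 / B).
have B0 : 0 < B by rewrite /B; lra.
have dl0 : 0 < dl by rewrite lt_min ltr01 divr_gt0 // exprn_gt0.
have [D0 Dl _ _] := alg_subalgebra hx 0.
have [p Dp] := strong_dense ro_f ro_bic uU Uc hphi wphi D0 (fun k : R => Dl k%:C) (dense w) [:: 1] dl0.
rewrite big_seq1 mulr1 => hd.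
have hd1 : n2 phi (w - p) < 1 by apply: lt_le_trans hd _; rewrite ge_min lexx.
have np : n2 phi p <= B.
  have := n2_tri w (- (w - p)) hphi; rewrite n2N opprB addrC subrK => h1.
  by apply: le_trans h1 _; rewrite /B ler_pM2l //; lra.
have nw : n2 phi w <= B by rewrite /B; lra.
have := cross_le h hphi nw np (ltW hd); set m := mod _ => hm.
have hs : Num.sqrt (dl * B) <= q.
  rewrite -[q]ger0_norm ?(ltW q0) // -sqrtr_sqr ler_wsqrtr //.
  by rewrite -ler_pdivlMr // ge_min lexx orbT.
have := Re_le_mod (phi (star w * h * w) - phi (star p * h * p)); rewrite -/m ReD ReN => hR.
have := ler_norm (- (Re (phi (star w * h * w)) - Re (phi (star p * h * p)))).
rewrite normrN => hn; have := hp p Dp.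
have : cnorm h * Num.sqrt (dl * B) <= r / 4.
  apply: le_trans (_ : cnorm h * q <= _); first by rewrite ler_wpM2l.
  have e : (cnorm h + 1) * q = r / 4 by rewrite /q; field; rewrite gt_eqF //; lra.
  rewrite -e; nra.
move: hm hn hR; rewrite -[Re (phi (star w * h * w))]opprK -/r.
move: (cnorm h * _) (Re _) m => X Y m; lra.
Qed.

(** A renaming that preserves [phi] is isometric for the GNS seminorm on polynomials. These are
    dense, and the norm of A is the operator norm on the GNS space by [norm_detect], whence a
    contraction. Without such bounds [wcompact] could not be applied to shifted words. *)
Lemma pren_norm_of f P : involutive f -> (forall P', phi (ev x (pren f P')) = phi (ev x P')) ->
  (forall z, (forall b, phi (star (z * b) * (z * b)) = 0) -> z = 0) ->
  cnorm (ev x (pren f P)) <= cnorm (ev x P).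
Proof.
move=> ff phr nd; set y := ev x (pren f P); set z := ev x P.
apply: (@norm_detect R A [set th | exists b, th = fun a => phi (star b * a * b)] y (cnorm z)).
- split=> [th [b ->]|th w [b ->]|w h].
  + exact: (pf_conj b hphi).1.
  + exact: (pf_conj b hphi).2.
  by apply: nd => b; have := h _ (ex_intro _ b erefl); rewrite starM !mulrA.
- exact: cnorm_ge0.
move=> th w [b ->]; set w' := w * b.
have hW W : n2 phi (y * ev x W) <= cnorm z ^+ 2 * n2 phi (ev x W).
  have WW : pren f (pren f W) = W.
    by rewrite /pren -map_comp map_id_in // => -[c v] _ /=; rewrite -map_comp map_id_in // => i _ /=.
  pose V := pren f W; rewrite -[in X in y * ev x X]WW -/V.
  have -> : n2 phi (y * ev x (pren f V)) = n2 phi (z * ev x V).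
    rewrite /n2 /y /z -!ev_pmul -!ev_pstar -!ev_pmul; congr (Re _).
    by rewrite -(phr (pmul (pstar (pmul P V)) (pmul P V))) !pren_mul !pren_star !pren_mul.
  have -> : n2 phi (ev x W) = n2 phi (ev x V).
    rewrite /n2 -!ev_pstar -!ev_pmul -(phr (pmul _ _)) pren_mul pren_star.
    by rewrite -/V.
  exact: pf_bound.
pose h := (cnorm z ^+ 2)%:C *: 1 - star y * y.
have hE v : phi (star v * h * v) = (cnorm z ^+ 2 * n2 phi v - n2 phi (y * v))%:C.
  have e1 := n2E v hphi; have e2 := n2E (y * v) hphi; rewrite starM !mulrA in e2.
  rewrite /h mulrBr mulrBl linearB /= -scalerAr mulr1 -scalerAl linearZ /= !mulrA e1 e2.
  by rewrite -rmorphM -rmorphB.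
have : 0 <= Re (phi (star w' * h * w')).
  apply: pos_dense => p [P' _ ->]; rewrite hE /= subr_ge0; exact: hW.
have e1 := n2E w' hphi; have e2 := n2E (y * w') hphi; rewrite /w' !starM !mulrA in e1 e2.
by rewrite hE /= subr_ge0 /w' !mulrA e1 e2 -rmorphM lecR.
Qed.

Lemma pren_norm n f P : finperm n f -> cnorm (ev x (pren f P)) <= cnorm (ev x P).
Proof.
move=> hf; apply: pren_norm_of => [|P'|z h]; first by case: hf.
  by have := phi_pren P' hf (@cl_alg1 n) (@cl_alg1 n); rewrite !mul1r !mulr1.
by apply: faithful; have := h 1; rewrite mulr1.
Qed.

Definition tail a := forall n, cl (alg x n) a.

Lemma tail_subalgebra : star_subalgebra tail.
Proof.
have h n := cl_star_subalgebra ro_f ro_bic (alg_subalgebra hx n).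
split=> [n|c a b ha hb n|a b ha hb n|a ha n]; have [h0 h1 h2 h3] := h n.
- exact: h0.
- exact: h1.
- exact: h2.
- exact: h3.
Qed.

Lemma tail_closed : sigma_weak_closed tail.
Proof.
move=> a h n; apply: cl_idem => m psi e hp e0; have [b hb hab] := h m psi e hp e0.
by exists b => //; exact: hb.
Qed.

Lemma tail1 : tail 1.
Proof. by move=> n; exact: cl_alg1. Qed.

Lemma tail_uniq e e' : tail e -> tail e' -> (forall b, tail b -> phi (b * e) = phi (b * e')) -> e = e'.
Proof.
move=> te te' h; have [_ hl _ hs] := tail_subalgebra.
have td : tail (e - e') by have := hl (-1) e' e te' te; rewrite scaleN1r addrC.
apply/eqP; rewrite -subr_eq0; apply/eqP/faithful.
by rewrite mulrBr linearB /= h ?subrr //; exact: hs.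
Qed.

(** Characterises the value of the expectation at [a]: faithfulness gives uniqueness on the tail,
    and linearity follows from uniqueness. *)
Definition is_ce a e := tail e /\ forall b b', tail b -> tail b' -> phi (b * e * b') = phi (b * a * b').

(** All letters of P are pushed to infinity by exchanging larger and larger blocks. A weak limit
    lies in the tail; tail elements are coefficients beyond every block, so [phi (b * _ * b')] is
    unchanged on the way. The norm bound is what permits passing to general elements. *)
Lemma ce_poly P : exists2 e, is_ce (ev x P) e & cnorm e <= cnorm (ev x P).
Proof.
have [U uU Uc] := nat_uf.
pose f n := ev x (pren (swp n.+1) P).
have fM n : cnorm (f n) <= cnorm (ev x P).
  by apply: (pren_norm _ (swp_perm n)).
have [e ne he] := wcompact ro_f ro_bic uU fM; exists e => //; split.
  move=> n; apply: (cl_wlim uU fM he).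
  pose N := (\max_(q <- P) \max_(i <- q.2) i.+1)%N.
  apply: (uf_S uU (Uc (n + N)%N)) => m /= hm.
  exists (pren (swp m.+1) P) => //; rewrite all_map; apply/allP => q qP /=.
  rewrite /far all_map; apply/allP => i iq /=.
  have hi : (i < N)%N.
    apply: leq_trans (_ : \max_(i <- q.2) i.+1 <= _)%N; first by rewrite (big_rem i) //= leq_maxl.
    by rewrite /N (big_rem q) //= leq_maxl.
  by rewrite /swp; case: ifP; lia.
move=> b b' tb tb'.
apply: (flim_uniq uU (wcont_mul ro_f b b' wphi uU fM he)).
apply: (flim_ext uU _ (flimC uU _)) => n.
by apply/esym/(phi_pren P (swp_perm n)).
Qed.

(** If z is a weak limit of the bounded sequence, Cauchy-Schwarz gives phi ((a - z)^* (a - p_k)) ->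
    0, hence phi ((a - z)^* (a - z)) = 0, and [phi] is faithful. *)
Lemma wlim_n2 (U : set (set nat)) (p : nat -> A) (M : R) a : uf U ->
  (forall N, U [set n | (N <= n)%N]) -> (forall k, cnorm (p k) <= M) ->
  (forall k, n2 phi (a - p k) < k.+1%:R^-1) -> wlim ro U p a.
Proof.
move=> uU Uc pM pn; have [z nz hz] := wcompact ro_f ro_bic uU pM.
suff -> : a = z by [].
apply/eqP; rewrite -subr_eq0; apply/eqP/faithful.
have h := flimB uU (flimC uU (phi (star (a - z) * a * 1))) (wcont_mul ro_f (star (a - z)) 1 wphi uU pM hz).
have E : phi (star (a - z) * (a - z)) = phi (star (a - z) * a * 1) - phi (star (a - z) * z * 1).
  by rewrite -linearB !mulr1 -mulrBr.
rewrite E; apply: (flim_uniq uU h) => e e0.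
have c0 := n2_ge0 (a - z) hphi; set c := n2 phi (a - z) in c0.
pose k0 := Num.truncn ((c + 1) / e ^+ 2).
apply: (uf_S uU (Uc k0)) => k /= hk; rewrite subr0 -linearB !mulr1 -mulrBr.
rewrite -(@ltr_pXn2r _ 2) ?nnegrE ?mod_ge0 ?(ltW e0) //.
apply: le_lt_trans (pCS _ _ hphi) _; rewrite -/c.
have h1 : (c + 1) / e ^+ 2 < k.+1%:R.
  by apply: lt_le_trans (truncnS_gt _) _; rewrite ler_nat.
have k1 : 0 < k.+1%:R :> R by rewrite ltr0n.
have e2 : 0 < e ^+ 2 by rewrite exprn_gt0.
apply: le_lt_trans (_ : k.+1%:R^-1 * c < _); first by rewrite ler_wpM2r // ltW.
rewrite mulrC ltr_pdivrMr //; move: h1; rewrite ltr_pdivrMr // mulrC; lra.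
Qed.

(** Bounded polynomials converge to [a] by [kaplansky]; the expectations of these polynomials are
    bounded too, and a weak limit of them is the expectation of [a]. *)
Lemma ce_ex a : exists e, is_ce a e.
Proof.
have [U uU Uc] := nat_uf; have [D0 Dl DM DS] := alg_subalgebra hx 0.
have H1 (k : nat) : exists q : seq (R[i] * seq nat) * A,
    [/\ cnorm (ev x q.1) <= 4 * (cnorm a + 1), n2 phi (a - ev x q.1) < k.+1%:R^-1,
      is_ce (ev x q.1) q.2 & cnorm q.2 <= 4 * (cnorm a + 1)].
  have k0 : 0 < (k.+1%:R^-1 : R) by rewrite invr_gt0 ltr0n.
  have [p [[P _ ->] np]] := kaplansky ro_f ro_bic a [:: 1] hphi wphi (alg_subalgebra hx 0)
    (alg1 x 0) dense k0.
  rewrite big_seq1 mulr1 => hp; have [e he ne] := ce_poly P.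
  by exists (P, e); split=> //; exact: le_trans ne np.
have [q hq] := choice H1.
have pM k : cnorm (ev x (q k).1) <= 4 * (cnorm a + 1) by case: (hq k).
have eM k : cnorm (q k).2 <= 4 * (cnorm a + 1) by case: (hq k).
have pa : wlim ro U (fun k => ev x (q k).1) a.
  by apply: (wlim_n2 uU Uc pM) => k; case: (hq k).
have [e _ he] := wcompact ro_f ro_bic uU eM.
exists e; split=> [n|b b' tb tb'].
  apply: cl_idem; apply: (cl_wlim (D := cl (alg x n)) uU eM he).
  by apply: (uf_T uU) => k; case: (hq k) => _ _ [h _] _; exact: h.
apply: (flim_uniq uU (wcont_mul ro_f b b' wphi uU eM he)).
apply: (flim_ext uU _ (wcont_mul ro_f b b' wphi uU pM pa)) => k.
by case: (hq k) => _ _ [_ h] _; rewrite h.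
Qed.

Definition ce_fun := projT1 (choice ce_ex).

Lemma ce_funP a : is_ce a (ce_fun a).
Proof. exact: (projT2 (choice ce_ex) a). Qed.

Lemma ce_fun_uniq a e : is_ce a e -> ce_fun a = e.
Proof.
move=> [te he]; have [tc hc] := ce_funP a; apply: tail_uniq => // b tb.
by have := hc b 1 tb tail1; rewrite -(he b 1 tb tail1) !mulr1.
Qed.

Lemma ce_fun_linear : linear ce_fun.
Proof.
move=> c a b; apply: ce_fun_uniq; have [ta ha] := ce_funP a; have [tb hb] := ce_funP b.
have [_ hl _ _] := tail_subalgebra; split; first exact: hl.
move=> d d' td td'; rewrite !mulrDr !mulrDl -!scalerAr -!scalerAl !linearP /=.
by rewrite ha // hb.
Qed.

HB.instance Definition _ := GRing.isLinear.Build R[i] A A *:%R ce_fun ce_fun_linear.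

Definition ce : {linear A -> A} := ce_fun.

Lemma ce_tail a : tail (ce a).
Proof. by case: (ce_funP a). Qed.

Lemma ce_phi a : phi (ce a) = phi a.
Proof. by have [_ h] := ce_funP a; have := h 1 1 tail1 tail1; rewrite !mul1r !mulr1. Qed.

Lemma ce_conditional : conditional_expectation tail ce.
Proof.
have [_ hl hm _] := tail_subalgebra; split; first exact: ce_tail.
  by move=> b tb; apply: ce_fun_uniq; split.
move=> b1 a b2 t1 t2; apply: ce_fun_uniq; split; first by exact: (hm _ _ (hm _ _ t1 (ce_tail a)) t2).
move=> b b' tb tb'; have [_ h] := ce_funP a.
have E y : b * (b1 * y * b2) * b' = (b * b1) * y * (b2 * b') by rewrite !mulrA.
by rewrite !E (h _ _ (hm _ _ tb t1) (hm _ _ t2 tb')).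
Qed.

Lemma x_norm i : cnorm (x i) <= cnorm (x 0%N).
Proof.
have := pren_norm [:: (1, [:: 0%N])] (transp_perm 0 i).
by rewrite /ev !big_seq1 /= !scale1r !X1 transpL.
Qed.

Definition bd t : R := \prod_(s <- t) match s with inl _ => cnorm (x 0%N) | inr b => cnorm b end.

Lemma evn_ren_norm f t : cnorm (evn (ren f t)) <= bd t.
Proof.
elim: t => [|s t IH]; first by rewrite evn_nil /bd big_nil cnorm1.
rewrite /= evn_cons /bd big_cons -/(bd t); apply: le_trans (cnormM _ _) _.
apply: ler_pM; rewrite ?cnorm_ge0 //; case: s => [i|b] //=; exact: x_norm.
Qed.

Lemma tail_perm n f t : finperm n f -> {in coefs t, forall b, tail b} ->
  phi (evn (ren f t)) = phi (evn t).
Proof.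
by move=> hf ht; apply: (perm_inv hf) => b /ht; apply.
Qed.

Lemma tail_evn n t : all (leq n) (letters t) -> {in coefs t, forall b, tail b} ->
  cl (alg x n) (evn t).
Proof.
have [h0 h1 h2 h3] := cl_star_subalgebra ro_f ro_bic (alg_subalgebra hx n).
elim: t => [|[i|b] t IH] /=; rewrite ?evn_nil ?evn_cons.
- by move=> *; exact: cl_alg1.
- move=> /andP[hi hl] hc; apply: (h2); last exact: IH.
  by apply: cl_sub; rewrite -X1; apply: span_wX; rewrite /far /= hi.
- move=> hl hc; apply: (h2); first by apply: hc; rewrite inE eqxx.
  by apply: IH => // b' hb'; apply: hc; rewrite inE hb' orbT.
Qed.

Lemma seq_bound (s : seq nat) : exists M, all (gtn M) s.
Proof.
exists (\max_(i <- s) i.+1)%N; apply/allP => i hi /=.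
by rewrite (big_rem i) //= leq_maxl.
Qed.

(** The letters of [y] occur nowhere else, so [lift] carries them to infinity without touching [t1]
    and [t2]. The value of [phi] does not change, and the moved [y] converges weakly to its
    expectation. *)
Lemma fresh t1 (y : seq (nat + A)) t2 : {in coefs (t1 ++ y ++ t2), forall b, tail b} ->
  {in letters y, forall i, (i \notin letters t1) && (i \notin letters t2)} ->
  phi (evn (t1 ++ y ++ t2)) = phi (evn t1 * ce (evn y) * evn t2).
Proof.
move=> hc hl; have [U uU Uc] := nat_uf.
have [M hM] := seq_bound (letters (t1 ++ y ++ t2)).
pose f n := lift (M + n).+1 (letters y).
have lyM n : all (gtn (M + n).+1) (letters y).
  apply: sub_all (_ : all (gtn M) (letters y)); first by move=> i /=; lia.
  by move: hM; rewrite !letters_cat !all_cat => /and3P[].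
have fid n t : all (gtn M) (letters t) -> (forall i, i \in letters t -> i \notin letters y) ->
    ren (f n) t = t.
  move=> /allP /= h1 h2; apply: ren_id => i hi; rewrite /f /lift (negbTE (h2 i hi)) ifF //.
  by apply/negP => /andP[]; have := h1 i hi; lia.
have fM n : cnorm (evn (ren (f n) y)) <= bd y by exact: evn_ren_norm.
have [e ne he] := wcompact ro_f ro_bic uU fM.
have cy : {in coefs y, forall b, tail b}.
  by move=> b hb; apply: hc; rewrite !coefs_cat !mem_cat hb orbT.
have -> : ce (evn y) = e.
  apply: ce_fun_uniq; split.
    move=> n; apply: cl_idem; apply: (cl_wlim (D := cl (alg x n)) uU fM he).
    apply: (uf_S uU (Uc n)) => m /= nm; apply: tail_evn; last by rewrite coefs_ren.
    rewrite letters_ren all_map; apply/allP => i hi /=; rewrite /f /lift hi; lia.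
  move=> b b' tb tb'; apply: (flim_uniq uU (wcont_mul ro_f b b' wphi uU fM he)).
  apply: (flim_ext uU _ (flimC uU _)) => n.
  have := @tail_perm _ _ (inr b :: y ++ [:: inr b']) (lift_perm (ltn0Sn _) (lyM n)).
  rewrite /= ren_cat /= !evn_cons !evn_cat !evn_cons !evn_nil !mulr1 !mulrA => -> // b''.
  by rewrite coefs_cat inE mem_cat /= inE => /or3P[/eqP ->|/cy|/eqP ->].
apply: (flim_uniq uU _ (wcont_mul ro_f (evn t1) (evn t2) wphi uU fM he)).
apply: (flim_ext uU _ (flimC uU _)) => n.
have := tail_perm (lift_perm (ltn0Sn _) (lyM n)) hc.
move: hM; rewrite !letters_cat !all_cat => /and3P[m1 _ m2].
rewrite !ren_cat (fid n t1) // ?(fid n t2) //.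
- by rewrite !evn_cat mulrA => ->.
- by move=> i hi; apply/negP => /hl /andP[_]; rewrite hi.
- by move=> i hi; apply/negP => /hl /andP[]; rewrite hi.
Qed.

Lemma tail_pair (Q : cstarType R) N (s s' : nat -> Q) t : (0 < N)%N ->
  (forall i, projection (s i) /\ s i + s' i = 1) -> all (gtn N) (letters t) ->
  {in coefs t, forall b, tail b} ->
  Pair N s s' (fun y => phi y *: 1) t = phi (evn t) *: 1.
Proof.
move=> N0 hs ht hc; apply: (pair_inv N0 hs ht).
by move=> b /hc; apply.
Qed.

End FreeExpectation.

(** * Crossings and alternating products of projections *)

Notation bool_pairs := [:: (false, false); (false, true); (true, false); (true, true)].

Lemma half_C (R : realType) : (2^-1 : R)%:C = 2^-1 :> R[i].
Proof. by rewrite fmorphV /= natC. Qed.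

Section Crossing.

(** The number of places where two neighbours differ; it does not increase under passage to a
    subsequence. *)
Fixpoint chg (zs : seq bool) : nat :=
  if zs is z :: zs' then (if zs' is z' :: _ then (z != z' : nat) else 0) + chg zs' else 0.

Lemma chg_cons z y zs : chg (z :: y :: zs) = ((z != y) + chg (y :: zs))%N.
Proof. by []. Qed.

Lemma chg_subseq (s1 s2 : seq bool) z1 z2 : subseq (z1 :: s1) (z2 :: s2) ->
  (chg (z1 :: s1) + (z1 != z2) <= chg (z2 :: s2))%N.
Proof.
elim: s2 s1 z1 z2 => [|z s2 IH] s1 z1 z2 /=.
  by case: (eqVneq z1 z2) => [->|_] //; case: s1.
case: (eqVneq z1 z2) => [->|n12] /=.
  rewrite addn0; case: s1 => [|z' s1] //= h.
  have := IH _ _ _ h => /=.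
  case: z z2 z' {h} => -[] [] /=; lia.
move=> h; have := IH _ _ _ h => /=.
by case: z z1 z2 n12 {h} => -[] [] //=; lia.
Qed.

Lemma chg_klkl (zs : seq bool) : subseq [:: true; false; true; false] zs -> (3 <= chg zs)%N.
Proof. by case: zs => // z zs h; have := chg_subseq h; rewrite /=; lia. Qed.

(** Take two equal letters k at minimal distance. They are not neighbours, so some l follows the
    first one; l occurs a second time, and by minimality not between the two k, so outside, which is
    a crossing. *)
Lemma crossing_exists (s : seq nat) : s != [::] -> sorted (fun i j => i != j) s ->
  (forall i, i \in s -> (1 < count_mem i s)%N) ->
  exists k l, k != l /\ subseq [:: k; l; k; l] s.
Proof.
move=> s0 so hc.
pose Pr m := [exists i : 'I_(size s), exists j : 'I_(size s),
  [&& (i < j)%N, nth 0%N s i == nth 0%N s j & (j - i == m)%N]].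
have exP : exists m, Pr m.
  case: s s0 so hc @Pr => // k s _ _ hc Pr; have := hc k (mem_head _ _).
  rewrite /= eqxx ltnS -has_count => /hasP[k' hk /eqP e].
  rewrite e in hk; have hi : (index k s < size s)%N by rewrite index_mem.
  exists (index k s).+1; apply/existsP; exists ord0; apply/existsP.
  by exists (Ordinal (hi : (index k s).+1 < (size s).+1)%N); rewrite /= subn0 nth_index ?eqxx.
have [m /existsP[i /existsP[j /and3P[ij /eqP eij /eqP jm]]] mmin] := ex_minnP exP.
have hnext a : (a.+1 < size s)%N -> nth 0%N s a != nth 0%N s a.+1.
  by move=> ha; move: so => /(sortedP 0%N); apply.
have ij1 : (i.+1 < j)%N.
  rewrite ltn_neqAle ij andbT; apply/eqP => e.
  by have := hnext i; rewrite e ltn_ord eij eqxx => /(_ isT).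
pose l := nth 0%N s i.+1; pose k := nth 0%N s i.
have i1 : (i.+1 < size s)%N := ltn_trans ij1 (ltn_ord j).
have kl : k != l by exact: hnext.
have [q [qi qs ql]] : exists q, [/\ q != i.+1, (q < size s)%N & nth 0%N s q = l].
  have := hc l (mem_nth _ i1); rewrite -{1}(cat_take_drop i.+1 s) (drop_nth 0%N i1) count_cat /= eqxx.
  move=> hh; have : ((0 < count_mem l (take i.+1 s)) || (0 < count_mem l (drop i.+2 s)))%N.
    by rewrite -addn_gt0; move: hh; rewrite addnCA add1n ltnS.
  case/orP; rewrite -has_count => /hasP[l' hl /eqP e]; rewrite e in hl.
    exists (index l (take i.+1 s)); have h1 : (index l (take i.+1 s) < i.+1)%N.
      by rewrite -{2}(size_takel (ltnW i1)) index_mem.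
    split; [by rewrite neq_ltn h1|exact: ltn_trans h1 i1|by rewrite -(nth_take 0%N h1) nth_index].
  exists (i.+2 + index l (drop i.+2 s))%N; rewrite -nth_drop nth_index //; split=> //.
    by rewrite neq_ltn orbC -[X in (X < _)%N]addn0 /= addSnnS; lia.
  have : (index l (drop i.+2 s) < size (drop i.+2 s))%N by rewrite index_mem.
  by rewrite size_drop; lia.
have sub4 a b c d : (a < b)%N -> (b < c)%N -> (c < d)%N -> (d < size s)%N ->
    subseq [:: nth 0%N s a; nth 0%N s b; nth 0%N s c; nth 0%N s d] s.
  move=> ab bc cd ds; rewrite -[X in subseq _ X](mkseq_nth 0%N) /mkseq.
  apply: (@map_subseq _ _ (nth 0%N s) [:: a; b; c; d]).
  have h : subseq [:: a; b; c; d] (iota 0 (size s)).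
    have -> : [:: a; b; c; d] = [seq v <- iota 0 (size s) | v \in [:: a; b; c; d]].
      apply: (@irr_sorted_eq _ ltn ltn_trans ltnn) => //=.
      - by rewrite ab bc cd.
      - exact/(sorted_filter ltn_trans)/iota_ltn_sorted.
      move=> v; rewrite mem_filter mem_iota /= add0n !inE.
      apply/idP/andP => [h|[]//]; split=> //; move: h => /or4P[] /eqP ->; lia.
    exact: filter_subseq.
  exact: h.
(* A second l inside would form a pair of equal letters closer than i and j. *)
have qout : (q < i)%N || (j < q)%N.
  rewrite -[_ || _]negbK negb_or -!leqNgt; apply/negP => /andP[iq qj].
  have qn : q != i by apply/eqP => e; move: kl; rewrite /k -e ql eqxx.
  have qnj : q != j by apply/eqP => e; move: kl; rewrite /k eij -e ql eqxx.
  have iq' : (i.+1 < q)%N by rewrite ltn_neqAle eq_sym qi ltn_neqAle eq_sym qn iq.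
  have : (m <= q - i.+1)%N.
    apply: mmin; apply/existsP; exists (Ordinal i1); apply/existsP; exists (Ordinal qs).
    by rewrite /= iq' ql !eqxx.
  by move: jm qj qnj; lia.
case/orP: qout => hq.
  exists l, k; rewrite eq_sym; split=> //.
  by have := @sub4 q i i.+1 j hq (ltnSn _) ij1 (ltn_ord j); rewrite ql -eij.
exists k, l; split=> //.
by have := @sub4 i i.+1 j q (ltnSn _) ij1 hq qs; rewrite ql -eij.
Qed.

End Crossing.

Section Alternating.
Variables (R : realType) (Q : cstarType R) (M : bool -> bool -> Q).
Hypothesis MM : forall z a, M z a * M z a = M z a.
Hypothesis Msum : forall z, M z false + M z true = 1.
Hypothesis Malt : forall z a b, M z a * M (~~ z) b * M z a = (2^-1 : R)%:C *: M z a.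

(** Two changes lead back to the same projection and cost one factor 1/2, by [Malt]. What remains is
    one projection, or a product of two when the number of changes is odd. *)
Lemma alt_prod (zs : seq bool) z (ab : bool -> bool) :
  \prod_(y <- z :: zs) M y (ab y) = ((2^-1 : R) ^+ (chg (z :: zs))./2)%:C *:
    (M z (ab z) * (if odd (chg (z :: zs)) then M (~~ z) (ab (~~ z)) else 1)).
Proof.
elim: zs z => [|y zs IH] z; first by rewrite big_seq1 /= expr0 scale1r mulr1.
rewrite big_cons IH -scalerAr.
have [->|zy] := eqVneq z y; first by rewrite chg_cons eqxx add0n mulrA MM.
have ey : y = ~~ z by case: z y zy => -[].
rewrite chg_cons zy add1n ey negbK; move: (chg _) => d.
rewrite /= uphalf_half; case: (odd d) => /=.
  by rewrite mulrA Malt add1n exprS rmorphM mulr1 scalerA mulrC.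
by rewrite add0n mulr1.
Qed.

(** The sum over the four choices contributes 2 for an even number of changes and 1 for an odd one.
    The value is 1 at d = 1 and d = 2 and below 1 from d = 3 on, the number of changes in k l k
    l. *)
Definition gam d : R := (2^-1) ^+ d./2 * (if odd d then 1 else 2).

Lemma gam_lt1 d : (3 <= d)%N -> gam d < 1.
Proof.
move=> d3; rewrite /gam; have e := odd_double_half d.
case: (odd d) e => /= e.
  rewrite mulr1 exprn_ilt1 //; last by lra.
  by lia.
have [k ->] : exists k, d./2 = k.+2 by exists (d./2 - 2)%N; lia.
rewrite exprS; have : (2^-1 : R) ^+ k.+1 < 1 by rewrite exprn_ilt1 //; lra.
lra.
Qed.

Lemma alt_sum (zs : seq bool) z :
  \sum_(ab <- bool_pairs)
     \prod_(y <- z :: zs) M y (if y then ab.1 else ab.2) = (gam (chg (z :: zs)))%:C *: 1.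
Proof.
under eq_bigr => ab _ do rewrite (alt_prod zs z (fun y => if y then ab.1 else ab.2)).
rewrite !big_cons big_nil addr0 -!scalerDr /gam rmorphM -scalerA.
congr (_ *: _); case: (odd _).
  rewrite rmorph1 scale1r; have Mt := Msum true; have Mf := Msum false.
  case: z => /=.
    by rewrite addrA -mulrDr Mf mulr1 -mulrDr Mf mulr1 Mt.
  rewrite [X in _ + X]addrCA !addrA -mulrDr Mt mulr1 -addrA -mulrDr Mt mulr1.
  exact: Mf.
rewrite !mulr1 /= natC scaler_nat mulr2n.
case: z => /=; have Mt := Msum true; have Mf := Msum false.
  by rewrite addrA -!mulr2n -mulrnDl Mt.
by rewrite addrA !Mf.
Qed.

End Alternating.

(** * Vanishing of crossing patterns *)

Section CrossingZero.
Variable (R : realType).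

Fixpoint bs n : seq (seq bool) :=
  if n is n'.+1 then map (cons false) (bs n') ++ map (cons true) (bs n') else [:: [::]].

Lemma mem_bs n (c : seq bool) : (c \in bs n) = (size c == n).
Proof.
elim: n c => [|n IH] [|q c] //=.
  by rewrite mem_cat; apply/negP => /orP[] /mapP[].
have h q' : (q :: c \in map (cons q') (bs n)) = (q == q') && (size c == n).
  by apply/mapP/andP => [[v hv [-> ->]]|[/eqP -> h]]; [rewrite eqxx -IH|exists c; rewrite ?IH].
by rewrite mem_cat !h eqSS; case: q {h}; rewrite /= ?orbF.
Qed.

Lemma uniq_bs n : uniq (bs n).
Proof.
elim: n => [|n IH] //=; rewrite cat_uniq !map_inj_uniq ?IH /=; try by move=> v v' [].
by rewrite andbT; apply/hasPn => _ /mapP[v _ ->]; apply/negP => /mapP[].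
Qed.

Lemma sum_img (Q : cstarType R) (I : eqType) (r r' : seq I) (T : I -> Q) : uniq r -> uniq r' ->
  {subset r' <= r} -> (forall i, i \in r -> i \notin r' -> T i = 0) ->
  \sum_(i <- r) T i = \sum_(i <- r') T i.
Proof.
move=> ur ur' sr hT; rewrite (bigID (mem r')) /= [X in _ + X]big_seq_cond.
rewrite [X in _ + X]big1 ?addr0; last by move=> i /andP[]; exact: hT.
rewrite -big_filter; apply/perm_big/uniq_perm => //; first exact: filter_uniq.
by move=> i; rewrite mem_filter; apply/andP/idP => [[]//|h]; split=> //; exact: sr.
Qed.

Lemma undup_strict (r : nat -> nat) (l : seq nat) u v : u \in l -> v \in l -> u != v -> r u = r v ->
  (size (undup (map r l)) < size (undup l))%N.
Proof.
move=> hu hv uv ruv.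
apply: leq_ltn_trans (_ : size (map r (rem v (undup l))) < _)%N.
  apply: uniq_leq_size; first exact: undup_uniq.
  move=> j; rewrite mem_undup => /mapP[i hi ->].
  have [->|iv] := eqVneq i v; last by rewrite map_f // mem_rem_uniq ?undup_uniq // inE iv mem_undup.
  by rewrite -ruv map_f // mem_rem_uniq ?undup_uniq // inE uv mem_undup.
rewrite size_map size_rem ?mem_undup // prednK //.
by case: (undup l) (mem_undup l v) => //; rewrite hv in_nil.
Qed.

(** Projections of M_2 on the vectors of two orthonormal bases at an angle of 45 degrees: the
    coordinate basis for [z = true], and the vectors (1, 1) and (1, -1), normalised, for
    [z = false]. *)
Definition pq (z a : bool) : Mat R 1 :=
  \matrix_(i, j) (if z then ((i == j :> nat) && (i == (nat_of_bool a) :> nat))%:R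
                  else 2^-1 * (if (i == j :> nat) then 1 else if a then -1 else 1)).

Lemma pq_sum (z : bool) : pq z false + pq z true = 1.
Proof.
apply/matrixP => i j; rewrite !mxE -val_eqE.
by case: z; case: i => -[|[|[]]] //= hi; case: j => -[|[|[]]] //= hj; field.
Qed.

Lemma pq_alt (z a b : bool) : pq z a * pq (~~ z) b * pq z a = (2^-1 : R)%:C *: pq z a.
Proof.
apply/matrixP => i j; rewrite half_C !mxE !big_ord_recl !big_ord0 !mxE !big_ord_recl !big_ord0 !mxE /=.
by case: z a b => -[] []; case: i => -[|[|[]]] //= hi; case: j => -[|[|[]]] //= hj; field.
Qed.

Lemma pq_idem (z a : bool) : pq z a * pq z a = pq z a.
Proof.
apply/matrixP => i j; rewrite !mxE !big_ord_recl !big_ord0 !mxE /=.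
by case: z a => -[]; case: i => -[|[|[]]] //= hi; case: j => -[|[|[]]] //= hj; field.
Qed.

Lemma pq_star (z a : bool) : star (pq z a) = pq z a.
Proof.
apply/matrixP => i j; rewrite !mxE [(j == i :> nat)]eq_sym.
have -> : ((i == j :> nat) && (j == (nat_of_bool a) :> nat)) = ((i == j :> nat) && (i == (nat_of_bool a) :> nat)).
  by case: eqP => [->|].
apply/CrealP; case: z; first exact: realn.
by rewrite realM ?realV ?realn //; case: ifP => _; rewrite ?real1 //; case: a; rewrite ?realN real1.
Qed.

Lemma prod_zero (Q : cstarType R) (I : eqType) (r : seq I) (T : I -> Q) i : i \in r -> T i = 0 ->
  \prod_(j <- r) T j = 0.
Proof. by move=> /splitPr [r1 r2] h; rewrite big_cat big_cons h /= mul0r mulr0. Qed.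

Lemma pair_index_inj (N a b : nat) (c1 c2 : bool) : (a < N)%N -> (b < N)%N ->
  (if c1 then N + a else a)%N = (if c2 then N + b else b)%N -> a = b.
Proof. by case: c1 c2 => -[]; lia. Qed.

Definition wl N (c : seq bool) (ls : seq nat) := [seq (if q.1 then N + q.2 else q.2)%N | q <- zip c ls].

Definition wprod (Q : cstarType R) (u u' : nat -> Q) (c : seq bool) (ls : seq nat) : Q :=
  \prod_(q <- zip c ls) (if q.1 then u' q.2 else u q.2).

Section Pattern.
Variables (Q : cstarType R) (M : bool -> bool -> Q) (P : Q) (k l : nat).
(** The first halves of the pairs attached to the letters: k carries one resolution of identity, l
    the other, and all other letters the trivial pair (1, 0). *)
Definition cu i : Q := if i == k then M true false else if i == l then M false false else 1.
Definition cu' i : Q := if i == k then M true true else if i == l then M false true else 0.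

(** In the expansion of the pair coaction every letter is kept or shifted by N. Shifting a letter
    other than k and l has coefficient 0. Treating the occurrences of k, or of l, unequally creates
    more distinct letters, and [hmore] removes the term. The four consistent choices are renamings,
    so they all carry the value G ls; their coefficients add up to ga, and G ls = ga G ls with ga <
    1. *)
Lemma pattern_zero (ls : seq nat) (G : seq nat -> R[i]) N (ga : R) : k != l ->
  k \in ls -> l \in ls -> all (gtn N) ls ->
  \sum_(c <- bs (size ls)) wprod cu cu' c ls * (G (wl N c ls) *: P) = G ls *: P ->
  (forall ly, all (gtn N) ly -> G (map (lift N ly) ls) = G ls) ->
  (forall c, size c = size ls -> (size (undup ls) < size (undup (wl N c ls)))%N ->
     wprod cu cu' c ls * (G (wl N c ls) *: P) = 0) ->
  \sum_(ab <- bool_pairs)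
    (\prod_(y <- [seq i == k | i <- ls & (i == k) || (i == l)]) M y (if y then ab.1 else ab.2)) * P = ga%:C *: P ->
  ga < 1 -> P <> 0 -> G ls = 0.
Proof.
move=> kl kls lls hN + hlift hmore halt r1 P0; rewrite /wprod in hmore *.
set u := cu; set u' := cu'.
pose g (ab : bool * bool) i := if i == k then ab.1 else if i == l then ab.2 else false.
pose img := [seq map (g ab) ls | ab <- bool_pairs].
have zipE (h : nat -> bool) : zip (map h ls) ls = [seq (h i, i) | i <- ls].
  by elim: (ls) => //= i s ->.
rewrite (sum_img (r' := img)); first last.
- move=> c; rewrite mem_bs => /eqP hcs cimg; pose zc := zip c ls.
  have c1 : map fst zc = c by rewrite /zc -/(unzip1 _) unzip1_zip // hcs.
  have c2 : map snd zc = ls by rewrite /zc -/(unzip2 _) unzip2_zip // hcs.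
  have [/hasP[q qz /andP[q1 /andP[qk ql]]]|/hasPn hother] := boolP (has (fun q : bool * nat =>
      q.1 && ((q.2 != k) && (q.2 != l))) zc).
    by rewrite (prod_zero qz) ?mul0r // q1 /u' /cu' (negbTE qk) (negbTE ql).
  apply: hmore => //.
  (* Folding the shifted letters back recovers ls and identifies the two copies of m, so the shifted
     word has strictly more distinct letters. *)
  have conf m : m \in [:: k; l] -> (exists2 q, q \in zc & q.1 && (q.2 == m)) ->
      (exists2 q, q \in zc & ~~ q.1 && (q.2 == m)) -> (size (undup ls) < size (undup (wl N c ls)))%N.
    move=> hm [q1 h1 /andP[t1 /eqP e1]] [q2 h2 /andP[t2 /eqP e2]].
    pose r j := if (j < N)%N then j else (j - N)%N.
    have hmN : (m < N)%N by apply: (allP hN); rewrite -e1 -c2; exact: map_f.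
    have eL : ls = map r (wl N c ls).
      rewrite -{1}c2 /wl -/zc -map_comp; apply/eq_in_map => q hq /=; rewrite /r.
      have : (q.2 < N)%N by apply: (allP hN); rewrite -c2; exact: map_f.
      by case: (q.1) => /= h; [rewrite ltnNge leq_addr /= addKn|rewrite h].
    rewrite {1}eL; apply: (@undup_strict r _ (N + m)%N m).
    - by apply/mapP; exists q1 => //; rewrite t1 e1.
    - by apply/mapP; exists q2 => //; rewrite (negbTE t2) e2.
    - by rewrite -[X in _ != X]add0n eqn_add2r -lt0n (leq_ltn_trans _ hmN).
    - by rewrite /r hmN ltnNge leq_addr /= addKn.
  pose tr m := has (fun q : bool * nat => q.1 && (q.2 == m)) zc.
  pose fa m := has (fun q : bool * nat => ~~ q.1 && (q.2 == m)) zc.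
  have [/andP[/hasP h1 /hasP h2]|nk] := boolP (tr k && fa k).
    by apply: (conf k); rewrite ?inE ?eqxx.
  have [/andP[/hasP h1 /hasP h2]|nl] := boolP (tr l && fa l).
    by apply: (conf l); rewrite ?inE ?eqxx ?orbT.
  case/negP: cimg; apply/mapP; exists (tr k, tr l).
    by rewrite !inE; case: (tr k); case: (tr l).
  rewrite -{1}c1 -c2 -map_comp; apply/eq_in_map => q hq /=; rewrite /g /=.
  have gen m : ~~ (tr m && fa m) -> q.2 = m -> q.1 = tr m.
    move=> hn e; case e1 : (q.1); first by apply/esym/hasP; exists q; rewrite ?e1 ?e ?eqxx.
    have fm : fa m by apply/hasP; exists q; rewrite ?e1 ?e ?eqxx.
    by move: hn; rewrite fm andbT => /negbTE ->.
  case: eqP => [|/eqP qk]; first exact: gen.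
  case: eqP => [|/eqP ql]; first exact: gen.
  by have := hother q hq; rewrite /= qk ql /= andbT => /negbTE.
- by move=> c /mapP[ab _ ->]; rewrite mem_bs size_map.
- rewrite map_inj_in_uniq // => -[a b] [a' b'] _ _ /eq_in_map h.
  have := h _ kls; have := h _ lls; rewrite /g /= !eqxx eq_sym (negbTE kl) => -> -> //.
- exact: uniq_bs.
rewrite big_map.
pose zs := [seq i == k | i <- ls & (i == k) || (i == l)].
have WE ab : \prod_(q <- zip (map (g ab) ls) ls) (if q.1 then u' q.2 else u q.2) =
    \prod_(y <- zs) M y (if y then ab.1 else ab.2).
  rewrite zipE big_map /= /zs big_map big_filter [RHS]big_mkcond /=.
  apply: eq_bigr => t _; rewrite /g /u /u' /cu /cu'; case: eqP => _ /=; first by case: (ab.1).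
  by case: eqP => _ /=; first by case: (ab.2).
have phE ab : G (wl N (map (g ab) ls) ls) = G ls.
  pose ly := (if ab.1 then [:: k] else [::]) ++ (if ab.2 then [:: l] else [::]).
  have lyN : all (gtn N) ly.
    by rewrite /ly all_cat; apply/andP; split; case: ifP => //= _; rewrite andbT; apply: (allP hN).
  rewrite -[RHS](hlift ly) //; congr (G _).
  rewrite /wl zipE -map_comp; apply/eq_in_map => t ht /=.
  have tN : (t < N)%N by exact: (allP hN).
  have -> : lift N ly t = if t \in ly then (t + N)%N else t.
    by rewrite /lift [(N <= _)%N]leqNgt tN.
  have -> : (t \in ly) = g ab t.
    rewrite /ly /g mem_cat; case: (eqVneq t k) => [->|nt].
      by case: (ab.1); case: (ab.2); rewrite ?inE ?in_nil ?eqxx ?(negbTE kl).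
    by case: (ab.1); case: (ab.2); rewrite ?inE ?in_nil ?(negbTE nt) //; case: (t == l).
  by rewrite addnC.
under eq_bigr => ab _ do rewrite WE phE -scalerAr.
rewrite -scaler_sumr halt scalerA => e.
have : (G ls * (1 - ga%:C)) *: P = 0 by rewrite mulrBr mulr1 scalerBl e subrr.
move=> h; apply: contrapT => /eqP g0; apply: P0.
have r0 : 1 - ga%:C != 0 :> R[i].
  apply/eqP => hr; have := congr1 (@Re R) hr; rewrite ReD ReN /= => h'.
  by move: r1; lra.
by rewrite -[P]scale1r -(mulVf (mulf_neq0 g0 r0)) -scalerA h scaler0.
Qed.

End Pattern.

(** The instance of [pattern_zero] for the projections [pq]: a subsequence k l k l has three
    changes. *)
Lemma crossing_zero (ls : seq nat) (G : seq nat -> R[i]) N k l : k != l ->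
  subseq [:: k; l; k; l] ls -> all (gtn N) ls ->
  (forall u u' : nat -> Mat R 1, (forall i, projection (u i) /\ u i + u' i = 1) ->
     \sum_(c <- bs (size ls)) wprod u u' c ls * (G (wl N c ls) *: 1) = G ls *: 1) ->
  (forall ly, all (gtn N) ly -> G (map (lift N ly) ls) = G ls) ->
  (forall c, size c = size ls -> (size (undup ls) < size (undup (wl N c ls)))%N -> G (wl N c ls) = 0) ->
  G ls = 0.
Proof.
move=> kl sub4 hN hinv hlift hmore; set zs := [seq i == k | i <- ls & (i == k) || (i == l)].
have zsub : (3 <= chg zs)%N.
  apply: chg_klkl; rewrite /zs.
  have := map_subseq (fun i => i == k) (_ : subseq [:: k; l; k; l] [seq i <- ls | (i == k) || (i == l)]).
  rewrite /= eqxx [l == k]eq_sym (negbTE kl); apply.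
  by rewrite subseq_filter sub4 /= !eqxx !orbT.
apply: (@pattern_zero _ pq 1 k l ls G N (gam R (chg zs)) kl _ _ hN) => //.
- by apply: (mem_subseq sub4); rewrite inE eqxx.
- by apply: (mem_subseq sub4); rewrite !inE eqxx orbT.
- apply: hinv => i; rewrite /cu /cu' /projection; case: eqP => _; first by rewrite pq_star pq_idem pq_sum.
  case: eqP => _; first by rewrite pq_star pq_idem pq_sum.
  by rewrite star1 mulr1 addr0.
- by move=> c hc hlt; rewrite hmore // scale0r mulr0.
- rewrite -mulr_suml mulr1 -/zs; case ezs : zs zsub => [|y zs'] // _.
  exact: (alt_sum pq_idem pq_sum pq_alt).
- exact: gam_lt1.
by apply/eqP; exact: oner_neq0.
Qed.

End CrossingZero.

(** * Nested evaluation of a noncrossing partition with a stack *)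

Section Stack.
Variables (R : realType) (A : cstarType R) (rho : seq A -> A) (BB : set A).
Hypothesis rhoB : forall a l, BB (rho (a :: l)).
Hypothesis rhoR : forall l a v, BB v -> rho (rcons l (a * v)) = rho (rcons l a) * v.
Implicit Types (a b v cur : A) (acc : seq A).

(** Each open block is a pair: its completed arguments, and its last argument, which still waits for
    the blocks nested on its right. [v] is the value of what has just been closed above, with 1 for
    nothing. *)
Fixpoint close v (st : seq (seq A * A)) : A :=
  if st is (acc, cur) :: st' then close (rho (rcons acc (cur * v))) st' else v.

(** All stacks that arise when the next point [b] joins one of the open blocks, those above it being
    closed. *)
Fixpoint pops v b (st : seq (seq A * A)) : seq (seq (seq A * A)) :=
  if st is (acc, cur) :: st' then
    ((rcons acc (cur * v), b) :: st') :: pops (rho (rcons acc (cur * v))) b st'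
  else [::].

Section Labels.
Variable L : eqType.
Implicit Types (U V W : L) (c : seq L) (w : seq (L * A)) (st : seq (L * (seq A * A))).

Definition ncseq c := forall U V, subseq [:: U; V; U; V] c -> U = V.
Definition ivseq c := forall U V, subseq [:: U; V; U] c -> U = V.

(** The empty stack is a default: [step] calls this only with a label present on the stack. *)
Fixpoint popl v V b st : seq (L * (seq A * A)) :=
  if st is (U, (acc, cur)) :: st' then
    if U == V then (V, (rcons acc (cur * v), b)) :: st'
    else popl (rho (rcons acc (cur * v))) V b st'
  else [::].

Definition step st (s : L * A) : seq (L * (seq A * A)) :=
  if s.1 \in unzip1 st then popl 1 s.1 s.2 st else (s.1, ([::], s.2)) :: st.

Definition sev st w : A := close 1 (unzip2 (foldl step st w)).

Lemma sev_cons st s w : sev st (s :: w) = sev (step st s) w.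
Proof. by []. Qed.

Lemma sev_cat st w1 w2 : sev st (w1 ++ w2) = sev (foldl step st w1) w2.
Proof. by rewrite /sev foldl_cat. Qed.

Definition B1 v := BB v \/ v = 1.

Lemma rhoR1 l a v : B1 v -> rho (rcons l (a * v)) = rho (rcons l a) * v.
Proof. by case=> [|->]; [exact: rhoR|rewrite !mulr1]. Qed.

Lemma B1_rho l a : B1 (rho (rcons l a)).
Proof. by left; case: l => [|a' l]; exact: rhoB. Qed.

Lemma close_drop (X st : seq (seq A * A)) acc cur acc' cur' v : B1 v ->
  close v (X ++ (acc, cur) :: (acc', cur') :: st) =
  close v (X ++ (acc', cur' * rho (rcons acc cur)) :: st) :> A.
Proof.
elim: X v => [|[ac cu] X IH] v hv /=; first by rewrite (rhoR1 acc cur hv) mulrA.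
by apply: IH; exact: B1_rho.
Qed.

Lemma popl_drop X V acc cur U acc' cur' st v W b : V != W -> B1 v ->
  W \notin unzip1 X ->
  popl v W b (X ++ (V, (acc, cur)) :: (U, (acc', cur')) :: st) =
  popl v W b (X ++ (U, (acc', cur' * rho (rcons acc cur))) :: st).
Proof.
move=> VW; elim: X v => [|[U' [ac cu]] X IH] v hv /=.
  by rewrite (negbTE VW) rhoR1 // mulrA.
by rewrite inE negb_or => /andP[n1 n2]; rewrite eq_sym (negbTE n1) IH //; exact: B1_rho.
Qed.

Lemma popl_in X st v W b : W \in unzip1 X -> popl v W b (X ++ st) = popl v W b X ++ st.
Proof.
elim: X v => [|[U [acc cur]] X IH] v //=; rewrite inE [W == U]eq_sym.
by case: eqP => //= _ h; rewrite IH.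
Qed.

(** A block that receives no further point may be closed at once instead of later: its value is in
    B, and [rho] is right linear over B, so the factors regroup by associativity. *)
Lemma sev_drop w X V acc cur U acc' cur' st : V \notin unzip1 w ->
  sev (X ++ (V, (acc, cur)) :: (U, (acc', cur')) :: st) w =
  sev (X ++ (U, (acc', cur' * rho (rcons acc cur))) :: st) w.
Proof.
elim: w X => [|[W b] w IH] X /=.
  by move=> _; rewrite /sev /= /unzip2 !map_cat /=; apply: close_drop => //; right.
rewrite inE negb_or => /andP[VW hw]; rewrite !sev_cons /step /= /unzip1 !map_cat !mem_cat /= !inE.
rewrite [W == V]eq_sym (negbTE VW) /=.
have [hX|hX] := boolP (W \in unzip1 X).
  by rewrite !popl_in //= IH.
rewrite /=; case: ifP => h; last exact: (IH ((W, ([::], b)) :: X)).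
by rewrite popl_drop //; right.
Qed.

Lemma step_head st s : exists acc st', step st s = (s.1, (acc, s.2)) :: st'.
Proof.
rewrite /step; case: ifP => [|_]; last by eexists _, _.
move: 1; elim: st => [|[U [acc cur]] st IH] v //=.
rewrite inE eq_sym; case: eqP => [_ _|_ /= h]; first by eexists _, _.
exact: IH.
Qed.

Lemma foldl_run st V acc b w : all (pred1 V) (unzip1 w) ->
  exists acc' b', rcons acc' b' = rcons acc b ++ unzip2 w /\
    foldl step ((V, (acc, b)) :: st) w = (V, (acc', b')) :: st.
Proof.
elim: w acc b => [|[W a] w IH] acc b /=; first by move=> _; exists acc, b; rewrite cats0.
move=> /andP[/eqP -> hw]; rewrite /step /= inE eqxx /= mulr1.
have [acc' [b' [e1 e2]]] := IH (rcons acc b) a hw; exists acc', b'; split=> //.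
by rewrite e1 -cats1 -catA.
Qed.

(** One removal of an interval block, as performed by [nested], does not change the stack
    evaluation. *)
Lemma sev_remove w1 U a wV V w3 : wV != [::] -> all (pred1 V) (unzip1 wV) ->
  V \notin unzip1 w1 -> V != U -> V \notin unzip1 w3 ->
  sev [::] (w1 ++ (U, a) :: wV ++ w3) = sev [::] (w1 ++ (U, a * rho (unzip2 wV)) :: w3).
Proof.
move=> nV hV h1 hU h3; rewrite !sev_cat !sev_cons.
set st := foldl step [::] w1.
have hst : {subset unzip1 st <= unzip1 w1}.
  rewrite /st -(revK w1); elim: (rev w1) => [|s w IH] //=.
  rewrite rev_cons -cats1 foldl_cat /= => W; rewrite /unzip1 map_cat mem_cat /= inE.
  move: IH; set st' := foldl _ _ _ => IH; rewrite /step.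
  case: ifP => hs /=; last by rewrite inE => /orP[->|/IH ->]; rewrite ?orbT.
  suff : forall v, {subset unzip1 (popl v s.1 s.2 st') <= unzip1 st'} by move=> h /h /IH ->.
  elim: st' {IH hs} => [|[U' [ac cu]] st' IH] v //=; case: eqP => [->|_] W' //=.
  by move=> /IH h; rewrite inE h orbT.
have [acc [st' e1]] := step_head st (U, a).
have e2 : step st (U, a * rho (unzip2 wV)) = (U, (acc, a * rho (unzip2 wV))) :: st'.
  move: e1; rewrite /step /=; case: ifP => _; last by move=> [<- <-].
  move: 1; elim: st {hst} => [|[U' [ac cu]] st IH] v //=.
  by case: eqP => _; [move=> [<- <-]|exact: IH].
rewrite e1 e2 sev_cat.
case: wV nV hV e2 => // -[V' b] wV _ /= /andP[/eqP -> hV] e2.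
have hVst : V \notin unzip1 ((U, (acc, a)) :: st').
  rewrite /= inE negb_or hU /=; apply: contra h1 => h.
  have hp v W d : {subset unzip1 (popl v W d st) <= unzip1 st}.
    elim: (st) v => [|[U' [ac cu]] s IH] v //=; case: eqP => [->|_] W' //=.
    by move=> /IH hh; rewrite inE hh orbT.
  apply: hst; move: e1; rewrite /step /=; case: ifP => _; last by move=> [_ ->].
  by move=> e; apply: (hp 1 U a); rewrite e /= inE h orbT.
rewrite {2}/step /= (negbTE hVst).
have [acc' [b' [e3 e4]]] := foldl_run ((U, (acc, a)) :: st') [::] b hV.
by rewrite e4 (sev_drop [::] _ _ _ _ _ _ h3) e3.
Qed.

(** V is the last label to make a first appearance: afterwards only V and older labels occur. *)
Lemma new_label V0 c : ~~ all (pred1 V0) c -> exists c1 V c2,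
  [/\ V0 :: c = c1 ++ V :: c2, c1 != [::], V \notin c1 & {subset c2 <= V :: c1}].
Proof.
elim/last_ind: c => // c W IH; rewrite all_rcons /= => h.
have [hW|hW] := boolP (W \in V0 :: c); last first.
  by exists (V0 :: c), W, [::]; rewrite -rcons_cons -cats1.
have [hc|hc] := boolP (all (pred1 V0) c).
  move: h; rewrite hc andbT => /negP[]; move: hW; rewrite inE => /orP[//|hW].
  exact: (allP hc).
have [c1 [V [c2 [e n1 n2 n3]]]] := IH hc.
exists c1, V, (rcons c2 W); split=> //; first by rewrite -rcons_cons e rcons_cat.
move=> W'; rewrite mem_rcons inE => /orP[/eqP ->|]; last exact: n3.
by move: hW; rewrite e mem_cat inE => /or3P[hW|/eqP ->|/n3 //]; rewrite inE ?eqxx ?hW ?orbT.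
Qed.

(** The last new label V forms an interval block: if an older label came between two occurrences of
    V, its earlier occurrence would produce a crossing. *)
Lemma nc_interval V0 c : ncseq (V0 :: c) -> ~~ all (pred1 V0) c ->
  exists2 l, (l < size c)%N & interval_block_at (V0 :: c) l.+1.
Proof.
move=> nc /new_label[c1 [V [c2 [e n1 n2 n3]]]].
have sz : size c = ((size c1).-1 + (size c2).+1)%N.
  have := congr1 size e; rewrite size_cat /=; case: (c1) n1 => // ? ? _ /=; lia.
exists (size c1).-1; first by rewrite sz; lia.
rewrite prednK; last by case: (c1) n1.
rewrite /interval_block_at e drop_size_cat // count_cat (count_memPn n2) add0n /= eqxx add1n /= eqseq_cons eqxx /=.
pose i := find (predC1 V) c2.
have pre : take i c2 = nseq i V.
  have hi : (i <= size c2)%N by exact: find_size.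
  rewrite -[in RHS](size_takel hi); apply/all_pred1P/(all_nthP V) => j; rewrite size_takel // => ji.
  by rewrite nth_take //; have := before_find V ji; rewrite /= => /negbT; rewrite negbK.
have [hi|hi] := ltnP i (size c2); last first.
  have e2 : c2 = nseq (size c2) V by rewrite -[LHS](@take_oversize _ i) // pre; congr nseq; apply/eqP; rewrite eqn_leq hi find_size.
  have -> : count_mem V c2 = size c2 by rewrite {1}e2 count_nseq /= eqxx mul1n.
  by rewrite take_size; apply/eqP.
pose W := nth V c2 i; have WV : W != V by apply: (@nth_find _ V (predC1 V)); rewrite has_find.
have post : V \notin drop i.+1 c2.
  apply/negP => hV; have hW : W \in c1.
    by have := n3 W (mem_nth _ hi); rewrite inE (negbTE WV).
  have : W = V; last by move/eqP; rewrite (negbTE WV).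
  apply: nc; rewrite e -[X in _ ++ V :: X](cat_take_drop i) (drop_nth V hi) -/W.
  have s1 : subseq [:: W] c1 by rewrite sub1seq.
  have s2 : subseq [:: V] (drop i.+1 c2) by rewrite sub1seq.
  apply: (@cat_subseq _ [:: W] [:: V; W; V]) => //.
  rewrite -cat_cons; apply: (@cat_subseq _ [:: V] [:: W; V]); last by rewrite /= eqxx.
  by rewrite /= eqxx sub0seq.
have -> : count_mem V c2 = i.
  rewrite -[X in count_mem V X](cat_take_drop i) (drop_nth V hi) count_cat /= -/W (negbTE WV) add0n.
  by rewrite (count_memPn post) addn0 pre count_nseq /= eqxx mul1n.
by rewrite pre.
Qed.

Lemma sev_block V a w : all (pred1 V) (unzip1 w) -> sev [::] ((V, a) :: w) = rho (a :: unzip2 w).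
Proof.
move=> h; rewrite sev_cons /step /=.
have [acc' [b' [e3 e4]]] := foldl_run [::] [::] a h.
by rewrite /sev e4 /= mulr1 e3.
Qed.

(** Induction on the removals: [nc_interval] supplies the block that [nested] looks for, and when
    the search fails a single block is left. *)
Lemma nested_sev fuel w : ncseq (unzip1 w) -> w != [::] -> (size w <= fuel)%N ->
  nested rho fuel w = sev [::] w.
Proof.
elim: fuel w => [|fuel IH] w nc w0 sw; first by case: w w0 sw {nc}.
rewrite /=; set c := unzip1 w; set l := find _ _.
have sc : size c = size w by rewrite size_map.
have [hl|hl] := ltnP l (size w).-1; last first.
  case: w nc w0 sw @c @l sc hl => // -[V a] w nc _ sw c l sc hl.
  have -> : drop l ((V, a) :: w) = [:: last (V, a) w].
    have el : l = size w by apply/eqP; rewrite eqn_leq hl andbT /l -[X in (_ <= X)%N](size_iota 0); exact: find_size.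
    by rewrite el lastI -cats1 drop_size_cat ?size_belast.
  case: (last _ _) => V' a'; rewrite sev_block //.
  apply/negPn/negP => h; have [m mw hm] := @nc_interval V (unzip1 w) nc h.
  have : has (fun l => interval_block_at c l.+1) (iota 0 (size w)).
    by apply/hasP; exists m => //; rewrite mem_iota /= add0n; move: mw; rewrite size_map.
  by rewrite has_find size_iota -/l; rewrite ltnNge hl.
have hI : interval_block_at c l.+1.
  have hh : has (fun l => interval_block_at c l.+1) (iota 0 (size w).-1) by rewrite has_find size_iota.
  by have := nth_find 0%N hh; rewrite -/l nth_iota // add0n.
have lw : (l.+1 < size w)%N by move: hl; case: (size w).
case e : (drop l w) => [|[U a] w2].
  by have := size_drop l w; rewrite e /=; lia.
case: w2 e => [|[V b] w'] e; first by have := size_drop l w; rewrite e /=; lia.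
have ec : drop l.+1 c = V :: unzip1 w'.
  have -> : drop l.+1 c = drop 1 (drop l c) by rewrite drop_drop add1n.
  by rewrite /c /unzip1 -map_drop e.
move: hI; rewrite /interval_block_at ec; set s := count_mem V c.
rewrite -[V :: unzip1 w']/(unzip1 ((V, b) :: w')) /unzip1 -map_take => /eqP hs.
have s0 : (0 < s)%N by rewrite /s -has_count has_pred1 -(cat_take_drop l.+1 c) mem_cat ec inE eqxx orbT.
pose wV := take s ((V, b) :: w'); pose w3 := drop s ((V, b) :: w').
have ew : w = take l w ++ (U, a) :: wV ++ w3 by rewrite /wV /w3 cat_take_drop -e cat_take_drop.
have hwV : all (pred1 V) (unzip1 wV) by rewrite /unzip1 hs all_pred1_nseq.
have cV : count_mem V (unzip1 wV) = s by rewrite /unzip1 hs count_nseq /= eqxx mul1n.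
have : s = (count_mem V (unzip1 (take l w)) + ((U == V) + (s + count_mem V (unzip1 w3))))%N.
  by rewrite {1}/s /c {1}ew /unzip1 map_cat count_cat /= map_cat count_cat -/(unzip1 wV) cV.
move=> es.
have z1 : count_mem V (unzip1 (take l w)) = 0%N by clear -es; lia.
have z2 : (U == V) = false by case: (U == V) es => //; clear; lia.
have z3 : count_mem V (unzip1 w3) = 0%N by clear -es; lia.
have wV0 : wV != [::] by rewrite /wV; case: (s) s0.
have n1 : V \notin unzip1 (take l w) by rewrite -has_pred1 has_count z1.
have n3 : V \notin unzip1 w3 by rewrite -has_pred1 has_count z3.
rewrite -/wV -/w3 IH.
- by rewrite [in RHS]ew (sev_remove a wV0 hwV n1 _ n3) // eq_sym z2.
- move=> U1 V1 h; apply: nc; apply: subseq_trans h _; rewrite [in X in subseq _ X]ew.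
  rewrite /unzip1 !map_cat /=; apply: cat_subseq => //=; rewrite eqxx map_cat.
  exact: suffix_subseq.
- by rewrite -size_eq0 size_cat /=; lia.
have : size w = (size (take l w) + (size wV + size w3).+1)%N by rewrite {1}ew size_cat /= size_cat.
have : (0 < size wV)%N by case: (wV) wV0.
by rewrite size_cat /=; move: sw; lia.
Qed.

End Labels.
End Stack.

(** * Enumeration of admissible label sequences ([k] is true for noncrossing, false for interval) *)

Section LabelSequences.
Variable k : bool.
Implicit Types (c e : seq nat) (l : nat).

Definition lstep (stk : seq nat) l := if l \in stk then drop (index l stk) stk else l :: stk.
Definition lstk c := foldl lstep [::] c.
(** No other block straddles [l]: this is the condition under which a further point may join the
    block [l] without a crossing. *)
Definition uncov c l := forall U, subseq [:: U; l; U] c -> U = l.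
(** Every point is labelled by the first position of its block, so that a partition has exactly one
    label sequence. *)
Definition canon c := forall i, (i < size c)%N ->
  (nth 0%N c i <= i)%N /\ nth 0%N c (nth 0%N c i) = nth 0%N c i.
Definition good c := [/\ ncseq c, canon c & k = false -> ivseq c].

Lemma subseq_rcons2 (T : eqType) (p c : seq T) (a : T) :
  subseq (rcons p a) (rcons c a) = subseq p c.
Proof. by rewrite -subseq_rev !rev_rcons /= eqxx subseq_rev. Qed.

Lemma subseq_rcons_cases (T : eqType) (p c : seq T) (a l : T) : subseq (rcons p a) (rcons c l) ->
  subseq (rcons p a) c \/ a = l /\ subseq p c.
Proof.
rewrite -subseq_rev !rev_rcons /=; case: eqP => [->|_]; first by right; split=> //; rewrite -subseq_rev.
by rewrite -rev_rcons subseq_rev; left.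
Qed.

Lemma canon_mem c l : canon c -> l \in c -> (l < size c)%N /\ nth 0%N c l = l.
Proof.
move=> hc /(nthP 0%N)[i hi <-]; have [h1 h2] := hc i hi.
by split=> //; exact: leq_ltn_trans h1 hi.
Qed.

Lemma good_cat c e : good (c ++ e) -> good c.
Proof.
move=> [h1 h2 h3]; split.
- by move=> U V h; apply: h1; apply: subseq_trans h (prefix_subseq _ _).
- move=> i hi; have [|a1 a2] := h2 i; first by rewrite size_cat ltn_addr.
  rewrite !nth_cat hi in a1 a2; split=> //.
  by move: a2; rewrite (leq_ltn_trans a1 hi).
- by move=> k0 U V h; apply: (h3 k0); apply: subseq_trans h (prefix_subseq _ _).
Qed.

Lemma good_rcons_lt c l : good (rcons c l) -> l = size c \/ l \in c /\ uncov c l.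
Proof.
move=> [h1 h2 h3]; have [|a1 a2] := h2 (size c); first by rewrite size_rcons.
rewrite !nth_rcons ltnn eqxx in a1 a2.
move: a1; rewrite leq_eqVlt => /orP[/eqP ->|ls]; first by left.
right; split; first by rewrite ls in a2; rewrite -[X in X \in _]a2 mem_nth.
by move=> U h; apply: h1; rewrite -[[:: U; l; U; l]]/(rcons [:: U; l; U] l) subseq_rcons2.
Qed.

Lemma nc_rcons c l : good c -> l = size c \/ l \in c /\ uncov c l ->
  ncseq (rcons c l) /\ canon (rcons c l).
Proof.
move=> [h1 h2 h3] hl; split.
  move=> U V h; have [h4|[h4 h5]] := @subseq_rcons_cases _ [:: U; V; U] c V l h; first exact: h1.
  case: hl => [e|[_ hl]]; last by rewrite h4; apply: hl; rewrite -h4.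
  have hV : V \in c by apply: (mem_subseq h5); rewrite !inE eqxx orbT.
  by have [] := canon_mem h2 hV; rewrite h4 e ltnn.
move=> i; rewrite size_rcons ltnS leq_eqVlt => /orP[/eqP ->|hi].
  rewrite nth_rcons ltnn eqxx; case: hl => [->|[hl _]]; first by rewrite nth_rcons ltnn eqxx.
  by have [a1 a2] := canon_mem h2 hl; rewrite nth_rcons a1 a2 ltnW.
have [a1 a2] := h2 i hi.
by rewrite !nth_rcons hi (leq_ltn_trans a1 hi).
Qed.

Lemma lstep_head stk l : exists s, lstep stk l = l :: s.
Proof.
rewrite /lstep; case: ifP => [h|_]; last by exists stk.
by exists (drop (index l stk).+1 stk); rewrite (drop_nth 0%N) ?index_mem // nth_index.
Qed.

Lemma lstk_rcons c l : lstk (rcons c l) = lstep (lstk c) l.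
Proof. by rewrite /lstk -cats1 foldl_cat. Qed.

Lemma gtn_trans : transitive gtn.
Proof. by move=> a b d h1 h2; exact: ltn_trans h2 h1. Qed.

Lemma sorted_drop_mem (s : seq nat) m l : sorted gtn s -> m \in s ->
  (l \in drop (index m s) s) = (l \in s) && (l <= m)%N.
Proof.
elim: s => // z s IH /=; rewrite (path_sortedE gtn_trans) => /andP[/allP /= hz so].
rewrite inE; have [e|zm] := eqVneq z m.
  rewrite -e drop0 => _; apply/idP/andP => [h|[]//]; split=> //.
  by move: h; rewrite inE => /orP[/eqP -> //|/hz /ltnW].
rewrite /= => hm; rewrite IH // inE.
case: (eqVneq l z) => [->|] //=; have := hz m hm => h1.
by rewrite leqNgt h1 andbF.
Qed.

(** The stack holds exactly the labels that may be continued. It is sorted because labels are first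
    positions, and popping down to m keeps the labels not above m. *)
Lemma lstk_spec c : good c -> sorted gtn (lstk c) /\
  forall l, l \in lstk c <-> l \in c /\ uncov c l.
Proof.
elim/last_ind: c => [|c m IH] hg; first by split=> // l; rewrite in_nil; split=> [//|[]].
have hgc : good c by apply: (@good_cat c [:: m]); rewrite cats1.
have [so hI] := IH hgc; have [n1 cn _] := hgc; have [_ cn' _] := hg.
have hm := good_rcons_lt hg; rewrite lstk_rcons /lstep.
have un_c l : uncov (rcons c m) l -> uncov c l.
  by move=> h U hU; apply: h; apply: subseq_trans hU (subseq_rcons _ _).
case: hm => [em|[mc mu]].
  have mN : m \notin c by apply/negP => /(canon_mem cn)[]; rewrite em ltnn.
  have mS : m \notin lstk c by apply/negP => /hI[]; rewrite (negbTE mN).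
  rewrite (negbTE mS); split.
    rewrite /= path_min_sorted //; apply/allP => l /hI[/(canon_mem cn)[h _] _].
    by rewrite /= em.
  move=> l; rewrite inE mem_rcons inE; split.
    move=> /orP[/eqP ->|/hI[h1 h2]].
      rewrite eqxx; split=> // U h; have [h4|[h4 _]] := @subseq_rcons_cases _ [:: U; m] c U m h => //.
      by exfalso; move: mN; rewrite (mem_subseq h4) // !inE eqxx orbT.
    rewrite h1 orbT; split=> // U h.
    have [h4|[h4 h5]] := @subseq_rcons_cases _ [:: U; l] c U m h; first exact: h2.
    have : m \in c by apply: (mem_subseq h5); rewrite -h4 inE eqxx.
    by rewrite (negbTE mN).
  by move=> [/orP[->//|h1] h2]; apply/orP; right; apply/hI; split=> //; exact: un_c.
have mS : m \in lstk c by apply/hI.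
rewrite mS; split; first exact: drop_sorted.
move=> l; rewrite sorted_drop_mem //; split.
  move=> /andP[/hI[lc lu] lm]; split; first by rewrite mem_rcons inE lc orbT.
  move=> U h; have [h4|[h4 h5]] := @subseq_rcons_cases _ [:: U; l] c U m h; first exact: lu.
  rewrite h4 in h5 *; apply/eqP; rewrite eqn_leq lm andbT leqNgt; apply/negP => ltm.
  have ml : l <> m by move=> e; rewrite e ltnn in ltm.
  apply: ml; apply: mu; have [lt1 lt2] := canon_mem cn lc.
  have -> : [:: l; m; l] = [:: l] ++ [:: m; l] by [].
  rewrite -(cat_take_drop l.+1 c); apply: cat_subseq.
    by rewrite sub1seq (take_nth 0%N lt1) lt2 mem_rcons inE eqxx.
  move: h5; rewrite -{1}(cat_take_drop l.+1 c) => h5.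
  have mt : m \notin take l.+1 c.
    apply/negP => hmt; have [i hi e] := elimT (nthP 0%N) hmt.
    rewrite size_takel // in hi; rewrite nth_take // in e.
    by have [] := cn i (leq_trans hi lt1); rewrite e; lia.
  by move: h5; elim: (take l.+1 c) mt => //= z s IHs; rewrite inE negb_or => /andP[mz ms];
     rewrite (negbTE mz) => /(IHs ms).
move=> [lc lu]; have lc' : l \in c.
  by move: lc; rewrite mem_rcons inE => /orP[/eqP ->|].
apply/andP; split; first by apply/hI; split=> //; exact: un_c.
rewrite leqNgt; apply/negP => ml.
have [l1 l2] := canon_mem cn lc'; have [m1 m2] := canon_mem cn mc.
have : m = l; last by move=> e; rewrite e ltnn in ml.
apply: lu; rewrite -[[:: m; l; m]]/(rcons [:: m; l] m) subseq_rcons2.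
rewrite -(cat_take_drop l c) (drop_nth 0%N l1) l2; apply: (@cat_subseq _ [:: m] [:: l]).
  by rewrite sub1seq -[X in X \in _]m2 -(nth_take _ ml) mem_nth // size_takel // ltnW.
by rewrite /= eqxx sub0seq.
Qed.

(** In the interval case only the block on top, the one just read, may be continued. *)
Definition sel (T : Type) (s : seq T) := if k then s else take 1 s.

Fixpoint ext n (stk : seq nat) (pos : nat) : seq (seq nat) :=
  if n is n'.+1 then
    flatten [seq map (cons l) (ext n' (lstep stk l) pos.+1) | l <- pos :: sel stk]
  else [:: [::]].

Lemma sel_spec c l : good c -> (l \in size c :: sel (lstk c)) <-> good (rcons c l).
Proof.
move=> hg; have [so hI] := lstk_spec hg; rewrite inE; split.
  move=> /orP[/eqP ->|hl].
    have [h1 h2] := nc_rcons hg (or_introl (erefl (size c))); split=> // k0 U V h.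
    have [_ cn /(_ k0) iv] := hg.
    have [h4|[h4 h5]] := @subseq_rcons_cases _ [:: U; V] c U _ h; first exact: iv.
    by have [|] := @canon_mem c U cn; [apply: (mem_subseq h5); rewrite inE eqxx|rewrite h4 ltnn].
  have hl' : l \in lstk c by move: hl; rewrite /sel; case: k => // /mem_take.
  have /hI hlc := hl'; have [h1 h2] := nc_rcons hg (or_intror hlc); split=> // k0 U V h.
  have [_ cn /(_ k0) iv] := hg.
  move: hl; rewrite /sel k0; case/lastP: c hg hI hlc iv h {h1 h2 hl' so cn} => // c m hg hI hlc iv h.
  have [s' e'] := lstep_head (lstk c) m; rewrite lstk_rcons e' /= take0 inE => /eqP lm.
  have [h4|[h4 h5]] := @subseq_rcons_cases _ [:: U; V] (rcons c m) U _ h; first exact: iv.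
  have [h6|[h6 h7]] := @subseq_rcons_cases _ [:: U] c V m h5; last by rewrite h4 h6.
  by apply: iv; rewrite -[[:: U; V; U]]/(rcons [:: U; V] U) h4 lm subseq_rcons2 -lm -h4.
move=> hg'; have [->|hl] := good_rcons_lt hg'; first by rewrite eqxx.
apply/orP; right; have hl' : l \in lstk c by apply/hI.
rewrite /sel; case ek : k => //; have [_ _ /(_ ek) iv] := hg'.
case/lastP: c hg hg' hl hl' iv {so hI} => // c m hg hg' hl hl' iv.
have [s' e'] := lstep_head (lstk c) m; rewrite lstk_rcons e' /= take0 inE; apply/eqP.
have [//|lm] := eqVneq l m.
apply: iv; rewrite -[[:: l; m; l]]/(rcons [:: l; m] l) subseq_rcons2.
rewrite -[[:: l; m]]/(rcons [:: l] m) subseq_rcons2 sub1seq.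
by move: hl => [+ _]; rewrite mem_rcons inE (negbTE lm).
Qed.

Lemma mem_ext n c e : good c -> e \in ext n (lstk c) (size c) <-> size e = n /\ good (c ++ e).
Proof.
elim: n c e => [|n IH] c e hg.
  by rewrite /= inE; split=> [/eqP ->|[/eqP]]; rewrite ?cats0 ?size_eq0.
rewrite /ext -/ext; split.
  move=> /flatten_mapP[l hl /mapP[e' he' ->]]; have hg' := (sel_spec l hg).1 hl.
  have /(IH (rcons c l)) : e' \in ext n (lstk (rcons c l)) (size (rcons c l)).
    by rewrite lstk_rcons size_rcons.
  by move=> /(_ hg')[<- hh]; split=> //; rewrite -cat_rcons.
case: e => [|l e]; first by case.
move=> [[se] hh]; rewrite -cat_rcons in hh; have hg' := good_cat hh.
apply/flatten_mapP; exists l; first exact/sel_spec.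
by apply: map_f; rewrite -lstk_rcons -(size_rcons c l); apply/IH.
Qed.

Lemma uniq_flatten_cons (ls : seq nat) (F : nat -> seq (seq nat)) : uniq ls ->
  (forall l, l \in ls -> uniq (F l)) -> uniq (flatten [seq map (cons l) (F l) | l <- ls]).
Proof.
elim: ls => //= l ls IH /andP[hl ul] hF; rewrite cat_uniq map_inj_uniq; last by move=> v v' [].
rewrite hF ?inE ?eqxx //= IH //; last by move=> l' h'; apply: hF; rewrite inE h' orbT.
rewrite andbT; apply/hasPn => v /flatten_mapP[l' hl' /mapP[v' _ ->]]; apply/negP => /mapP[v2 _ [e _]].
by rewrite -e hl' in hl.
Qed.

Lemma uniq_ext n c : good c -> uniq (ext n (lstk c) (size c)).
Proof.
elim: n c => [|n IH] c hg //.
have [so hI] := lstk_spec hg; rewrite /ext -/ext; apply: uniq_flatten_cons.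
  have ul : uniq (lstk c) by exact: (sorted_uniq gtn_trans ltnn so).
  rewrite /= /sel; have nl : size c \notin lstk c.
    by apply/negP => /hI[h _]; have [_ cn _] := hg; have [] := canon_mem cn h; rewrite ltnn.
  case: k; rewrite ?nl ?ul //= take_uniq // andbT.
  by apply: contra nl; exact: mem_take.
move=> l /(sel_spec l hg) hg'.
by rewrite -lstk_rcons -(size_rcons c l); exact: IH.
Qed.

Lemma good_nil : good [::].
Proof. by split=> [U V|i|_ U V]. Qed.

Section StackSums.
Variables (R : realType) (A : cstarType R) (rho : seq A -> A) (BB : set A).
Hypothesis rhoB : forall a (l : seq A), BB (rho (a :: l)).
Hypothesis rhoR : forall (l : seq A) a v, BB v -> rho (rcons l (a * v)) = rho (rcons l a) * v.

(** The sum over all admissible partitions as a recursion on points: each one opens a block or joins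
    an open one. *)
Fixpoint T0 (st : seq (seq A * A)) (w : seq A) : A :=
  if w is b :: w' then
    T0 (([::], b) :: st) w' + \sum_(st' <- sel (pops rho 1 b st)) T0 st' w'
  else close rho 1 st.

Implicit Types (st : seq (nat * (seq A * A))).

Lemma step_labels st s : unzip1 (step rho st s) = lstep (unzip1 st) s.1.
Proof.
rewrite /step /lstep; case: ifP => // hs.
move: 1; elim: st hs => [|[U [acc cur]] st IH] //= hs v.
move: hs; rewrite inE [s.1 == U]eq_sym; case: eqP => [->|_] /= hs; first by [].
exact: IH.
Qed.

Lemma popl_pops st v b : uniq (unzip1 st) ->
  [seq unzip2 (popl rho v l b st) | l <- unzip1 st] = pops rho v b (unzip2 st).
Proof.
elim: st v => [|[U [acc cur]] st IH] v //= /andP[hU us]; rewrite eqxx /=; congr (_ :: _).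
rewrite -IH //; apply/eq_in_map => l hl; case: eqP => // e.
by rewrite e hl in hU.
Qed.

Lemma sel_map (T T' : Type) (f : T -> T') (s : seq T) : sel (map f s) = map f (sel s).
Proof. by rewrite /sel; case: k => //; rewrite map_take. Qed.

Lemma ext_sum w st pos : uniq (unzip1 st) -> all (gtn pos) (unzip1 st) ->
  \sum_(c <- ext (size w) (unzip1 st) pos) sev rho st (zip c w) = T0 (unzip2 st) w.
Proof.
elim: w st pos => [|b w IH] st pos us hp; first by rewrite big_seq1.
rewrite [size _]/= /ext -/ext big_flatten big_map big_cons /=.
have hpos : pos \notin unzip1 st by apply/negP => /(allP hp) /=; rewrite ltnn.
have E l : uniq (lstep (unzip1 st) l) -> all (gtn pos.+1) (lstep (unzip1 st) l) ->
    \sum_(c <- map (cons l) (ext (size w) (lstep (unzip1 st) l) pos.+1)) sev rho st (zip c (b :: w)) =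
    T0 (unzip2 (step rho st (l, b))) w.
  move=> h1 h2; rewrite big_map -(IH _ pos.+1) ?step_labels //.
congr (_ + _).
  rewrite E /lstep ?(negbTE hpos) /= ?hpos ?us ?ltnS ?leqnn //=.
    by rewrite /step /= (negbTE hpos).
  by apply: sub_all hp => i /= h; rewrite ltnS ltnW.
rewrite -(popl_pops 1 b us) sel_map big_map; apply: eq_big_seq => l hl.
have hl' : l \in unzip1 st by move: hl; rewrite /sel; case: k => // /mem_take.
rewrite E /lstep ?hl'; first by rewrite /step /= hl'.
- exact: drop_uniq.
- by apply/allP => i /mem_drop /(allP hp) /= h; rewrite ltnS ltnW.
Qed.

Section Relabel.
Variables (L L' : eqType) (f : L -> L').

Lemma sev_relabel (w : seq (L * A)) (D : {pred L}) : {in D &, injective f} ->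
  {subset unzip1 w <= D} ->
  sev rho [::] [seq (f s.1, s.2) | s <- w] = sev rho [::] w.
Proof.
move=> fi; have gen (st : seq (L * (seq A * A))) : {subset unzip1 w <= D} -> {subset unzip1 st <= D} ->
    sev rho [seq (f s.1, s.2) | s <- st] [seq (f s.1, s.2) | s <- w] = sev rho st w.
  elim: w st => [|[V a] w IH] st hw hst.
    by rewrite /sev /= /unzip2 -map_comp.
  rewrite /= !sev_cons.
  have DV : V \in D by apply: hw; rewrite inE eqxx.
  have e1 : unzip1 [seq (f s.1, s.2) | s <- st] = map f (unzip1 st).
    by rewrite /unzip1 -!map_comp.
  have e2 : (f V \in map f (unzip1 st)) = (V \in unzip1 st).
    apply/mapP/idP => [[U hU e]|h]; last by exists V.
    by rewrite (fi _ _ DV (hst _ hU) e).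
  have -> : step rho [seq (f s.1, s.2) | s <- st] (f V, a) = [seq (f s.1, s.2) | s <- step rho st (V, a)].
    rewrite /step /= e1 e2; case: ifP => // _; move: 1.
    elim: st hst {e1 e2} => [|[U [acc cur]] st IHs] hst v //=.
    have hU : U \in D by apply: hst; rewrite inE eqxx.
    have -> : (f U == f V) = (U == V) by apply/eqP/eqP => [/(fi _ _ hU DV)|->].
    by case: eqP => //= _; apply: IHs => W hW; apply: hst; rewrite inE hW orbT.
  apply: IH => [W hW|W]; first by apply: hw; rewrite inE hW orbT.
  have : {subset unzip1 (step rho st (V, a)) <= V :: unzip1 st}.
    rewrite /step /=; case: ifP => _; last by move=> W'.
    move: (1 : A); elim: (st) => [|[U [acc cur]] s IHs] v W' //=.
    case: eqP => [->|_] /=; first by rewrite !inE => ->; rewrite orbT.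
    by move=> /IHs; rewrite !inE => /orP[->|->]; rewrite ?orbT.
  by move=> h /h; rewrite inE => /orP[/eqP -> //|]; exact: hst.
by move=> hw; exact: (gen [::]).
Qed.

End Relabel.
End StackSums.

End LabelSequences.

(** * From set partitions to label sequences *)

Lemma subseq_nth (L : eqType) (x0 a : L) (p s : seq L) : subseq (a :: p) s <->
  exists i, [/\ (i < size s)%N, nth x0 s i = a & subseq p (drop i.+1 s)].
Proof.
split.
  elim: s => //= z s IH; case: eqP => [->|_] h; first by exists 0%N; rewrite /= drop0.
  by have [i [h1 h2 h3]] := IH h; exists i.+1.
case=> i [hi <- hp]; rewrite -[s in subseq _ s](cat_take_drop i) (drop_nth x0 hi).
apply: subseq_trans (suffix_subseq _ _); by rewrite /= eqxx.
Qed.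

Section Crossing.
Variables (L : eqType) (x0 : L) (s : seq L).
Local Notation c := (nth x0 s).

Lemma ncseq_nth : ncseq s <-> forall i j m l, (i < j)%N -> (j < m)%N -> (m < l)%N -> (l < size s)%N ->
  c i = c m -> c j = c l -> c i = c j.
Proof.
split=> [h i j m l ij jm ml ls e1 e2|h U V].
  apply: h; apply/(subseq_nth x0); exists i; split; [lia|by []|].
  apply/(subseq_nth x0); exists (j - i.+1)%N; rewrite size_drop nth_drop subnKC //; split; [lia|by []|].
  rewrite drop_drop addSn subnK //; apply/(subseq_nth x0); exists (m - j.+1)%N.
  rewrite size_drop nth_drop subnKC //; split; [lia|by []|].
  rewrite drop_drop addSn subnK //; apply/(subseq_nth x0); exists (l - m.+1)%N.
  rewrite size_drop nth_drop subnKC //; split; [lia|by []|exact: sub0seq].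
move=> /(subseq_nth x0)[i [hi e1 /(subseq_nth x0)[j [hj e2 /(subseq_nth x0)[m [hm e3 /(subseq_nth x0)[l [hl e4 _]]]]]]]].
rewrite !drop_drop !nth_drop !size_drop in hj e2 hm e3 hl e4.
rewrite -e1 -e2; apply: (h _ _ (j.+1 + i.+1 + m)%N (m.+1 + (j.+1 + i.+1) + l)%N); rewrite ?e1 ?e2 ?e3 ?e4 //; lia.
Qed.

Lemma ivseq_nth : ivseq s <-> forall i j m, (i < j)%N -> (j < m)%N -> (m < size s)%N ->
  c i = c m -> c i = c j.
Proof.
split=> [h i j m ij jm ls e1|h U V].
  apply: h; apply/(subseq_nth x0); exists i; split; [lia|by []|].
  apply/(subseq_nth x0); exists (j - i.+1)%N; rewrite size_drop nth_drop subnKC //; split; [lia|by []|].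
  rewrite drop_drop addSn subnK //; apply/(subseq_nth x0); exists (m - j.+1)%N.
  rewrite size_drop nth_drop subnKC //; split; [lia|by []|exact: sub0seq].
move=> /(subseq_nth x0)[i [hi e1 /(subseq_nth x0)[j [hj e2 /(subseq_nth x0)[m [hm e3 _]]]]]].
rewrite !drop_drop !nth_drop !size_drop in hj e2 hm e3.
rewrite -e1 -e2; apply: (h _ _ (j.+1 + i.+1 + m)%N); rewrite ?e1 ?e2 ?e3 //; lia.
Qed.

End Crossing.

Section PartitionSum.
Variables (k : bool) (n : nat).
Implicit Types (p : {set {set 'I_n}}) (i j : 'I_n).

Definition lattice p := if k then noncrossing p else interval_partition p.
Definition blocks p := [seq finset.pblock p i | i <- enum 'I_n].
(** The index of a block in the list of the blocks of successive points is its first point, which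
    gives the canonical labelling. *)
Definition labels p := [seq index V (blocks p) | V <- blocks p].

Lemma size_blocks p : size (blocks p) = n.
Proof. by rewrite size_map size_enum_ord. Qed.

Lemma nth_blocks p i : nth finset.set0 (blocks p) i = finset.pblock p i.
Proof. by rewrite (nth_map i) ?size_enum_ord // nth_ord_enum. Qed.

Lemma mem_blocks p i : finset.pblock p i \in blocks p.
Proof. by rewrite -nth_blocks mem_nth // size_blocks. Qed.

Lemma index_nth_le (T : eqType) (x0 : T) (s : seq T) i : (i < size s)%N -> (index (nth x0 s i) s <= i)%N.
Proof.
by move=> hi; rewrite leqNgt; apply/negP => /(before_find x0); rewrite /= eqxx.
Qed.

Lemma index_inj (T : eqType) (s : seq T) : {in s &, injective (index^~ s)}.
Proof. by move=> V W hV hW e; rewrite -(nth_index V hV) e nth_index. Qed.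

Lemma nth_labels p i : nth 0%N (labels p) i = index (finset.pblock p i) (blocks p).
Proof. by rewrite (nth_map finset.set0) ?size_blocks // nth_blocks. Qed.

Lemma labels_eq p i j : (nth 0%N (labels p) i = nth 0%N (labels p) j) <->
  finset.pblock p i = finset.pblock p j.
Proof. by rewrite !nth_labels; split=> [|-> //]; apply: index_inj; exact: mem_blocks. Qed.

Lemma labels_canon p : canon (labels p).
Proof.
move=> m; rewrite size_map size_blocks => hm.
rewrite -[m]/(nat_of_ord (Ordinal hm)) nth_labels; set i := Ordinal hm.
have h1 : (index (finset.pblock p i) (blocks p) <= i)%N.
  by rewrite -nth_blocks index_nth_le // size_blocks.
split=> //; set m' := index _ _.
have hm' : (m' < n)%N by exact: leq_ltn_trans h1 hm.
rewrite -[X in nth _ _ X]/(nat_of_ord (Ordinal hm')) nth_labels -nth_blocks /=.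
by rewrite nth_index // mem_blocks.
Qed.

Lemma labels_good p : good k (labels p) <-> lattice p.
Proof.
have sz : size (labels p) = n by rewrite size_map size_blocks.
have nc : ncseq (labels p) <-> noncrossing p.
  split.
    move/(ncseq_nth 0%N) => h; apply/forallP => i; apply/forallP => j; apply/forallP => m; apply/forallP => l.
    apply/implyP => /and5P[ij jm ml /eqP e1 /eqP e2]; apply/eqP/labels_eq.
    by apply: (h i j m l); rewrite ?sz //; apply/labels_eq.
  move=> h; apply/(ncseq_nth 0%N) => i j m l ij jm ml; rewrite sz => hl.
  have hm := ltn_trans ml hl; have hj := ltn_trans jm hm; have hi := ltn_trans ij hj.
  move=> /(labels_eq p (Ordinal hi) (Ordinal hm)) e1 /(labels_eq p (Ordinal hj) (Ordinal hl)) e2.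
  apply/(labels_eq p (Ordinal hi) (Ordinal hj)).
  move/forallP/(_ (Ordinal hi))/forallP/(_ (Ordinal hj))/forallP/(_ (Ordinal hm))/forallP/(_ (Ordinal hl)): h.
  by rewrite e1 e2 !eqxx /= ij jm ml /= => /eqP.
have iv : ivseq (labels p) <-> interval_partition p.
  split.
    move/(ivseq_nth 0%N) => h; apply/forallP => i; apply/forallP => j; apply/forallP => m.
    apply/implyP => /and3P[ij jm /eqP e1]; apply/eqP/labels_eq.
    by apply: (h i j m); rewrite ?sz //; apply/labels_eq.
  move=> h; apply/(ivseq_nth 0%N) => i j m ij jm; rewrite sz => hm.
  have hj := ltn_trans jm hm; have hi := ltn_trans ij hj.
  move=> /(labels_eq p (Ordinal hi) (Ordinal hm)) e1.
  apply/(labels_eq p (Ordinal hi) (Ordinal hj)).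
  move/forallP/(_ (Ordinal hi))/forallP/(_ (Ordinal hj))/forallP/(_ (Ordinal hm)): h.
  by rewrite e1 !eqxx /= ij jm /= => /eqP.
rewrite /lattice; split=> [[h1 _ h3]|h].
  by case ek : k in h3 *; [apply/nc|apply/iv/h3].
case ek : k in h *.
  by split; [apply/nc|exact: labels_canon|by []].
have /iv h' := h; split; [|exact: labels_canon|by []].
move=> U V hs; apply: h'; apply: subseq_trans hs.
by rewrite -[[:: U; V; U; V]]/([:: U; V; U] ++ [:: V]) prefix_subseq.
Qed.

Lemma partition_pblock p : finset.partition p [set: 'I_n] ->
  p = [set [set j | finset.pblock p i == finset.pblock p j] | i in 'I_n]%SET.
Proof.
move=> /and3P[/eqP hc ht h0].
have cov i : i \in finset.cover p by rewrite hc finset.inE.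
have eb i : [set j | finset.pblock p i == finset.pblock p j]%SET = finset.pblock p i.
  by apply/finset.setP => j; rewrite finset.inE finset.eq_pblock.
apply/finset.setP => V; apply/idP/finset.imsetP => [hV|[i _ ->]].
  have [i hi] : exists i, i \in V.
    by apply/finset.set0Pn; apply: contraNneq h0 => <-.
  by exists i => //; rewrite eb (finset.def_pblock ht hV hi).
by rewrite eb finset.pblock_mem.
Qed.

Lemma labels_inj p q : finset.partition p [set: 'I_n] -> finset.partition q [set: 'I_n] ->
  labels p = labels q -> p = q.
Proof.
move=> hp hq e; rewrite [LHS](partition_pblock hp) [RHS](partition_pblock hq).
apply: finset.eq_imset => i; apply/finset.setP => j; rewrite !finset.inE.
by apply/eqP/eqP => /labels_eq h; apply/labels_eq; rewrite ?e // -e.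
Qed.

Lemma labels_surj c : size c = n -> good k c ->
  exists2 p, finset.partition p [set: 'I_n] & labels p = c.
Proof.
move=> sc [_ cn _]; pose f (i : 'I_n) := nth 0%N c i.
have pP := finset.preim_partitionP f [set: 'I_n]; exists (finset.preim_partition f [set: 'I_n]) => //.
set p := finset.preim_partition _ _ in pP *.
have hb i j : (finset.pblock p i == finset.pblock p j) = (f i == f j).
  have [/eqP hc ht h0] := and3P pP.
  rewrite finset.eq_pblock ?hc ?finset.inE // finset.pblock_equivalence_partition ?finset.inE //.
  by move=> ? ? ? _ _ _ /=; split=> // /eqP ->.
apply: (@eq_from_nth _ 0%N) => [|m]; first by rewrite size_map size_blocks sc.
rewrite size_map size_blocks => hm; rewrite -[m]/(nat_of_ord (Ordinal hm)) nth_labels.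
set i := Ordinal hm; have [|h1 h2] := cn m; first by rewrite sc.
have hfi : (f i < n)%N by exact: leq_ltn_trans h1 hm.
pose j := Ordinal hfi.
have ej : finset.pblock p j = finset.pblock p i by apply/eqP; rewrite hb; apply/eqP; exact: h2.
apply/eqP; rewrite eqn_leq; apply/andP; split.
  by rewrite -[nth _ _ _]/(nat_of_ord j) -ej -nth_blocks index_nth_le // size_blocks.
rewrite leqNgt; apply/negP => hlt; set m' := index _ _ in hlt.
have hm' : (m' < n)%N by rewrite -(size_blocks p) index_mem mem_blocks.
have : finset.pblock p (Ordinal hm') == finset.pblock p i by rewrite -nth_blocks nth_index // mem_blocks.
rewrite hb => /eqP e; have [|h3 _] := cn m'; first by rewrite sc.
by move: h3; rewrite -[nth _ _ m']/(f (Ordinal hm')) e leqNgt hlt.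
Qed.

Variables (R : realType) (A : cstarType R) (rho : seq A -> A) (BB : set A).
Hypothesis rhoB : forall a (l : seq A), BB (rho (a :: l)).
Hypothesis rhoR : forall (l : seq A) a v, BB v -> rho (rcons l (a * v)) = rho (rcons l a) * v.

(** Canonical admissible label sequences are in bijection with partitions, and both [nested] and the
    stack evaluation depend on labels only up to renaming. *)
Lemma partition_sum (a : n.-tuple A) : (0 < n)%N ->
  \sum_(p : {set {set 'I_n}} | finset.partition p [set: 'I_n] && lattice p) rho_partition rho p a =
  T0 k rho [::] a.
Proof.
move=> n0; pose F (c : seq nat) := sev rho [::] (zip c (a : seq A)).
transitivity (\sum_(p : {set {set 'I_n}} | finset.partition p [set: 'I_n] && lattice p) F (labels p)).
  apply: eq_bigr => p /andP[hp hl]; rewrite /rho_partition.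
  set w := [seq _ | i <- enum 'I_n].
  have u1 : unzip1 w = blocks p by rewrite /unzip1 -map_comp.
  have sw : size w = n by rewrite size_map size_enum_ord.
  have u2 : unzip2 w = a by rewrite /unzip2 -map_comp -[RHS]map_tnth_enum; apply: eq_map.
  rewrite (nested_sev rhoB rhoR) ?sw //; last 2 first.
  - rewrite u1; have /labels_good[/(ncseq_nth 0%N) h _ _] := hl.
    apply/(ncseq_nth finset.set0) => i j m l ij jm ml; rewrite size_blocks => hl'.
    have hm := ltn_trans ml hl'; have hj := ltn_trans jm hm; have hi := ltn_trans ij hj.
    rewrite (nth_blocks p (Ordinal hi)) (nth_blocks p (Ordinal hj)).
    rewrite (nth_blocks p (Ordinal hm)) (nth_blocks p (Ordinal hl')) => /labels_eq e1 /labels_eq e2; apply/labels_eq; apply: h e1 e2 => //.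
    by rewrite size_map size_blocks.
  - by rewrite -size_eq0 sw -lt0n.
  rewrite -(@sev_relabel _ _ rho _ _ (index^~ (blocks p)) w (mem (blocks p))).
  - rewrite /F; congr (sev _ _ _); rewrite -[LHS]zip_unzip; congr zip.
      by transitivity (map (index^~ (blocks p)) (unzip1 w)); [rewrite /unzip1 -!map_comp|rewrite u1].
    by rewrite /unzip2 -map_comp -[RHS]u2 /unzip2; apply: eq_map.
  - exact: index_inj.
  - by rewrite u1.
rewrite -big_filter -(big_map labels xpredT F) -[T0 _ _ _ _]/(T0 k rho (unzip2 ([::] : seq (nat * (seq A * A)))) a).
rewrite -(@ext_sum k _ _ rho _ [::] 0%N) // size_tuple; apply: perm_big; apply: uniq_perm.
- rewrite map_inj_in_uniq ?filter_uniq ?index_enum_uniq // => p q.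
  by rewrite !mem_filter => /andP[/andP[hp _] _] /andP[/andP[hq _] _]; exact: labels_inj.
- exact: (uniq_ext n (good_nil k)).
move=> c; apply/mapP/idP => [[p + ->]|/(mem_ext n c (good_nil k))[sc hc]].
  rewrite mem_filter => /andP[/andP[_ hl] _]; apply/(mem_ext n _ (good_nil k)).
  by split; [rewrite size_map size_blocks|apply/labels_good].
have [p hp ep] := labels_surj sc hc; exists p => //.
by rewrite mem_filter hp mem_index_enum andbT; apply/labels_good; rewrite ep.
Qed.

End PartitionSum.

(** * Cumulants by recursion on the block of the first point *)

Section FirstBlock.
Variables (k : bool) (R : realType) (A : cstarType R).

Section Generic.
Variables (T : Type) (mul : T -> A -> T) (M : seq T -> A).

(* Sum over the block of the first point; rho receives the block, each point
   multiplied by the moment M of the gap on its right. *)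
Fixpoint fblock (V : zmodType) (rho : seq T -> V) cur gap (r : seq T) : V :=
  if r is b :: r' then
    fblock rho cur (rcons gap b) r' +
    (if k || nilp gap then fblock (fun l => rho (mul cur (M gap) :: l)) b [::] r' else 0)
  else rho [:: mul cur (M gap)].

Lemma fblock_head (V : zmodType) (rho rho' : seq T -> V) c c' g r :
  (forall v l, rho (mul c v :: l) = rho' (mul c' v :: l)) -> fblock rho c g r = fblock rho' c' g r.
Proof.
move=> h; elim: r g => [|b r IH] g //=; rewrite IH; congr (_ + _); case: ifP => // _.
by congr (fblock _ _ _ _); apply/funext => l.
Qed.

Lemma fblock_add (V W : zmodType) (f : V -> W) (rho : seq T -> V) c g r :
  {morph f : a b / a + b} -> fblock (fun l => f (rho l)) c g r = f (fblock rho c g r).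
Proof.
move=> fD; have f0 : f 0 = 0 by apply: (@addrI _ (f 0)); rewrite -fD !addr0.
elim: r c g rho => [|b r IH] c g rho //=; rewrite fD IH; congr (_ + _).
by case: ifP => // _; rewrite IH.
Qed.

Lemma fblock0 (V : zmodType) c g r : fblock (fun=> 0 : V) c g r = 0.
Proof. by elim: r c g => [|b r IH] c g //=; rewrite !IH add0r; case: ifP. Qed.

Lemma fblockD (V : zmodType) (rho rho' : seq T -> V) c g r :
  fblock (fun l => rho l + rho' l) c g r = fblock rho c g r + fblock rho' c g r.
Proof.
elim: r c g rho rho' => [|b r IH] c g rho rho' //=; rewrite IH addrACA; congr (_ + _).
by case: ifP => _; rewrite ?IH ?addr0.
Qed.

Lemma fblock_sum (V : zmodType) (I : Type) (s : seq I) (rho : I -> seq T -> V) c g r :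
  fblock (fun l => \sum_(i <- s) rho i l) c g r = \sum_(i <- s) fblock (rho i) c g r.
Proof.
elim: s => [|i s IH].
  rewrite big_nil -[RHS](fblock0 V c g r); congr (fblock _ _ _ _).
  by apply/funext => l; rewrite big_nil.
rewrite big_cons -IH -fblockD; congr (fblock _ _ _ _).
by apply/funext => l; rewrite big_cons.
Qed.

Lemma fblock_eq (V : zmodType) (rho rho' : seq T -> V) c g r :
  (forall l, (size l <= (size r).+1)%N -> rho l = rho' l) -> fblock rho c g r = fblock rho' c g r.
Proof.
elim: r c g rho rho' => [|b r IH] c g rho rho' h /=; first exact: h.
rewrite (IH c _ rho rho') => [|l hl]; last by apply: h; exact: leqW.
by congr (_ + _); case: ifP => // _; apply: IH => l hl; apply: h.
Qed.

(** Only the partition with a single block gives [rho] an argument of full length, and its gaps are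
    empty, hence contribute 1. *)
Lemma fblock_top (V : zmodType) (rho rho' : seq T -> V) c r : M [::] = 1 ->
  (forall c, mul c 1 = c) ->
  (forall l, (size l <= size r)%N -> rho l = rho' l) ->
  fblock rho c [::] r - fblock rho' c [::] r = rho (c :: r) - rho' (c :: r).
Proof.
move=> M1 m1; elim: r c rho rho' => [|b r IH] c rho rho' h; first by rewrite /= M1 m1.
rewrite /= orbT M1 m1 (@fblock_eq _ rho rho') // opprD addrACA subrr add0r.
by rewrite (IH b (fun l => rho (c :: l)) (fun l => rho' (c :: l))) // => l hl; apply: h.
Qed.

End Generic.

Lemma fblock_map (T T' : Type) (mul : T -> A -> T) (mul' : T' -> A -> T') (M : seq T -> A)
    (M' : seq T' -> A) (f : T -> T') (V : zmodType) (rho : seq T' -> V) c g r :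
  (forall t v, f (mul t v) = mul' (f t) v) -> (forall s, M s = M' (map f s)) ->
  fblock mul M (fun l => rho (map f l)) c g r = fblock mul' M' rho (f c) (map f g) (map f r).
Proof.
move=> h1 h2; elim: r c g rho => [|b r IH] c g rho /=; first by rewrite h1 h2.
rewrite IH map_rcons; congr (_ + _); rewrite /nilp size_map; case: ifP => // _.
by rewrite -(IH b [::]) /= h1 h2.
Qed.

End FirstBlock.

Section Cumulants.
Variables (k : bool) (R : realType) (A : cstarType R) (E : {linear A -> A}) (BB : set A).
Hypothesis B_sub : star_subalgebra BB.
Hypothesis EB : forall a, BB (E a).
Hypothesis El : forall b a, BB b -> E (b * a) = b * E a.
Hypothesis Er : forall a b, BB b -> E (a * b) = E a * b.
Implicit Types (a b c v cur : A) (g r w l : seq A).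

(** The empty moment is 1 and not [E 1], which in the Boolean case is the projection [e]. *)
Definition Mo w : A := if w is [::] then 1 else E (\prod_(y <- w) y).
Local Notation fb := (fblock k *%R Mo).

Lemma Mo_nonnil w : w <> [::] -> Mo w = E (\prod_(y <- w) y).
Proof. by case: w. Qed.

Lemma Mo_mid l1 a l2 : Mo (l1 ++ a :: l2) = E (\prod_(y <- l1) y * (a * \prod_(y <- l2) y)).
Proof. by rewrite Mo_nonnil ?big_cat ?big_cons //; case: l1. Qed.

Definition mlin (V : lmodType R[i]) (rho : seq A -> V) := forall l1 (c : R[i]) a b l2,
  rho (l1 ++ (c *: a + b) :: l2) = c *: rho (l1 ++ a :: l2) + rho (l1 ++ b :: l2).

Lemma mlin_Mo : mlin Mo.
Proof.
by move=> l1 c a b l2; rewrite !Mo_mid mulrDl mulrDr -scalerAl -scalerAr linearP.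
Qed.

Lemma mlin_cons (V : lmodType R[i]) (rho : seq A -> V) y : mlin rho -> mlin (fun l => rho (y :: l)).
Proof. by move=> h l1 c a b l2; exact: (h (y :: l1)). Qed.

Section Multilinear.
Variables (V : lmodType R[i]).
Implicit Types (rho : seq A -> V).

Lemma mlin_head rho (s : R[i]) a b l : mlin rho -> rho ((s *: a + b) :: l) = s *: rho (a :: l) + rho (b :: l).
Proof. by move=> h; exact: (h [::]). Qed.

Lemma fb_cur rho (s : R[i]) a b g r : mlin rho ->
  fb rho (s *: a + b) g r = s *: fb rho a g r + fb rho b g r.
Proof.
elim: r g rho => [|b' r IH] g rho h /=.
  by rewrite mulrDl -scalerAl mlin_head.
rewrite IH // scalerDr addrACA; congr (_ + _); case: ifP => _; last by rewrite scaler0 addr0.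
rewrite -fblock_add; last by move=> u v; exact: scalerDr.
rewrite -fblockD; congr (fblock _ _ _ _ _ _ _); apply/funext => l.
by rewrite mulrDl -scalerAl mlin_head.
Qed.

Lemma fb_gap rho (s : R[i]) a b g1 g2 cur r : mlin rho ->
  fb rho cur (g1 ++ (s *: a + b) :: g2) r =
  s *: fb rho cur (g1 ++ a :: g2) r + fb rho cur (g1 ++ b :: g2) r.
Proof.
elim: r g2 rho => [|b' r IH] g2 rho h /=.
  by rewrite mlin_Mo mulrDr -scalerAr mlin_head.
rewrite -!cats1 -!catA !cat_cons IH // scalerDr addrACA; congr (_ + _).
have nn y : nilp (g1 ++ y :: g2) = false by rewrite /nilp size_cat /= addnS.
rewrite !nn; case: ifP => _; last by rewrite scaler0 addr0.
rewrite -fblock_add; last by move=> u v; exact: scalerDr.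
rewrite -fblockD; congr (fblock _ _ _ _ _ _ _); apply/funext => l.
by rewrite mlin_Mo mulrDr -scalerAr mlin_head.
Qed.

Lemma fb_rest rho (s : R[i]) a b g cur r1 r2 : mlin rho ->
  fb rho cur g (r1 ++ (s *: a + b) :: r2) =
  s *: fb rho cur g (r1 ++ a :: r2) + fb rho cur g (r1 ++ b :: r2).
Proof.
elim: r1 cur g rho => [|b' r1 IH] cur g rho h /=.
  rewrite -!cats1 fb_gap // scalerDr addrACA; congr (_ + _); case: ifP => _; last by rewrite scaler0 addr0.
  by rewrite fb_cur //; exact: mlin_cons.
rewrite IH // scalerDr addrACA; congr (_ + _); case: ifP => _; last by rewrite scaler0 addr0.
by rewrite IH //; exact: mlin_cons.
Qed.

Lemma mlin_fb rho : mlin rho -> mlin (fun w => if w is a :: r then fb rho a [::] r else 0).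
Proof.
move=> h [|a' l1] s a b l2 /=; [exact: fb_cur|exact: fb_rest].
Qed.

End Multilinear.

Lemma fb_last (rho : seq A -> A) cur g r a v : BB v ->
  (forall l y, rho (rcons l (y * v)) = rho (rcons l y) * v) ->
  fb rho cur g (rcons r (a * v)) = fb rho cur g (rcons r a) * v.
Proof.
move=> hv; have hM g' y : Mo (rcons g' (y * v)) = Mo (rcons g' y) * v.
  by rewrite -!cats1 !Mo_mid !big_nil !mulr1 mulrA Er.
elim: r cur g rho => [|b r IH] cur g rho h /=.
  rewrite mulrDl; congr (_ + _).
    by rewrite hM mulrA; exact: (h [::]).
  case: ifP => _; last by rewrite mul0r.
  by rewrite !mulr1; exact: (h [:: _]).
rewrite mulrDl IH //; congr (_ + _); case: ifP => _; last by rewrite mul0r.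
by rewrite IH // => l y; rewrite -!rcons_cons h.
Qed.

Lemma fb_left (rho : seq A -> A) b a g r : (forall y l, rho (b * y :: l) = b * rho (y :: l)) ->
  fb rho (b * a) g r = b * fb rho a g r.
Proof.
move=> h; rewrite -fblock_add; last by move=> u v; exact: mulrDr.
by apply: fblock_head => v l; rewrite -mulrA h.
Qed.

Lemma fb_B (rho : seq A -> A) cur g r : (forall a l, BB (rho (a :: l))) -> BB (fb rho cur g r).
Proof.
have [h0 hl _ _] := B_sub.
elim: r cur g rho => [|b r IH] cur g rho h //=.
rewrite -[X in X + _]scale1r; apply: (hl); first exact: IH.
by case: ifP => _ //; exact: IH.
Qed.

(** The cumulants of length at most n, and 0 beyond. With this truncation the sum over first blocks
    omits exactly the one-block term, so that it can be solved for the next cumulant. *)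
Fixpoint cumul n w : A :=
  if n is n'.+1 then
    if size w == n then (if w is a :: r then Mo w - fb (cumul n') a [::] r else 0) else cumul n' w
  else 0.

Definition kappa w := cumul (size w) w.

Lemma cumul_big n w : (n < size w)%N -> cumul n w = 0.
Proof. by elim: n => //= n IH h; rewrite gtn_eqF // IH // ltnW. Qed.

Lemma cumul_le n w : (size w <= n)%N -> cumul n w = kappa w.
Proof.
elim: n => [|n IH] h; first by move: h; case: w.
rewrite /=; case: eqP => e; first by rewrite /kappa e /= e eqxx.
by apply: IH; lia.
Qed.

Lemma kappa_rec a r : kappa (a :: r) = Mo (a :: r) - fb (cumul (size r)) a [::] r.
Proof. by rewrite /kappa /= eqxx. Qed.

Lemma kappa_fb a r : Mo (a :: r) = fb kappa a [::] r.
Proof.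
have := @fblock_top k _ _ _ *%R Mo _ kappa (cumul (size r)) a r erefl (@mulr1 A).
move=> /(_ (fun l hl => esym (cumul_le hl))).
rewrite (cumul_big (w := a :: r)) // subr0 kappa_rec => h.
by rewrite -[LHS](subrK (fb (cumul (size r)) a [::] r)) -h subrK.
Qed.

Lemma mlin_cumul n : mlin (cumul n).
Proof.
elim: n => [|n IH] l1 s a b l2; first by rewrite /= scaler0 addr0.
have sz y : size (l1 ++ y :: l2) = size (l1 ++ a :: l2) by rewrite !size_cat.
rewrite /= !(sz (_ + _)) !(sz b); case: eqP => _; last exact: IH.
have := @mlin_fb A (cumul n) IH l1 s a b l2.
case: l1 {sz} => [|a' l1] /= h; rewrite ?h opprD scalerBr addrACA; congr (_ + _).
- exact: (mlin_Mo [::]).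
- exact: (mlin_Mo (a' :: l1)).
Qed.

Lemma mlin_kappa : mlin kappa.
Proof.
move=> l1 s a b l2; rewrite /kappa.
have sz y : size (l1 ++ y :: l2) = size (l1 ++ a :: l2) by rewrite !size_cat.
by rewrite (sz b) (sz (_ + _)); exact: mlin_cumul.
Qed.

Lemma cumulR n l a v : BB v -> cumul n (rcons l (a * v)) = cumul n (rcons l a) * v.
Proof.
move=> hv; elim: n l a => [|n IH] l a; first by rewrite /= mul0r.
rewrite /= !size_rcons; case: ifP => _ //.
case: l => [|b l] /=.
  by rewrite mulrBl /Mo !big_seq1 Er // !mulr1 -(IH [::]).
rewrite mulrBl fb_last //; congr (_ - _).
by rewrite -!cats1 /= !big_cons !big_cat !big_seq1 /= !mulrA Er.
Qed.

Lemma kappaR l a v : BB v -> kappa (rcons l (a * v)) = kappa (rcons l a) * v.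
Proof. by move=> hv; rewrite /kappa !size_rcons cumulR. Qed.

Lemma cumulL n b a l : BB b -> cumul n (b * a :: l) = b * cumul n (a :: l).
Proof.
move=> hb; elim: n a l => [|n IH] a l; first by rewrite /= mulr0.
rewrite /=; case: ifP => _ //; rewrite mulrBr fb_left //.
by rewrite !big_cons -mulrA El.
Qed.

Lemma kappaL b a l : BB b -> kappa (b * a :: l) = b * kappa (a :: l).
Proof. by move=> hb; exact: (cumulL (size l).+1 a l hb). Qed.

Lemma cumulB n a l : BB (cumul n (a :: l)).
Proof.
have [h0 hl _ _] := B_sub.
elim: n a l => [|n IH] a l //=; case: ifP => _ //.
by rewrite addrC -scaleN1r; apply: (hl) => //; exact: fb_B.
Qed.

Lemma kappaB a l : BB (kappa (a :: l)). Proof. exact: cumulB. Qed.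

Local Notation T0 := (T0 k kappa).

Lemma kappaD l1 a b l2 : kappa (l1 ++ (a + b) :: l2) = kappa (l1 ++ a :: l2) + kappa (l1 ++ b :: l2).
Proof. by have := mlin_kappa l1 1 a b l2; rewrite !scale1r. Qed.

Lemma sel_cat1 (U : Type) (s : seq U) z : sel k (rcons s z) = sel k s ++ (if k || nilp s then [:: z] else [::]).
Proof. by rewrite /sel; case: k => /=; rewrite ?cats1 //; case: s => //= y s; rewrite !take0. Qed.

Lemma pops_rcons v b (u : seq (seq A * A)) acc cur : pops kappa v b (rcons u (acc, cur)) =
  rcons [seq rcons st (acc, cur) | st <- pops kappa v b u] [:: (rcons acc (cur * close kappa v u), b)].
Proof. by elim: u v => [|[ac cu] u IH] v //=; rewrite IH. Qed.

Lemma close_rcons v (u : seq (seq A * A)) acc cur : close kappa v (rcons u (acc, cur)) =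
  kappa (rcons acc (cur * close kappa v u)).
Proof. by elim: u v => [|[ac cu] u IH] v //=. Qed.

Lemma nilp_pops v b (u : seq (seq A * A)) : nilp (pops kappa v b u) = nilp u.
Proof. by case: u => [|[]]. Qed.

Lemma T0_acc (u : seq (seq A * A)) l1 a b l2 cur r :
  T0 (rcons u (l1 ++ (a + b) :: l2, cur)) r =
  T0 (rcons u (l1 ++ a :: l2, cur)) r + T0 (rcons u (l1 ++ b :: l2, cur)) r.
Proof.
elim: r u l2 cur => [|y r IH] u l2 cur /=.
  by rewrite !close_rcons !rcons_cat !rcons_cons kappaD.
rewrite -!rcons_cons !IH !pops_rcons !sel_cat1 !big_cat /= /nilp !size_map -!/(nilp _) !nilp_pops.
rewrite [RHS]addrACA; congr (_ + _); rewrite [RHS]addrACA !sel_map !big_map; congr (_ + _).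
  by rewrite -big_split; apply: eq_bigr => st _; exact: IH.
case: ifP => _; last by rewrite !big_nil addr0.
by rewrite !big_seq1 !rcons_cat !rcons_cons (IH [::]).
Qed.

Fixpoint splits (F : seq A -> A -> seq A -> A) r : A :=
  if r is b :: r' then F [::] b r' + splits (fun r1 b' r2 => F (b :: r1) b' r2) r' else 0.

Lemma splits_eq F F' r : (forall r1 b r2, r = r1 ++ b :: r2 -> F r1 b r2 = F' r1 b r2) ->
  splits F r = splits F' r.
Proof.
elim: r F F' => //= b r IH F F' h; rewrite (h [::]) //; congr (_ + _).
by apply: IH => r1 b' r2 e; apply: h; rewrite e.
Qed.

Lemma splitsD F F' r : splits (fun r1 b r2 => F r1 b r2 + F' r1 b r2) r = splits F r + splits F' r.
Proof. by elim: r F F' => [|b r IH] F F' /=; rewrite ?addr0 // IH addrACA. Qed.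

Lemma splits0 r : splits (fun _ _ _ => 0) r = 0.
Proof. by elim: r => //= b r ->; rewrite addr0. Qed.

Lemma splits_sum (I : Type) (s : seq I) F r :
  splits (fun r1 b r2 => \sum_(i <- s) F i r1 b r2) r = \sum_(i <- s) splits (F i) r.
Proof.
elim: s => [|i s IH].
  by rewrite big_nil -[RHS](splits0 r); apply: splits_eq => *; rewrite big_nil.
by rewrite big_cons -IH -splitsD; apply: splits_eq => *; rewrite big_cons.
Qed.

Lemma fb_splits (rho : seq A -> A) cur g r : fb rho cur g r = rho [:: cur * Mo (g ++ r)] +
  splits (fun r1 b r2 => if k || nilp (g ++ r1) then
    fb (fun l => rho (cur * Mo (g ++ r1) :: l)) b [::] r2 else 0) r.
Proof.
elim: r g => [|b r IH] g /=; first by rewrite cats0 addr0.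
rewrite IH cat_rcons -addrA; congr (_ + _); rewrite cats0 addrC; congr (_ + _).
by apply: splits_eq => r1 b' r2 _; rewrite cat_rcons.
Qed.

(** The sum is split according to the next point that joins the bottom block of the stack. The
    points before it see only the blocks above, and their total enters by right multiplication of
    the last argument of the bottom block. *)
Lemma T0_rcons (u : seq (seq A * A)) acc cur r : T0 (rcons u (acc, cur)) r =
  kappa (rcons acc (cur * T0 u r)) +
  splits (fun r1 b r2 => if k || (nilp u && nilp r1) then
    T0 [:: (rcons acc (cur * T0 u r1), b)] r2 else 0) r.
Proof.
elim: r u => [|b r IH] u /=; first by rewrite close_rcons addr0.
pose G v b' r2 := T0 [:: (rcons acc (cur * v), b')] r2.
have GD v v' b' r2 : G (v + v') b' r2 = G v b' r2 + G v' b' r2.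
  by rewrite /G mulrDr -!cats1; exact: (T0_acc [::] acc (cur * v) (cur * v') [::]).
have KD v v' : kappa (rcons acc (cur * (v + v'))) = kappa (rcons acc (cur * v)) + kappa (rcons acc (cur * v')).
  by rewrite mulrDr -!cats1 kappaD.
have G0 b' r2 : G 0 b' r2 = 0 by apply: (@addrI _ (G 0 b' r2)); rewrite -GD !addr0.
have K0 : kappa (rcons acc (cur * 0)) = 0.
  by apply: (@addrI _ (kappa (rcons acc (cur * 0)))); rewrite -KD !addr0.
rewrite -rcons_cons IH /= pops_rcons sel_cat1 big_cat /= sel_map big_map /nilp size_map -!/(nilp _) nilp_pops.
under eq_bigr => st _ do rewrite IH.
rewrite big_split /= KD (big_morph (fun v => kappa (rcons acc (cur * v))) KD K0).
rewrite -!addrA; congr (_ + _); rewrite addrCA; congr (_ + _).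
rewrite addrA addrC; congr (_ + _).
  by rewrite /= andbT; case: ifP => _; rewrite ?big_nil ?big_seq1.
rewrite -splits_sum -splitsD; apply: splits_eq => r1 b' r2 _ /=.
have [ek|ek] : k = true \/ k = false by case: (k); [left|right].
  rewrite andbF orbF !(ifT _ _ ek) -/(G (T0 (([::], b) :: u) r1 + _) b' r2) GD; congr (_ + _).
  rewrite (big_morph (fun v => G v b' r2) (fun v v' => GD v v' b' r2) (G0 b' r2)).
  by apply: eq_bigr => st _; rewrite ifT // [X in X || _]ek.
rewrite andbF orbF !(ifF _ _ ek) add0r big1_seq // => st /= hst.
rewrite ifF // [X in X || _]ek /=; case: st hst => // hst.
exfalso; move: hst; rewrite /sel ek => /mem_take.
have : forall v u0 st, st \in pops kappa v b u0 -> st <> [::].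
  by move=> v u0; elim: u0 v => [|[? ?] u0 IHu] v st //=; rewrite inE => /orP[/eqP -> //|/IHu].
by move=> hh /hh.
Qed.

(** With one open block, the sum over stacks is the sum over first blocks, the gaps being moments by
    induction on the length; [kappa_fb] then identifies it with the moment. *)
Lemma T0_Mo w : T0 [::] w = Mo w.
Proof.
have gen n : forall w, (size w <= n)%N -> T0 [::] w = Mo w; last exact: gen (leqnn _).
elim: n => [|n IH] {w}[|a r] //= hr.
rewrite [sel _ _](_ : _ = [::]); last by rewrite /sel; case: k.
rewrite big_nil addr0 -[RHS]/(Mo (a :: r)) kappa_fb.
have : forall acc cur r', (size r' <= n)%N ->
  T0 [:: (acc, cur)] r' = fb (fun l => kappa (acc ++ l)) cur [::] r'.
  move=> acc cur r' hr'.
  have [m hm] := ubnP (size r'); elim: m r' hm acc cur hr' => // m IHm r' hm acc cur hr'.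
  rewrite (T0_rcons [::]) fb_splits /= IH // cats1; congr (_ + _).
  apply: splits_eq => r1 b r2 e; case: ifP => // _.
  have s1 : (size r1 <= n)%N by apply: leq_trans hr'; rewrite e size_cat leq_addr.
  have s2 : (size r2 < size r')%N by rewrite e size_cat /= addnS ltnS leq_addl.
  rewrite IH // IHm //; last 2 first.
  - exact: leq_trans s2 _.
  - by apply: leq_trans hr'; exact: ltnW.
  congr (fblock _ _ _ _ _ _ _); apply/funext => l; by rewrite cat_rcons.
by move=> /(_ [::] a r hr) ->.
Qed.

Theorem kappa_moment n (a : n.-tuple A) : (0 < n)%N ->
  E (\prod_(y <- a) y) =
  \sum_(p : {set {set 'I_n}} | finset.partition p [set: 'I_n] && lattice k p) rho_partition kappa p a.
Proof.
move=> n0; rewrite (partition_sum k kappaB kappaR) // T0_Mo Mo_nonnil //.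
by move=> e; have := size_tuple a; rewrite e => e0; move: n0; rewrite -e0.
Qed.

End Cumulants.

(** * Invariance passes from moments to cumulants *)

Section Substitution.
Variables (R : realType) (A Q : cstarType R) (s : nat -> seq (nat * Q)).
Implicit Types (t : nat * A) (ts : seq (nat * A)).

(** The coaction again, on lists of letters with coefficients: F receives the whole list, so that
    cumulants, and not only products, can be evaluated. *)
Fixpoint subst (F : seq (nat * A) -> Q) ts : Q :=
  if ts is t :: ts' then \sum_(p <- s t.1) p.2 * subst (fun l => F ((p.1, t.2) :: l)) ts'
  else F [::].

Lemma subst_eq F F' ts : (forall l, map snd l = map snd ts -> F l = F' l) -> subst F ts = subst F' ts.
Proof.
elim: ts F F' => [|t ts IH] F F' h /=; first exact: h.
by apply: eq_bigr => p _; congr (_ * _); apply: IH => l hl; apply: h; rewrite /= hl.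
Qed.

Lemma subst_cat F ts1 ts2 : subst F (ts1 ++ ts2) = subst (fun l1 => subst (fun l2 => F (l1 ++ l2)) ts2) ts1.
Proof. by elim: ts1 F => //= t ts1 IH F; apply: eq_bigr => p _; rewrite IH. Qed.

Lemma substD F F' ts : subst (fun l => F l + F' l) ts = subst F ts + subst F' ts.
Proof.
elim: ts F F' => //= t ts IH F F'; rewrite -big_split; apply: eq_bigr => p _.
by rewrite IH mulrDr.
Qed.

Lemma substZ (c : R[i]) F ts : subst (fun l => c *: F l) ts = c *: subst F ts.
Proof.
elim: ts F => //= t ts IH F; rewrite scaler_sumr; apply: eq_bigr => p _.
by rewrite IH scalerAr.
Qed.

Lemma subst0 ts : subst (fun=> 0) ts = 0.
Proof. by elim: ts => //= t ts IH; rewrite big1 // => p _; rewrite IH mulr0. Qed.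

Fixpoint subl ts : seq (Q * seq (nat * A)) :=
  if ts is t :: ts' then [seq (p.2 * q.1, (p.1, t.2) :: q.2) | p <- s t.1, q <- subl ts']
  else [:: (1, [::])].

Lemma subst_subl F ts : subst F ts = \sum_(p <- subl ts) p.1 * F p.2.
Proof.
elim: ts F => [|t ts IH] F /=; first by rewrite big_seq1 mul1r.
rewrite big_allpairs_dep; apply: eq_bigr => p _; rewrite IH mulr_sumr.
by apply: eq_bigr => q _; rewrite mulrA.
Qed.

End Substitution.

(** If functionals separating D annihilate the D-leg of sum q (x) e, this tensor is zero; arbitrary
    linear F replace the tensor product. Induction on the number of terms: either the first e is
    zero, or some functional is non-zero at e and the first q becomes a combination of the
    others. *)
Lemma tensor_separation (R : realType) (A Q : cstarType R) (I : Type) (th : I -> A -> R[i]) (D : set A)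
    (L : seq (Q * A)) (F : A -> Q) : (forall b, lfun (th b)) -> D 0 -> (forall (c : R[i]) a b, D a -> D b -> D (c *: a + b)) ->
  (forall e, D e -> (forall b, th b e = 0) -> e = 0) ->
  {in L, forall p, D p.2} ->
  (forall b, \sum_(p <- L) th b p.2 *: p.1 = 0) ->
  linear F -> \sum_(p <- L) p.1 * F p.2 = 0.
Proof.
move=> thl D0 Dl sep hD hL hF.
have F0 : F 0 = 0 by have := hF (-1) 0 0; rewrite scaleN1r oppr0 addr0 scaleN1r addNr.
have [n] := ubnP (size L); elim: n L hD hL => // n IH [|[q e] L] hD hL; first by rewrite big_nil.
rewrite /= ltnS => hn; rewrite big_cons /=.
have De : D e by exact: (hD (q, e) (mem_head _ _)).
have DL : {in L, forall p, D p.2} by move=> p hp; apply: hD; rewrite inE hp orbT.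
have [h|] := pselect (forall b, th b e = 0).
  rewrite (sep e De h) F0 mulr0 add0r; apply: IH => // b.
  by have := hL b; rewrite big_cons /= h // scale0r add0r.
move=> /existsNP[b0 /eqP n0].
pose t (p : Q * A) := th b0 p.2 / th b0 e.
pose L' := [seq (p.1, - t p *: e + p.2) | p <- L].
pose q' := q + \sum_(p <- L) t p *: p.1.
have E b : th b e *: q' + \sum_(p <- L') th b p.2 *: p.1 = 0.
  rewrite -[RHS](hL b) big_cons /= /q' scalerDr -addrA; congr (_ + _).
  rewrite big_map scaler_sumr -big_split; apply: eq_bigr => p _ /=.
  rewrite (thl b) scalerDl !scalerA addrA -scalerDl.
  by rewrite mulNr [th b e * _]mulrC addrN scale0r add0r.
have q0 : q' = 0.
  have := E b0; rewrite big_map big1 ?addr0 => [|p _] /=.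
    by move=> h; rewrite -[q']scale1r -(mulVf n0) -scalerA h scaler0.
  by rewrite (thl b0) /t mulNr divfK // addNr scale0r.
have : \sum_(p <- L') p.1 * F p.2 = 0.
  apply: IH; [|move=> b|by rewrite size_map].
    by move=> p /mapP[p' hp ->] /=; apply: Dl => //; exact: DL.
  by have := E b; rewrite q0 scaler0 add0r.
rewrite big_map /= => h.
have -> : q * F e + \sum_(p <- L) p.1 * F p.2 = q' * F e + \sum_(p <- L) p.1 * F (- t p *: e + p.2).
  rewrite /q' mulrDl -addrA; congr (_ + _); rewrite mulr_suml -big_split; apply: eq_bigr => p _ /=.
  by rewrite hF mulrDr -scalerAr -scalerAl scaleNr addrA subrr add0r.
by rewrite q0 mul0r add0r.
Qed.

Section CumulantInvariance.
Variables (k : bool) (R : realType) (A : cstarType R) (E : {linear A -> A}) (x : nat -> A).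
Variables (Q : cstarType R) (s : nat -> seq (nat * Q)) (D : set (nat * A)).
Implicit Types (t : nat * A) (ts g r l : seq (nat * A)) (F : A -> Q) (H : seq (nat * A) -> Q).
Local Notation subst := (subst s).

Definition tval t := x t.1 * t.2.
Definition tmul t v := (t.1, t.2 * v).
Definition Mt ts := Mo E (map tval ts).
Local Notation fbt := (fblock k tmul Mt).
Definition inD ts := forall t, t \in ts -> D t.
Hypothesis DM : forall t ts, D t -> inD ts -> D (tmul t (Mt ts)).
Hypothesis invM : forall F ts, linear F -> inD ts -> subst (fun l => F (Mt l)) ts = F (Mt ts).

Lemma tval_mul t v : tval (tmul t v) = tval t * v.
Proof. by rewrite /tval mulrA. Qed.

Lemma inD_cons t ts : inD (t :: ts) <-> D t /\ inD ts.
Proof.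
split=> [h|[h1 h2] t']; first by split=> [|t' ht']; apply: h; rewrite inE ?eqxx ?ht' ?orbT.
by rewrite inE => /orP[/eqP ->|/h2].
Qed.

Lemma inD_cat ts1 ts2 : inD (ts1 ++ ts2) <-> inD ts1 /\ inD ts2.
Proof.
split=> [h|[h1 h2] t]; first by split=> t ht; apply: h; rewrite mem_cat ht ?orbT.
by rewrite mem_cat => /orP[/h1|/h2].
Qed.

Definition tlin H := forall l1 i c l2, linear (fun y => H (l1 ++ (i, c * y) :: l2)).

Lemma tlin_cons H t : tlin H -> tlin (fun l => H (t :: l)).
Proof. by move=> h l1; exact: (h (t :: l1)). Qed.

Lemma fbt_in (V : zmodType) (rho rho' : seq (nat * A) -> V) c g r : D c -> inD g -> inD r ->
  (forall v l, D (tmul c v) -> inD l -> (size l <= size r)%N -> rho (tmul c v :: l) = rho' (tmul c v :: l)) ->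
  fbt rho c g r = fbt rho' c g r.
Proof.
elim: r c g rho rho' => [|b r IH] c g rho rho' hc hg hr h /=; first by apply: h => //; exact: DM.
have [hb hr'] := (inD_cons _ _).1 hr.
congr (_ + _).
  apply: IH => // [|v l hv hl sl]; last by apply: h => //; exact: leqW.
  by rewrite -cats1; apply/inD_cat; split=> //; apply/inD_cons.
case: ifP => // _; apply: IH => // v l hv hl sl; apply: h => //; first exact: DM.
by apply/inD_cons.
Qed.

Definition subst_tail H l := if l is h :: l' then subst (fun l'' => H (h :: l'')) l' else 0.

Lemma fbt_letter H t r : fbt (subst H) t [::] r =
  \sum_(p <- s t.1) p.2 * fbt (subst_tail H) (p.1, t.2) [::] r.
Proof.
pose rho (p : nat * Q) l := if l is h :: l' then p.2 * subst (fun l'' => H ((p.1, h.2) :: l'')) l' else 0.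
rewrite (@fblock_head _ _ _ _ _ _ _ _ (fun l => \sum_(p <- s t.1) rho p l) _ t) //.
rewrite fblock_sum; apply: eq_bigr => p _.
rewrite -fblock_add; last by move=> a b; exact: mulrDr.
exact: fblock_head.
Qed.

(** Letters that fall into gaps are absorbed by the invariance of moments; only the letters of the
    block are still substituted. The head [c] is left alone here and treated by [fbt_letter]. *)
Lemma subst_fbt H c g r : tlin H -> inD g -> inD r ->
  subst (fun g' => subst (fun r' => fbt H c g' r') r) g = fbt (subst_tail H) c g r.
Proof.
elim: r c g H => [|b r IH] c g H hH hg hr /=.
  exact: (invM (F := fun y => H [:: (c.1, c.2 * y)]) (hH [::] c.1 c.2 [::]) hg).
have [hb hr'] := (inD_cons _ _).1 hr.
have hgb : inD (rcons g b) by rewrite -cats1; apply/inD_cat; split=> //; apply/inD_cons.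
rewrite -(IH c (rcons g b) H) // -cats1 subst_cat.
transitivity (subst (fun g' => subst (fun l => subst (fun r' => fbt H c (g' ++ l) r') r) [:: b]) g +
  subst (fun g' => if k || nilp g then \sum_(p <- s b.1) p.2 * subst (fun r' =>
    fbt (fun l => H (tmul c (Mt g') :: l)) (p.1, b.2) [::] r') r else 0) g).
  rewrite -substD; apply: subst_eq => g' eg /=; have -> : nilp g' = nilp g.
    by rewrite /nilp -(size_map snd g') eg size_map.
  have -> : (if k || nilp g then \sum_(p <- s b.1) p.2 * subst (fun r' =>
     fbt (fun l => H (tmul c (Mt g') :: l)) (p.1, b.2) [::] r') r else 0) =
     \sum_(p <- s b.1) p.2 * subst (fun r' => if k || nilp g then
     fbt (fun l => H (tmul c (Mt g') :: l)) (p.1, b.2) [::] r' else 0) r.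
    case: ifP => // _; rewrite big1 // => p _; rewrite (_ : subst _ r = 0) ?mulr0 //.
    exact: subst0.
  rewrite -[RHS]big_split; apply: eq_bigr => p _ /=; rewrite -mulrDr -substD; congr (_ * _).
  by apply: subst_eq => r' _; rewrite cats1.
congr (_ + _); case: ifP => _; last first.
  exact: subst0.
pose F y := \sum_(p <- s b.1) p.2 * subst (fun r' => fbt (fun l => H (tmul c y :: l)) (p.1, b.2) [::] r') r.
have hF : linear F.
  move=> z y y'; rewrite /F scaler_sumr -big_split; apply: eq_bigr => p _ /=.
  rewrite scalerAr -mulrDr -substZ -substD; congr (_ * _); apply: subst_eq => l _.
  rewrite -fblock_add; last by move=> u v; exact: scalerDr.
  rewrite -fblockD; congr (fblock _ _ _ _ _ _ _); apply/funext => l'.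
  exact: (hH [::] c.1 c.2 l').
rewrite (invM hF hg) /F -[RHS]/(fbt (subst (fun l => H (tmul c (Mt g) :: l))) b [::] r) fbt_letter.
apply: eq_bigr => p _; congr (_ * _).
by rewrite -(IH _ [::]) //; exact: tlin_cons.
Qed.

(** Induction on the length. In the recursion for the cumulant, the moment is invariant, and so is
    the sum over first blocks by [subst_fbt] together with the induction hypothesis for shorter
    cumulants. *)
Theorem kappa_invariant F ts : linear F -> inD ts ->
  subst (fun l => F (kappa k E (map tval l))) ts = F (kappa k E (map tval ts)).
Proof.
move=> hF; have FD : {morph F : a b / a + b} by move=> a b; have := hF 1 a b; rewrite !scale1r.
have F0 : F 0 = 0 by apply: (@addrI _ (F 0)); rewrite -FD !addr0.
have FN a : F (- a) = - F a by have := hF (-1) a 0; rewrite !scaleN1r F0 !addr0.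
have [n] := ubnP (size ts); elim: n ts => // n IH [|a r] //; rewrite [size _]/= ltnS => hn hts.
have [ha hr] := (inD_cons _ _).1 hts.
pose H l := F (cumul k E (size r) (map tval l)).
have hH : tlin H.
  move=> l1 i c l2 z y y'; rewrite /H !map_cat /= /tval /= mulrDr -!scalerAr mulrDr -!scalerAr.
  by rewrite (mlin_cumul k E (size r)) hF.
have HE b r' : F (fblock k *%R (Mo E) (cumul k E (size r)) (tval b) [::] (map tval r')) = fbt H b [::] r'.
  rewrite -(@fblock_map k _ _ _ _ tmul _ Mt _ tval _ _ b [::] r') //; first by rewrite fblock_add.
  by move=> *; exact: tval_mul.
rewrite (@subst_eq _ _ _ _ _ (fun l => F (Mt l) + (if l is b :: r' then - fbt H b [::] r' else 0))); last first.
  move=> [|b r'] //= [_ e]; have sz : size r' = size r by rewrite -(size_map snd r') e size_map.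
  by rewrite kappa_rec size_map FD FN sz HE.
rewrite substD invM // kappa_rec size_map FD FN HE; congr (_ + _).
transitivity (- \sum_(p <- s a.1) p.2 * subst (fun r' => fbt H (p.1, a.2) [::] r') r).
  rewrite -sumrN; apply: eq_bigr => p _; rewrite -mulrN; congr (_ * _).
  by rewrite -scaleN1r -substZ; apply: subst_eq => l _; rewrite scaleN1r.
congr (- _); transitivity (fbt (subst H) a [::] r).
  by rewrite fbt_letter; apply: eq_bigr => p _; rewrite -(@subst_fbt _ _ [::]).
apply: fbt_in => // v l' hv hl' sl; have := (inD_cons _ l').2 (conj hv hl').
move: (tmul a v :: l') => l hl {sl hv hl' l' v}.
have [hs|hs] := leqP (size l) (size r).
  rewrite -[RHS]/(F _) cumul_le ?size_map // -IH //; last exact: leq_ltn_trans hs _.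
  apply: subst_eq => l' e; rewrite /H cumul_le // size_map.
  by rewrite -(size_map snd l') e size_map.
rewrite /H (@cumul_big _ _ _ _ _ (map tval l)) ?size_map // F0.
rewrite -[RHS](subst0 s l); apply: subst_eq => l' e.
rewrite cumul_big // size_map.
by rewrite -(size_map snd l') e size_map.
Qed.

End CumulantInvariance.

(** * The relations of power sums and the matrices that satisfy them *)

Section PowerSums.
Variables (R : realType) (Q : cstarType R) (n : nat) (u : 'M[Q]_n).
Hypothesis ou : mx_orthogonal u.

Definition power_sums m := forall s : seq 'I_n, size s = m ->
  \sum_k \prod_(j <- s) u k j = (constant s)%:R.

Lemma row_sum i j : \sum_k u i k * u j k = (i == j)%:R.
Proof.
have [_ /matrixP/(_ i j) + _] := ou; rewrite !mxE => <-.
by apply: eq_bigr => k _; rewrite mxE.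
Qed.

(** Multiply the relation for the indices i1, i, s by [u l i1] and sum over i1: orthogonality of the
    rows singles out k = l on one side, and the Kronecker symbol singles out i1 = i on the other. *)
Lemma row_prod m l (i : 'I_n) s : power_sums m -> m = (size s).+2 ->
  u l i * \prod_(j <- s) u l j = (constant (i :: s))%:R * u l i.
Proof.
move=> h em.
have E : \sum_i1 u l i1 * (\sum_k u k i1 * (u k i * \prod_(j <- s) u k j)) = u l i * \prod_(j <- s) u l j.
  transitivity (\sum_i1 \sum_k u l i1 * (u k i1 * (u k i * \prod_(j <- s) u k j))).
    by apply: eq_bigr => i1 _; rewrite mulr_sumr.
  rewrite exchange_big (bigD1 l) //= [X in _ + X]big1 ?addr0 => [|k kl].
    by under eq_bigr => i1 _ do rewrite mulrA; rewrite -mulr_suml row_sum eqxx mul1r.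
  by under eq_bigr => i1 _ do rewrite mulrA; rewrite -mulr_suml row_sum eq_sym (negbTE kl) mul0r.
have P j : \sum_k u k j * (u k i * \prod_(j' <- s) u k j') = (constant [:: j, i & s])%:R.
  by rewrite -(h [:: j, i & s]) ?em //; apply: eq_bigr => k _; rewrite !big_cons.
rewrite -E (bigD1 i) //= [X in _ + X]big1 ?addr0 => [|i1 ii]; rewrite P /=.
  by rewrite eqxx /=; case: (all _ _); rewrite ?mulr1 ?mul1r ?mul0r ?mulr0.
by rewrite eq_sym (negbTE ii) mulr0.
Qed.

Lemma prod_nseq l (i : 'I_n) q : \prod_(j <- nseq q i) u l j = u l i ^+ q.
Proof. by elim: q => [|q IH] /=; rewrite ?big_nil // big_cons exprS IH. Qed.

Lemma row_power m l i q : power_sums m -> m = q.+2 -> u l i ^+ q.+1 = u l i.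
Proof.
move=> h em; have := @row_prod m l i (nseq q i) h; rewrite size_nseq => /(_ em).
by rewrite /= all_pred1_nseq mul1r prod_nseq -exprS.
Qed.

(** With m = q + 3, [row_prod] gives u_i^(q+1) u_j = 0, while u_i^(q+2) = u_i; so u_i u_j = u_i
    u_i^(q+1) u_j = 0. *)
Lemma row_orth m l i j : power_sums m -> (2 < m)%N -> i != j -> u l i * u l j = 0.
Proof.
move=> h m3 ij; have [q em] : exists q, m = q.+3 by exists (m - 3)%N; lia.
have e1 : u l i ^+ q.+2 = u l i by exact: (row_power l i h em).
have := @row_prod m l i (rcons (nseq q i) j) h; rewrite size_rcons size_nseq => /(_ em).
rewrite /= all_rcons /= eq_sym (negbTE ij) mul0r -cats1 big_cat big_seq1 /= mulrA.
by rewrite prod_nseq -exprS => e2; rewrite -e1 exprS -mulrA e2 mulr0.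
Qed.

Lemma power_sums1 : power_sums 1 -> mx_bistochastic u.
Proof.
move=> h; have hc j : \sum_i u i j = 1.
  by have := h [:: j] erefl; under eq_bigr => k _ do rewrite big_seq1.
split=> // k; transitivity (\sum_j u k j * \sum_l u l j).
  by apply: eq_bigr => j _; rewrite hc mulr1.
under eq_bigr => j _ do rewrite mulr_sumr.
rewrite exchange_big (bigD1 k) //= [X in _ + X]big1 ?addr0 => [|l kl]; first by rewrite row_sum eqxx.
by rewrite row_sum eq_sym (negbTE kl).
Qed.

Lemma magic_idem : (forall i j, u i j * u i j = u i j) -> mx_magic u.
Proof. by move=> h; split=> // i j; split; [have [h1 _ _] := ou; exact: h1|]. Qed.

Lemma bistochastic_magic m : mx_bistochastic u -> power_sums m -> (2 < m)%N -> mx_magic u.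
Proof.
move=> [_ _ hr] h m3; apply: magic_idem => l i.
rewrite -[RHS]mulr1 -(hr l) mulr_sumr (bigD1 i) //= big1 ?addr0 // => j ji.
by apply: (row_orth _ h m3); rewrite eq_sym.
Qed.

(** For m = 1, column sums equal to 1 and orthogonality in columns give idempotents. Otherwise row
    orthogonality gives u^3 = u, and u^(m-1) = u with an even exponent gives u^2 = u. *)
Lemma cubic_odd_magic m : mx_cubic u -> power_sums m -> odd m -> mx_magic u.
Proof.
move=> [_ hc] h om; apply: magic_idem => l i.
have [m1|m1] := leqP m 1.
  have e : m = 1%N by case: m om m1 {h} => [|[]].
  rewrite e in h; have [_ hs _] := power_sums1 h.
  rewrite -[RHS]mulr1 -(hs i) mulr_sumr (bigD1 l) //= big1 ?addr0 // => k kl.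
  by have [] := hc i l k; rewrite // eq_sym.
have e3 : u l i ^+ 3 = u l i.
  rewrite !exprS expr0 mulr1 -[RHS]mulr1 -[X in _ = u l i * X](_ : \sum_k u l k * u l k = 1).
    rewrite mulr_sumr (bigD1 i) //= big1 ?addr0 // => k ki.
    have ik : i != k by rewrite eq_sym.
    by rewrite mulrA; have [-> _] := hc l i k ik; rewrite mul0r.
  by rewrite row_sum eqxx.
have [q em] : exists q, m = (q.*2.+1).+2 by exists (m./2.-1); move: (odd_double_half m); rewrite om; lia.
have := row_power l i h em; rewrite -addn2 => e.
suff e2 : u l i ^+ (q.*2 + 2) = u l i ^+ 2 by rewrite -{3}e e2 expr2.
elim: (q) => // q' IH; rewrite doubleS -[X in _ ^+ X]/((q'.*2 + 2).+2) -addn2 exprD IH -exprD.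
by rewrite -[(2 + 2)%N]/(3 + 1)%N exprD e3 expr1 expr2.
Qed.

End PowerSums.

Section HopfRelations.
Variables (R : realType) (n : nat) (E : genalg R n).

(** The relation yields orthogonality inside rows; the antipode transposes it to columns. *)
Lemma power_sums_cubic m : orthogonal_hopf E -> power_sums (ga_u E) m -> (2 < m)%N -> mx_cubic (ga_u E).
Proof.
move=> [_ ou _ _ [S [S1 SM _ Su]]] h m3; split=> // i j k jk.
split; first exact: (row_orth ou _ h m3).
have := congr1 S (row_orth ou i h m3 (_ : k != j)); rewrite eq_sym => /(_ jk).
by rewrite SM linear0 !Su.
Qed.

Variables (A : genalg R n).

Lemma sub_orthogonal : ga_sub E A -> mx_orthogonal (ga_u A) -> mx_orthogonal (ga_u E).
Proof.
move=> [f hf fu] [h1 h2 h3].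
split.
- by move=> i j; rewrite -fu /selfadjoint -hf h1.
- apply/matrixP => i j; have /matrixP/(_ i j) := h2; rewrite !mxE => e.
  by rewrite -(rmorph_nat f) -e rmorph_sum; apply: eq_bigr => k _; rewrite !mxE rmorphM /= !fu.
apply/matrixP => i j; have /matrixP/(_ i j) := h3; rewrite !mxE => e.
by rewrite -(rmorph_nat f) -e rmorph_sum; apply: eq_bigr => k _; rewrite !mxE rmorphM /= !fu.
Qed.

Lemma sub_cubic : ga_sub E A -> mx_cubic (ga_u A) -> mx_cubic (ga_u E).
Proof.
move=> hs [ho hc]; split; first exact: sub_orthogonal.
have [f _ fu] := hs; move=> i j k jk; have [h1 h2] := hc i j k jk.
by rewrite -!fu -!rmorphM h1 h2 rmorph0.
Qed.

Lemma sub_bistochastic : ga_sub E A -> mx_bistochastic (ga_u A) -> mx_bistochastic (ga_u E).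
Proof.
move=> hs [ho h1 h2]; split; first exact: sub_orthogonal.
  by have [f _ fu] := hs => j; rewrite -(rmorph1 f) -(h1 j) rmorph_sum; apply: eq_bigr => i _; exact/esym/fu.
by have [f _ fu] := hs => j; rewrite -(rmorph1 f) -(h2 j) rmorph_sum; apply: eq_bigr => i _; exact/esym/fu.
Qed.

End HopfRelations.

Section HopfCases.
Variables (R : realType) (n : nat) (E As Ah Ab : genalg R n) (m : nat).
Hypothesis hE : orthogonal_hopf E.
Hypothesis hm : power_sums (ga_u E) m.

Let ou : mx_orthogonal (ga_u E). Proof. by case: hE. Qed.

Lemma sub_As_cubic : is_As As -> is_Ah Ah -> ga_sub E Ah -> odd m -> ga_sub E As.
Proof.
move=> [_ _ hs] [hh _ _] hEh om; apply: hs; apply: (cubic_odd_magic ou _ hm om).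
exact: sub_cubic hEh hh.
Qed.

Lemma sub_As_bistochastic : is_As As -> is_Ab Ab -> ga_sub E Ab -> (2 < m)%N -> ga_sub E As.
Proof.
move=> [_ _ hs] [hb _ _] hEb m3; apply: hs; apply: (bistochastic_magic ou _ hm m3).
exact: sub_bistochastic hEb hb.
Qed.

Lemma sub_Ah : is_Ah Ah -> (2 < m)%N -> ga_sub E Ah.
Proof. by move=> [_ _ hs] m3; apply: hs; exact: power_sums_cubic hE hm m3. Qed.

Lemma sub_Ab : is_Ab Ab -> m = 1%N -> ga_sub E Ab.
Proof. by move=> [_ _ hs] m1; apply: hs; apply: power_sums1 ou _; rewrite -m1. Qed.

End HopfCases.

(** * Freeness over the tail algebra *)

Section FreeIndependence.
Variables (R : realType) (A : cstarType R) (x : nat -> A) (phi : {scalar A}).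
Variables (B : set A) (EE : {linear A -> A}).
Hypothesis hB : star_subalgebra B.
Hypothesis B1 : B 1.
Hypothesis EB : forall a, B (EE a).
Hypothesis Eb : forall b, B b -> EE b = b.
Hypothesis Ebi : forall b1 a b2, B b1 -> B b2 -> EE (b1 * a * b2) = b1 * EE a * b2.
Hypothesis Ephi : forall a, phi (EE a) = phi a.
Hypothesis faithful : forall z, phi (star z * z) = 0 -> z = 0.
Hypothesis Hperm : forall n f t, finperm n f -> {in coefs t, forall b, B b} ->
  phi (evn x (ren f t)) = phi (evn x t).
Hypothesis Hpair : forall (Q : cstarType R) N (s s' : nat -> Q) (t : seq (nat + A)), (0 < N)%N ->
  (forall i, projection (s i) /\ s i + s' i = 1) -> all (gtn N) (letters t) ->
  {in coefs t, forall b, B b} ->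
  Pair x N s s' (fun y => phi y *: 1) t = phi (evn x t) *: 1.
Hypothesis Hfresh : forall t1 (y : seq (nat + A)) t2, {in coefs (t1 ++ y ++ t2), forall b, B b} ->
  {in letters y, forall i, (i \notin letters t1) && (i \notin letters t2)} ->
  phi (evn x (t1 ++ y ++ t2)) = phi (evn x t1 * EE (evn x y) * evn x t2).
Local Notation evn := (evn x).

Section Polynomials.
Implicit Types (a b c e y z : A) (s : seq (nat * bpoly A)) (p : bpoly A).

Lemma E_eq e e' : B e -> B e' -> (forall b, B b -> phi (b * e) = phi (b * e')) -> e = e'.
Proof.
move=> te te' h; have [_ hl _ hs] := hB.
have td : B (e - e') by have := hl (-1) e' e te' te; rewrite scaleN1r addrC.
apply/eqP; rewrite -subr_eq0; apply/eqP/faithful.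
by rewrite mulrBr linearB /= h ?subrr //; exact: hs.
Qed.

Lemma Ephi_l b a : B b -> phi (b * EE a) = phi (b * a).
Proof. by move=> tb; rewrite -[in RHS]Ephi -[b * a]mulr1 Ebi // mulr1. Qed.

Lemma E_phi a a' : (forall b, B b -> phi (b * a) = phi (b * a')) -> EE a = EE a'.
Proof. by move=> h; apply: E_eq => // b tb; rewrite !Ephi_l // h. Qed.

Lemma coefB b : coef B b -> B b.
Proof.
case=> // -[c ->]; have [h0 hl _ _] := hB.
by have := hl c 1 0 B1 h0; rewrite addr0.
Qed.

Definition mtok i (m : A * seq A) : seq (nat + A) :=
  let: (b0, bs) := m in inr b0 :: flatten [seq [:: inl i; inr b] | b <- bs].

Lemma evn_mtok i m : evn (mtok i m) = bmon_eval (x i) m.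
Proof.
case: m => b0 bs; rewrite /mtok evn_cons /bmon_eval; congr (_ * _); elim: bs => [|b l IH] /=.
  by rewrite evn_nil big_nil.
by rewrite /= !evn_cons IH big_cons mulrA.
Qed.

Lemma letters_mtok i m : {subset letters (mtok i m) <= [:: i]}.
Proof. by case: m => b0 bs j /=; elim: bs => //= b l IH; rewrite !inE => /orP[-> //|/IH]; rewrite inE. Qed.

Lemma coefs_mtok i m : coefs (mtok i m) = m.1 :: m.2.
Proof. by case: m => b0 bs /=; congr (_ :: _); elim: bs => //= b l ->. Qed.

Lemma ren_mtok f i m : ren f (mtok i m) = mtok (f i) m.
Proof. by case: m => b0 bs /=; congr (_ :: _); elim: bs => //= b l ->. Qed.

Definition Pi s : A := \prod_(t <- s) bpoly_eval (x t.1) t.2.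

Lemma Pi_cons t s : Pi (t :: s) = bpoly_eval (x t.1) t.2 * Pi s.
Proof. by rewrite /Pi big_cons. Qed.

Lemma Pi_nil : Pi [::] = 1.
Proof. by rewrite /Pi big_nil. Qed.

Lemma Pi_cat s1 s2 : Pi (s1 ++ s2) = Pi s1 * Pi s2.
Proof. by rewrite /Pi big_cat. Qed.

Fixpoint expand s : seq (seq (nat + A)) :=
  if s is t :: s' then [seq mtok t.1 m ++ u | m <- t.2, u <- expand s'] else [:: [::]].

Lemma Pi_expand s : Pi s = \sum_(u <- expand s) evn u.
Proof.
elim: s => [|t s IH]; first by rewrite Pi_nil big_seq1 evn_nil.
rewrite Pi_cons IH /= big_allpairs_dep /bpoly_eval mulr_suml; apply: eq_bigr => m _.
by rewrite mulr_sumr; apply: eq_bigr => u _; rewrite evn_cat evn_mtok.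
Qed.

Definition polyB s := forall t, t \in s -> in_BX B t.2.

Lemma polyB_cons t s : polyB (t :: s) <-> in_BX B t.2 /\ polyB s.
Proof.
split=> [h|[h1 h2] u]; first by split=> [|u hu]; apply: h; rewrite inE ?eqxx // hu orbT.
by rewrite inE => /orP[/eqP ->|/h2].
Qed.

Lemma polyB_cat s1 s2 : polyB (s1 ++ s2) <-> polyB s1 /\ polyB s2.
Proof.
split=> [h|[h1 h2] u]; first by split=> u hu; apply: h; rewrite mem_cat hu ?orbT.
by rewrite mem_cat => /orP[/h1|/h2].
Qed.

Lemma expand_coefs s u : polyB s -> u \in expand s -> {in coefs u, forall b, B b}.
Proof.
elim: s u => [|t s IH] u; first by move=> _; rewrite inE => /eqP ->.
move=> /polyB_cons[ht hs] /allpairsP[[m v] /= [hm hv ->]] b.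
rewrite coefs_cat coefs_mtok mem_cat => /orP[|]; last exact: IH.
by have [h1 h2] := ht m hm; rewrite inE => /orP[/eqP ->|/h2 /coefB //]; exact: coefB.
Qed.

Lemma expand_letters s u : u \in expand s -> {subset letters u <= unzip1 s}.
Proof.
elim: s u => [|t s IH] u; first by rewrite inE => /eqP ->.
move=> /allpairsP[[m v] /= [hm hv ->]] i; rewrite letters_cat mem_cat inE => /orP[|/(IH _ hv) ->].
  by move=> /letters_mtok; rewrite inE => ->.
by rewrite orbT.
Qed.

Definition fren (f : nat -> nat) s := [seq (f t.1, t.2) | t <- s].

Lemma expand_fren f s : expand (fren f s) = map (ren f) (expand s).
Proof.
elim: s => //= t s ->; rewrite map_allpairs allpairs_mapr.
by apply: eq_allpairs => // m u; rewrite ren_cat ren_mtok.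
Qed.

Lemma phi_fren n f s : finperm n f -> polyB s -> phi (Pi (fren f s)) = phi (Pi s).
Proof.
move=> hf hs; rewrite !Pi_expand expand_fren big_map !linear_sum.
by apply: eq_big_seq => u hu; apply: (Hperm hf); exact: expand_coefs hu.
Qed.

Lemma Pi_fresh s1 k p s2 : polyB (s1 ++ (k, p) :: s2) -> k \notin unzip1 s1 -> k \notin unzip1 s2 ->
  phi (Pi (s1 ++ (k, p) :: s2)) = phi (Pi s1 * EE (bpoly_eval (x k) p) * Pi s2).
Proof.
move=> /polyB_cat[b1 /polyB_cons[/= bp b2]] k1 k2; rewrite Pi_cat Pi_cons /= mulrA.
rewrite !Pi_expand /bpoly_eval linear_sum /= !mulr_suml !linear_sum; apply: eq_big_seq => u1 h1.
rewrite ![evn u1 * _]mulr_sumr !mulr_suml !linear_sum; apply: eq_big_seq => m hm.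
rewrite !mulr_sumr !linear_sum; apply: eq_big_seq => u2 h2.
rewrite -evn_mtok -Hfresh ?evn_cat ?mulrA // => b.
  rewrite !coefs_cat !mem_cat coefs_mtok => /or3P[||].
  - exact: expand_coefs h1 _.
  - by have [h3 h4] := bp m hm; rewrite inE => /orP[/eqP ->|/h4 /coefB //]; exact: coefB.
  - exact: expand_coefs h2 _.
move=> /letters_mtok; rewrite inE => /eqP ->; apply/andP; split.
  by apply: contra k1; exact: expand_letters h1 k.
by apply: contra k2; exact: expand_letters h2 k.
Qed.

Definition bscale b p : bpoly A := [seq (b * m.1, m.2) | m <- p].

Lemma bscale_eval b p z : bpoly_eval z (bscale b p) = b * bpoly_eval z p.
Proof.
by rewrite /bpoly_eval big_map mulr_sumr; apply: eq_bigr => m _; rewrite /bmon_eval mulrA.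
Qed.

Lemma bscale_BX b p : B b -> in_BX B p -> in_BX B (bscale b p).
Proof.
move=> tb hp m /mapP[m' /hp [h1 h2] ->]; split=> //=; left.
by have [_ _ hM _] := hB; apply: (hM) => //; exact: coefB.
Qed.

Lemma E_ident : identically_distributed B EE x.
Proof.
move=> p hp i j; apply: E_phi => b tb; rewrite -!bscale_eval.
have := @phi_fren _ _ [:: (i, bscale b p)] (transp_perm i j).
rewrite /Pi /= !big_seq1 /= transpL => -> // t; rewrite inE => /eqP -> /=; exact: bscale_BX.
Qed.

(** The pair coaction with whole polynomials in one variable as letters; [FPair_expand] justifies
    it. *)
Fixpoint FPair (Q : cstarType R) N (s s' : nat -> Q) (L : A -> Q) (fs : seq (nat * bpoly A)) : Q :=
  if fs is t :: fs' then
    s t.1 * FPair N s s' (fun y => L (bpoly_eval (x t.1) t.2 * y)) fs' +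
    s' t.1 * FPair N s s' (fun y => L (bpoly_eval (x (N + t.1)%N) t.2 * y)) fs'
  else L 1.

Section PairExpansion.
Variables (Q : cstarType R) (N : nat) (s s' : nat -> Q).
Hypothesis ss : forall i, projection (s i) /\ s i + s' i = 1.
Implicit Types (L : A -> Q).

Lemma FPair_ext L L' fs : L =1 L' -> FPair N s s' L fs = FPair N s s' L' fs.
Proof. by move=> /funext ->. Qed.

Lemma FPair_sum (I : Type) (r : seq I) (L : I -> A -> Q) fs :
  FPair N s s' (fun y => \sum_(i <- r) L i y) fs = \sum_(i <- r) FPair N s s' (L i) fs.
Proof.
elim: fs L => [|t fs IH] L //=.
by rewrite !IH !mulr_sumr -big_split.
Qed.

(** s_i and s'_i are orthogonal projections, so mixed terms of a monomial in s_i (x) x_i + s'_i (x)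
    x_(N+i) vanish and powers collapse; degree 0 is covered by s_i + s'_i = 1. *)
Lemma Pair_mtok L i m t : Pair x N s s' L (mtok i m ++ t) =
  s i * Pair x N s s' (fun y => L (evn (mtok i m) * y)) t +
  s' i * Pair x N s s' (fun y => L (evn (mtok (N + i)%N m) * y)) t.
Proof.
have s'E j : s' j = 1 - s j by rewrite -(ss j).2 addrC addKr.
have s1 j : s j * s j = s j by case: (ss j) => -[].
have s2 j : s j * s' j = 0 by rewrite s'E mulrBr mulr1 s1 subrr.
have s3 j : s' j * s j = 0 by rewrite s'E mulrBl mul1r s1 subrr.
have s4 j : s' j * s' j = s' j by rewrite {2}s'E mulrBr mulr1 s3 subr0.
have ext (L1 L2 : A -> Q) : L1 =1 L2 -> Pair x N s s' L1 t = Pair x N s s' L2 t.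
  by move=> /funext ->.
case: m => b0 bs; rewrite /mtok.
elim: bs b0 L => [|b bs IH] b0 L /=.
  rewrite -mulrDl (ss i).2 mul1r.
  by apply: ext => y; rewrite !evn_cons evn_nil mulr1.
have HH (j : nat) : Pair x N s s' (fun y => L (b0 * (x j * (b * y)))) (flatten [seq [:: inl i; inr b] | b <- bs] ++ t) =
    Pair x N s s' (fun y => L (b0 * x j * y)) ((inr b :: flatten [seq [:: inl i; inr b] | b <- bs]) ++ t).
  by rewrite /=; congr (Pair _ _ _ _ _ _); apply/funext => y; rewrite !mulrA.
have E j k : Pair x N s s' (fun y => L (b0 * x j * (evn (inr b :: flatten [seq [:: inl k; inr b] | b <- bs]) * y))) t =
    Pair x N s s' (fun y => L (evn [:: inr b0, inl j, inr b & flatten [seq [:: inl k; inr b] | b <- bs]] * y)) t.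
  by apply: ext => y; rewrite !evn_cons !mulrA.
rewrite !HH !cat_cons (IH b (fun y => L (b0 * x i * y))) (IH b (fun y => L (b0 * x (N + i)%N * y))) !E.
by rewrite !mulrDr !mulrA s1 s2 s3 s4 !mul0r addr0 add0r.
Qed.

Lemma FPair_expand L fs : (forall y y', L (y + y') = L y + L y') ->
  FPair N s s' L fs = \sum_(u <- expand fs) Pair x N s s' L u.
Proof.
elim: fs L => [|t fs IH] L hL /=; first by rewrite big_seq1.
have L0 : L 0 = 0 by apply: (@addrI _ (L 0)); rewrite -hL !addr0.
have hLs (f : A * seq A -> A) y : L ((\sum_(m <- t.2) f m) * y) = \sum_(m <- t.2) L (f m * y).
  by rewrite mulr_suml (big_morph L hL L0).
rewrite !(FPair_ext _ (fun y => hLs _ y)) !FPair_sum big_allpairs_dep !mulr_sumr -big_split.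
apply: eq_bigr => m _ /=.
under [RHS]eq_bigr => u _ do rewrite Pair_mtok !evn_mtok.
rewrite big_split /= -!mulr_sumr -!IH // => y y'; by rewrite mulrDr hL.
Qed.

End PairExpansion.

Lemma FPair_inv (Q : cstarType R) N (s s' : nat -> Q) fs : (0 < N)%N ->
  (forall i, projection (s i) /\ s i + s' i = 1) -> all (gtn N) (unzip1 fs) -> polyB fs ->
  FPair N s s' (fun y => phi y *: (1 : Q)) fs = phi (Pi fs) *: 1.
Proof.
move=> N0 ss hN hs; rewrite FPair_expand //; last by move=> y y'; rewrite linearD scalerDl.
rewrite Pi_expand linear_sum scaler_suml; apply: eq_big_seq => u hu.
apply: Hpair => //; last exact: expand_coefs hu.
by apply/allP => i /(expand_letters hu) hi; exact: (allP hN).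
Qed.

Definition wc N (c : seq bool) (fs : seq (nat * bpoly A)) := [seq ((if q.1 then N + q.2.1 else q.2.1)%N, q.2.2) | q <- zip c fs].
Definition wW (Q : cstarType R) (s s' : nat -> Q) (c : seq bool) (fs : seq (nat * bpoly A)) : Q :=
  \prod_(q <- zip c fs) (if q.1 then s' q.2.1 else s q.2.1).

Lemma FPair_bs (Q : cstarType R) N (s s' : nat -> Q) (L : A -> Q) fs :
  FPair N s s' L fs = \sum_(c <- bs (size fs)) wW s s' c fs * L (Pi (wc N c fs)).
Proof.
elim: fs L => [|t fs IH] L /=.
  by rewrite big_seq1 /wW /wc /= big_nil mul1r Pi_nil.
rewrite !IH big_cat !big_map /=.
by congr (_ + _); rewrite mulr_sumr; apply: eq_bigr => c _; rewrite /wW big_cons /= Pi_cons mulrA.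
Qed.

(** A letter that occurs once can be replaced by its expectation, which is 0. Otherwise there is a
    crossing and [crossing_zero] applies. The induction runs on length minus number of distinct
    letters, so that words with more distinct letters of the same length are already known to
    vanish. *)
Lemma freeness_core d s : s <> [::] -> neighbours_differ s -> polyB s ->
  (forall t, t \in s -> EE (bpoly_eval (x t.1) t.2) = 0) ->
  (size s - size (undup (unzip1 s)) < d)%N -> phi (Pi s) = 0.
Proof.
elim: d s => // d IH s s0 so hs hc hd; set ls := unzip1 s.
have [hcnt|/allPn [k kls hk]] := boolP (all (fun i => 1 < count_mem i ls)%N ls); last first.
  have /mapP[[k' p] hkp /= ek] := kls; rewrite -{}ek in hkp.
  have e0 := hc _ hkp; move: hkp hk hs e0; rewrite /ls => /splitPr [s1 s2].
  rewrite -leqNgt /unzip1 map_cat count_cat /= eqxx /= addnCA add1n ltnS leqn0 addn_eq0.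
  move=> /andP[/eqP n1 /eqP n2] hs e0.
  rewrite Pi_fresh //; first by rewrite e0 mulr0 mul0r linear0.
    by rewrite -has_pred1 has_count n1.
  by rewrite -has_pred1 has_count n2.
have [||k [l [kl sub4]]] := @crossing_exists ls _ so.
- by rewrite /ls; case: (s) s0.
- by move=> i hi; exact: (allP hcnt).
have [N hN] := seq_bound ls.
pose G ls' := phi (Pi (zip ls' (unzip2 s))).
have Gs : G ls = phi (Pi s) by rewrite /G zip_unzip.
have sls : size ls = size s by rewrite size_map.
have wcE (c : seq bool) : size c = size ls -> wc N c s = zip (wl N c ls) (unzip2 s).
  by rewrite /ls /wc /wl; elim: (s) c => [|t s' IHs] [|b c] //= [e]; rewrite IHs.
rewrite -Gs; apply: (crossing_zero kl sub4 hN) => [u u' hu|ly hly|c sc hlt].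
- have N0 : (0 < N)%N.
    by apply: leq_ltn_trans (allP hN k (mem_subseq sub4 _)) => //; rewrite inE eqxx.
  rewrite Gs -(FPair_inv N0 hu hN hs) FPair_bs sls; apply: eq_big_seq => c.
  rewrite mem_bs => /eqP hcs; rewrite wcE ?hcs //; congr (_ * _).
  rewrite /wW /wprod /ls; elim: (s) c {hcs} => [|t s' IHs] [|b c] //=; rewrite ?big_nil //.
  by rewrite !big_cons IHs.
- rewrite Gs -(@phi_fren (N + N) (lift N ly) s) //.
    by congr (phi (Pi _)); rewrite /fren /ls; elim: (s) => //= t s' ->.
  by apply: lift_perm => //; case: (N) hN => //; case: (ls) sub4 => // ? ? _ /andP[].
rewrite /G -wcE //; pose zc := zip c s.
have c2 : map snd zc = s by rewrite /zc -/(unzip2 _) unzip2_zip // sc sls.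
have ls2 : map (fun q => q.2.1) zc = ls by rewrite /ls -[in RHS]c2 /unzip1 -map_comp.
have sz : size (wc N c s) = size s by rewrite size_map -/zc -(size_map snd) c2.
have u1 : unzip1 (wc N c s) = wl N c ls.
  by rewrite wcE // unzip1_zip // size_map size_zip sc minnn sls size_map.
apply: IH.
- by apply/eqP; rewrite -size_eq0 sz size_eq0; apply/eqP.
- rewrite /neighbours_differ; move: so; rewrite /neighbours_differ -/(unzip1 s) -/ls -ls2 /wc -/zc.
  rewrite -map_comp !sorted_map; apply: (@sub_in_sorted _ (mem zc)); last exact/allP.
  move=> q1 q2 hq1 hq2 /=; apply: contra => /eqP e.
  have h q : q \in zc -> (q.2.1 < N)%N.
    by move=> hq; apply: (allP hN); rewrite -ls2; exact: (map_f (fun q => q.2.1) hq).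
  exact/eqP/(pair_index_inj (h _ hq1) (h _ hq2) e).
- by move=> t /mapP[q hq ->] /=; apply: hs; rewrite -c2 map_f.
- move=> t /mapP[q hq ->] /=; have hq2 : q.2 \in s by rewrite -c2 map_f.
  by rewrite (E_ident (hs _ hq2) _ q.2.1) hc.
rewrite sz u1; have := size_undup (wl N c ls).
have -> : size (wl N c ls) = size s by rewrite -u1 size_map sz.
by move: hd hlt; rewrite -/ls; lia.
Qed.

(** A test element b of B is absorbed in the first polynomial, which reduces the operator statement
    to the scalar one. *)
Theorem freeness : free_independent B EE x.
Proof.
move=> s s0 so hs; case: s s0 so hs => // -[i p] s _ so hs.
have [h0 _ _ _] := hB.
rewrite -[RHS](Eb h0); apply: E_phi => b tb; rewrite mulr0 linear0.
have -> : b * \prod_(t <- (i, p) :: s) bpoly_eval (x t.1) t.2 = Pi ((i, bscale b p) :: s).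
  by rewrite Pi_cons /= bscale_eval big_cons /= mulrA.
have hp : in_BX B p by case: (hs (i, p) (mem_head _ _)).
apply: (@freeness_core (size s).+2) => //; last by rewrite ltnS leq_subr.
  move=> t; rewrite inE => /orP[/eqP -> /=|ht]; first exact: bscale_BX.
  by case: (hs t _) => //; rewrite inE ht orbT.
move=> t; rewrite inE => /orP[/eqP -> /=|ht]; last by case: (hs t _) => //; rewrite inE ht orbT.
rewrite bscale_eval -[b * _]mulr1 Ebi // mulr1.
by have [_ /= ->] := hs (i, p) (mem_head _ _); rewrite mulr0.
Qed.

End Polynomials.

(** * Vanishing of mixed free cumulants *)

Implicit Types (a b e : A) (t : nat * A) (ts g r l w : seq (nat * A)).
Local Notation Mt := (Mt EE x).
Local Notation fbt := (fblock true (@tmul R A) Mt).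
Local Notation tval := (tval x).
Local Notation kap ts := (kappa true EE (map tval ts)).
Definition tB : set (nat * A) := fun t => B t.2.
Local Notation inB := (inD tB).

Lemma Er1 a b : B b -> EE (a * b) = EE a * b.
Proof. by move=> hb; have := Ebi a B1 hb; rewrite !mul1r. Qed.

Lemma El1 b a : B b -> EE (b * a) = b * EE a.
Proof. by move=> hb; have := Ebi a hb B1; rewrite !mulr1. Qed.

Definition tPi ts : A := \prod_(y <- map tval ts) y.

Lemma tPi_cons t ts : tPi (t :: ts) = tval t * tPi ts.
Proof. by rewrite /tPi big_cons. Qed.

Lemma tPi_nil : tPi [::] = 1.
Proof. by rewrite /tPi big_nil. Qed.

Lemma tPi_cat ts1 ts2 : tPi (ts1 ++ ts2) = tPi ts1 * tPi ts2.
Proof. by rewrite /tPi map_cat big_cat. Qed.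

Lemma MtE ts : Mt ts = EE (tPi ts).
Proof. by case: ts => [|t ts] //; rewrite /Defs.star /tPi big_nil Eb. Qed.

Lemma Mt_B ts : B (Mt ts). Proof. by rewrite MtE. Qed.

Lemma tB_DM t ts : tB t -> inB ts -> tB (tmul t (Mt ts)).
Proof. by move=> ht _; have [_ _ hM _] := hB; apply: hM => //; exact: Mt_B. Qed.

Definition toks ts : seq (nat + A) := flatten [seq [:: inl t.1; inr t.2] | t <- ts].

Lemma evn_toks ts : evn (toks ts) = tPi ts.
Proof.
elim: ts => [|t ts IH]; first by rewrite evn_nil /tPi big_nil.
by rewrite /toks /= !evn_cons -/(toks ts) IH tPi_cons mulrA.
Qed.

Lemma letters_toks ts : letters (toks ts) = map fst ts.
Proof. by elim: ts => //= t ts ->. Qed.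

Lemma coefs_toks ts : coefs (toks ts) = map snd ts.
Proof. by elim: ts => //= t ts ->. Qed.

Lemma toks_B ts : inB ts -> {in coefs (toks ts), forall b, B b}.
Proof. by move=> h b; rewrite coefs_toks => /mapP[t ht ->]; exact: h. Qed.

Lemma Mt_fresh g1 v g2 : inB (g1 ++ v ++ g2) ->
  {in map fst v, forall i, (i \notin map fst g1) && (i \notin map fst g2)} ->
  Mt (g1 ++ v ++ g2) = EE (tPi g1 * Mt v * tPi g2).
Proof.
move=> hc hi; rewrite !MtE; apply: E_phi => b hb.
have := @Hfresh (inr b :: toks g1) (toks v) (toks g2).
rewrite !evn_cat evn_cons !evn_toks !tPi_cat !mulrA => -> //.
  move=> c; rewrite /= !coefs_cat -!(coefs_cat (toks _)) inE => /orP[/eqP -> //|].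
  have -> : toks g1 ++ toks v ++ toks g2 = toks (g1 ++ v ++ g2).
    by rewrite /toks !map_cat !flatten_cat.
  exact: toks_B.
by move=> i; rewrite /= !letters_toks; exact: hi.
Qed.

(** The scalar relations for all [phi (b * _)] determine the B-valued one: these functionals
    separate B, by faithfulness at b = e^*, and [tensor_separation] applies. *)
Lemma subst_invM (Q : cstarType R) (s : nat -> seq (nat * Q)) (D : set (nat * A)) :
  (forall t, D t -> B t.2) ->
  (forall b ts, B b -> inD D ts -> subst s (fun l => phi (b * tPi l) *: 1) ts = phi (b * tPi ts) *: 1) ->
  forall (F : A -> Q) ts, linear F -> inD D ts -> subst s (fun l => F (Mt l)) ts = F (Mt ts).
Proof.
move=> DB hphi F ts hF hts; apply/eqP; rewrite -subr_eq0; apply/eqP.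
have [h0 hl _ _] := hB.
pose L := (-1, Mt ts) :: [seq (p.1, Mt p.2) | p <- subl s ts].
suff : \sum_(p <- L) p.1 * F p.2 = 0.
  by rewrite /L big_cons big_map /= mulN1r addrC subst_subl.
apply: (@tensor_separation R A Q {b | B b} (fun (p : {b | B b}) a => phi (sval p * a)) B L F _ h0 hl) => //.
- by move=> b c y y'; rewrite mulrDr -scalerAr linearP.
- move=> e he h; apply: faithful; have [_ _ _ hs] := hB.
  exact: (h (exist _ (star e) (hs _ he))).
- by move=> p; rewrite inE => /orP[/eqP -> /=|/mapP[q _ ->] /=]; exact: Mt_B.
move=> [b hb] /=; rewrite big_cons big_map /=.
have pE l : phi (b * Mt l) = phi (b * tPi l) by rewrite MtE Ephi_l.
have := hphi b ts hb hts; rewrite subst_subl pE => h.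
rewrite scalerN -h addrC; apply/eqP; rewrite subr_eq0; apply/eqP.
by apply: eq_bigr => p _; rewrite pE -scalerAr mulr1.
Qed.

Definition tren (f : nat -> nat) ts := [seq (f t.1, t.2) | t <- ts].

Lemma kap_ren n f ts : finperm n f -> inB ts -> kap (tren f ts) = kap ts.
Proof.
move=> hf hts.
pose s (i : nat) := [:: (f i, 1 : A)].
have sE (F : seq (nat * A) -> A) l : subst s F l = F (tren f l).
  by elim: l F => //= t l IH F; rewrite big_seq1 mul1r IH.
rewrite -(sE (fun l => kap l)); apply: (@kappa_invariant true _ _ EE x _ s tB tB_DM _ id ts) => //.
apply: subst_invM => // b l hb hl; rewrite sE; congr (_ *: _).
have := @Hperm n f (inr b :: toks l) hf.
rewrite /= !evn_cons !evn_toks => <-.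
  by rewrite -evn_toks; congr (phi (b * evn _)); elim: (l) => //= t l' IH; congr [:: _, _ & _].
by move=> c; rewrite inE => /orP[/eqP -> //|]; exact: toks_B.
Qed.

Lemma kap_pair (Q : cstarType R) N (u u' : nat -> Q) (F : A -> Q) ts : (0 < N)%N ->
  (forall i, projection (u i) /\ u i + u' i = 1) -> all (gtn N) (map fst ts) -> inB ts -> linear F ->
  subst (fun i => [:: (i, u i); ((N + i)%N, u' i)]) (fun l => F (kap l)) ts = F (kap ts).
Proof.
move=> N0 hu hN hts hF; pose D : set (nat * A) := fun t => (t.1 < N)%N /\ B t.2.
apply: (@kappa_invariant _ _ _ _ _ _ _ D) => //.
- by move=> t l [h1 h2] hl; split=> //; have [_ _ hM _] := hB; apply: hM => //; exact: Mt_B.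
- apply: subst_invM => [t []//|b l hb hl].
  have := @Hpair Q N u u' (inr b :: toks l) N0 hu.
  rewrite /= evn_cons evn_toks letters_toks => <-.
  + have gen (L : A -> Q) : subst (fun i => [:: (i, u i); ((N + i)%N, u' i)]) (fun l' => L (tPi l')) l =
        Pair x N u u' L (toks l).
      elim: l L {hl} => [|t l IH] L /=; first by rewrite /tPi big_nil.
      by rewrite big_cons big_seq1 /= -!IH; congr (_ * _ + _ * _); apply: subst_eq => l' _; rewrite tPi_cons /tval mulrA.
    exact: (gen (fun y => phi (b * y) *: 1)).
  + by apply/allP => i /mapP[t /hl[h1 _] ->].
  + by move=> c; rewrite inE => /orP[/eqP -> //|]; apply: toks_B => t /hl[].
by move=> t ht; split; [apply: (allP hN); exact: map_f|exact: hts].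
Qed.

Lemma fbt_map (rho : seq A -> A) c r : fbt (fun l => rho (map tval l)) c [::] r =
  fblock true *%R (Mo EE) rho (tval c) [::] (map tval r).
Proof. by apply: (@fblock_map true _ _ _ _ (@tmul R A) _ Mt _ tval) => // *; exact: tval_mul. Qed.

Section Avoid.
Variables (p : pred nat).
Definition avoid (rho : seq (nat * A) -> A) := forall ts, has p (map fst ts) -> rho ts = 0.

Lemma avoid_cons rho t : avoid rho -> avoid (fun l => rho (t :: l)).
Proof. by move=> h ts hts; apply: h; rewrite /= hts orbT. Qed.

Lemma fbt_avoid rho (c : nat * A) g r1 r2 : avoid rho -> all p (map fst r1) ->
  fbt rho c g (r1 ++ r2) = fbt rho c (g ++ r1) r2.
Proof.
move=> h; elim: r1 g => [|b r1 IH] g /=; first by rewrite cats0.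
move=> /andP[pb hr]; rewrite IH // cat_rcons -[RHS]addr0; congr (_ + _).
rewrite -[RHS](fblock0 true (@tmul R A) Mt _ b [::] (r1 ++ r2)); apply: fblock_head => v l.
by apply: h; rewrite /= pb orbT.
Qed.

End Avoid.

Lemma fbt_gap (rho : seq (nat * A) -> A) (c : nat * A) g g' g0 r : (forall s, {subset s <= g0 ++ r} -> Mt (g ++ s) = Mt (g' ++ s)) ->
  fbt rho c (g ++ g0) r = fbt rho c (g' ++ g0) r.
Proof.
elim: r g0 rho => [|b r IH] g0 rho h /=; first by rewrite h // cats0.
rewrite -!cats1 -!catA IH; last by move=> s hs; apply: h => t /hs; rewrite -catA.
by rewrite h // => t ht; rewrite mem_cat ht.
Qed.

Lemma fbt_absorb (rho : seq (nat * A) -> A) (c : nat * A) v g0 r : (forall s, {subset s <= g0 ++ r} -> Mt (v ++ s) = Mt v * Mt s) ->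
  fbt rho c (v ++ g0) r = fbt rho (tmul c (Mt v)) g0 r.
Proof.
elim: r g0 rho => [|b r IH] g0 rho h /=.
  by rewrite h ?cats0 // /tmul /= mulrA.
rewrite -!cats1 -!catA IH; last by move=> s hs; apply: h => t /hs; rewrite -catA.
rewrite h; last by move=> t ht; rewrite mem_cat ht.
by rewrite /tmul /= mulrA.
Qed.

Lemma inB_cats ts1 ts2 : inB (ts1 ++ ts2) <-> inB ts1 /\ inB ts2.
Proof. exact: inD_cat. Qed.

Lemma inB_cns t ts : inB (t :: ts) <-> B t.2 /\ inB ts.
Proof. exact: inD_cons. Qed.

Definition vanish n := forall ts, inB ts -> (size ts <= n)%N -> ~~ constant (map fst ts) -> kap ts = 0.

(** Truncated cumulants set to zero as soon as a letter outside p occurs; they stand for a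
    distribution in which the other letters take no part in the first block. *)
Definition crest n (p : pred nat) ts : A :=
  if all p (map fst ts) then cumul true EE n (map tval ts) else 0.

Lemma crest_avoid n p : avoid (predC p) (crest n p).
Proof. by move=> ts; rewrite has_predC /crest => /negbTE ->. Qed.

Lemma crestR n p l t v : B v -> crest n p (rcons l (tmul t v)) = crest n p (rcons l t) * v.
Proof.
move=> hv; rewrite /crest !map_rcons !all_rcons tval_mul; case: ifP => _; last by rewrite mul0r.
exact: (cumulR true Er1).
Qed.

(** The head satisfies p, so a shorter cumulant with a letter outside p is mixed and vanishes: the
    recursion does not change when it is restricted to p. *)
Lemma kap_crest c r (p : pred nat) : vanish (size r) -> inB (c :: r) -> p c.1 ->
  kap (c :: r) = Mt (c :: r) - fbt (crest (size r) p) c [::] r.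
Proof.
move=> hv /inB_cns[hc hr] pc; rewrite [map _ _]/= kappa_rec size_map; congr (_ - _).
rewrite -fbt_map.
apply: (fbt_in true tB_DM) => // v l hcv hl sl; rewrite /crest; case: ifP => // /allPn[i hi pi].
have nc : ~~ constant (map fst (tmul c v :: l)).
  apply/allPn; exists i; last by apply/eqP => e; rewrite e pc in pi.
  by move: hi; rewrite inE => /orP[/eqP e|//]; rewrite e pc in pi.
have [hs|hs] := leqP (size l).+1 (size r); last by rewrite cumul_big // [size _]/= size_map.
rewrite cumul_le; last by rewrite [size _]/= size_map.
by apply: hv => //; apply/inB_cns.
Qed.

(** On words entirely in p the restriction is invisible; the bound on the length ensures that the
    one-block term is included. *)
Lemma crest_Mt n p c r : inB (c :: r) -> all p (map fst (c :: r)) -> (size r < n)%N ->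
  fbt (crest n p) c [::] r = Mt (c :: r).
Proof.
move=> /inB_cns[hc hr] /= /andP[pc pr] hn.
rewrite -[RHS]/(Mo EE (tval c :: map tval r)) (kappa_fb true).
rewrite -fbt_map.
pose D : set (nat * A) := fun t => B t.2 /\ p t.1.
have DM t ts : D t -> inD D ts -> D (tmul t (Mt ts)).
  by move=> [h1 h2] _; split=> //; have [_ _ hM _] := hB; apply: hM => //; exact: Mt_B.
apply: (fbt_in true DM) => //.
  by move=> t ht; split; [exact: hr|apply: (allP pr); exact: map_f].
move=> v l [_ pv] hl sl; rewrite /crest ifT; last first.
  by rewrite /= pv /=; apply/allP => i /mapP[t /hl[_ h] ->].
by rewrite cumul_le // [size _]/= size_map; lia.
Qed.

Lemma Mt_split v w2 : inB (v ++ w2) -> {in map fst v, forall i, i \notin map fst w2} ->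
  Mt (v ++ w2) = Mt v * Mt w2.
Proof.
move=> hc hi; have := @Mt_fresh [::] v w2 hc; rewrite /= => ->.
  by rewrite /tPi big_nil mul1r El1 ?(MtE w2) //; exact: Mt_B.
by move=> i /hi ->.
Qed.

Lemma fbt_prefix (rho : seq (nat * A) -> A) (l0 : nat) (a : nat * A) g v w2 : avoid (predC1 l0) rho ->
  (forall l t b, B b -> rho (rcons l (tmul t b)) = rho (rcons l t) * b) ->
  all (predC1 l0) (map fst w2) ->
  (forall g', {subset g' <= g ++ v} -> Mt (g' ++ w2) = Mt g' * Mt w2) ->
  fbt rho a g (v ++ w2) = fbt rho a g v * Mt w2.
Proof.
elim: v a g rho => [|b v IH] a g rho hav hR hw h /=.
  rewrite cats0 in h; rewrite -[w2 in LHS]cats0 (fbt_avoid _ _ _ hav) //= h //.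
  have -> : tmul a (Mt g * Mt w2) = tmul (tmul a (Mt g)) (Mt w2) by rewrite /tmul /= mulrA.
  by rewrite (hR [::]) //; exact: Mt_B.
rewrite mulrDl; congr (_ + _); apply: IH => //.
- by move=> g' hg; apply: h => t /hg; rewrite cat_rcons.
- exact: avoid_cons.
- by move=> l t b' hb'; rewrite -!rcons_cons hR.
- by move=> g' hg; apply: h => t /hg ht; rewrite cat0s in ht; rewrite mem_cat inE ht !orbT.
Qed.

(** The block avoids the letter l0, so the run [v] lies inside one gap. It occurs nowhere else, and
    its moment can be attached to the point [y] just before it, whether [y] belongs to the gap or to
    the block. *)
Lemma fbt_contract (rho : seq (nat * A) -> A) (l0 : nat) c g r1 y v w2 : avoid (pred1 l0) rho ->
  all (pred1 l0) (map fst v) -> inB v -> inB w2 -> l0 \notin map fst w2 ->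
  inB (g ++ rcons r1 y) -> l0 \notin map fst (g ++ rcons r1 y) ->
  fbt rho c g (rcons r1 y ++ v ++ w2) = fbt rho c g (rcons r1 (tmul y (Mt v)) ++ w2).
Proof.
move=> + hv bv bw hw; have sub s : {subset s <= w2} -> inB s /\ l0 \notin map fst s.
  move=> hs; split; first by move=> t /hs; exact: bw.
  by apply: contra hw => /mapP[t /hs ht ->]; exact: map_f.
have dis (s : seq (nat * A)) : l0 \notin map fst s -> {in map fst v, forall i, i \notin map fst s}.
  by move=> hs i /(allP hv)/eqP ->.
elim: r1 c g rho => [|t r1 IH] c g rho hav bg hg /=.
  rewrite (fbt_avoid _ _ _ hav) //; congr (_ + _).
    rewrite -[rcons g y ++ v]cats0 -[rcons g (tmul y (Mt v))]cats0.
    apply: fbt_gap => s /sub[bs hs]; have bg' : inB (rcons g y) by rewrite -cats1.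
    rewrite -catA Mt_fresh; first last.
    - by move=> i hi; rewrite (dis _ hs) // andbT; apply: dis hi; rewrite -cats1.
    - by apply/inB_cats; split=> //; apply/inB_cats.
    by rewrite [RHS]MtE -!cats1 !tPi_cat !tPi_cons !tPi_nil !mulr1 tval_mul !mulrA.
  rewrite (fbt_avoid _ _ _ (avoid_cons _ hav)) //.
  have := @fbt_absorb (fun l => rho (tmul c (Mt g) :: l)) y v [::] w2; rewrite cats0; apply=> s /sub[bs hs].
  by apply: Mt_split; [apply/inB_cats|exact: dis].
rewrite (IH _ (rcons g t)) ?[rcons g t ++ _]cat_rcons //; congr (_ + _); apply: IH; first exact: avoid_cons.
  by move: bg => /inB_cats[_ /inB_cns[]].
by move: hg; rewrite map_cat mem_cat negb_or => /andP[_]; rewrite /= inE negb_or => /andP[].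
Qed.

(** A run whose letter occurs nowhere else is replaced by its moment in the total moment, by
    [Mt_fresh]. The sum over first blocks produces the same value: over blocks of l0 if the word
    starts with the run, over blocks avoiding l0 otherwise. Nothing is left for the cumulant of the
    whole word. *)
Lemma kap_interval (l0 : nat) w1 v w2 : vanish (size (w1 ++ v ++ w2)).-1 -> inB (w1 ++ v ++ w2) ->
  v != [::] -> all (pred1 l0) (map fst v) -> l0 \notin map fst w1 -> l0 \notin map fst w2 ->
  w1 ++ w2 != [::] -> kap (w1 ++ v ++ w2) = 0.
Proof.
move=> hvan hb v0 hv h1 h2 h12.
have /inB_cats[b1 /inB_cats[bv b2]] := hb.
have sv : (0 < size v)%N by rewrite lt0n size_eq0.
have dis (s : seq (nat * A)) : l0 \notin map fst s -> {in map fst v, forall i, i \notin map fst s}.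
  by move=> hs i /(allP hv)/eqP ->.
case: w1 h1 h12 hvan hb b1 => [|c w1] h1 h12 hvan hb b1.
  case: v v0 hv bv dis sv hvan hb => // a v _ hv bv dis _ hvan hb.
  have ea : a.1 = l0 by case/andP: hv => /eqP.
  rewrite [_ ++ _]/= (@kap_crest _ _ (pred1 l0) hvan hb) /=; last by rewrite ea eqxx.
  clear hvan.
  rewrite (@fbt_prefix _ l0).
  - rewrite crest_Mt; [|exact: bv|by []|]; last first.
      by rewrite size_cat -[X in (X < _)%N]addn0 ltn_add2l lt0n size_eq0.
    by rewrite -(@Mt_split (a :: v)) ?subrr //; exact: dis.
  - by apply: (@crest_avoid _ (pred1 l0)).
  - by move=> *; exact: crestR.
  - by apply/allP => i hi /=; apply: contraNneq h2 => <-.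
  move=> g' hg; apply: Mt_split; last first.
    move=> i hi; apply: dis => //; rewrite /= inE; case/mapP: hi => t /hg ht ->.
    by apply/orP; right; exact: map_f.
  apply/inB_cats; split=> // t /hg ht; apply: bv; by rewrite inE ht orbT.
rewrite cat_cons in hvan hb *.
have /inB_cns[bc b1'] := b1.
move: h1; rewrite /= inE negb_or => /andP[hc h1].
rewrite (@kap_crest _ _ (predC1 l0) hvan hb) /=; last by rewrite eq_sym.
clear hvan.
have hav n : avoid (pred1 l0) (crest n (predC1 l0)).
  have := @crest_avoid n (predC1 l0); congr (avoid _ _).
  by apply/funext => i /=; rewrite negbK.
have aw (w : seq (nat * A)) : l0 \notin map fst w -> all (predC1 l0) (map fst w).
  by move=> hw; apply/allP => i hi /=; apply: contraNneq hw => <-.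
have hM : Mt (c :: w1 ++ v ++ w2) = EE (tPi (c :: w1) * Mt v * tPi w2).
  rewrite -cat_cons Mt_fresh // => i hi; rewrite (dis _ h2) // andbT; apply: dis hi.
  by rewrite /= inE negb_or hc.
have Bv := Mt_B v.
case/lastP: w1 h1 b1 b1' hb hM h12 => [|r1 y] h1 b1 b1' hb hM h12.
  rewrite /= in hM *; rewrite (fbt_avoid _ _ _ (hav _)) // -[v in X in _ - X]cats0.
  rewrite (@fbt_absorb _ _ _ [::]) => [|s hs]; last first.
    apply: Mt_split; last by apply: dis; apply: contra h2 => /mapP[t /hs ht ->]; exact: map_f.
    by apply/inB_cats; split=> // t /hs; exact: b2.
  rewrite crest_Mt.
  - by rewrite hM [X in _ - X]MtE !tPi_cons tPi_nil mulr1 tval_mul subrr.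
  - apply/inB_cns; split=> //; have [_ _ hMB _] := hB; exact: hMB.
  - by rewrite /= eq_sym hc; exact: aw.
  by rewrite cats0 size_cat -[X in (X < _)%N]add0n ltn_add2r.
rewrite (fbt_contract _ (hav _)) // crest_Mt.
- rewrite hM [X in _ - X]MtE !tPi_cons tPi_cat -!cats1 !tPi_cat !tPi_cons !tPi_nil !mulr1 tval_mul !mulrA.
  by rewrite subrr.
- move: b1'; rewrite -cats1 => /inB_cats[b1' /inB_cns[by' _]].
  apply/inB_cns; split=> //; apply/inB_cats; split=> //; rewrite -cats1; apply/inB_cats; split=> //.
  by apply/inB_cns; split=> //=; have [_ _ hMB _] := hB; exact: hMB.
- rewrite /= eq_sym hc map_cat all_cat (aw _ h2) andbT /=.
  by have := aw _ h1; rewrite !map_rcons !all_rcons.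
by rewrite !size_cat !size_rcons addSn; lia.
Qed.

Lemma subst_bs (Q : cstarType R) N (u u' : nat -> Q) (F : seq (nat * A) -> Q) ts :
  subst (fun i => [:: (i, u i); ((N + i)%N, u' i)]) F ts =
  \sum_(c <- bs (size ts)) (\prod_(q <- zip c (map fst ts)) (if q.1 then u' q.2 else u q.2)) *
    F (zip (wl N c (map fst ts)) (map snd ts)).
Proof.
elim: ts F => [|t ts IH] F /=; first by rewrite big_seq1 big_nil mul1r.
rewrite big_cons big_seq1 !IH big_cat !big_map /=.
by congr (_ + _); rewrite mulr_sumr; apply: eq_bigr => c _; rewrite big_cons /= mulrA.
Qed.

Lemma interval_or_crossing (ls : seq nat) : ~~ constant ls ->
  (exists (l0 i m : nat), [/\ (0 < m)%N, (i + m <= size ls)%N, all (pred1 (l0 : nat)) (take m (drop i ls)),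
     l0 \notin take i ls & l0 \notin drop (i + m) (ls : seq nat)]) \/
  exists k l : nat, k != l /\ subseq [:: k; l; k; l] ls.
Proof.
case: ls => // V0 c hc; have [nc|] := pselect (ncseq (V0 :: c)); last first.
  move=> /existsNP[U /existsNP[V /not_implyP[h /eqP n]]]; right; by exists U, V.
left; have [l hl] := nc_interval nc hc; rewrite /interval_block_at.
set ls := V0 :: c; case e : (drop l.+1 ls) => [|V s] //; rewrite -e => /eqP h.
set m := count_mem V ls in h; exists V, l.+1, m.
have hV : V \in ls by apply: (mem_drop (n0 := l.+1)); rewrite e mem_head.
have m0 : (0 < m)%N by rewrite /m -has_count has_pred1.
have sm : (m <= size (drop l.+1 ls))%N by have := congr1 size h; rewrite size_take_min size_nseq => /minn_idPl.
have cnt : m = (count_mem V (take l.+1 ls) + (m + count_mem V (drop (l.+1 + m) ls)))%N.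
  rewrite {1}/m -{1}(cat_take_drop l.+1 ls) count_cat -{1}(cat_take_drop m (drop l.+1 ls)) count_cat h.
  have -> : count_mem V (nseq m V) = m by rewrite count_nseq /= eqxx mul1n.
  by rewrite drop_drop ?[(m + l.+1)%N]addnC.
split=> //.
- by move: sm; rewrite size_drop; rewrite -ltnS in hl; rewrite /ls /= in hl *; lia.
- by rewrite h all_pred1_nseq.
- by rewrite -has_pred1 has_count -leqNgt leqn0; apply/eqP; move: cnt; lia.
by rewrite -has_pred1 has_count -leqNgt leqn0; apply/eqP; move: cnt; lia.
Qed.

Lemma kap0_phi ts : inB ts -> ts <> [::] -> (forall b, B b -> phi (b * kap ts) = 0) -> kap ts = 0.
Proof.
case: ts => // t ts _ _ h; apply: E_eq.
- exact: (kappaB true hB EB).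
- by have [] := hB.
by move=> b hb; rewrite h // mulr0 linear0.
Qed.

(** Induction on the length, then on the number of distinct letters, downwards. A non-constant word
    has an isolated run, handled by [kap_interval], or a crossing, handled by [crossing_zero], for
    cumulants satisfy the same pair relation as moments. *)
Theorem mixed_cumulant ts : inB ts -> ~~ constant (map fst ts) -> kap ts = 0.
Proof.
suff : forall n, vanish n by move=> h hts; apply: h (leqnn _).
elim=> [|n IHn] {ts}; first by case.
suff gen d ts : inB ts -> size ts = n.+1 -> ~~ constant (map fst ts) ->
    (n.+1 - size (undup (map fst ts)) < d)%N -> kap ts = 0.
  move=> ts hts; rewrite leq_eqVlt => /orP[/eqP e|hs] hc; last exact: IHn.
  exact: (gen n.+2) (leq_subr _ _).
elim: d ts => // d IH ts hts sts hc hd.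
have [[l0 [i [m [m0 him hm h1 h2]]]]|[k [l [kl sub4]]]] := interval_or_crossing hc.
  have e : ts = take i ts ++ take m (drop i ts) ++ drop (i + m) ts.
    by rewrite addnC -drop_drop !cat_take_drop.
  rewrite size_map in him; rewrite e.
  have hm' : (m <= size (drop i ts))%N by rewrite size_drop leq_subRL // (leq_trans (leq_addr _ _) him).
  apply: (@kap_interval l0); rewrite -?e ?sts // -?size_eq0 ?map_take ?map_drop //.
    by rewrite size_takel // -lt0n.
  rewrite size_cat size_take_min size_drop; apply/eqP => hz; move: hc; have -> : ts = take m (drop i ts).
    have i0 : i = 0%N by move: hz; rewrite sts; clear; lia.
    by rewrite i0 drop0 take_oversize //; move: hz; rewrite i0 sts add0n; clear; lia.
  rewrite map_take map_drop; case: (take _ _) hm => //= z s /andP[/eqP ->] h.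
  by rewrite h.
apply: kap0_phi => //; first by case: (ts) sts.
move=> b hb; have [N hN] := seq_bound (map fst ts).
pose G ls' := phi (b * kap (zip ls' (map snd ts))).
have Gs : G (map fst ts) = phi (b * kap ts).
  by rewrite /G -/(unzip1 ts) -/(unzip2 ts) zip_unzip.
rewrite -Gs; apply: (crossing_zero kl sub4 hN) => [u u' hu|ly hly|c sc hlt].
- have N0 : (0 < N)%N.
    by apply: leq_ltn_trans (allP hN k (mem_subseq sub4 _)) => //; rewrite inE eqxx.
  rewrite Gs -(@kap_pair _ N u u' (fun a => phi (b * a) *: 1) ts) // ?subst_bs ?size_map //.
  by move=> z a a'; rewrite mulrDr -scalerAr linearP scalerDl scalerA.
- rewrite Gs -(@kap_ren (N + N) (lift N ly)) //.
    by rewrite /G; congr (phi (b * kappa _ _ (map _ _))); elim: (ts) => //= t s' ->.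
  by apply: lift_perm => //; case: (N) hN => //; case: (map _ _) sub4 => // ? ? _ /andP[].
rewrite size_map in sc.
have swl : size (wl N c (map fst ts)) = size ts by rewrite size_map size_zip size_map sc minnn.
have e1 : map fst (zip (wl N c (map fst ts)) (map snd ts)) = wl N c (map fst ts).
  by rewrite -/(unzip1 _) unzip1_zip // swl size_map.
have e2 : map snd (zip (wl N c (map fst ts)) (map snd ts)) = map snd ts.
  by rewrite -/(unzip2 _) unzip2_zip // swl size_map.
rewrite /G IH ?mulr0 ?linear0 //.
- by move=> t /(map_f snd); rewrite e2 => /mapP[t' ht' e]; rewrite /tB e; exact: hts.
- by rewrite size_zip swl size_map minnn.
- rewrite e1; apply/negP => hcs; move: hlt; have : (size (undup (wl N c (map fst ts))) <= 1)%N.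
    case: (wl _ _ _) hcs => //= z s h; have /all_pred1P -> := h.
    by rewrite (@leq_trans (size (undup (z :: nseq (size s) z)))) //=; elim: (size s) => //= n' ; rewrite inE eqxx.
  have : (0 < size (undup (map fst ts)))%N.
    by case: (ts) sts => //= t s _; case: ifP => //; case: (undup _) (mem_undup (map fst s) t.1) => //= <-.
  lia.
rewrite e1; have := size_undup (wl N c (map fst ts)); rewrite swl sts.
by move: hd hlt; lia.
Qed.

Definition word i (cs : seq A) : seq (nat * A) := [seq (i, c) | c <- cs].

Lemma word_B i cs : {in cs, forall c, B c} -> inB (word i cs).
Proof. by move=> h t /mapP[c hc ->]; exact: h. Qed.

Lemma kap_word i j cs : {in cs, forall c, B c} -> kap (word i cs) = kap (word j cs).
Proof.
move=> hc; rewrite -(kap_ren (transp_perm i j) (@word_B i _ hc)).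
have -> : tren (transp i j) (word i cs) = word (transp i j i) cs by rewrite /tren /word -map_comp.
by rewrite transpL.
Qed.

(** * From non-zero free cumulants to relations between generators *)

Section Relations.
Variables (Q : cstarType R) (n : nat) (u : 'M[Q]_n).

(** Letters beyond the size of the matrix are fixed, as in the extended coaction. *)
Definition mx_letters i : seq (nat * Q) :=
  if insub i is Some j then [seq (val k, u k j) | k <- enum 'I_n] else [:: (i, 1)].

Lemma Phi_subst (L : A -> Q) ts :
  Phi x u L (map (tok x n) (toks ts)) = subst mx_letters (fun l => L (tPi l)) ts.
Proof.
elim: ts L => [|t ts IH] L /=; first by rewrite tPi_nil.
rewrite /mx_letters; case: insubP => [j _ _|_] /=.
  rewrite big_map big_enum; apply: eq_bigr => k _; congr (_ * _).
  by rewrite -/(toks ts) IH; apply: subst_eq => l _; rewrite tPi_cons /tval mulrA.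
rewrite big_seq1 mul1r -/(toks ts) IH; apply: subst_eq => l _.
by rewrite tPi_cons /tval mulrA.
Qed.

Lemma subst_all (k : 'I_n) (g : Q) (s : seq 'I_n) (cs : seq A) : size s = size cs ->
  subst mx_letters (fun l => if all (pred1 (val k)) (map fst l) then g else 0) (zip (map val s) cs) =
  (\prod_(j <- s) u k j) * g.
Proof.
elim: s cs => [|j s IH] [|c cs] //= => [_|[e]]; first by rewrite big_nil mul1r.
rewrite {1}/mx_letters insubT //= => hj; rewrite big_map big_enum (bigD1 k) //= eqxx /= IH //.
have -> : Sub (val j) hj = j by exact: val_inj.
rewrite big_cons mulrA [X in _ + X]big1 ?addr0 // => k' kk.
rewrite -[RHS](mulr0 (u k' j)); congr (_ * _).
transitivity (subst mx_letters (fun=> 0 : Q) (zip (map val s) cs)); last exact: subst0.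
by apply: subst_eq => l _; rewrite val_eqE (negbTE kk).
Qed.

Hypothesis hu : forall t : seq (nat + A), {in coefs t, forall b, B b} ->
  Phi x u (fun y => phi y *: (1 : Q)) (map (tok x n) t) = phi (evn t) *: 1.

(** Mixed cumulants vanish and pure ones do not depend on the letter, so invariance of a cumulant
    reads (sum_k u_(k s1) ... u_(k sm)) g = delta g, with g a non-zero value [phi (b * _)] of the
    cumulant; g is cancelled. *)
Lemma kap_power_sums cs : {in cs, forall c, B c} -> kap (word 0 cs) <> 0 -> power_sums u (size cs).
Proof.
move=> hc k0 s ss; have c0 : cs <> [::] by move=> e; apply: k0; rewrite e.
have [b [hb b0]] : exists b, B b /\ phi (b * kap (word 0 cs)) <> 0.
  apply: contrapT => h; apply: k0; apply: kap0_phi; first exact: word_B.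
    by case: (cs) c0.
  by move=> b hb; apply: contrapT => h'; apply: h; exists b.
set g := phi _ in b0.
pose F a : Q := phi (b * a) *: 1; pose ts := zip (map val s) cs.
have hF : linear F by move=> z a a'; rewrite /F mulrDr -scalerAr linearP scalerDl scalerA.
have e1 : map fst ts = map val s by rewrite -/(unzip1 _) unzip1_zip // size_map ss.
have e2 : map snd ts = cs by rewrite -/(unzip2 _) unzip2_zip // size_map ss.
have bl l : map snd l = cs -> inB l.
  by move=> e t /(map_f snd); rewrite e; exact: hc.
have FE l : map snd l = cs -> F (kap l) = if constant (map fst l) then g *: 1 else 0.
  move=> e; case: ifP => h; last first.
    by have -> : kap l = 0; [apply: mixed_cumulant; rewrite ?h //; exact: bl|rewrite /F mulr0 linear0 scale0r].
  have [i el] : exists i, l = word i cs.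
    case: l e h => [|t l] e h; first by case: c0; rewrite -e.
    exists t.1; rewrite -e /word -map_comp; apply/esym; rewrite -[RHS]map_id; apply/eq_in_map => t' ht'.
    have /eqP -> : t.1 == t'.1 by move: ht'; rewrite inE => /orP[/eqP -> //|/(map_f fst)/(allP h)]; rewrite eq_sym.
    by case: (t').
  by rewrite el /F (kap_word i 0).
have inv : subst mx_letters (fun l => F (kap l)) ts = F (kap ts).
  apply: (@kappa_invariant true _ _ EE x _ _ tB tB_DM) => //; last exact: bl.
  apply: subst_invM => // b' l hb' hl; have := @hu (inr b' :: toks l).
  rewrite /= evn_cons evn_toks => <-.
    by rewrite (Phi_subst (fun y => phi (b' * y) *: 1)).
  by move=> c; rewrite inE => /orP[/eqP -> //|]; exact: toks_B.
move: inv; rewrite FE // e1.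
have -> : constant (map val s) = constant s.
  by case: (s) => //= j s'; rewrite all_map; apply: eq_all => j' /=; rewrite val_eqE.
have -> : subst mx_letters (fun l => F (kap l)) ts = (\sum_k \prod_(j <- s) u k j) * (g *: 1).
  case: s ss @ts e1 e2 => [|j s] ss ts e1 e2; first by case: (cs) ss c0.
  rewrite /ts; case: cs hc k0 c0 @g b0 ss @ts e1 e2 bl FE => // c cs hc k0 c0 g b0 [ss] ts e1 e2 bl FE /=.
  rewrite {1}/mx_letters insubT //= => hj; rewrite big_map big_enum mulr_suml; apply: eq_bigr => k _ /=.
  have -> : Sub (val j) hj = j by exact: val_inj.
  rewrite big_cons -mulrA -(subst_all k _ ss); congr (_ * _); apply: subst_eq => l hl.
  have := FE ((k : nat, c) :: l); rewrite /= => -> //.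
  by rewrite hl -/(unzip2 _) unzip2_zip // size_map ss.
rewrite -scalerAr mulr1 => e.
have g0 : g != 0 by exact/eqP.
by rewrite -[LHS]scale1r -(mulVf g0) -scalerA e; case: ifP => _; rewrite ?scaler0 ?scalerA ?mulVf ?scale1r.
Qed.

End Relations.

Lemma cumulants_vanish_words (N : pred nat) i :
  (forall cs, {in cs, forall c, B c} -> N (size cs) -> kap (word 0 cs) = 0) ->
  cumulants_vanish B (kappa true EE) N (x i).
Proof.
move=> h b0 b1 bs /coefB hb0 /coefB hb1 hbs hN.
rewrite -mulrA (kappaL true El1) //.
have -> : x i * b1 :: [seq x i * b | b <- bs] = map tval (word i (b1 :: bs)).
  by rewrite /= /tval /=; congr (_ :: _); rewrite -map_comp.
have hc : {in b1 :: bs, forall c, B c}.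
  by move=> c; rewrite inE => /orP[/eqP -> //|/hbs /coefB].
by rewrite (kap_word i 0 hc) h ?mulr0.
Qed.

Lemma bmon_Mt i m : is_bmonomial B m -> EE (bmon_eval (x i) m) = m.1 * Mt (word i m.2).
Proof.
move=> [/coefB h1 _]; rewrite /bmon_eval El1 // MtE; congr (_ * EE _).
by rewrite /tPi big_map /word big_map.
Qed.

(** When an odd word is divided into the first block and its gaps, the block or one of the gaps has
    odd length: the cumulant vanishes, or the moment does by induction. *)
Lemma odd_moment i : (forall cs, {in cs, forall c, B c} -> odd (size cs) -> kap (word i cs) = 0) ->
  forall ts, inB ts -> all (pred1 i) (map fst ts) -> odd (size ts) -> Mt ts = 0.
Proof.
move=> hodd ts; have [N] := ubnP (size ts); elim: N ts => // N IHN [|c r] // hN hts hp od.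
pose D : set (nat * A) := fun t => B t.2 /\ t.1 = i.
have hD : inD D (c :: r).
  by move=> t ht; split; [exact: hts|apply/eqP/(allP hp)/map_f].
have [hc hr] := (inD_cons _ _ _).1 hD.
rewrite -[LHS]/(Mo EE (tval c :: map tval r)) (kappa_fb true).
rewrite -fbt_map.
have DM t ts : D t -> inD D ts -> D (tmul t (Mt ts)).
  by move=> [h1 h2] _; split=> //; have [_ _ hM _] := hB; apply: hM => //; exact: Mt_B.
pose rho l := if all (pred1 i) (map fst l) && ~~ odd (size l) then kap l else 0.
rewrite (fbt_in true (rho' := rho) DM) //; last first.
  move=> v l hv hl _; have ea : all (pred1 i) (map fst (tmul c v :: l)).
    by apply/allP => j /mapP[t + ->]; rewrite inE => /orP[/eqP ->|/hl[_ ->]]; rewrite /= ?hc.2.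
  rewrite /rho ea andTb; case: ifP => // /negbFE ho.
  have -> : tmul c v :: l = word i (map snd (tmul c v :: l)).
    rewrite /word -map_comp -[LHS]map_id; apply/eq_in_map => -[j a] ht /=.
    by have /= /eqP -> := allP ea _ (map_f fst ht).
  apply: hodd; last by rewrite size_map.
  by move=> a /mapP[t + ->]; rewrite inE => /orP[/eqP ->|/hl[]//]; case: hv.
(* [q] counts the block letters already passed to [f]. As long as all gaps are even, the parity of q
   plus the remaining points is preserved, and at the end the block is odd. *)
have gen q (f : seq (nat * A) -> A) d g s : inD D (d :: g) -> inD D s -> (size g + size s < N)%N ->
    (forall l, odd (size l + q) -> f l = 0) ->
    (forall l1 t l2, t.2 = 0 -> f (l1 ++ t :: l2) = 0) ->
    odd ((size g + size s).+1 + q) -> fbt f d g s = 0.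
  elim: s q f d g => [|b s IH] q f d g hg hs hsz f1 f2 ho /=.
    rewrite addn0 addSn /= in ho.
    have [og|og] := boolP (odd (size g)).
      rewrite IHN // ?mulr0; first by apply: (f2 [::]); rewrite /= mulr0.
      - by rewrite addn0 in hsz.
      - by move=> t ht; have [] := hg t; rewrite // inE ht orbT.
      - by apply/allP => j /mapP[t ht ->]; apply/eqP; have [] := hg t; rewrite // inE ht orbT.
    by apply: f1; move: ho; rewrite /= !oddD (negbTE og).
  have [hb hs'] := (inD_cons _ _ _).1 hs; have [hd hg'] := (inD_cons _ _ _).1 hg.
  rewrite (IH q) ?add0r ?size_rcons //; first last.
  - by move: ho; rewrite /= addnS addSn.
  - by move: hsz; rewrite /= addnS addSn.
  - by apply/inD_cons; split=> //; rewrite -cats1; apply/inD_cat; split=> //; apply/inD_cons.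
  have [og|og] := boolP (odd (size g)).
    rewrite -[RHS](fblock0 true (@tmul R A) Mt _ b [::] s); congr (fblock _ _ _ _ _ _ _).
    apply/funext => l; apply: (f2 [::]) => /=; rewrite IHN ?mulr0 //.
    - by apply: leq_ltn_trans hsz; exact: leq_addr.
    - by move=> t /hg'[].
    - by apply/allP => j /mapP[t /hg'[_ ->] ->] /=.
  apply: (IH q.+1) => //.
  - by apply/inD_cons.
  - by move: hsz => /=; lia.
  - by move=> l hl; apply: f1; rewrite [size _]/= addSnnS.
  - by move=> l1 t l2 t0; exact: (f2 (_ :: l1)).
  by move: ho; rewrite /= !addnS !addSn !oddS !oddD (negbTE og) /= !negbK.
apply: (gen 0%N) => //.
- by apply/inD_cons.
- by move=> l; rewrite addn0 /rho => ->; rewrite andbF.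
- move=> l1 t l2 t0; rewrite /rho; case: ifP => // _.
  have tv : tval t = 0 by rewrite /tval t0 mulr0.
  rewrite map_cat [map tval (t :: l2)]/= tv.
  apply: (@addrI _ (kappa true EE (map tval l1 ++ 0 :: map tval l2))).
  by rewrite -kappaD !addr0.
by rewrite addn0 add0n.
Qed.

Lemma symmetric_words i :
  (forall cs, {in cs, forall c, B c} -> odd (size cs) -> kap (word 0 cs) = 0) ->
  symmetric_distribution B EE (x i).
Proof.
move=> h m hm om; rewrite bmon_Mt // (@odd_moment i) ?mulr0 ?size_map //.
- by move=> cs hc oc; rewrite (kap_word i 0 hc) h.
- by apply: word_B => c hc; apply: coefB; case: hm => _; exact.
by apply/allP => j /mapP[t /mapP[c _ ->] ->] /=.
Qed.

Lemma kappa_free : free_cumulants EE (kappa true EE).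
Proof. by move=> n a n0; rewrite (kappa_moment true hB EB Er1). Qed.

End FreeIndependence.

Lemma dense_words (R : realType) (A : cstarType R) (H : hilbertType R) (ro : A -> H -> H)
    (ro_f : faithful_rep ro)
    (ro_bic : bicommutant ro)
    (x : nat -> A) : (forall i, selfadjoint (x i)) -> wstar_generated [set x i | i in [set: nat]] ->
  forall a, cl (alg x 0) a.
Proof.
move=> hx hgen; have := hgen (cl (alg x 0)); move=> /(_ _ _ _) h a; rewrite h //.
- split; first by apply: (cl_star_subalgebra ro_f ro_bic); exact: alg_subalgebra.
  exact: cl_idem.
- by apply: cl_sub; exact: alg1.
- by move=> _ [i _ <-]; apply: cl_sub; rewrite -X1; exact: span_wX.
Qed.

(** * Boolean case: contractions and projections in C^3 *)

Section MatrixOrder.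
Variables (R : realType) (Q : cstarType R) (T : set (Q -> R[i])).
Hypothesis hT : sep_family T.
Implicit Types (a b e w : Q).

Lemma cnorm_mono a b : star a = a -> star b = b -> (forall th w, T th -> 0 <= th (star w * a * w)) ->
  (forall th w, T th -> th (star w * a * w) <= th (star w * b * w)) -> cnorm a <= cnorm b.
Proof.
move=> sa sb ha hab; have [T1 T2 T3] := hT.
have [q [sq eq _]] := pos_detect hT sa ha.
have [q' [sq' eq' _]] := pos_detect hT sb (fun th w h => le_trans (ha th w h) (hab th w h)).
have na : cnorm a = cnorm q ^+ 2 by rewrite eq -cnorm_star sq.
have nb : cnorm b = cnorm q' ^+ 2 by rewrite eq' -cnorm_star sq'.
rewrite na nb lerXn2r ?nnegrE ?cnorm_ge0 //.
apply: (norm_detect hT) => [|th w hth]; first exact: cnorm_ge0.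
rewrite sq -eq; apply: le_trans (hab th w hth) _.
have pth : pfun th by split; [exact: T1|move=> z; exact: T2].
have h := pf_bound w q' pth; have e1 := n2E (q' * w) pth; have e2 := n2E w pth.
rewrite starM sq' -!mulrA [q' * (q' * w)]mulrA -eq' mulrA in e1.
by rewrite e1 e2 -rmorphM lecR.
Qed.

(** The square norm of u v is that of sum_j v_j^* e_j v_j, which is below sum_j v_j^* v_j since the
    e_j are projections. It secures the bound on the norm of u in the universal property of Bs. *)
Lemma gram_contraction n (u : 'M[Q]_n) (e : 'I_n -> Q) : (forall i j, star (u i j) = u i j) ->
  (forall j, projection (e j)) -> (forall j k, \sum_i u i j * u i k = (j == k)%:R * e j) ->
  mx_cnorm u <= 1.
Proof.
move=> su pe hu; rewrite /mx_cnorm; apply: ge_sup.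
  exists (hmod_norm (u *m 0)); exists 0 => //=.
  rewrite /hmod_norm big1 ?cnorm0 ?sqrtr0 // => i _; by rewrite !mxE mulr0.
move=> _ [v /= hv <-]; apply: le_trans hv; rewrite /hmod_norm ler_sqrt ?cnorm_ge0 //.
have E : \sum_i star ((u *m v) i ord0) * (u *m v) i ord0 = \sum_j star (v j ord0) * e j * v j ord0.
  transitivity (\sum_i \sum_j \sum_k star (v j ord0) * (u i j * u i k) * v k ord0).
    apply: eq_bigr => i _; rewrite !mxE star_sum mulr_suml; apply: eq_bigr => j _.
    rewrite mulr_sumr; apply: eq_bigr => k _; by rewrite starM su !mulrA.
  rewrite exchange_big; apply: eq_bigr => j _ /=; rewrite exchange_big /= (bigD1 j) //=.
  rewrite -mulr_suml -mulr_sumr hu eqxx mul1r [X in _ + X]big1 ?addr0 // => k kj.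
  by rewrite -mulr_suml -mulr_sumr hu eq_sym (negbTE kj) mul0r mulr0 mul0r.
have [T1 T2 T3] := hT.
have pe' j y : star (e j * y) * (e j * y) = star y * e j * y.
  by have [h1 h2] := pe j; rewrite starM h1 -!mulrA [e j * (e j * y)]mulrA h2.
rewrite E; apply: cnorm_mono.
- rewrite star_sum; apply: eq_bigr => j _.
  by rewrite !starM starK (pe j).1 mulrA.
- by rewrite star_sum; apply: eq_bigr => j _; rewrite starM starK.
- move=> th w hth; rewrite mulr_sumr mulr_suml (lfun_sum _ _ (T1 _ hth)); apply: sumr_ge0 => j _.
  have -> : star w * (star (v j ord0) * e j * v j ord0) * w = star (e j * (v j ord0 * w)) * (e j * (v j ord0 * w)).
    by rewrite pe' starM !mulrA.
  exact: T2.
move=> th w hth; rewrite !mulr_sumr !mulr_suml !(lfun_sum _ _ (T1 _ hth)); apply: ler_sum => j _.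
rewrite -subr_ge0 -(lfunB _ _ (T1 _ hth)).
have -> : star w * (star (v j ord0) * v j ord0) * w - star w * (star (v j ord0) * e j * v j ord0) * w =
    star ((1 - e j) * (v j ord0 * w)) * ((1 - e j) * (v j ord0 * w)).
  have [h1 h2] := pe j; rewrite starM starB star1 h1 starM.
  have h : (1 - e j) * (1 - e j) = 1 - e j by rewrite mulrBl mul1r mulrBr mulr1 h2 subrr subr0.
  rewrite -!mulrA [(1 - e j) * ((1 - e j) * _)]mulrA h !mulrA mulrBr mulr1 !mulrBl.
  by [].
exact: T2.
Qed.

End MatrixOrder.

Lemma mat_sep (R : realType) (d : nat) :
  sep_family [set th : Mat R d -> R[i] | exists v, th = fun a => vdot (a *m v) v].
Proof.
split.
- by move=> th [v ->] c a b; rewrite mulmxDl -scalemxAl vdot_lin.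
- move=> th z [v ->]; rewrite [star z * z]/(mstar z *m z) -mulmxA.
  have := vdot_adj (mstar z) (z *m v) v; rewrite mstarK => ->; exact: vdot_ge0.
move=> z hz; apply/matrixP => i j; rewrite mxE.
have := hz _ (ex_intro _ (delta_mx j 0) erefl).
rewrite [star z * z]/(mstar z *m z) -mulmxA.
have := vdot_adj (mstar z) (z *m delta_mx j 0) (delta_mx j 0); rewrite mstarK => -> h.
have := hvE (z *m delta_mx j 0 : 'cV[R[i]]_d.+1); rewrite /hv h /= => /esym/eqP.
rewrite psumr_eq0 => [/allP /(_ i (mem_index_enum _))|k _]; last exact: sqr_ge0.
rewrite /= expf_eq0 /= => /eqP /mod_eq0.
by rewrite -colE mxE.
Qed.

Lemma P_magic_inv_words (R : realType) (A : cstarType R) (x : nat -> A) (phi : {scalar A}) n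
    (Bs E : bgenalg R n) (Q : cstarType R) (u : 'M[Q]_n) (P : Q) :
  is_Bs Bs -> bg_sub Bs E -> boolean_invariant phi x E ->
  projection P -> mx_cnorm u <= 1 -> P_magic u P -> inv_words x phi u P.
Proof.
move=> [_ _ h] [f [_ hf fP]] /boolean_inv_words hE pP nu mu.
have [g [_ hg gP]] := h (BGenAlg u P) (And3 pP nu mu).
have h1 := inv_words_hom f hE; have := inv_words_hom g h1; rewrite fP gP.
rewrite (_ : (fun k i => g (f (bg_u E k i))) = u) //.
by apply/funext => k; apply/funext => i; rewrite hf hg.
Qed.

Section BooleanProjections.
Variable R : realType.

(* In C^3 with basis Omega, e, f: rk1 z a is the projection onto Omega + e or Omega - e
   (z = true), onto Omega + f or Omega - f (z = false), and vac the projection onto Omega. *)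
Definition vac : Mat R 2 := delta_mx 0 0.
Definition bvec (z a : bool) : 'I_3 -> R[i] := fun i =>
  if i == 0 :> nat then 1 else if (i == (if z then 1 else 2)%N :> nat) then (if a then -1 else 1) else 0.
Definition rk1 (z a : bool) : Mat R 2 := \matrix_(i, j) (2^-1 * (bvec z a i * bvec z a j)).

Local Ltac mat3 := apply/matrixP => i j; rewrite /vac !mxE ?big_ord_recl ?big_ord0 ?mxE /bvec -?val_eqE /=.

Lemma rk1_idem z a : rk1 z a * rk1 z a = rk1 z a.
Proof.
by mat3; case: z a => -[]; case: i => -[|[|[|[]]]] //= hi; case: j => -[|[|[|[]]]] //= hj; field.
Qed.

Lemma rk1_orth z : rk1 z false * rk1 z true = 0.
Proof.
by mat3; case: z; case: i => -[|[|[|[]]]] //= hi; case: j => -[|[|[|[]]]] //= hj; field.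
Qed.

Lemma rk1_vac z : (rk1 z false + rk1 z true) * vac = vac.
Proof.
by mat3; case: z; case: i => -[|[|[|[]]]] //= hi; case: j => -[|[|[|[]]]] //= hj; field.
Qed.

(** The vectors of different [z] overlap only along Omega, whatever the signs, and the overlap of
    the unit vectors is 1/2. *)
Lemma rk1_alt z a b : rk1 z a * rk1 (~~ z) b * vac = (2^-1 : R)%:C *: (rk1 z a * vac).
Proof.
rewrite half_C; apply/matrixP => i j; rewrite /vac !mxE !big_ord_recl !big_ord0 !mxE !big_ord_recl !big_ord0 !mxE /bvec -?val_eqE /=.
by case: z a b => -[] []; case: i => -[|[|[|[]]]] //= hi; case: j => -[|[|[|[]]]] //= hj; field.
Qed.

Lemma rk1_star z a : star (rk1 z a) = rk1 z a.
Proof.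
apply/matrixP => i j; rewrite !mxE [bvec z a j * _]mulrC; apply/CrealP.
have rb k : bvec z a k \is Num.real.
  by rewrite /bvec; case: ifP => _; rewrite ?real1 //; case: ifP => _; rewrite ?real0 //; case: a; rewrite ?realN real1.
by rewrite realM ?realM ?rb // realV realn.
Qed.

Lemma rk1_proj z a : projection (rk1 z a).
Proof. by split; [exact: rk1_star|exact: rk1_idem]. Qed.

Lemma vac_proj : projection vac.
Proof.
split; last by rewrite /vac -[LHS]/(delta_mx 0 0 *m delta_mx 0 0) mul_delta_mx.
apply/matrixP => i j; rewrite !mxE andbC; case: (_ && _); rewrite ?mulr1n ?mulr0n ?conjC1 ?conjC0 //.
Qed.

Lemma vac_neq0 : vac <> 0.
Proof. by move/matrixP/(_ 0 0); rewrite !mxE /= => /eqP; rewrite oner_eq0. Qed.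

Lemma rk1_prod (zs : seq bool) z (ab : bool -> bool) :
  (\prod_(y <- z :: zs) rk1 y (ab y)) * vac = ((2^-1 : R) ^+ chg (z :: zs))%:C *: (rk1 z (ab z) * vac).
Proof.
elim: zs z => [|y zs IH] z; first by rewrite big_seq1 /= expr0 scale1r.
rewrite big_cons -mulrA IH -scalerAr mulrA chg_cons.
have [->|zy] := eqVneq z y; first by rewrite add0n rk1_idem.
have -> : y = ~~ z by case: y z zy => -[].
by rewrite rk1_alt scalerA add1n exprSr rmorphM.
Qed.

(** Each change costs a factor 1/2 and the sum over the choices gives 2: the constant is below 1
    from two changes on, as in k l k. *)
Lemma rk1_sum (zs : seq bool) z :
  \sum_(ab <- bool_pairs)
     (\prod_(y <- z :: zs) rk1 y (if y then ab.1 else ab.2)) * vac =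
  ((2^-1 : R) ^+ chg (z :: zs) * 2)%:C *: vac.
Proof.
under eq_bigr => ab _ do rewrite (rk1_prod zs z (fun y => if y then ab.1 else ab.2)).
rewrite -scaler_sumr rmorphM -scalerA; congr (_ *: _).
rewrite !big_cons big_nil addr0 /= natC scaler_nat mulr2n.
rewrite -[in RHS](rk1_vac z) mulrDl; case: z => /=; last by rewrite !addrA.
by rewrite [RHS]addrACA [LHS]addrA.
Qed.

End BooleanProjections.

(** * Boolean moments depend on the adjacency pattern only *)

Section Adjacency.
Implicit Types (w v : seq nat) (o : option nat).

(* The entry of adj w o at a point of w tells whether the next letter (o after the last one) is
   the same. *)
Fixpoint adj w o : seq bool :=
  if w is i :: w' then (Some i == (if w' is j :: _ then Some j else o)) :: adj w' o else [::].

Definition nxt w o := if w is j :: _ then Some j else o.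

Lemma adj_cat v w o : adj (v ++ w) o = adj v (nxt w o) ++ adj w o.
Proof. by elim: v => //= i v ->; case: v. Qed.

Lemma adj_map (f : nat -> nat) w o : injective f -> adj (map f w) (omap f o) = adj w o.
Proof.
move=> fi; have fE i o' : (Some (f i) == omap f o') = (Some i == o').
  by case: o' => //= j; apply/eqP/eqP => [[/fi ->]|[->]].
elim: w => //= i w ->; congr (_ :: _); rewrite -[RHS]fE.
by case: w.
Qed.

Lemma adj_last v (j j' : option nat) : v = [::] \/ (Some (last 0%N v) == j) = (Some (last 0%N v) == j') ->
  adj v j = adj v j'.
Proof.
elim: v => // i v IH /= [//|]; case: v IH => [|i' v] IH /= h; first by rewrite h.
congr (_ :: _); exact: IH (or_intror h).
Qed.

Lemma size_adj w o : size (adj w o) = size w.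
Proof. by elim: w => //= i w ->. Qed.

(** Numbers the maximal runs of equal letters consecutively from m: the canonical word with a given
    adjacency pattern. *)
Fixpoint runs m w : seq nat :=
  if w is i :: w' then m :: (if w' is j :: _ then runs (if i == j then m else m.+1) w' else [::])
  else [::].

Lemma runs_adj m w w' : adj w None = adj w' None -> runs m w = runs m w'.
Proof.
elim: w w' m => [|i w IH] [|i' w'] m //= [e1 e2]; congr (_ :: _).
have := congr1 size e2; rewrite !size_adj.
case: w w' e1 e2 IH => [|j w] [|j' w'] // e1 e2 IH _.
change (runs (if i == j then m else m.+1) (j :: w) = runs (if i' == j' then m else m.+1) (j' :: w')).
have -> : (i == j) = (i' == j') by rewrite -[LHS](inj_eq Some_inj) -[RHS](inj_eq Some_inj).
exact: IH.
Qed.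

Lemma runs_map m w : ivseq w ->
  exists r, [/\ {in w &, injective r}, runs m w = map r w & forall i, i \in w -> (m <= r i)%N].
Proof.
elim: w m => [|i w IH] m iv; first by exists id.
have iv' : ivseq w by move=> U V h; apply: iv; apply: subseq_trans h (subseq_cons _ _).
case: w IH iv iv' => [|j w] IH iv iv'.
  by exists (fun=> m); split=> // a b; rewrite !inE => /eqP -> /eqP ->.
rewrite [runs _ _]/= -/(runs _ (j :: w)); have [ij|ij] := eqVneq i j.
  have [r [h1 h2 h3]] := IH m iv'; rewrite -ij in h1 h2 h3 *; exists r; split.
  - by move=> a b ha hb; apply: h1; [move: ha|move: hb]; rewrite !inE => /orP[->|].
  - have ri : r i = m by move: h2; rewrite /= => -[].
    by rewrite h2 /= ri.
  by move=> a; rewrite inE => /orP[/eqP ->|]; apply: h3; rewrite inE eqxx.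
have [r [h1 h2 h3]] := IH m.+1 iv'.
have iw : i \notin j :: w.
  apply/negP; rewrite inE (negbTE ij) => hi.
  have : i = j; last by move/eqP; rewrite (negbTE ij).
  by apply: iv; rewrite /= eqxx /= eqxx /= sub1seq.
have ni a : a \in j :: w -> (a == i) = false by move=> ha; apply/eqP => e; rewrite -e ha in iw.
exists (fun a => if a == i then m else r a); split.
- move=> a b; rewrite inE => /orP[/eqP ->|ha]; rewrite inE => /orP[/eqP ->|hb] //; rewrite ?eqxx ?ni //.
  + by move=> e; have := h3 b hb; rewrite -e ltnn.
  + by move=> e; have := h3 a ha; rewrite e ltnn.
  + exact: h1.
- rewrite h2 [RHS]/= eqxx; congr (_ :: _); apply/eq_in_map => a ha; by rewrite ni.
by move=> a; rewrite inE => /orP[/eqP ->|ha]; rewrite ?eqxx // ni // ltnW // h3.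
Qed.

End Adjacency.

Section BooleanMoments.
Variables (R : realType) (A : cstarType R) (x : nat -> A) (phi : {scalar A}).
Hypothesis Pmagic : forall n (Q : cstarType R) (u : 'M[Q]_n) (P : Q), (0 < n)%N ->
  projection P -> mx_cnorm u <= 1 -> P_magic u P -> inv_words x phi u P.
Implicit Types (w v : seq nat).
Local Notation m w := (phi (X x w)).

Lemma tok_wordE n w : tok_word x n w = map (tok x n) (wt A w).
Proof. by rewrite /tok_word /wt -map_comp. Qed.

Lemma bperm n f w : finperm n f -> m (map f w) = m w.
Proof.
move=> [n0 ff f1 f2]; have mu := @magic_perm R n (Mat R 0) f f1 ff.
set u := \matrix_(k, i) _ in mu.
have [[su u1 u2] pu] := mu.
have hi : inv_words x phi u (1 : Mat R 0).
  apply: Pmagic => //; first by split; rewrite ?star1 ?mulr1.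
    apply: (gram_contraction (mat_sep R 0) (e := fun=> 1)) => // [j|j k].
      by split; rewrite ?star1 ?mulr1.
    rewrite mulr1; have /matrixP/(_ j k) := u2; rewrite !mxE => <-.
    by apply: eq_bigr => i _; rewrite !mxE.
  split=> //; split=> // i j; rewrite !mulr1; split.
    have /matrixP/(_ i j) := u1; rewrite !mxE => <-.
    by apply: eq_bigr => k _; rewrite !mxE.
  have /matrixP/(_ i j) := u2; rewrite !mxE => <-.
  by apply: eq_bigr => k _; rewrite !mxE.
have := hi w; rewrite /inv tok_wordE evt_tokn evn_wt.
rewrite (_ : Phi _ _ _ _ = m (map f w) *: 1); last first.
  rewrite -(evn_wt x) -ren_wt -(@Phi_perm R A x n _ f _ (fun y => phi y *: (1 : Mat R 0)) f1 f2).
  by congr (Phi _ _ _ _); apply/funext => k; apply/funext => i; rewrite mxE.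
move=> /matrixP /(_ 0 0); rewrite !mxE eqxx !mulr1; exact.
Qed.

(** The square of the block matrix is diagonal with entries s + s'. These are projections, so the
    matrix is a contraction, and they fix P, so it is P-orthogonal. *)
Lemma bpair (s s' : nat -> Mat R 2) (P : Mat R 2) N w : (0 < N)%N -> projection P ->
  (forall i, projection (s i)) -> (forall i, projection (s' i)) -> (forall i, s i * s' i = 0) ->
  (forall i, (s i + s' i) * P = P) -> all (gtn N) w ->
  Pair x N s s' (fun y => phi y *: P) (wt A w) = m w *: P.
Proof.
move=> N0 pP ps ps' os sP hw.
have os' k : s' k * s k = 0.
  by have := congr1 star (os k); rewrite starM star0 (ps k).1 (ps' k).1.
have su i j : star (pairmx N s s' i j) = pairmx N s s' i j by case: (pairmx_proj ps ps' i j).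
have uE i j : \sum_k pairmx N s s' i k * pairmx N s s' j k = (i == j)%:R * (s (i %% N)%N + s' (i %% N)%N).
  rewrite -pairmx_sqr // mxE; apply: eq_bigr => k _.
  by congr (_ * _); rewrite -{1}[pairmx N s s']pairmx_sym mxE.
have uE' i j : \sum_k pairmx N s s' k i * pairmx N s s' k j = (i == j)%:R * (s (i %% N)%N + s' (i %% N)%N).
  have sy k l : pairmx N s s' k l = pairmx N s s' l k by rewrite -{1}[pairmx N s s']pairmx_sym mxE.
  by rewrite -uE; apply: eq_bigr => k _; rewrite (sy k) (sy k).
have hi : inv_words x phi (pairmx N s s') P.
  apply: Pmagic => //; first by rewrite addn_gt0 N0.
    apply: (gram_contraction (mat_sep R 2) (e := fun j => s (j %% N)%N + s' (j %% N)%N)) => // j.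
    split; first by rewrite starD (ps _).1 (ps' _).1.
    by rewrite mulrDl !mulrDr (ps _).2 (ps' _).2 os os' addr0 add0r.
  split; last by move=> i j; exact: pairmx_proj.
  split=> [i j|i j]; first exact: su.
  by rewrite uE uE' -mulrA sP.
have := hi w; rewrite /inv tok_wordE evt_tokn evn_wt => <-.
by rewrite Phi_pair // letters_wt.
Qed.

Lemma Pair_bs (Q : cstarType R) (s s' : nat -> Q) N (L : A -> Q) w :
  Pair x N s s' L (wt A w) = \sum_(c <- bs (size w)) wprod s s' c w * L (X x (wl N c w)).
Proof.
elim: w L => [|i w IH] L /=; first by rewrite big_seq1 /wprod /wl big_nil mul1r X_nil.
rewrite !IH big_cat !big_map /=.
by congr (_ + _); rewrite mulr_sumr; apply: eq_bigr => c _; rewrite /wprod /wl /= big_cons X_cons mulrA.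
Qed.

(** Exchanging each letter i of w with N + r i is an involution, because the letters of w are below
    N. *)
Lemma inj_shift N (r : nat -> nat) w : (0 < N)%N -> all (gtn N) w -> {in w &, injective r} ->
  m [seq (N + r i)%N | i <- w] = m w.
Proof.
move=> N0 hw ri; have [M hM] := seq_bound (map r w).
pose rinv j := nth 0%N w (index j (map r w)).
have rK i : i \in w -> rinv (r i) = i.
  move=> hi; apply: ri; rewrite // /rinv.
    by rewrite mem_nth // -(size_map r) index_mem map_f.
  by rewrite -(nth_map _ 0%N) ?nth_index ?map_f // -(size_map r) index_mem map_f.
have rV j : j \in map r w -> rinv j \in w /\ r (rinv j) = j.
  by move=> /mapP[i hi ->]; rewrite rK.
pose f i := if i \in w then (N + r i)%N else
  if (N <= i)%N && ((i - N)%N \in map r w) then rinv (i - N)%N else i.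
have fw i : i \in w -> f i = (N + r i)%N by rewrite /f => ->.
have far j : (N + j)%N \notin w.
  by apply/negP => /(allP hw) /=; rewrite ltnNge leq_addr.
have fp : finperm (N + M) f.
  split=> [||i hi|i hi]; first by rewrite addn_gt0 N0.
  - move=> i; rewrite {2}/f; case: ifP => [h|h].
      by rewrite /f (negbTE (far _)) leq_addr /= addKn map_f // rK.
    case: ifP => [/andP[h1 h2]|h2]; last by rewrite /f h h2.
    by have [h3 h4] := rV _ h2; rewrite fw // h4 subnKC.
  - rewrite /f; case: ifP => [h|_].
      by rewrite ltn_add2l; apply: (allP hM); exact: map_f.
    case: ifP => // /andP[h1 /rV[h2 _]]; apply: leq_trans (allP hw _ h2) _; exact: leq_addr.
  rewrite /f; case: ifP => [/(allP hw) /= h|_]; first by move: h hi; lia.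
  by case: ifP => // /andP[h1 /(allP hM) /= h]; move: h h1 hi; lia.
by rewrite -[RHS](bperm w fp); congr (phi (X x _)); apply/eq_in_map => i hi; rewrite fw.
Qed.

(** An injective renaming is not an involution in general; w and its image are both moved to the
    same word beyond N. *)
Lemma inj_moment (r : nat -> nat) w : {in w &, injective r} -> m (map r w) = m w.
Proof.
move=> ri; have [N hN] := seq_bound (0%N :: w ++ map r w).
have /andP[N0] : (0 < N)%N && all (gtn N) (w ++ map r w) by exact: hN.
rewrite all_cat => /andP[h1 h2].
rewrite -(inj_shift N0 h1 ri) -(@inj_shift N id (map r w)) //.
by rewrite -map_comp.
Qed.

(** If the pattern changes, two equal neighbours have been separated, since distinct letters below N
    stay distinct; the coefficient then contains u_i u'_i or u'_i u_i, which is 0. *)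
Lemma wprod_split (Q : cstarType R) (u u' : nat -> Q) N (c : seq bool) w :
  (forall i, u i * u' i = 0) -> (forall i, u' i * u i = 0) -> size c = size w -> all (gtn N) w ->
  adj (wl N c w) None <> adj w None -> wprod u u' c w = 0.
Proof.
move=> h1 h2; elim: w c => [|i w IH] [|a c] // [sc] /= /andP[iN hN].
rewrite /wprod /wl /= big_cons; case: w c IH sc hN => [|j w] [|b c] // IH [sc] hN hne.
have [e|ne] := pselect (adj (wl N (b :: c) (j :: w)) None = adj (j :: w) None); last first.
  by have := IH (b :: c); rewrite /wprod => ->; rewrite ?mulr0 //= sc.
have jN : (j < N)%N by case/andP: hN.
rewrite /= big_cons mulrA.
have [ab|nab] := eqVneq a b.
  case: hne; move: e; rewrite /wl /= => ->; congr (_ :: _); rewrite ab.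
  by rewrite !(inj_eq Some_inj); case: (b) => //; rewrite eqn_add2l.
have [ij|nij] := eqVneq i j.
  by rewrite ij; case: a b nab {hne e IH} => -[] // _; rewrite ?h1 ?h2 mul0r.
case: hne; move: e; rewrite /wl /= => ->; congr (_ :: _).
rewrite !(inj_eq Some_inj) (negbTE nij); apply/negbTE.
by case: a b nab {IH} => -[] // _; apply/eqP => e; move: iN jN; rewrite ?e -?e; lia.
Qed.

(** The moment of the canonical word is subtracted. This constant satisfies the pair relation, as
    (u_i + u'_i) P = P, so the difference does too. Terms with another pattern have coefficient 0,
    and those with more letters vanish by induction. A subsequence k l k then makes the difference 0
    by [pattern_zero]; without one the word is a renaming of its canonical form. *)
Lemma moment_runs w : m w = m (runs 0 w).
Proof.
have [d] := ubnP (size w - size (undup w)); elim: d w => // d IH w hd.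
have [iv|] := pselect (ivseq w).
  by have [r [ri -> _]] := runs_map 0 iv; rewrite inj_moment.
move=> /existsNP[k /existsNP[l /not_implyP[sub3 /eqP kl]]].
have kw : k \in w by apply: (mem_subseq sub3); rewrite inE eqxx.
have lw : l \in w by apply: (mem_subseq sub3); rewrite !inE eqxx orbT.
have [N hN] := seq_bound w; have N0 : (0 < N)%N by apply: leq_ltn_trans (allP hN _ kw).
pose c0 := m (runs 0 w); pose G ls := m ls - c0.
pose u := cu (@rk1 R) k l; pose u' := cu' (@rk1 R) k l.
have pu i : projection (u i).
  by rewrite /u /cu; do 2?[case: eqP => _; first exact: rk1_proj]; split; rewrite ?star1 ?mulr1.
have pu' i : projection (u' i).
  by rewrite /u' /cu'; do 2?[case: eqP => _; first exact: rk1_proj]; split; rewrite ?star0 ?mulr0.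
have ou i : u i * u' i = 0.
  by rewrite /u /u' /cu /cu'; do 2?[case: eqP => _; first exact: rk1_orth]; rewrite mulr0.
have ou' i : u' i * u i = 0.
  by have := congr1 star (ou i); rewrite starM star0 (pu i).1 (pu' i).1.
have sP i : (u i + u' i) * vac R = vac R.
  by rewrite /u /u' /cu /cu'; do 2?[case: eqP => _; first exact: rk1_vac]; rewrite addr0 mul1r.
set zs := [seq i == k | i <- w & (i == k) || (i == l)].
have zsub : (2 <= chg zs)%N.
  have h : subseq [:: true; false; true] zs.
    have := map_subseq (fun i => i == k) (_ : subseq [:: k; l; k] [seq i <- w | (i == k) || (i == l)]).
    rewrite /= eqxx [l == k]eq_sym (negbTE kl); apply.
    by rewrite subseq_filter sub3 /= !eqxx !orbT.
  by case: (zs) h => // z zs' h; have := chg_subseq h; rewrite /=; lia.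
suff : G w = 0 by move/eqP; rewrite subr_eq0 => /eqP.
apply: (@pattern_zero _ _ (@rk1 R) (vac R) k l w G N ((2^-1) ^+ chg zs * 2) kl kw lw hN) => //.
- under eq_bigr => c _ do rewrite scalerBl mulrBr.
  rewrite sumrB scalerBl; congr (_ - _).
    by rewrite -(bpair N0 (vac_proj R) pu pu' ou sP hN) Pair_bs.
  rewrite -(Pair_bs u u' N (fun=> c0 *: vac R)).
  elim: (w) => //= i w' ->; by rewrite -mulrDl -scalerAr sP.
- move=> ly hly; congr (_ - _); apply: inj_moment => i j _ _ /(congr1 (lift N ly)).
  by rewrite !liftK.
- move=> c sc hlt; have [e|ne] := pselect (adj (wl N c w) None = adj w None).
    rewrite /G IH ?(runs_adj 0 e) ?subrr ?scale0r ?mulr0 //.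
    have := size_undup (wl N c w); have -> : size (wl N c w) = size w.
      by rewrite size_map size_zip sc minnn.
    by move: hd hlt; lia.
  by rewrite (wprod_split ou ou' sc hN ne) mul0r.
- rewrite -/zs; case: zs zsub => [|z zs'] // _; exact: rk1_sum.
- have [q ->] : exists q, chg zs = q.+2 by exists (chg zs - 2)%N; lia.
  have : (2^-1 : R) ^+ q <= 1 by rewrite exprn_ile1 // ?invr_ge0 ?ler0n // invf_le1 ?ler1n ?ltr0n.
  by rewrite !exprS; lra.
exact: vac_neq0.
Qed.

Theorem adj_moment w v : adj w None = adj v None -> m w = m v.
Proof. by move=> e; rewrite moment_runs (runs_adj 0 e) -moment_runs. Qed.

End BooleanMoments.

Lemma rev_nonnil (T : Type) (w : seq T) : w <> [::] -> rev w <> [::].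
Proof. by case: w => // i w _; rewrite rev_cons; case: (rev w). Qed.

(** * The vacuum projection *)

Section SeparatedWords.
Implicit Types (v w u : seq nat).

Definition sadj w := adj w None.

Lemma sadj_cat v w : v = [::] \/ w = [::] \/ last 0%N v <> head 0%N w ->
  sadj (v ++ w) = sadj v ++ sadj w.
Proof.
move=> h; rewrite /sadj adj_cat; congr (_ ++ _); apply: adj_last.
case: w h => [|i w] h; first by right.
by case: h => [h|[//|h]]; [left|right; rewrite /= (inj_eq Some_inj); apply/negbTE/eqP].
Qed.

Definition shift k w := [seq (k + i)%N | i <- w].

Lemma sadj_shift k w : sadj (shift k w) = sadj w.
Proof. exact: (adj_map w None (@addnI k)). Qed.

Lemma shift_nil k w : w <> [::] -> shift k w <> [::].
Proof. by case: w. Qed.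

Lemma sadj_farl k v w : all (gtn k) v -> sadj (v ++ shift k w) = sadj v ++ sadj w.
Proof.
move=> hv; rewrite sadj_cat ?sadj_shift //.
case: v hv => [|i v] hv; [by left|right]; case: w => [|j w]; [by left|right=> /= e].
by have := allP hv (last i v) (mem_last _ _); rewrite /= e ltnNge leq_addr.
Qed.

Lemma sadj_farr k w u : all (gtn k) u -> sadj (shift k w ++ u) = sadj w ++ sadj u.
Proof.
move=> hu; rewrite sadj_cat ?sadj_shift //.
case: w => [|j w]; [by left|right]; case: u hu => [|i u] hu; [by left|right=> /= e].
have := mem_last (k + j)%N (shift k w); rewrite e -[_ :: _]/(shift k (j :: w)) => /mapP[l _ e'].
by have /andP[] := hu; rewrite /= e' ltnNge leq_addr.
Qed.

Lemma sadj_far k v w u : w <> [::] -> all (gtn k) v -> all (gtn k) u ->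
  sadj (v ++ shift k w ++ u) = sadj v ++ sadj w ++ sadj u.
Proof.
move=> w0 hv hu; rewrite sadj_cat ?sadj_farr //.
case: v hv => [|i v] hv; [by left|right; right]; case: w w0 => // j w _ /= e.
by have := allP hv (last i v) (mem_last _ _); rewrite /= e ltnNge leq_addr.
Qed.

Lemma far_le N k w : (N <= k)%N -> all (gtn N) w -> all (gtn k) w.
Proof. by move=> h; apply: sub_all => i /= hi; exact: leq_trans hi h. Qed.

End SeparatedWords.

Section VacuumProjection.
Variables (R : realType) (A : cstarType R) (H : hilbertType R) (ro : A -> H -> H).
Hypothesis ro_f : faithful_rep ro.
Hypothesis ro_bic : bicommutant ro.
Variables (x : nat -> A) (phi : {scalar A}).
Hypothesis hx : forall i, star (x i) = x i.
Hypothesis hphi : pfun phi.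
Hypothesis wphi : wcont ro phi.
Hypothesis mom : forall w v, adj w None = adj v None -> phi (X x w) = phi (X x v).
Hypothesis nondeg : forall z, (forall b c, phi (b * z * c) = 0) -> z = 0.
Hypothesis dense : forall a, cl (alg x 0) a.
(* The support is the weak limit of h_N (1 + h_N)^-1, h_N = (N + 1) sum_(n < N) c_n c_n^*. *)
Lemma support (c : nat -> A) : exists s, [/\ projection s, forall n, s * c n = c n
  & forall L : A -> R[i], lfun L -> wcont ro L -> (forall a n, L (a * star (c n)) = 0) -> L s = 0].
Proof.
have [U uU Uc] := nat_uf.
pose h N : A := \sum_(n < N) (N.+1%:R : R)%:C *: (c n * star (c n)).
pose ps k a := dotp (ro a k) k.
have pps k : pfun (ps k) by exact: ro_pfun.
have psh (N : nat) k z : ps k (star z * h N * z) =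
    \sum_(n < N) (N.+1%:R * n2 (ps k) (star (c n) * z))%:C.
  rewrite /h mulr_sumr mulr_suml (lfun_sum _ _ (pps k).1); apply: eq_bigr => n _.
  rewrite -scalerAr -scalerAl (lfunZ _ _ (pps k).1) [RHS]rmorphM /= -n2E // starM starK.
  by rewrite !mulrA.
have hv (N : nat) : exists v, [/\ star v = v, cnorm v <= 1, v * h N = 1 - v & h N * v = 1 - v].
  have [||q [q1 q2 _]] := @ro_pos _ _ _ _ ro_f (h N).
  - by rewrite /h star_sum; apply: eq_bigr => n _; rewrite starZr starM starK.
  - move=> k; have := psh N k 1; rewrite star1 mul1r mulr1 /ps => ->.
    apply: sumr_ge0 => n _; rewrite ler0c mulr_ge0 ?ler0n //; exact: (n2_ge0 _ (pps k)).
  have [v [v1 v2 v3 v4 _]] := inv1p q1; exists v; split=> //; rewrite q2.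
    by rewrite mulrA -v4 // -mulrA -v4 // mulrA -[in RHS]v1 mulrDl mul1r addrC addKr.
  by rewrite -v1 mulrDl mul1r addrC addKr.
have [v hv'] := choice hv; pose y N := 1 - v N.
have yM N : cnorm (y N) <= 2.
  have [_ v2 _ _] := hv' N; apply: le_trans (cnormB _ _) _; rewrite cnorm1; lra.
have [s _ lim] := wcompact ro_f ro_bic uU yM.
(* [v * h N * v = (1 - v) * v] is bounded by 2, while [h N] dominates N + 1 times each c_n c_n^*:
   hence c_n^* v tends to 0 strongly. *)
have est (N : nat) (n : nat) k : (n < N)%N -> n2 (ps k) (star (c n) * v N) <= 2 * hs k / N.+1%:R.
  move=> nN; have [v1 v2 v3 v4] := hv' N.
  have e := psh N k (v N); rewrite v1 v3 -rmorph_sum in e.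
  have b : mod (ps k ((1 - v N) * v N)) <= hs k * 2.
    apply: le_trans (pf_norm _ (pps k)) _; rewrite /ps ro1 // hsE /= ler_wpM2l ?hs_ge0 //.
    apply: le_trans (cnormM _ _) _; rewrite -[2]mulr1; apply: ler_pM; rewrite ?cnorm_ge0 //; exact: yM.
  have t : N.+1%:R * n2 (ps k) (star (c n) * v N) <=
      \sum_(n < N) N.+1%:R * n2 (ps k) (star (c n) * v N).
    rewrite (bigD1 (Ordinal nN)) //= lerDl sumr_ge0 // => i _.
    by rewrite mulr_ge0 ?ler0n //; exact: (n2_ge0 _ (pps k)).
  rewrite e mod_real in b; rewrite ler_pdivlMr ?ltr0n // mulrC; apply: le_trans t _.
  by apply: le_trans (ler_norm _) _; rewrite mulrC.
have sa : star s = s.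
  apply: (ro_inj ro_f) => h'; apply: dotp_inj => k.
  apply/esym/(flim_uniq uU (lim h' k)).
  rewrite (ro_adj ro_f) starK dotpC; apply: (flim_ext uU _ (flim_conj uU (lim k h'))) => N.
  have [v1 _ _ _] := hv' N.
  by rewrite -dotpC (ro_adj ro_f) /y starB star1 v1.
have sc n : s * c n = c n.
  apply: (ro_inj ro_f) => h'; apply: dotp_inj => k; rewrite (roM ro_f).
  apply: (flim_uniq uU (lim (ro (c n) h') k)) => e e0.
  pose N0 := maxn n.+1 (Num.truncn (hs h' * 2 * hs k / e ^+ 2)).
  apply: (uf_S uU (Uc N0)) => N /=; rewrite geq_max => /andP[nN hN]; have [v1 _ _ _] := hv' N.
  rewrite mod_distC -dotpBl /y (roB ro_f) (ro1 ro_f) opprB addrCA subrr addr0 -(roM ro_f) (ro_adj ro_f).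
  rewrite starM v1 -(@ltr_pXn2r _ 2) ?nnegrE ?mod_ge0 ?(ltW e0) //.
  apply: le_lt_trans (dotp_CS _ _) _; rewrite -(ro_n2 ro_f).
  apply: le_lt_trans (ler_wpM2l (hs_ge0 _) (est N n k nN)) _.
  have e2 : 0 < e ^+ 2 by rewrite exprn_gt0.
  have h1 : hs h' * 2 * hs k / e ^+ 2 < N.+1%:R.
    by apply: lt_le_trans (truncnS_gt _) _; rewrite ler_nat.
  by rewrite !mulrA ltr_pdivrMr ?ltr0n // [e ^+ 2 * _]mulrC -ltr_pdivrMr.
have sL (L : A -> R[i]) : lfun L -> wcont ro L -> (forall a n, L (a * star (c n)) = 0) -> L s = 0.
  move=> Ll Lw L0; apply: (flim_uniq uU (Lw _ _ _ _ _ uU yM lim)).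
  apply: (flim_ext uU _ (flimC uU 0)) => N; have [_ _ v3 _] := hv' N.
  rewrite /y -v3 /h mulr_sumr lfun_sum // big1 // => n _.
  by rewrite -scalerAr lfunZ // mulrA L0 mulr0.
(* Idempotence is an instance of the third property, for the matrix coefficients of a |-> a (s - 1),
   which vanish at a c_n^* because s c_n = c_n. *)
exists s; split=> //; split=> //.
apply: (ro_inj ro_f) => h'; apply: dotp_inj => k; apply/eqP; rewrite -subr_eq0 -dotpBl -(roB ro_f).
have -> : s * s - s = 1 * s * (s - 1) by rewrite mul1r mulrBr mulr1.
apply/eqP; apply: (sL (fun a => dotp (ro (1 * a * (s - 1)) h') k)).
- move=> z a b; rewrite !mul1r mulrDl -scalerAl; exact: (ro_lfun ro_f h' k).
- exact: (wcont_mul ro_f 1 (s - 1) (wcont_vf h' k)).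
move=> a n; rewrite mul1r -mulrA (_ : star (c n) * (s - 1) = 0) ?mulr0 ?(ro0 ro_f) ?dotp0l //.
by rewrite mulrBr mulr1 -{1}sa -starM sc subrr.
Qed.

Implicit Types (a b c d y z : A) (v w u : seq nat).
Local Notation X := (X x).
Definition mB (l : seq bool) := phi (X (xget [::] [set w | sadj w = l])).

Lemma mB_adj w : phi (X w) = mB (sadj w).
Proof. by apply/esym/mom; exact: (@xgetPex _ [::] [set v | sadj v = sadj w] (ex_intro _ w erefl)). Qed.

Lemma words_dense c d : (forall w, phi (c * X w * d) = 0) -> forall a, phi (c * a * d) = 0.
Proof.
move=> h a; suff h0 : alg x 0 `<=` [set b | phi (c * b * d) = 0].
  exact: (cl_lfun0 ro_f ro_bic (dense a) hphi wphi h0).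
apply: span_w_ind => [|k b b' hb hb'|w _] //=.
  by rewrite mulr0 mul0r linear0.
by rewrite mulrDr mulrDl -scalerAr -scalerAl linearP hb hb' mulr0 addr0.
Qed.

Lemma sepw z : (forall v u, phi (X v * z * X u) = 0) -> z = 0.
Proof.
move=> h; apply: nondeg => b c; rewrite -[b]mul1r -mulrA; apply: words_dense => v.
rewrite mul1r mulrA -[X v * z * c]mulr1; apply: words_dense => u.
by rewrite mulr1.
Qed.

Lemma sepw_eq z z' : (forall v u, phi (X v * z * X u) = phi (X v * z' * X u)) -> z = z'.
Proof.
move=> h; apply/eqP; rewrite -subr_eq0; apply/eqP/sepw => v u.
by rewrite mulrBr mulrBl linearB /= h subrr.
Qed.

(** A transposition preserves [phi] on polynomials because it preserves patterns, so [pren_norm_of]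
    bounds the letters uniformly. *)
Lemma letter_norm i : cnorm (x i) <= cnorm (x 0%N).
Proof.
have [_ ff _ _] := transp_perm 0 i.
have h : cnorm (ev x (pren (transp 0 i) [:: (1, [:: 0%N])])) <= cnorm (ev x [:: (1, [:: 0%N])]).
  apply: (pren_norm_of ro_f ro_bic hx hphi wphi dense) => // [P'|z hz].
    rewrite /ev big_map !linear_sum; apply: eq_bigr => q _ /=; rewrite !linearZ /=; congr (_ * _).
    by apply: mom; exact: (adj_map q.2 None (inv_inj ff)).
  apply: nondeg => c b; apply: mod_eq0; apply/eqP; rewrite -sqrf_eq0 eq_le sqr_ge0 andbT.
  have := pCS (z * b) (star c) hphi; rewrite starK mulrA; move=> /le_trans; apply.
  by rewrite /n2 hz /= mul0r.
by move: h; rewrite /ev !big_seq1 /= !scale1r !X1 transpL.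
Qed.

(** A weak limit of the word shifted to infinity. It is used only against functionals for which the
    sequence is eventually constant, so the choice of the limit does not matter. *)
Lemma bw_ex w : exists b, forall c d r N,
  (forall k, (N <= k)%N -> phi (c * X (shift k w) * d) = r) -> phi (c * b * d) = r.
Proof.
have [U uU Uc] := nat_uf.
have nM k : cnorm (X (shift k w)) <= cnorm (x 0%N) ^+ size w.
  elim: (w) => [|i w' IH]; first by rewrite X_nil cnorm1.
  rewrite /= X_cons exprS; apply: le_trans (cnormM _ _) _.
  by apply: ler_pM; rewrite ?cnorm_ge0 //; exact: letter_norm.
have [b _ hb] := wcompact ro_f ro_bic uU nM; exists b => c d r N h.
apply: (flim_uniq uU (wcont_mul ro_f c d wphi uU nM hb)).
apply: (flim_eqF uU _ (flimC uU r)); apply: (uf_S uU (Uc N)) => k /= hk.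
by rewrite h.
Qed.

Definition bw w := sval (cid (bw_ex w)).

Lemma bwP w c d r N : (forall k, (N <= k)%N -> phi (c * X (shift k w) * d) = r) ->
  phi (c * bw w * d) = r.
Proof. exact: (svalP (cid (bw_ex w))). Qed.

(** Shifted far away, w has no letter in common with its neighbours, and the patterns are simply
    concatenated. *)
Lemma bw_moment v w u : w <> [::] -> phi (X v * bw w * X u) = mB (sadj v ++ sadj w ++ sadj u).
Proof.
move=> w0; have [N hN] := seq_bound (v ++ u); apply: (@bwP _ _ _ _ N) => k hk.
have := far_le hk hN; rewrite all_cat => /andP[hv hu].
by rewrite -!X_cat mB_adj -catA sadj_far.
Qed.

Lemma bw2_moment v w w' : w <> [::] -> phi (X v * bw w * bw w') = mB (sadj v ++ sadj w ++ sadj w').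
Proof.
move=> w0; rewrite -[_ * bw w']mulr1; apply: (@bwP _ _ _ _ 0%N) => k hk.
by rewrite mulr1 bw_moment // sadj_shift.
Qed.

Lemma star_bw w : w <> [::] -> star (bw w) = bw (rev w).
Proof.
move=> w0; apply: sepw_eq => v u.
have rw0 : rev w <> [::] by exact: rev_nonnil.
rewrite bw_moment //.
have -> : X v * star (bw w) * X u = star (X (rev u) * bw w * X (rev v)).
  by rewrite !starM !(star_X hx) !revK mulrA.
rewrite pf_star // bw_moment //.
have [k hk] := seq_bound (v ++ u); move: hk; rewrite all_cat => /andP[hv hu].
rewrite -(@sadj_far k) ?all_rev // -mB_adj -pf_star // (star_X hx) mB_adj.
by rewrite !rev_cat !revK -map_rev -catA sadj_far.
Qed.

Lemma phi_lfun c d : lfun (fun a => phi (c * a * d)).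
Proof. by move=> k a b; rewrite mulrDr mulrDl -scalerAr -scalerAl linearP. Qed.

(** [e0] is the support of the letters, [e1] that of the limits [bw w], and e1 <= e0. A limit [bw w]
    behaves as the moment of w times a projection onto the vacuum, so [e1] is that projection inside
    the algebra of the letters; 1 - e0, where the letters act as 0, is added to it. *)
Theorem vacuum_projection : exists e, [/\ projection e, forall c, phi (c * e) = phi c
  & forall c u, u <> [::] -> phi (c * e * X u) = phi (c * bw u)].
Proof.
have [e0 [[sa0 id0] s0 L0]] := support x.
pose c n := if @unpickle (seq nat) n is Some (i :: w) then bw (i :: w) else 0.
have [e1 [[sa1 id1] s1 L1]] := support c.
have cP n : c n = 0 \/ exists2 w, w <> [::] & c n = bw w.
  by rewrite /c; case: unpickle => [[|i w]|]; [left|right; exists (i :: w)|left].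
have e1b w : w <> [::] -> e1 * bw w = bw w.
  by case: w => // i w _; have := s1 (pickle (i :: w)); rewrite /c pickleK.
have e0X w : w <> [::] -> e0 * X w = X w.
  by case: w => // i w _; rewrite X_cons mulrA s0.
have Xe0 w : w <> [::] -> X w * e0 = X w.
  move=> w0; have := congr1 star (e0X (rev w) _); rewrite starM sa0 (star_X hx) revK; apply.
  by move=> /(congr1 size); rewrite size_rev; case: (w) w0.
have e0b w : w <> [::] -> (1 - e0) * bw w = 0.
  move=> w0; apply: sepw => v u; rewrite mulrA; apply: (@bwP _ _ _ _ 0%N) => k _.
  by rewrite -[X v * _ * _]mulrA mulrBl mul1r e0X ?subrr ?mulr0 ?mul0r ?linear0 //; exact: shift_nil.
have e10 : e1 * e0 = e1.
  apply: sepw_eq => v u; apply/eqP; rewrite eq_sym -subr_eq0 -linearB -mulrBl -mulrBr; apply/eqP.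
  have -> : X v * (e1 - e1 * e0) * X u = X v * e1 * ((1 - e0) * X u) by rewrite !mulrA !mulrBr mulr1 !mulrA.
  apply: (L1 _ (phi_lfun _ _) (wcont_mul ro_f _ _ wphi)) => a n.
  suff h : star (c n) * (1 - e0) = 0 by rewrite -!mulrA [star _ * _]mulrA h mul0r !mulr0 linear0.
  have := cP n => -[->|[w w0 ->]]; first by rewrite star0 mul0r.
  by have := congr1 star (e0b w w0); rewrite starM starB star1 sa0 star0.
have e01 : e0 * e1 = e1 by have := congr1 star e10; rewrite starM sa0 sa1.
(* By the last property of [support] it suffices to insert a limit [bw w] in place of [e1]; then X u
   and [bw u] have the same moments, both separated from w. *)
have K1 c' u : u <> [::] -> phi (c' * e1 * X u) = phi (c' * bw u).
  move=> u0; rewrite -(e1b u u0) mulrA; apply/eqP; rewrite -subr_eq0 -linearB -mulrBr; apply/eqP.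
  apply: (L1 _ (phi_lfun _ _) (wcont_mul ro_f _ _ wphi)) => a n.
  have := cP n => -[->|[w w0 ->]]; first by rewrite star0 mulr0 mulr0 mul0r linear0.
  have w0' : rev w <> [::] by exact: rev_nonnil.
  rewrite star_bw // mulrA -[c' * a]mul1r -mulrA; apply: words_dense => v.
  by rewrite mul1r !mulrBr linearB !mulrA bw2_moment // bw_moment // subrr.
(* [phi] does not see e0 - e1. After insertion of a letter, a non-empty word w remains, and phi (X w
   e1) equals phi (X w) by [K1] for the reversed word. *)
have K0 c' : phi (c' * (e0 - e1)) = 0.
  have -> : c' * (e0 - e1) = c' * e0 * (e0 - e1) by rewrite -mulrA [in RHS]mulrBr id0 e01.
  apply: (L0 _ (phi_lfun _ _) (wcont_mul ro_f _ _ wphi)) => a n.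
  rewrite hx mulrA -[c' * a]mul1r -mulrA; apply: words_dense => v.
  rewrite mul1r mulrA -X1 -X_cat; set w := v ++ _.
  have w0 : w <> [::] by rewrite /w; case: (v).
  have rw0 : rev w <> [::] by exact: rev_nonnil.
  rewrite mulrBr Xe0 // linearB /=; have := K1 1 (rev w) rw0; rewrite !mul1r => h.
  have -> : X w * e1 = star (e1 * X (rev w)) by rewrite starM sa1 (star_X hx) revK.
  rewrite pf_star // h; have := bw_moment [::] [::] rw0; rewrite X_nil mul1r mulr1 cats0 => ->.
  by rewrite -mB_adj -pf_star // (star_X hx) revK subrr.
exists (e1 + (1 - e0)); split=> [|c'|c' u u0].
- split; first by rewrite starD starB star1 sa0 sa1.
  have -> : (e1 + (1 - e0)) * (e1 + (1 - e0)) =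
    e1 * e1 + (e1 - e1 * e0) + (e1 - e0 * e1) + (1 - e0 - e0 + e0 * e0) by ncring_in R[i] A.
  by rewrite id1 id0 e10 e01 !subrr !addr0 subrK.
- have -> : c' * (e1 + (1 - e0)) = c' - c' * (e0 - e1) by ncring_in R[i] A.
  by rewrite linearB /= K0 subr0.
by rewrite mulrDr mulrDl linearD K1 // -mulrA mulrBl mul1r e0X // subrr mulr0 linear0 addr0.
Qed.

End VacuumProjection.

Section VacuumCompression.
Variables (R : realType) (A : cstarType R) (x : nat -> A) (phi : {scalar A}) (e : A).
Local Notation X := (X x).
Implicit Types (c : A) (v w u : seq nat) (l : seq bool).
Variables (m : seq bool -> R[i]) (b : seq nat -> A).
Hypothesis ee : e * e = e.
Hypothesis m_adj : forall w, phi (X w) = m (sadj w).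
Hypothesis phi_e : forall c, phi (c * e) = phi c.
Hypothesis phi_b : forall c u, u <> [::] -> phi (c * e * X u) = phi (c * b u).
Hypothesis b_lim : forall w c r N,
  (forall k, (N <= k)%N -> phi (c * X (shift k w)) = r) -> phi (c * b w) = r.
Hypothesis sep : forall z z', (forall v u, phi (X v * z * X u) = phi (X v * z' * X u)) -> z = z'.

(** Under [phi], [c * e] behaves as a word of pattern [l] separated from all that follows. *)
Definition tested c l := forall u, phi (c * e * X u) = m (l ++ sadj u).

Lemma tested_word v : tested (X v) (sadj v).
Proof.
move=> u; have [->|/eqP u0] := eqVneq u [::]; first by rewrite X_nil mulr1 phi_e m_adj cats0.
rewrite phi_b //; have [N hN] := seq_bound v; apply: (@b_lim _ _ _ N) => k hk.
by rewrite -X_cat m_adj sadj_farl // (far_le hk).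
Qed.

Lemma tested_step c l w : w <> [::] -> tested c l -> tested (c * e * X w) (l ++ sadj w).
Proof.
move=> w0 h u; have [->|/eqP u0] := eqVneq u [::]; first by rewrite X_nil mulr1 phi_e h cats0.
rewrite phi_b //; have [N hN] := seq_bound w; apply: (@b_lim _ _ _ N) => k hk.
by rewrite -mulrA -X_cat h sadj_farl ?catA // (far_le hk).
Qed.

Definition q w := e * X w * e.

(** Between two different letters the pattern has a break anyway, so inserting [e] there changes no
    moment; the moments determine the element. *)
Lemma q_cat w1 w2 : w1 <> [::] -> w2 <> [::] -> last 0%N w1 <> head 0%N w2 ->
  q (w1 ++ w2) = q w1 * q w2.
Proof.
move=> h1 h2 h; have h0 : w1 ++ w2 <> [::] by case: (w1) h1.
apply: sep => v u; rewrite /q !mulrA -[X v * e * X w1 * e * e]mulrA ee.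
rewrite (tested_step h0 (tested_word v)) (tested_step h2 (tested_step h1 (tested_word v))).
by rewrite sadj_cat ?catA //; right; right.
Qed.

Lemma q_adj w w' : sadj w = sadj w' -> q w = q w'.
Proof.
move=> h; have [w0|/eqP w0] := eqVneq w [::].
  by case: w' h => //; rewrite w0.
have w0' : w' <> [::] by move=> e'; move: h; rewrite e'; case: (w) w0.
by apply: sep => v u; rewrite /q !mulrA (tested_step w0 (tested_word v)) h (tested_step w0' (tested_word v)).
Qed.

End VacuumCompression.

(** * Boolean cumulants by cuts *)

Section BooleanCuts.
Variables (T : Type) (V : zmodType).
Implicit Types (r w : seq T) (f g : seq T -> seq T -> V).

Fixpoint cuts f r : V :=
  if r is b :: r' then f [::] r + cuts (fun r1 r2 => f (b :: r1) r2) r' else 0.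

Lemma cuts_eq f g r : (forall r1 r2, r = r1 ++ r2 -> r2 <> [::] -> f r1 r2 = g r1 r2) ->
  cuts f r = cuts g r.
Proof.
elim: r f g => //= b r IH f g h; rewrite (h [::]) //; congr (_ + _).
by apply: IH => r1 r2 er h2; apply: h; rewrite ?er.
Qed.

Lemma cuts0 r : cuts (fun _ _ => 0) r = 0.
Proof. by elim: r => //= b r ->; rewrite addr0. Qed.

Lemma cuts_cat f r1 r2 : cuts f (r1 ++ r2) =
  cuts (fun s1 s2 => f s1 (s2 ++ r2)) r1 + cuts (fun s1 s2 => f (r1 ++ s1) s2) r2.
Proof. by elim: r1 f => [|b r1 IH] f /=; rewrite ?add0r // IH addrA. Qed.

End BooleanCuts.

Lemma cuts_add (T : Type) (V W : zmodType) (h : V -> W) (f : seq T -> seq T -> V) (r : seq T) :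
  {morph h : a b / a + b} -> h (cuts f r) = cuts (fun r1 r2 => h (f r1 r2)) r.
Proof.
move=> hD; have h0 : h 0 = 0 by apply: (@addrI _ (h 0)); rewrite -hD !addr0.
by elim: r f => //= b r IH f; rewrite hD IH.
Qed.

Lemma cuts_map (T T' : Type) (V : zmodType) (h : T -> T') (f : seq T' -> seq T' -> V) (w : seq T) :
  cuts f (map h w) = cuts (fun w1 w2 => f (map h w1) (map h w2)) w.
Proof. by elim: w f => //= b w IH f; rewrite IH. Qed.

Section BooleanCumulants.
Variables (R : realType) (A : cstarType R) (E : {linear A -> A}) (BB : set A).
Hypothesis B_sub : star_subalgebra BB.
Hypothesis EB : forall a, BB (E a).
Hypothesis El : forall b a, BB b -> E (b * a) = b * E a.
Hypothesis Er : forall a b, BB b -> E (a * b) = E a * b.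
Implicit Types (a b : A) (l r w : seq A).
Local Notation Mo := (Mo E).
Local Notation kap := (kappa false E).

Lemma fblock_gap (T : Type) (mul : T -> A -> T) (M : seq T -> A) (V : zmodType) (rho : seq T -> V)
    cur (b : T) (g r : seq T) : fblock false mul M rho cur (b :: g) r = rho [:: mul cur (M (b :: g ++ r))].
Proof. by elim: r g => [|b' r IH] g /=; rewrite ?cats0 // IH cat_rcons addr0. Qed.

(** The block of the first point is an initial segment: the moment is the sum over its end. The
    empty segment contributes 0, since [kappa] vanishes on the empty word. *)
Lemma kappa_cuts w : w <> [::] -> Mo w = kap w + cuts (fun w1 w2 => kap w1 * Mo w2) w.
Proof.
case: w => // a r _; rewrite (kappa_fb false) /= mul0r add0r.
have : forall l, fblock false *%R Mo (fun l' => kap (l ++ l')) a [::] r =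
    kap (l ++ a :: r) + cuts (fun w1 w2 => kap (l ++ a :: w1) * Mo w2) r; last exact: (@^~ [::]).
elim: r a => [|b r IH] a l /=; first by rewrite mulr1 addr0.
rewrite fblock_gap /= mulr1.
have -> : (fun l' => kap (l ++ a :: l')) = (fun l' => kap (rcons l a ++ l')).
  by apply/funext => l'; rewrite cat_rcons.
rewrite IH !cat_rcons !cats1 (kappaR _ Er); last exact: EB.
by rewrite addrCA; congr (_ + (_ + _)); apply: cuts_eq => *; rewrite cat_rcons.
Qed.

(** If moments factor at a place, cuts to its left give kap s1 Mo s2 Mo l2, the cut at this place
    gives kap l1 Mo l2, and cuts to its right vanish by induction. Together these make Mo l1 Mo l2,
    the whole moment, so the cumulant is 0. *)
Lemma kappa_cut l1 l2 : l1 <> [::] -> l2 <> [::] ->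
  (forall s1 s p p2, l1 = s1 ++ s -> l2 = p ++ p2 -> s <> [::] -> p <> [::] -> Mo (s ++ p) = Mo s * Mo p) ->
  kap (l1 ++ l2) = 0.
Proof.
have [n] := ubnP (size l2); elim: n l2 => // n IH l2 hn h1 h2 h.
have h12 : l1 ++ l2 <> [::] by case: (l1) h1.
have := kappa_cuts h12; rewrite (h [::] _ _ [::]) ?cats0 // cuts_cat.
have -> : cuts (fun s1 s2 => kap s1 * Mo (s2 ++ l2)) l1 = cuts (fun s1 s2 => kap s1 * Mo s2) l1 * Mo l2.
  rewrite (@cuts_add _ _ _ (fun y => y * Mo l2)); last by move=> a b; exact: mulrDl.
  by apply: cuts_eq => s1 s2 e s20; rewrite (h s1 s2 l2 [::]) ?cats0 // mulrA.
case: l2 hn h2 h h12 => // b l2 hn h2 h h12; rewrite [in X in _ + (_ + X)]/= cats0.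
have -> : cuts (fun s1 s2 => kap (l1 ++ b :: s1) * Mo s2) l2 = 0.
  rewrite -[RHS](cuts0 A l2); apply: cuts_eq => s1 s2 e s20.
  rewrite IH ?mul0r // => [|t1 t p p2 e1 e2].
    by move: hn; rewrite e /= size_cat; case: (s2) s20 => //= *; lia.
  by apply: (h t1 t p (p2 ++ s2)) => //; rewrite e -cat_cons e2 catA.
rewrite addr0 -mulrDl [cuts _ _ + _]addrC -kappa_cuts // => h'.
by move/eqP: h'; rewrite -subr_eq0 opprD addrCA subrr addr0 oppr_eq0 => /eqP.
Qed.

Lemma kappaZ l1 (c : R[i]) a l2 : kap (l1 ++ c *: a :: l2) = c *: kap (l1 ++ a :: l2).
Proof.
have -> : c *: a = (c - 1) *: a + a by rewrite scalerBl scale1r subrK.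
by rewrite (mlin_kappa false) scalerBl scale1r subrK.
Qed.

End BooleanCumulants.

(** * Independence and cumulants over the corner e A e *)

Section BooleanIndependence.
Variables (R : realType) (A : cstarType R) (x : nat -> A) (e : A).
Local Notation X := (X x).
Hypothesis pe : projection e.
Hypothesis q_cat : forall w1 w2, w1 <> [::] -> w2 <> [::] -> last 0%N w1 <> head 0%N w2 ->
  e * X (w1 ++ w2) * e = e * X w1 * e * (e * X w2 * e).
Hypothesis q_adj : forall w w', sadj w = sadj w' -> e * X w * e = e * X w' * e.
Implicit Types (a b c l : A) (w : seq nat) (m : A * seq A).

Definition cornerB : set A := [set a | e * a * e = a].
Local Notation B := cornerB.

Let ee : e * e = e := pe.2.

Lemma cornerl b : B b -> e * b = b.
Proof. by move=> <-; rewrite !mulrA ee. Qed.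

Lemma cornerr b : B b -> b * e = b.
Proof. by move=> <-; rewrite -!mulrA ee. Qed.

Lemma cornerP b : e * b = b -> b * e = b -> B b.
Proof. by rewrite /cornerB /= => -> ->. Qed.

Lemma corner_subalgebra : star_subalgebra B.
Proof.
split=> [|c a b ha hb|a b ha hb|a ha].
- by rewrite /cornerB /= mulr0 mul0r.
- by rewrite /cornerB /= mulrDr mulrDl -scalerAr -scalerAl ha hb.
- by apply: cornerP; rewrite ?mulrA ?cornerl // -mulrA cornerr.
by apply: cornerP; rewrite -{1}pe.1 -starM ?cornerl ?cornerr.
Qed.

Definition corner a := e * a * e.

Lemma corner_lin : linear corner.
Proof. by move=> c a b; rewrite /corner mulrDr mulrDl -scalerAr -scalerAl. Qed.

HB.instance Definition _ := GRing.isLinear.Build R[i] A A *:%R corner corner_lin.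

Lemma corner_B a : B (corner a).
Proof. by apply: cornerP; rewrite /corner ?mulrA ?ee // -mulrA ee. Qed.

Lemma corner_mull b a : B b -> corner (b * a) = b * corner a.
Proof. by move=> hb; rewrite /corner !mulrA (cornerl hb) (cornerr hb). Qed.

Lemma corner_mulr a b : B b -> corner (a * b) = corner a * b.
Proof. by move=> hb; rewrite /corner -!mulrA (cornerr hb) (cornerl hb). Qed.

Lemma corner_expectation : conditional_expectation B corner.
Proof.
split=> [a|b //|b1 a b2 h1 h2]; first exact: corner_B.
exact: etrans (corner_mulr _ h2) (congr1 ( *%R^~ b2) (corner_mull a h1)).
Qed.

(** Coefficients may be scalars, in which case the letters on both sides merge into one run, so [e]
    cannot be inserted at every coefficient. [separating] and [starting] say where it can, in front
    of a right factor l that ends in e. *)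
Definition separating l := forall w1 w2, w1 <> [::] -> w2 <> [::] -> last 0%N w1 <> head 0%N w2 ->
  e * X w1 * (X w2 * l) = e * X w1 * e * (X w2 * l).
Definition starting j l := forall w, w = [::] \/ last 0%N w <> j -> e * X w * l = e * X w * e * l.

Lemma separating_e : separating e.
Proof.
move=> w1 w2 h1 h2 h; have := q_cat h1 h2 h; rewrite X_cat !mulrA => ->.
by rewrite -[_ * e * e]mulrA ee.
Qed.

Lemma separating_lin (c : R[i]) a b : separating a -> separating b -> separating (c *: a + b).
Proof.
by move=> ha hb w1 w2 h1 h2 h; rewrite !mulrDr -!scalerAr ha // hb.
Qed.

Lemma starting_lin j (c : R[i]) a b : starting j a -> starting j b -> starting j (c *: a + b).
Proof. by move=> ha hb w h; rewrite !mulrDr -!scalerAr ha // hb. Qed.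

Lemma separating_coef b l : coef B b -> separating l -> separating (b * l).
Proof.
case=> [hb _ w1 w2 h1 h2 h|[c ->] hl]; last first.
  have -> : c%:A * l = c *: l + 0 by rewrite addr0 mulr_algl.
  by apply: separating_lin => // w1 w2 _ _ _; rewrite !mulr0.
have := separating_e h1 h2 h; rewrite !mulrA -(cornerl hb) !mulrA => ->.
by [].
Qed.

Lemma starting_coef j b l : coef B b -> starting j l -> starting j (b * l).
Proof.
case=> [hb _ w h|[c ->] hl].
  by rewrite -{1}(cornerl hb) !mulrA -(cornerl hb) !mulrA.
have -> : c%:A * l = c *: l + 0 by rewrite addr0 mulr_algl.
by apply: starting_lin => // w _; rewrite !mulr0.
Qed.

Lemma separating_letter j l : separating l -> separating (x j * l).
Proof.
move=> hl w1 w2 h1 h2 h; have := hl w1 (w2 ++ [:: j]) h1; rewrite X_cat X1 -!mulrA; apply.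
  by case: (w2).
by case: (w2) h2 h.
Qed.

Lemma starting_letter j l : separating l -> starting j (x j * l).
Proof.
move=> hl w [->|h]; first by rewrite X_nil mulr1 ee.
have [->|/eqP w0] := eqVneq w [::]; first by rewrite X_nil mulr1 ee.
by have := hl w [:: j] w0; rewrite X1; apply.
Qed.

Lemma monomial_starting j m l : is_bmonomial B m -> (0 < size m.2)%N -> separating l ->
  separating (bmon_eval (x j) m * l) /\ starting j (bmon_eval (x j) m * l).
Proof.
case: m => b0 [//|b bs] [/= h0 hb] _ hl; rewrite /bmon_eval /= big_cons.
have hs : separating (b * (\prod_(b' <- bs) (x j * b') * l)).
  apply: separating_coef; first by apply: hb; rewrite inE eqxx.
  have : forall b', b' \in bs -> coef B b' by move=> b' hb'; apply: hb; rewrite inE hb' orbT.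
  elim: bs {hb} => [|b' bs IH] hb; first by rewrite big_nil mul1r.
  rewrite big_cons -!mulrA; apply: separating_letter; apply: separating_coef.
    by apply: hb; rewrite inE eqxx.
  by apply: IH => b'' h''; apply: hb; rewrite inE h'' orbT.
rewrite -!mulrA; split; [apply: separating_coef|apply: starting_coef] => //.
  exact: separating_letter.
exact: starting_letter.
Qed.

Lemma corner_stepB k i b l : B b ->
  e * X (nseq k i) * (x i * b * l) = e * X (nseq k.+1 i) * e * (b * (e * l)).
Proof.
move=> hb; have hb' : b = e * (b * e) by rewrite cornerr // cornerl.
by rewrite [in LHS]hb' -addn1 nseqD X_cat X1 !mulrA.
Qed.

Lemma corner_stepZ k i (c : R[i]) l :
  e * X (nseq k i) * (x i * c%:A * l) = c *: (e * X (nseq k.+1 i) * l).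
Proof. by rewrite -addn1 nseqD X_cat X1 mulr_algr -scalerAl -scalerAr !mulrA. Qed.

(** A coefficient in B contains [e] on both sides and restarts the argument; otherwise the run of
    x_i at the end of the monomial meets a different letter j, where [starting] inserts e. *)
Lemma monomial_splits i j m l : is_bmonomial B m -> i <> j -> starting j l ->
  e * bmon_eval (x i) m * l = e * bmon_eval (x i) m * (e * l).
Proof.
case: m => b0 bs [/= h0 hb] ij hl; rewrite /bmon_eval /=.
(* [k] counts the letters read since the last coefficient in B; a scalar coefficient only lengthens
   the run. *)
have : forall k, e * X (nseq k i) * (\prod_(b <- bs) (x i * b) * l) =
    e * X (nseq k i) * (\prod_(b <- bs) (x i * b) * (e * l)).
  elim: bs hb => [|b bs IH] hb k.
    rewrite !big_nil !mul1r mulrA; apply: hl; case: k => [|k]; [by left|right].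
    by rewrite /=; elim: k.
  have hb' b' h := hb b' (@mem_behead _ (_ :: _) b' h).
  rewrite !big_cons -!(mulrA (x i * b)); have [h|[c ->]] := hb b (mem_head _ _).
    have h1 := IH hb' 0%N; rewrite /= X_nil mulr1 in h1.
    by rewrite !corner_stepB // h1.
  by rewrite !corner_stepZ IH.
move=> h; have h1 := h 0%N; rewrite /= X_nil mulr1 in h1.
case: h0 => [h0|[c ->]]; last by rewrite mulr_algl -!scalerAr -!scalerAl -!mulrA h1.
by rewrite -!mulrA -(cornerr h0) -!mulrA h1.
Qed.

Lemma poly_ind (D : set A) i (p : bpoly A) l : D 0 -> (forall (c : R[i]) a b, D a -> D b -> D (c *: a + b)) ->
  (forall m, m \in p -> D (bmon_eval (x i) m * l)) -> D (bpoly_eval (x i) p * l).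
Proof.
move=> D0 Dl; rewrite /bpoly_eval; elim: p => [|m p IH] h; first by rewrite big_nil mul0r.
rewrite big_cons mulrDl -[X in X + _]scale1r; apply: Dl; first by apply: h; rewrite inE eqxx.
by apply: IH => m' h'; apply: h; rewrite inE h' orbT.
Qed.

(** All right factors are separating and start with the letter of their first polynomial, so [e] is
    inserted between successive polynomials one after the other. *)
Theorem corner_independent : boolean_independent B corner x.
Proof.
have good (s : seq (nat * bpoly A)) : (forall t, t \in s -> in_BX0 B t.2) ->
    separating ((\prod_(t <- s) bpoly_eval (x t.1) t.2) * e) /\
    if s is t :: _ then starting t.1 ((\prod_(t <- s) bpoly_eval (x t.1) t.2) * e) else True.
  elim: s => [|t s IH] h; first by rewrite big_nil mul1r; split=> //; exact: separating_e.
  have [h1 _] := IH (fun t' h' => h t' (mem_behead (s := t :: s) h')).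
  have ht m (hm : m \in t.2) := h t (mem_head _ _) m hm.
  rewrite !big_cons -!mulrA; split.
    apply: (@poly_ind separating) => [w1 w2 *|*|m /ht[hm sm]]; first by rewrite !mulr0.
      exact: separating_lin.
    exact: (monomial_starting t.1 hm sm h1).1.
  apply: (@poly_ind (starting t.1)) => [w *|*|m /ht[hm sm]]; first by rewrite !mulr0.
    exact: starting_lin.
  exact: (monomial_starting t.1 hm sm h1).2.
elim=> [//|t [|t' s] IH] _ nd h; first by rewrite !big_seq1.
have h' u : u \in t' :: s -> in_BX0 B u.2 by move=> hu; apply: h; rewrite inE hu orbT.
have [_ st] := good _ h'.
have tt' : t.1 <> t'.1 by move: nd; rewrite /neighbours_differ /= => /andP[/eqP].
rewrite big_cons [RHS]big_cons -IH //; last by move: nd; rewrite /neighbours_differ /= => /andP[].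
set P := \prod_(u <- _) _ in st *; rewrite /corner -!mulrA [e * (e * _)]mulrA ee.
rewrite ![e * (bpoly_eval _ _ * _)]mulrA /bpoly_eval mulr_sumr !mulr_suml.
apply: eq_big_seq => m hm; have [hm1 _] := h t (mem_head _ _) m hm.
exact: monomial_splits hm1 tt' st.
Qed.

Lemma sadj_nseq k i j : sadj (nseq k i) = sadj (nseq k j).
Proof. elim: k => // -[//|k] IH.
change ((Some i == Some i) :: sadj (nseq k.+1 i) = (Some j == Some j) :: sadj (nseq k.+1 j)).
by rewrite !eqxx IH.
Qed.

Lemma corner_moment i j bs k : (forall b, b \in bs -> coef B b) ->
  e * X (nseq k i) * (\prod_(b <- bs) (x i * b) * e) =
  e * X (nseq k j) * (\prod_(b <- bs) (x j * b) * e).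
Proof.
elim: bs k => [|b bs IH] k hb.
  by rewrite !big_nil !mul1r; apply: q_adj; exact: sadj_nseq.
have hb' b' h := hb b' (@mem_behead _ (_ :: _) b' h).
rewrite !big_cons -(mulrA (x i * b)) -(mulrA (x j * b)); have [h|[c ->]] := hb b (mem_head _ _).
  rewrite !corner_stepB // (q_adj (sadj_nseq k.+1 i j)).
  by have := IH 0%N hb'; rewrite !X_nil !mulr1 => ->.
by rewrite !corner_stepZ IH.
Qed.

Theorem corner_identical : identically_distributed0 B corner x.
Proof.
move=> p hp i j; rewrite /bpoly_eval !linear_sum; apply: eq_big_seq => -[b0 bs] /hp[[/= h0 hb] _].
have h : corner (\prod_(b <- bs) (x i * b)) = corner (\prod_(b <- bs) (x j * b)).
  by have := corner_moment i j 0%N hb; rewrite /= !X_nil !mulr1 !mulrA.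
rewrite /bmon_eval /=; case: h0 => [h0|[c ->]]; first by rewrite !corner_mull // h.
by rewrite !mulr_algl; have := linearZ; rewrite /corner -!scalerAr -!scalerAl -!/(corner _) h.
Qed.

Lemma corner_symmetric i : (forall n, odd n -> e * X (nseq n i) * e = 0) ->
  symmetric_distribution B corner (x i).
Proof.
move=> hq [b0 bs] [/= h0 hb] os.
have h : forall k, odd (k + size bs) -> e * X (nseq k i) * (\prod_(b <- bs) (x i * b) * e) = 0.
  elim: bs hb {os} => [|b bs IH] hb k; first by rewrite addn0 big_nil mul1r; exact: hq.
  have hb' b' h := hb b' (@mem_behead _ (_ :: _) b' h).
  rewrite big_cons -(mulrA (x i * b)) [size _]/= addnS => ok; have [h|[c ->]] := hb b (mem_head _ _).
    rewrite corner_stepB //; have [ok'|ok'] := boolP (odd k.+1); first by rewrite hq // !mul0r.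
    have := IH hb' 0%N; rewrite X_nil mulr1 add0n => ->; first by rewrite !mulr0.
    by move: ok ok'; rewrite /= oddD negbK; case: (odd k); case: (odd _).
  by rewrite corner_stepZ IH ?scaler0 // addSn.
have := h 0%N os; rewrite X_nil mulr1 mulrA => h'.
rewrite /bmon_eval /=; case: h0 => [h0|[c ->]]; first by rewrite corner_mull // /corner h' mulr0.
by rewrite mulr_algl /corner -scalerAr -scalerAl h' scaler0.
Qed.

Local Notation kap := (kappa false corner).
Local Notation Mo := (Mo corner).

Lemma corner_cumulants : boolean_cumulants corner kap.
Proof.
move=> n a n0.
exact: (kappa_moment false corner_subalgebra corner_B (fun b c hc => corner_mulr b hc)).
Qed.

Lemma Mo_words w : w <> [::] -> Mo (map x w) = e * X w * e.
Proof. by move=> w0; rewrite Mo_nonnil ?big_map //; case: (w) w0. Qed.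

Lemma nseq_cat (T : eqType) n (y : T) r1 r2 : nseq n y = r1 ++ r2 ->
  r1 = nseq (size r1) y /\ r2 = nseq (size r2) y.
Proof. by move=> h; have := all_pred1_nseq y n; rewrite h all_cat => /andP[/all_pred1P h1 /all_pred1P h2]. Qed.

Definition kap_cuts := @kappa_cuts _ _ corner _ corner_B (fun a b hb => corner_mulr a hb).
Definition kap_cut := @kappa_cut _ _ corner _ corner_B (fun a b hb => corner_mulr a hb).

Lemma kap_nseq n i j : kap (nseq n (x i)) = kap (nseq n (x j)).
Proof.
have [d] := ubnP n; elim: d n => // d IH [|n] hn //.
have ny (T : Type) (y : T) k : nseq k y = map (fun=> y) (nseq k tt) by rewrite map_nseq.
have h y : kap (nseq n.+1 y) = Mo (nseq n.+1 y) - cuts (fun w1 w2 : seq A => kap w1 * Mo w2) (nseq n.+1 y).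
  by rewrite kap_cuts // addrK.
have hM k : Mo (nseq k (x i)) = Mo (nseq k (x j)).
  case: k => // k; have := Mo_words (w := nseq k.+1 i); have := Mo_words (w := nseq k.+1 j).
  by rewrite !map_nseq => -> // -> //; apply: q_adj; exact: sadj_nseq.
rewrite !h hM; congr (_ - _); rewrite (ny _ (x i)) (ny _ (x j)) !cuts_map.
apply: cuts_eq => r1 r2 e12 r20; have [h1 h2] := nseq_cat e12.
rewrite h1 h2 !map_nseq hM IH //.
have := congr1 size e12; rewrite size_cat size_nseq; case: (r2) r20 => //= *; lia.
Qed.

Lemma odd_corner i : (forall n, odd n -> kap (nseq n (x i)) = 0) ->
  forall n, odd n -> e * X (nseq n i) * e = 0.
Proof.
move=> hk n; have [d] := ubnP n; elim: d n => // d IH [|n] hn // on.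
rewrite -Mo_words // map_nseq kap_cuts // hk // add0r.
rewrite -[RHS](cuts0 A (nseq n.+1 (x i))); apply: cuts_eq => r1 r2 e12 r20.
have [h1 h2] := nseq_cat e12; rewrite h1 h2.
have := congr1 size e12; rewrite size_cat size_nseq => sz.
have [odd1|odd1] := boolP (odd (size r1)); first by rewrite hk ?mul0r.
have r2' : (0 < size r2)%N by case: (r2) r20.
have s2 : nseq (size r2) i <> [::] by case: (size r2) r2'.
have [s10|s10] := posnP (size r1); first by rewrite s10 mul0r.
have := Mo_words s2; rewrite map_nseq => ->; rewrite IH ?mulr0 //; first by lia.
by move: on; rewrite sz oddD (negbTE odd1).
Qed.

(** An interior coefficient in B carries an [e] at which moments factor, so [kap_cut] kills the
    cumulant; extreme ones factor out by B-linearity and scalars by homogeneity. Only cumulants of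
    powers of x_i remain. *)
Lemma kap_coefs (N : pred nat) i : (forall n, N n -> kap (nseq n (x i)) = 0) ->
  cumulants_vanish B kap N (x i).
Proof.
move=> hK b0 b1 bs h0 h1 hbs hN.
have : forall cs k, (forall b, b \in cs -> coef B b) -> N (k + size cs)%N ->
    kap (nseq k (x i) ++ [seq x i * b | b <- cs]) = 0.
  elim=> [|b cs IH] k hb; first by rewrite addn0 cats0; exact: hK.
  have hb' b' h := hb b' (@mem_behead _ (_ :: _) b' h).
  rewrite /= addnS => hk; have [h|[c ->]] := hb b (mem_head _ _); last first.
    rewrite mulr_algr kappaZ -cat1s catA -[nseq k _ ++ _](nseqD k 1) addn1 IH ?scaler0 //.
  case: cs IH hb hb' hk => [|b' cs] IH hb hb' hk.
    rewrite /= cats1 (kappaR _ (fun a b hb => corner_mulr a hb)) // -cats1 -[nseq k _ ++ _](nseqD k 1).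
    by rewrite hK ?mul0r //; move: hk; rewrite addn0 addn1.
  rewrite -cat1s catA; apply: kap_cut => //; first by case: (k).
  move=> s1 s p p2; case/lastP: s => [//|s y]; rewrite -rcons_cat cats1 => /rcons_inj[_ <-] _ _ p0.
  rewrite !Mo_nonnil //; [|by case: (s)|by case: (s)].
  rewrite big_cat -cats1 big_cat big_seq1 /= /corner -!mulrA [e * (e * _)]mulrA ee.
  by rewrite ![b * (e * _)]mulrA (cornerr h).
have mem b : b \in b1 :: bs -> coef B b by rewrite inE => /orP[/eqP ->|/hbs].
move=> /(_ (b1 :: bs) 0%N mem hN) /= h.
case: h0 => [h0|[c ->]]; first by rewrite -mulrA (kappaL _ (fun b a hb => corner_mull a hb)) // h mulr0.
by rewrite mulr_algl -scalerAl (kappaZ _ [::]) h scaler0.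
Qed.

Lemma change_point w : ~~ constant w -> exists w1 w2,
  [/\ w = w1 ++ w2, w1 <> [::], w2 <> [::] & last 0%N w1 <> head 0%N w2].
Proof.
elim: w => // i [//|j w] IH h; have [ij|/eqP ij] := eqVneq i j; last first.
  by exists [:: i], (j :: w).
have [|w1 [w2 [-> h1 h2 h3]]] := IH; first by move: h; rewrite /= ij eqxx.
by exists (i :: w1), w2; split=> //; case: (w1) h1 h3.
Qed.

Lemma kap_words w : ~~ constant w -> kap (map x w) = 0.
Proof.
move=> /change_point[w1 [w2 [-> h1 h2 h12]]]; rewrite map_cat; apply: kap_cut.
- by case: (w1) h1.
- by case: (w2) h2.
move=> s1 s p p2 e1 e2 s0 p0.
have es : s = map x (drop (size s1) w1) by rewrite map_drop e1 drop_size_cat.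
have ep : p = map x (take (size p) w2) by rewrite map_take e2 take_size_cat.
set v1 := drop _ _ in es; set v2 := take _ _ in ep.
have v10 : v1 <> [::] by move=> h; rewrite es h in s0.
have v20 : v2 <> [::] by move=> h; rewrite ep h in p0.
have v120 : v1 ++ v2 <> [::] by case: (v1) v10.
rewrite es ep -map_cat !Mo_words // q_cat //; move: h12.
rewrite -[in last _ _](cat_take_drop (size s1) w1) -/v1 last_cat -[in head _ _](cat_take_drop (size p) w2) -/v2.
by case: (v2) v20 => //= k v2' _; case: (v1) v10.
Qed.

End BooleanIndependence.

Lemma cuts_sum (T I : Type) (V : zmodType) (s : seq I) (f : I -> seq T -> seq T -> V) (r : seq T) :
  \sum_(i <- s) cuts (f i) r = cuts (fun r1 r2 => \sum_(i <- s) f i r1 r2) r.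
Proof. by elim: r f => [|b r IH] f /=; [rewrite big1|rewrite big_split IH]. Qed.

(** * From non-zero Boolean cumulants to relations between generators *)

Section PsiTheory.
Variables (R : realType) (Q : cstarType R) (n : nat) (U : 'M[Q]_n).
Implicit Types (f g : seq 'I_n -> Q) (w k : seq 'I_n).

Lemma Psi_size f g w : (forall k, size k = size w -> f k = g k) -> Psi U f w = Psi U g w.
Proof.
elim: w f g => [|i w IH] f g h /=; first exact: h.
by apply: eq_bigr => k _; congr (_ * _); apply: IH => v hv; apply: h; rewrite /= hv.
Qed.

Lemma PsiD f g w : Psi U (fun k => f k + g k) w = Psi U f w + Psi U g w.
Proof.
elim: w f g => //= i w IH f g; rewrite -big_split; apply: eq_bigr => k _ /=.
by rewrite IH mulrDr.
Qed.

Lemma Psi0 w : Psi U (fun=> 0) w = 0.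
Proof. by elim: w => //= i w IH; rewrite big1 // => k _; rewrite IH mulr0. Qed.

Lemma Psi_cuts (f : seq 'I_n -> seq 'I_n -> Q) w : Psi U (cuts f) w =
  cuts (fun w1 w2 => Psi U (fun k1 => Psi U (f k1) w2) w1) w.
Proof.
elim: w f => //= i w IH f; rewrite -cuts_sum -big_split; apply: eq_bigr => k _ /=.
rewrite PsiD mulrDr IH; congr (_ + _).
by rewrite (@cuts_add _ _ _ ( *%R (U k i))) // => a b; exact: mulrDr.
Qed.

Lemma Psi_constant (k : 'I_n) (y : Q) w :
  Psi U (fun v => if all (pred1 k) v then y else 0) w = (\prod_(j <- w) U k j) * y.
Proof.
elim: w => [|j w IH] /=; first by rewrite big_nil mul1r.
rewrite big_cons (bigD1 k) //= eqxx IH [X in _ + X]big1 ?addr0 ?mulrA // => l /negbTE lk.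
by rewrite lk Psi0 mulr0.
Qed.

End PsiTheory.

Section BooleanPowerSums.
Variables (R : realType) (A : cstarType R) (x : nat -> A) (phi : {scalar A}) (e : A).
Variables (m : seq bool -> R[i]) (Q : cstarType R) (n : nat) (u : 'M[Q]_n).
Local Notation X := (X x).
Hypothesis pe : projection e.
Hypothesis hcat : forall w1 w2, w1 <> [::] -> w2 <> [::] -> last 0%N w1 <> head 0%N w2 ->
  e * X (w1 ++ w2) * e = e * X w1 * e * (e * X w2 * e).
Hypothesis hadj : forall w w', sadj w = sadj w' -> e * X w * e = e * X w' * e.
Hypothesis sep : forall z, (forall v v', phi (X v * z * X v') = 0) -> z = 0.
Hypothesis m_adj : forall w, phi (X w) = m (sadj w).
Hypothesis m_corner : forall v w v', w <> [::] ->
  phi (X v * (e * X w * e) * X v') = m (sadj v ++ sadj w ++ sadj v').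
Hypothesis hu : inv_words x phi u 1.
Local Notation kap := (kappa false (corner e)).
Local Notation Mo := (Mo (corner e)).
Local Notation wd w := (map val w).
Implicit Types (w k : seq 'I_n) (F : A -> Q).

Lemma Phi_far (L : A -> Q) (v : seq nat) t : all (leq n) v ->
  Phi x u L (tok_word x n v ++ t) = Phi x u (fun y => L (X v * y)) t.
Proof.
elim: v L => [|i v IH] L /= => [_|/andP[hi hv]].
  by apply: Phi_ext => y; rewrite X_nil mul1r.
rewrite insubF ?ltnNge ?hi //= IH //; apply: Phi_ext => y; by rewrite X_cons mulrA.
Qed.

Lemma Phi_near (L : A -> Q) w t : Phi x u L (tok_word x n (wd w) ++ t) =
  Psi u (fun k => Phi x u (fun y => L (X (wd k) * y)) t) w.
Proof.
elim: w L => [|i w IH] L /=; first by apply: Phi_ext => y; rewrite X_nil mul1r.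
rewrite valK /=; apply: eq_bigr => k _; rewrite IH; congr (_ * _); apply: Psi_ext => v.
by apply: Phi_ext => y; rewrite X_cons mulrA.
Qed.

Lemma word_invariant (v v' : seq nat) w : all (leq n) v -> all (leq n) v' ->
  Psi u (fun k => phi (X v * X (wd k) * X v') *: 1) w = phi (X v * X (wd w) * X v') *: (1 : Q).
Proof.
move=> hv hv'; have := hu (v ++ wd w ++ v'); rewrite /inv evt_tok !X_cat mulrA => <-.
rewrite /tok_word !map_cat -!/(tok_word x n _) Phi_far // Phi_near; apply: Psi_ext => k.
by rewrite -[tok_word x n v']cats0 Phi_far //= mulr1 !mulrA.
Qed.

(** The separating functionals [phi (X v * _ * X v')] see only patterns, so v and v' may be shifted
    beyond n. There the coaction does not touch them, and the words between them have letters below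
    n, so that the middle word may stand without [e]. [tensor_separation] concludes. *)
Lemma corner_invariant F w : linear F -> w <> [::] ->
  Psi u (fun k => F (e * X (wd k) * e)) w = F (e * X (wd w) * e).
Proof.
move=> hF w0; pose th (p : seq nat * seq nat) a := phi (X p.1 * a * X p.2).
pose qq k := e * X (wd k) * e.
have [s [_ hs]] := expand_prod u w.
have thP p k : size k = size w -> th p (qq k) =
    phi (X (shift n p.1) * X (wd k) * X (shift n p.2)).
  move=> sk; have k0 : wd k <> [::] by case: (k) sk; case: (w) w0.
  have hk : all (gtn n) (wd k) by apply/allP => _ /mapP[i _ ->] /=.
  have far v : all (leq n) (shift n v) by apply/allP => _ /mapP[i _ ->]; exact: leq_addr.
  rewrite /th /qq m_corner // -!X_cat m_adj -catA.
  have l1 : wd k = [::] \/ shift n p.2 = [::] \/ last 0%N (wd k) <> head 0%N (shift n p.2).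
    right; case: (p.2) => [|j v]; [by left|right=> /= e'].
    have : last 0%N (wd k) \in wd k by case: (wd k) k0 => //= i l _; exact: mem_last.
    by move=> /(allP hk) /=; rewrite e' ltnNge leq_addr.
  have l2 : shift n p.1 = [::] \/ wd k ++ shift n p.2 = [::] \/
      last 0%N (shift n p.1) <> head 0%N (wd k ++ shift n p.2).
    case e1 : (shift n p.1) => [|j v]; [by left|right; right=> /= e'].
    have : last j v \in shift n p.1 by rewrite e1; exact: mem_last.
    move=> /(allP (far _)); rewrite e' leqNgt; case: (wd k) k0 hk => //= i l _ /andP[-> _].
    by [].
  by rewrite (sadj_cat l2) (sadj_cat l1) !sadj_shift.
have far v : all (leq n) (shift n v) by apply/allP => _ /mapP[i _ ->]; exact: leq_addr.
have := @tensor_separation R A Q _ th (cornerB e) ((-1, qq w) :: [seq (p.1, qq p.2) | p <- s]) F.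
have [c0 cl _ _] := corner_subalgebra pe.
move=> /(_ _ c0 cl _ _ _ hF); rewrite big_cons big_map /= => h.
have : -1 * F (qq w) + \sum_(p <- s) p.1 * F (qq p.2) = 0.
  apply: h => [p|a _ ha|p|p].
  - by move=> c a b; rewrite /th mulrDr mulrDl -scalerAr -scalerAl linearP.
  - by apply: sep => v v'; exact: (ha (v, v')).
  - by rewrite inE => /orP[/eqP ->|/mapP[p' _ ->]] /=; exact: (corner_B pe).
  rewrite big_cons big_map /=.
  have -> : \sum_(p0 <- s) th p (qq p0.2) *: p0.1 = \sum_(p0 <- s) p0.1 * (th p (qq p0.2) *: 1).
    by apply: eq_bigr => p0 _; rewrite mulr_algr.
  rewrite (hs (fun k => th p (qq k) *: 1)) (@Psi_size _ _ _ u _ (fun k =>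
    phi (X (shift n p.1) * X (wd k) * X (shift n p.2)) *: 1)) => [|k sk]; last by rewrite thP.
  by rewrite word_invariant // thP // scalerN addNr.
by rewrite (hs (fun k => F (qq k))) mulN1r => /eqP; rewrite addrC subr_eq0 => /eqP.
Qed.

(** Induction on the length through [kap_cuts]: in every proper cut the cumulant factor is invariant
    by induction and the moment factor by [corner_invariant]. *)
Lemma kap_invariant F w : linear F ->
  Psi u (fun k => F (kap (map x (wd k)))) w = F (kap (map x (wd w))).
Proof.
have [d] := ubnP (size w); elim: d w F => // d IH w F hd hF.
have [->|/eqP w0] := eqVneq w [::]; first by [].
have FD : {morph F : a b / a + b} by move=> a b; have := hF 1 a b; rewrite !scale1r.
pose g k1 k2 := F (kap (map x (wd k1)) * Mo (map x (wd k2))).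
have rec k : k <> [::] -> F (e * X (wd k) * e) = F (kap (map x (wd k))) + cuts g k.
  move=> k0; rewrite -Mo_words; last by case: (k) k0.
  rewrite (kap_cuts pe) ?FD; last by case: (k) k0.
  by rewrite cuts_add // !cuts_map.
have nz k : size k = size w -> k <> [::] by case: (k); case: (w) w0.
apply: (@addIr _ (cuts g w)); rewrite -rec // -corner_invariant //.
rewrite [RHS](@Psi_size _ _ _ u _ (fun k => F (kap (map x (wd k))) + cuts g k)) => [|k sk]; last first.
  by rewrite rec //; exact: nz.
rewrite PsiD Psi_cuts; congr (_ + _); apply: cuts_eq => w1 w2 ew w20.
have MoF k G : size k = size w2 -> G (Mo (map x (wd k))) = G (e * X (wd k) * e) :> Q.
  by move=> sk; rewrite Mo_words //; case: (k) sk; case: (w2) w20.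
have lr c : linear (fun y => F (c * y)) by move=> z a b; rewrite mulrDr -scalerAr hF.
have ll c : linear (fun y => F (y * c)) by move=> z a b; rewrite mulrDl -scalerAl hF.
rewrite /g -(IH w1 _ _ (ll _)).
  apply: Psi_size => k1 _; rewrite [RHS](@Psi_size _ _ _ u _ (fun k2 => F (kap (map x (wd k1)) * (e * X (wd k2) * e)))).
    by rewrite (MoF w2 (fun y => F (kap (map x (wd k1)) * y))) // (corner_invariant (lr (kap (map x (wd k1)))) w20).
  by move=> k2 sk; rewrite (MoF k2 (fun y => F (_ * y))).
by move: hd; rewrite ew size_cat; case: (w2) w20 => //= *; lia.
Qed.

(** As in the free case, mixed cumulants vanish and the others do not depend on the letter; a
    non-zero scalar [phi (X v * K * X v')] is cancelled. *)
Lemma boolean_power_sums q : kap (nseq q (x 0%N)) <> 0 -> power_sums u q.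
Proof.
move=> k0 s ss; set K := kap _ in k0.
have [v [v' g0]] : exists v v', phi (X v * K * X v') <> 0.
  apply: contrapT => h; apply: k0; apply: sep => v v'; apply: contrapT => h'.
  by apply: h; exists v, v'.
set c := phi _ in g0; pose F a : Q := phi (X v * a * X v') *: 1.
have hF : linear F.
  by move=> z a b; rewrite /F mulrDr mulrDl -scalerAr -scalerAl linearP scalerDl scalerA.
have FE k : size k = q -> F (kap (map x (wd k))) = if constant k then c *: 1 else 0.
  move=> sk; case: ifP => h.
    have [i ->] : exists i : nat, wd k = nseq q i.
      case: k sk h => [<- _|i k sk /all_pred1P ->]; first by exists 0%N.
      by exists (val i); rewrite -sk /= map_nseq.
    by rewrite map_nseq (kap_nseq pe hadj q i 0) .
  rewrite (kap_words pe hcat) ?/F ?mulr0 ?mul0r ?linear0 ?scale0r //.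
  apply/negP => hc; case/negP: h; case: (k) hc => //= i k'; rewrite all_map.
  by apply: sub_all => j /=; rewrite val_eqE.
have := kap_invariant s hF; rewrite FE //.
have -> : Psi u (fun k => F (kap (map x (wd k)))) s = (\sum_k \prod_(j <- s) u k j) * (c *: 1).
  case: s ss => [|j s] ss; first by case: k0; rewrite /K -ss.
  rewrite /= mulr_suml; apply: eq_bigr => k _; rewrite big_cons -mulrA -Psi_constant; congr (_ * _).
  by apply: Psi_size => l sl; have := FE (k :: l); rewrite /= sl => ->.
rewrite -scalerAr mulr1 => h; have c0 : c != 0 by exact/eqP.
by rewrite -[LHS]scale1r -(mulVf c0) -scalerA h; case: ifP => _; rewrite ?scaler0 ?scalerA ?mulVf ?scale1r.
Qed.

End BooleanPowerSums.

(** The hypothesis makes z vanish on all vectors pi c xi, which are dense; boundedness of pi z and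
    injectivity of pi give z = 0. *)
Lemma gns_separating (R : realType) (A : cstarType R) (phi : {scalar A}) : nondegenerate_state phi ->
  forall z, (forall b c, phi (b * z * c) = 0) -> z = 0.
Proof.
move=> [H [pi [xi [[[pb pl pM p1 pa] pphi pd] pinj]]]] z hz; apply: pinj; apply/funext => h.
have -> : pi 0 h = 0 by have := pl (-1) 0 0 h; rewrite scaleN1r oppr0 addr0 scaleN1r addNr.
have z0 c : pi z (pi c xi) = 0.
  apply: hs_eq0; rewrite /hs -pM pa -pM.
  have -> : dotp xi (pi (star (z * c) * (z * c)) xi) = (dotp (pi (star (z * c) * (z * c)) xi) xi)^*.
    exact: dotpC.
  by rewrite -pphi mulrA hz conjC0.
have [lz cz] := pb z; have [K K0 hK] := bop_bound (pb z).
apply: hs_eq0; apply/eqP; rewrite eq_le hs_ge0 andbT leNgt; apply/negP => pos.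
pose r := Num.sqrt (hs (pi z h) / (K + 1)).
have K1 : 0 < K + 1 by lra.
have r0 : 0 < r by rewrite sqrtr_gt0 divr_gt0.
have : closure [set pi a xi | a in [set: A]] h by rewrite pd.
move=> /(_ (ball h r%:C)) [|_ [[c _ <-] hb]].
  by apply: nbhsx_ballx; rewrite (_ : 0 = 0%:C) ?ltcR.
move: hb; rewrite -ball_normE /= hs_norm ltcR /r ltr_sqrt ?divr_gt0 // => hb.
have : pi z h = pi z (h - pi c xi).
  by have := lz (-1) (pi c xi) h; rewrite z0 scaler0 add0r scaleN1r addrC.
move=> e; have := hK (h - pi c xi); rewrite -e; apply/negP; rewrite -ltNge.
move: hb; rewrite ltr_pdivlMr //; have := hs_ge0 (h - pi c xi); nra.
Qed.

(** * Assembly of the two cases *)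

Theorem theorem1p2 (R : realType)
  (As Ao Ah Ab : forall n : nat, genalg R n)
  (Bs Bo Bh Bb : forall n : nat, bgenalg R n)
  (hAs : forall n, (0 < n)%N -> is_As (As n))
  (hAo : forall n, (0 < n)%N -> is_Ao (Ao n))
  (hAh : forall n, (0 < n)%N -> is_Ah (Ah n))
  (hAb : forall n, (0 < n)%N -> is_Ab (Ab n))
  (hBs : forall n, (0 < n)%N -> is_Bs (Bs n))
  (hBo : forall n, (0 < n)%N -> is_Bo (Bo n))
  (hBh : forall n, (0 < n)%N -> is_Bh (Bh n))
  (hBb : forall n, (0 < n)%N -> is_Bb (Bb n))
  (A : cstarType R) (hA : is_wstar A)
  (phi : {scalar A}) (hphi : normal_state phi)
  (x : nat -> A) (hx : forall i, selfadjoint (x i))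
  (hgen : wstar_generated [set x i | i in [set: nat]]) :
  (* free case *)
  (faithful_state phi ->
   forall E : forall n : nat, genalg R n,
     (forall n, (0 < n)%N -> orthogonal_hopf (E n)) ->
     (forall n, (0 < n)%N -> ga_sub (As n) (E n) /\ ga_sub (E n) (Ao n)) ->
     (forall n, (0 < n)%N -> hopf_invariant phi x (E n)) ->
     exists (B : set A) (EE : {linear A -> A}),
       [/\ wstar_subalgebra B, B 1, conditional_expectation B EE
         & forall a, phi (EE a) = phi a] /\
       [/\ (forall n, (0 < n)%N -> ga_eq (E n) (As n)) ->
           free_independent B EE x /\ identically_distributed B EE x,

           (forall n, (0 < n)%N -> ga_sub (As n) (E n) /\ ga_sub (E n) (Ah n)) ->
           (exists2 k, (0 < k)%N & ~ ga_eq (E k) (As k)) ->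
           [/\ free_independent B EE x, identically_distributed B EE x
             & forall i, symmetric_distribution B EE (x i)],

           (forall n, (0 < n)%N -> ga_sub (As n) (E n) /\ ga_sub (E n) (Ab n)) ->
           (exists2 k, (0 < k)%N & ~ ga_eq (E k) (As k)) ->
           [/\ free_independent B EE x, identically_distributed B EE x
             & forall i, shifted_semicircular B EE (x i)]
         & (exists2 k1, (0 < k1)%N & ~ ga_sub (E k1) (Ah k1)) ->
           (exists2 k2, (0 < k2)%N & ~ ga_sub (E k2) (Ab k2)) ->
           [/\ free_independent B EE x, identically_distributed B EE x
             & forall i, centered_semicircular B EE (x i)]]) /\
  (* Boolean case *)
  (nondegenerate_state phi ->
   forall E : forall n : nat, bgenalg R n,
     (forall n, (0 < n)%N -> boolean_semigroup (E n)) ->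
     (forall n, (0 < n)%N -> bg_sub (Bs n) (E n) /\ bg_sub (E n) (Bo n)) ->
     (forall n, (0 < n)%N -> boolean_invariant phi x (E n)) ->
     exists (B : set A) (EE : {linear A -> A}),
       [/\ wstar_subalgebra B, conditional_expectation B EE
         & forall a, phi (EE a) = phi a] /\
       [/\ (forall n, (0 < n)%N -> bg_eq (E n) (Bs n)) ->
           boolean_independent B EE x /\ identically_distributed0 B EE x,

           (forall n, (0 < n)%N -> bg_sub (Bs n) (E n) /\ bg_sub (E n) (Bh n)) ->
           (exists2 k, (0 < k)%N & exists E' : genalg R k,
              [/\ quotient_algebra (E k) E', ga_proper (As k) E'
                & ga_sub E' (Ah k)]) ->
           [/\ boolean_independent B EE x, identically_distributed0 B EE x
             & forall i, symmetric_distribution B EE (x i)],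

           (forall n, (0 < n)%N -> bg_sub (Bs n) (E n) /\ bg_sub (E n) (Bb n)) ->
           (exists2 k, (0 < k)%N & exists E' : genalg R k,
              [/\ quotient_algebra (E k) E', ga_proper (As k) E'
                & ga_sub E' (Ab k)]) ->
           [/\ boolean_independent B EE x, identically_distributed0 B EE x
             & forall i, shifted_bernoulli B EE (x i)]
         & (exists2 k1, (0 < k1)%N & exists E' : genalg R k1,
              [/\ quotient_algebra (E k1) E', ga_sub E' (Ao k1)
                & ~ ga_sub E' (Ah k1)]) ->
           (exists2 k2, (0 < k2)%N & exists E' : genalg R k2,
              [/\ quotient_algebra (E k2) E', ga_sub E' (Ao k2)
                & ~ ga_sub E' (Ab k2)]) ->
           [/\ boolean_independent B EE x, identically_distributed0 B EE x
             & forall i, centered_bernoulli B EE (x i)]]).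
Proof.
have [H [ro [ro_f ro_bic]]] := hA; have [[p1 p0] pn] := hphi.
have pf : pfun phi by split=> // k a b; rewrite linearP.
have wphi := normal_wcont ro_f ro_bic pf pn.
have dense := dense_words ro_f ro_bic hx hgen.
split=> [hf E hE hs hi|hn E hE hs hi].
  have magic n (Q : cstarType R) (u : 'M[Q]_n) : (0 < n)%N -> mx_magic u -> inv_words x phi u 1.
    by move=> n0 mu; exact: (magic_inv_words (hAs _ n0) (hs _ n0).1 (hi _ n0) mu).
  have faithful z : phi (star z * z) = 0 -> z = 0.
    by move=> h; rewrite -[z]starK (hf (star z)) ?star0 // starK.
  pose EE := ce ro_f ro_bic hx pf wphi magic faithful dense.
  have hce : conditional_expectation (tail x) EE by exact: ce_conditional.
  have [EB Eb Ebi] := hce.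
  have hB := @tail_subalgebra R A H ro ro_f ro_bic x hx.
  have Ephi a : phi (EE a) = phi a by exact: ce_phi.
  have B1 : tail x 1 := tail1 x.
  pose Hperm := @tail_perm R A H ro ro_f ro_bic x phi pf wphi magic.
  pose Hpair := @tail_pair R A H ro ro_f ro_bic x phi pf wphi magic.
  pose Hfresh := @fresh R A H ro ro_f ro_bic x phi hx pf wphi magic faithful dense.
  have R_ m n : (0 < n)%N -> (exists2 cs, {in cs, forall c, tail x c} & size cs = m /\
      kappa true EE (map (tval x) (word 0 cs)) <> 0) -> power_sums (ga_u (E n)) m.
    move=> n0 [cs hc [<- h]].
    apply: (kap_power_sums hB B1 EB Eb Ebi Ephi faithful Hperm Hpair Hfresh _ hc h) => t ht.
    by apply: (words_inv ro_f ro_bic pf wphi) => [|b /ht]; [exact/hopf_inv_words/hi|exact].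
  (* The dichotomy behind all four items: either all cumulants of length m vanish, or every E n
     satisfies the relation of power sums of length m. *)
  have N_ m : (forall cs, {in cs, forall c, tail x c} -> size cs = m ->
      kappa true EE (map (tval x) (word 0 cs)) = 0) \/ forall n, (0 < n)%N -> power_sums (ga_u (E n)) m.
    have [h|h] := pselect (exists2 cs, {in cs, forall c, tail x c} & size cs = m /\
      kappa true EE (map (tval x) (word 0 cs)) <> 0); first by right=> n n0; exact: R_.
    by left=> cs hc hz; apply: contrapT => h'; apply: h; exists cs.
  have hind : free_independent (tail x) EE x := freeness hB B1 EB Eb Ebi Ephi faithful Hperm Hpair Hfresh.
  have hid : identically_distributed (tail x) EE x := E_ident hB B1 EB Ebi Ephi faithful Hperm.
  have hk := kappa_free hB B1 EB Ebi.
  have hv := cumulants_vanish_words hB B1 EB Eb Ebi Ephi faithful Hperm.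
  exists (tail x), EE; split; first by split=> //; split=> //; exact: tail_closed.
  split=> // [hh [k k0 nk]|hh [k k0 nk]|[k1 k10 h1] [k2 k20 h2]]; split=> // i.
  (* A non-zero cumulant of odd length would put E k below As k, hence make them equal. *)
  - apply: (symmetric_words hB B1 EB Eb Ebi Ephi faithful Hperm) => cs hc oc.
    have [h|h] := N_ (size cs); first exact: h.
    case: nk; split; last exact: (hs _ k0).1.
    exact: (sub_As_cubic (hE _ k0) (h _ k0) (hAs _ k0) (hAh _ k0) (hh _ k0).2 oc).
  - exists (kappa true EE) => //; apply: hv => cs hc oc.
    have [h|h] := N_ (size cs); first exact: h.
    case: nk; split; last exact: (hs _ k0).1.
    exact: (sub_As_bistochastic (hE _ k0) (h _ k0) (hAs _ k0) (hAb _ k0) (hh _ k0).2 oc).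
  exists (kappa true EE) => //; apply: hv => cs hc oc.
  (* Length 0 satisfies [n != 2]; the cumulant of the empty word is 0 by definition. *)
  have [-> //|c0] := eqVneq cs [::].
  have [h|h] := N_ (size cs); first exact: h.
  have [e1|m3] : size cs = 1%N \/ (2 < size cs)%N.
  - by case: cs {hc h} oc c0 => [|c [|c' [|c'' cs]]] //=; [left|right].
  - by case: h2; exact: (sub_Ab (hE _ k20) (h _ k20) (hAb _ k20) e1).
  by case: h1; exact: (sub_Ah (hE _ k10) (h _ k10) (hAh _ k10) m3).
have nondeg := gns_separating hn.
have mom : forall w v, adj w None = adj v None -> phi (X x w) = phi (X x v).
  apply: adj_moment => n Q u P n0; exact: (P_magic_inv_words (hBs _ n0) (hs _ n0).1 (hi _ n0)).
have [e [pe phi_e phi_b]] := vacuum_projection ro_f ro_bic hx pf wphi mom nondeg dense.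
set b := bw _ _ _ _ _ _ _ _ in phi_b.
have b_lim w c r N : (forall k, (N <= k)%N -> phi (c * X x (shift k w)) = r) -> phi (c * b w) = r.
  move=> h; rewrite -[c * b w]mulr1; apply: (@bwP _ _ _ _ _ _ _ _ _ _ _ _ _ _ _ _ _ _ N) => k hk.
  by rewrite mulr1 h.
have sep : forall z z', (forall v u, phi (X x v * z * X x u) = phi (X x v * z' * X x u)) -> z = z'.
  by move=> z z'; exact: (sepw_eq ro_f ro_bic pf wphi nondeg dense).
have m_adj := mB_adj mom.
have hcat w1 w2 (h1 : w1 <> [::]) (h2 : w2 <> [::]) (h : last 0%N w1 <> head 0%N w2) :=
  q_cat pe.2 m_adj phi_e phi_b b_lim sep h1 h2 h.
have hadj w w' (h : sadj w = sadj w') := q_adj m_adj phi_e phi_b b_lim sep h.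
have m_corner v w v' : w <> [::] ->
    phi (X x v * (e * X x w * e) * X x v') = mB x phi (sadj v ++ sadj w ++ sadj v').
  move=> w0; rewrite !mulrA catA.
  exact: (tested_step phi_e phi_b b_lim w0 (tested_word m_adj phi_e phi_b b_lim v)).
have sep0 z : (forall v v', phi (X x v * z * X x v') = 0) -> z = 0.
  by move=> h; apply: sep => v v'; rewrite h mulr0 mul0r linear0.
(* Invariance under a Boolean semigroup holds only after multiplication by P; the quotient sends P
   to 1 and turns it into invariance under a Hopf algebra. *)
have R_ k (E' : genalg R k) m : (0 < k)%N -> quotient_algebra (E k) E' ->
    kappa false (corner e) (nseq m (x 0%N)) <> 0 -> power_sums (ga_u E') m.
  move=> k0 [_ [f [_ _ fu fP]]]; apply: (boolean_power_sums pe hcat hadj sep0 m_adj m_corner).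
  have := inv_words_hom f (boolean_inv_words (hi k k0)); rewrite fP.
  congr (inv_words _ _ _ _); apply/funext => i; apply/funext => j; exact: fu.
have N_ m : kappa false (corner e) (nseq m (x 0%N)) = 0 \/
    forall k (E' : genalg R k), (0 < k)%N -> quotient_algebra (E k) E' -> power_sums (ga_u E') m.
  by have [h|h] := pselect (kappa false (corner e) (nseq m (x 0%N)) = 0); [left|right=> k E' k0 hE'; exact: R_].
have phi_el a : phi (e * a) = phi a.
  by rewrite -[e * a]starK starM pe.1 pf_star // phi_e -pf_star // starK.
exists (cornerB e), (corner e); split.
  split=> [||a]; last by rewrite /= /corner phi_e phi_el.
    split=> [|a ha]; first exact: corner_subalgebra.
    (* Multiplication by fixed elements is sigma-weakly continuous under [phi], so identities of the
       corner extend to its closure; (1 - e) a = 0 and a (1 - e) = 0 show that it is closed. *)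
    have z0 c d y : (forall a', cornerB e a' -> y * a' * d = 0) -> phi (c * (y * a * d)) = 0.
      move=> h; rewrite !mulrA -mulrA [c * y * _]mulrA.
      apply: (cl_lfun0 ro_f ro_bic ha pf wphi) => a' /h h'.
      by rewrite -mulrA -[c * y * _]mulrA [y * _]mulrA h' mulr0 linear0.
    have l0 : (1 - e) * a = 0.
      apply: (nondeg _) => c d; rewrite -mulrA; apply: z0 => a' ha'.
      by rewrite mulrBl mul1r (cornerl pe ha') subrr mul0r.
    have r0 : a * (1 - e) = 0.
      apply: (nondeg _) => c d; rewrite -!mulrA -[a * _]mul1r [1 * _]mulrA; apply: z0 => a' ha'.
      by rewrite mul1r mulrA mulrBr mulr1 (cornerr pe ha') subrr mul0r.
    apply: cornerP; apply/eqP; rewrite eq_sym -subr_eq0; apply/eqP.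
      by rewrite -[X in X - _]mul1r -mulrBl.
    by rewrite -[X in X - _]mulr1 -mulrBr.
  exact: corner_expectation.
have hind := corner_independent pe hcat; have hid := corner_identical pe hadj.
have hk := corner_cumulants pe.
split=> // [_ [k k0 [E' [hE' pr h1]]]|_ [k k0 [E' [hE' pr h1]]]|[k1 k10 [E1 [hE1 _ h1]]] [k2 k20 [E2 [hE2 _ h2]]]];
  split=> // i.
- apply: (corner_symmetric pe); apply: (odd_corner pe) => m om.
  rewrite (kap_nseq pe hadj m i 0); have [//|h] := N_ m.
  case: pr.2; split; first exact: pr.1.
  exact: (sub_As_cubic hE'.1 (h _ _ k0 hE') (hAs _ k0) (hAh _ k0) h1 om).
- exists (kappa false (corner e)) => //; apply: (kap_coefs pe) => m hm.
  rewrite (kap_nseq pe hadj m i 0); have [//|h] := N_ m.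
  case: pr.2; split; first exact: pr.1.
  exact: (sub_As_bistochastic hE'.1 (h _ _ k0 hE') (hAs _ k0) (hAb _ k0) h1 hm).
exists (kappa false (corner e)) => //; apply: (kap_coefs pe) => m hm.
rewrite (kap_nseq pe hadj m i 0); have [//|h] := N_ m.
(* The lengths left are 1, which would give a bistochastic matrix, and those above 2, which would
   give a cubic one. *)
case: m hm h => [//|[|[//|m]]] _ h.
  by case: h2; exact: (sub_Ab hE2.1 (h _ _ k20 hE2) (hAb _ k20) erefl).
by case: h1; exact: (sub_Ah hE1.1 (h _ _ k10 hE1) (hAh _ k10)).
Qed.
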